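(* Let $d\ge 2$ be a fixed constant. There is an algorithm that, for every storyline instance with $k$ characters and $n$ meetings in which every meeting has at most $d$ characters and no two meetings are the same set of characters, outputs in $O(kn)$ time a solution whose number of block crossings is at most $\frac{3(d^2-1)d^2}{2}$ times the minimum possible.
   Context: A storyline instance is a pair $(C,M)$ where $C=\{1,\dots,k\}$ is a set of characters and $M=[m_1,\dots,m_n]$ is a sequence of meetings with $m_i\subseteq C$ and $|m_i|\ge 2$. A permutation of $C$ lists each character exactly once. For $1\le a\le b<c\le k$, the block crossing $(a,b,c)$ maps $\langle \pi_1,\dots,\pi_k\rangle$ to $\langle \pi_1,\dots,\pi_{a-1},\pi_{b+1},\dots,\pi_c,\pi_a,\dots,\pi_b,\pi_{c+1},\dots,\pi_k\rangle$. A meeting fits (is supported by) a permutation if its characters occupy consecutive positions. A solution is a start permutation $\pi^0$ and sequences $B_1,\dots,B_n$ of block crossings (possibly empty) such that, with $\pi^i$ obtained by applying $B_i$ in order to $\pi^{i-1}$, $\pi^i$ supports $m_i$ for all $i$; its cost is the total number of block crossings. *)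

(* Defs.v *)
From Stdlib Require Import List Arith Lia Permutation.
Import ListNotations.

(* Storylines.  Characters are the naturals 1..k; a permutation is a
   list that is a rearrangement of [1;...;k]; positions are 1-based.  *)

Definition block_crossing (pi : list nat) (a b c : nat) : list nat :=
  firstn (a - 1) pi
  ++ firstn (c - b) (skipn b pi)
  ++ firstn (b - a + 1) (skipn (a - 1) pi)
  ++ skipn c pi.

Definition triple := (nat * nat * nat)%type.

Definition valid_bc (k : nat) (t : triple) : Prop :=
  let '(a, b, c) := t in 1 <= a /\ a <= b /\ b < c /\ c <= k.

Definition apply_bcs (pi : list nat) (B : list triple) : list nat :=
  fold_left (fun p (t : triple) => let '(a, b, c) := t in block_crossing p a b c) B pi.

Definition is_perm (k : nat) (pi : list nat) : Prop := Permutation pi (seq 1 k).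

Definition supports (pi : list nat) (m : list nat) : Prop :=
  exists l mid r, pi = l ++ mid ++ r /\ Permutation mid m.

Definition storyline_instance (k : nat) (M : list (list nat)) : Prop :=
  Forall (fun m => NoDup m /\ 2 <= length m /\ Forall (fun x => 1 <= x <= k) m) M.

Definition meetings_at_most (d : nat) (M : list (list nat)) : Prop :=
  Forall (fun m => length m <= d) M.

Definition distinct_meetings (M : list (list nat)) : Prop :=
  forall i j, i < j < length M ->
    ~ (forall x, In x (nth i M []) <-> In x (nth j M [])).

Record solution := mkSolution {
  start : list nat;
  crossings : list (list triple) }.

Fixpoint valid_run (k : nat) (pi : list nat) (M : list (list nat))
    (Bs : list (list triple)) : Prop :=
  match M, Bs with
  | [], [] => True
  | m :: M', B :: Bs' =>
      Forall (valid_bc k) B /\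
      supports (apply_bcs pi B) m /\
      valid_run k (apply_bcs pi B) M' Bs'
  | _, _ => False
  end.

Definition is_solution (k : nat) (M : list (list nat)) (s : solution) : Prop :=
  is_perm k (start s) /\ valid_run k (start s) M (crossings s).

Definition cost (s : solution) : nat := list_sum (map (@length triple) (crossings s)).

(* Machine model: a unit-cost RAM.  Memory is nat -> nat, every cell is
   a register; instructions have unit cost; indirect addressing allowed;
   arithmetic is + and truncated - only.                                *)

Inductive instr :=
| IConst (r v : nat)
| IAdd (r a b : nat)
| ISub (r a b : nat)
| ILoad (r a : nat)
| IStore (a b : nat)
| IJz (r l : nat)
| IHalt.

Definition program := list instr.

Definition upd (mem : nat -> nat) (a v : nat) : nat -> nat :=
  fun x => if Nat.eqb x a then v else mem x.

Fixpoint run (P : program) (fuel pc : nat) (mem : nat -> nat) : option (nat -> nat) :=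
  match fuel with
  | 0 => None
  | S f =>
    match nth_error P pc with
    | None | Some IHalt => Some mem
    | Some (IConst r v) => run P f (S pc) (upd mem r v)
    | Some (IAdd r a b) => run P f (S pc) (upd mem r (mem a + mem b))
    | Some (ISub r a b) => run P f (S pc) (upd mem r (mem a - mem b))
    | Some (ILoad r a) => run P f (S pc) (upd mem r (mem (mem a)))
    | Some (IStore a b) => run P f (S pc) (upd mem (mem a) (mem b))
    | Some (IJz r l) => if Nat.eqb (mem r) 0 then run P f l mem else run P f (S pc) mem
    end
  end.

Definition encode_instance (k : nat) (M : list (list nat)) : list nat :=
  k :: length M :: concat (map (fun m => length m :: m) M).

Definition init_mem (l : list nat) : nat -> nat := fun a => nth a l 0.

Definition read_output (mem : nat -> nat) : list nat :=
  let a := mem 0 in map (fun i => mem (a + 1 + i)) (seq 0 (mem a)).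

Fixpoint parse_triples (t : nat) (o : list nat) : option (list triple * list nat) :=
  match t with
  | 0 => Some ([], o)
  | S t' =>
    match o with
    | a :: b :: c :: o' =>
      match parse_triples t' o' with
      | Some (B, r) => Some ((a, b, c) :: B, r)
      | None => None
      end
    | _ => None
    end
  end.

Fixpoint parse_blocks (n : nat) (o : list nat) : option (list (list triple)) :=
  match n with
  | 0 => match o with [] => Some [] | _ => None end
  | S n' =>
    match o with
    | t :: o' =>
      match parse_triples t o' with
      | Some (B, r) =>
        match parse_blocks n' r with
        | Some Bs => Some (B :: Bs)
        | None => None
        end
      | None => None
      end
    | [] => None
    end
  end.

(* Output sequence: pi^0 (k numbers), then for each meeting i:
   |B_i| followed by the 3|B_i| numbers a,b,c of its block crossings. *)
Definition decode_solution (k n : nat) (o : list nat) : option solution :=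
  if length o <? k then None
  else match parse_blocks n (skipn k o) with
       | Some Bs => Some (mkSolution (firstn k o) Bs)
       | None => None
       end.

(* Main.v *)
(* The order in which all meetings are gathered is a concatenation of pieces.  A piece absorbs the missing characters
   of a meeting that meets it whenever some order of the enlarged piece keeps the trace of every meeting contiguous;
   when no meeting can be absorbed any more, the next piece is begun.  Each meeting is gathered by block crossings,
   one fewer than its characters have runs, and these are undone before the next meeting.  Inside a piece a meeting is
   contiguous, so it costs at most twice the number of pieces that it meets, minus two.

   A piece is connected by meetings inside it, so an admissible order of the enlarged piece can be spliced with the
   current one outside a window of O(d) characters near the absorbed ones.  Trying all orders of the window costs
   O(n), and O(k + n) attempts suffice.  If n > 2dk the identity is used instead of this order: distinct meetings
   then force enough crossings.

   For the lower bound, take a solution with T crossings.  Each crossing destroys three adjacencies, which yields at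
   most 3T cuts in its start permutation.  A meeting that is not contiguous there reaches a cut, and few meetings
   can.  For the others, count the breaks, the places inside a meeting where the piece changes: a stretch of
   positions without cuts contains at most two breaks far from its ends, because a piece between two breaks could
   still grow, the start permutation itself being an admissible order.  At most d(d-1)/2 contiguous meetings contain
   a given break, and for d <= 3 a finer count is needed. *)

Require Import Defs.
From Stdlib Require Import List Arith Lia Permutation Classical ClassicalEpsilon.
Import ListNotations.

(** * Counting breaks on a line with cuts *)

(** The pieces are compared with an order that is unknown while they are built. Absorption therefore
    asks for any admissible order of the enlarged piece, not for an extension of the present one; a
    piece that has stopped growing then rules out all orders, among them the start permutation of
    every competitor. Restricting an order keeps it admissible, so a meeting once rejected stays
    rejected while the piece grows and need not be tried again. The bound O(kn) leaves O(n) time for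
    an attempt, whatever k is. A piece has at most 1 + dn characters, as its meetings bring them in,
    and loops over it run to this limit instead of k; a new piece begins by looking at a single
    character. The O(k + n) attempts leave a term of order n squared, which is harmless only for n =
    O(k): this is the origin of the threshold 2dk. The constant leaves no room for d = 2 and d = 3,
    where the refined counts of 2 and 13 per cut meet it exactly. *)

Definition dec (P : Prop) : bool :=
  if excluded_middle_informative P then true else false.

Lemma dec_true (P : Prop) : dec P = true <-> P.
Proof. unfold dec. destruct (excluded_middle_informative P); split; intuition congruence. Qed.

Lemma dec_false (P : Prop) : dec P = false <-> ~ P.
Proof. unfold dec. destruct (excluded_middle_informative P); split; intuition congruence. Qed.

Lemma dec_elim (P : Prop) : dec P = true -> P.
Proof. apply dec_true. Qed.

Lemma dec_nelim (P : Prop) : dec P = false -> ~ P.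
Proof. apply dec_false. Qed.

Definition sel {A} (P : A -> Prop) (l : list A) : list A := filter (fun x => dec (P x)) l.

Lemma in_sel {A} (P : A -> Prop) l x : In x (sel P l) <-> In x l /\ P x.
Proof. unfold sel. rewrite filter_In, dec_true. tauto. Qed.

Lemma sel_NoDup {A} (P : A -> Prop) l : NoDup l -> NoDup (sel P l).
Proof. apply NoDup_filter. Qed.

Lemma sel_length {A} (P : A -> Prop) l : length (sel P l) + length (sel (fun x => ~ P x) l) = length l.
Proof.
  unfold sel. induction l as [|a l IH]; simpl; [reflexivity|].
  destruct (dec (P a)) eqn:H1; destruct (dec (~ P a)) eqn:H2; simpl;
    rewrite ?dec_true, ?dec_false in *; try tauto; lia.
Qed.

Definition sumf {A} (g : A -> nat) (l : list A) : nat := list_sum (map g l).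

Lemma sumf_cons {A} (g : A -> nat) a l : sumf g (a :: l) = g a + sumf g l.
Proof. reflexivity. Qed.

Lemma sumf_app {A} (g : A -> nat) l l' : sumf g (l ++ l') = sumf g l + sumf g l'.
Proof. unfold sumf. rewrite map_app. apply list_sum_app. Qed.

Lemma sumf_le {A} (g h : A -> nat) l : (forall x, In x l -> g x <= h x) -> sumf g l <= sumf h l.
Proof.
  induction l as [|a l IH]; intros H; [reflexivity|].
  rewrite !sumf_cons. pose proof (H a (or_introl eq_refl)).
  assert (sumf g l <= sumf h l) by (apply IH; intros; apply H; now right). lia.
Qed.

Lemma sumf_add {A} (g h : A -> nat) l : sumf (fun x => g x + h x) l = sumf g l + sumf h l.
Proof. induction l as [|a l IH]; [reflexivity|]. rewrite !sumf_cons. lia. Qed.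

Lemma sumf_const {A} c (l : list A) : sumf (fun _ => c) l = c * length l.
Proof. induction l as [|a l IH]; simpl; [unfold sumf; simpl; lia|]. rewrite sumf_cons. lia. Qed.

Lemma sumf_mul {A} c (g : A -> nat) l : sumf (fun x => c * g x) l = c * sumf g l.
Proof. induction l as [|a l IH]; [unfold sumf; simpl; lia|]. rewrite !sumf_cons. lia. Qed.

Lemma sumf_sel {A} (P : A -> Prop) (g : A -> nat) l :
  sumf g (sel P l) + sumf g (sel (fun x => ~ P x) l) = sumf g l.
Proof.
  unfold sel. induction l as [|a l IH]; simpl; [reflexivity|].
  destruct (dec (P a)) eqn:H1; destruct (dec (~ P a)) eqn:H2; simpl;
    rewrite ?dec_true, ?dec_false in *; try tauto; rewrite !sumf_cons; lia.
Qed.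

Definition b2n (b : bool) := if b then 1 else 0.

Lemma sel_length_sumf {A} (P : A -> Prop) l : length (sel P l) = sumf (fun x => b2n (dec (P x))) l.
Proof.
  unfold sel. induction l as [|a l IH]; simpl; [reflexivity|].
  rewrite sumf_cons. destruct (dec (P a)); simpl; lia.
Qed.

Lemma sumf_swap {A B} (g : A -> B -> nat) (l : list A) (l' : list B) :
  sumf (fun x => sumf (g x) l') l = sumf (fun y => sumf (fun x => g x y) l) l'.
Proof.
  induction l as [|a l IH].
  - unfold sumf at 1; simpl. induction l' as [|b l' IH']; [reflexivity|].
    rewrite sumf_cons. unfold sumf at 1. simpl. exact IH'.
  - rewrite sumf_cons, IH, <- sumf_add. unfold sumf. f_equal.
Qed.

(** The charging principle of the whole count: every item of [l] claims an item of [L], and none is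
    claimed twice. A relation stands in for a function because the claimed item is only known to
    exist. *)
Lemma rel_inj_length {A B} (R : A -> B -> Prop) (l : list A) (L : list B) :
  NoDup l -> (forall a, In a l -> exists b, In b L /\ R a b) ->
  (forall a a' b, In a l -> In a' l -> R a b -> R a' b -> a = a') -> length l <= length L.
Proof.
  revert L. induction l as [|a l IH]; intros L ND Hex Hinj; simpl; [lia|].
  inversion_clear ND.
  destruct (Hex a (or_introl eq_refl)) as (b & Hb & Rab).
  apply in_split in Hb as (L1 & L2 & ->).
  assert (length l <= length (L1 ++ L2)).
  { apply IH; auto.
    - intros a' Ha'. destruct (Hex a' (or_intror Ha')) as (b' & Hb' & Rb').
      exists b'. split; auto. apply in_app_or in Hb'. apply in_or_app.
      destruct Hb' as [|[->|]]; auto.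
      exfalso. apply H. rewrite (Hinj a a' b'); simpl; auto.
    - intros; eapply Hinj; simpl; eauto. }
  rewrite !length_app in *. simpl. lia.
Qed.

Definition seteq (a b : list nat) := forall x, In x a <-> In x b.

Lemma distinct_NoDup (E : list (list nat)) : ForallOrdPairs (fun a b => ~ seteq a b) E -> NoDup E.
Proof.
  induction 1 as [|a E Ha HE IH]; constructor; auto.
  intros Hin. rewrite Forall_forall in Ha. apply (Ha a Hin). intros x; tauto.
Qed.

Lemma distinct_eq (E : list (list nat)) a b :
  ForallOrdPairs (fun a b => ~ seteq a b) E -> In a E -> In b E -> seteq a b -> a = b.
Proof.
  induction 1 as [|c E Hc HE IH]; simpl; [tauto|].
  rewrite Forall_forall in Hc. intros [->|Ha] [->|Hb] Hs; auto.
  - exfalso. now apply (Hc b).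
  - exfalso. apply (Hc a); auto. intros x; symmetry; apply Hs.
Qed.

Definition itv (e : list nat) := forall x y z, In x e -> In z e -> x < y < z -> In y e.

Lemma itv_seq e : NoDup e -> itv e -> e <> [] -> exists lo, forall x, In x e <-> lo <= x < lo + length e.
Proof.
  intros ND Hi Hne.
  assert (Hmin : exists lo, In lo e /\ forall x, In x e -> lo <= x).
  { clear ND Hi. induction e as [|a e IH]; [tauto|].
    destruct e as [|b e]. { exists a; simpl; split; auto; intros x [->|[]]; lia. }
    destruct IH as (lo & H1 & H2); [discriminate|].
    destruct (le_lt_dec a lo).
    - exists a. split; [now left|]. intros x [->|Hx]; [lia|]. specialize (H2 x Hx). lia.
    - exists lo. split; [now right|]. intros x [->|Hx]; [lia|]. auto. }
  destruct Hmin as (lo & Hlo & Hmin). exists lo.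
  assert (Hup : forall x, In x e -> x < lo + length e).
  { intros x Hx. destruct (le_lt_dec (lo + length e) x); [|lia]. exfalso.
    assert (S (length e) <= length e); [|lia].
    rewrite <- (length_seq (S (length e)) lo) at 1.
    apply NoDup_incl_length; [apply seq_NoDup|].
    intros y Hy. apply in_seq in Hy.
    destruct (Nat.eq_dec y lo) as [->|]; auto.
    destruct (Nat.eq_dec y x) as [->|]; auto. apply (Hi lo y x); auto. lia. }
  assert (incl (seq lo (length e)) e).
  { apply NoDup_length_incl; auto; [now rewrite length_seq|].
    intros x Hx. apply in_seq. specialize (Hmin x Hx). specialize (Hup x Hx). lia. }
  intros x; split.
  - intros Hx; split; auto.
  - intros Hx. apply H, in_seq. lia.
Qed.

Lemma itv_span e x y : NoDup e -> itv e -> In x e -> In y e -> y < x + length e.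
Proof.
  intros ND Hi Hx Hy. destruct (itv_seq e) as (lo & H); auto; [intros ->; destruct Hx|].
  apply H in Hx. apply H in Hy. lia.
Qed.

Lemma exists_max (P : nat -> Prop) (l : list nat) :
  (exists x, In x l /\ P x) -> exists x, In x l /\ P x /\ forall y, In y l -> P y -> y <= x.
Proof.
  induction l as [|a l IH]; intros (x & Hx & Px); [destruct Hx|].
  destruct (classic (exists x, In x l /\ P x)) as [H|H].
  - destruct (IH H) as (m & Hm & Pm & Hmax).
    destruct (classic (P a /\ m < a)) as [(Pa & Hlt)|Hn].
    + exists a. split; [now left|]. split; auto. intros y [->|Hy] Py; [lia|].
      specialize (Hmax y Hy Py). lia.
    + exists m. split; [now right|]. split; auto. intros y [->|Hy] Py; auto.
      destruct (le_lt_dec y m); auto. tauto.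
  - destruct Hx as [->|Hx]; [|exfalso; eauto].
    exists x. split; [now left|]. split; auto. intros y [->|Hy] Py; [lia|]. exfalso; eauto.
Qed.

Lemma exists_min (P : nat -> Prop) (l : list nat) :
  (exists x, In x l /\ P x) -> exists x, In x l /\ P x /\ forall y, In y l -> P y -> x <= y.
Proof.
  induction l as [|a l IH]; intros (x & Hx & Px); [destruct Hx|].
  destruct (classic (exists x, In x l /\ P x)) as [H|H].
  - destruct (IH H) as (m & Hm & Pm & Hmin).
    destruct (classic (P a /\ a < m)) as [(Pa & Hlt)|Hn].
    + exists a. split; [now left|]. split; auto. intros y [->|Hy] Py; [lia|].
      specialize (Hmin y Hy Py). lia.
    + exists m. split; [now right|]. split; auto. intros y [->|Hy] Py; auto.
      destruct (le_lt_dec m y); auto. tauto.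
  - destruct Hx as [->|Hx]; [|exfalso; eauto].
    exists x. split; [now left|]. split; auto. intros y [->|Hy] Py; [lia|]. exfalso; eauto.
Qed.

Lemma sel_le {A} (P Q : A -> Prop) l : (forall x, In x l -> P x -> Q x) -> length (sel P l) <= length (sel Q l).
Proof.
  intros H. rewrite !sel_length_sumf. apply sumf_le. intros x Hx.
  destruct (dec (P x)) eqn:E1; simpl; [|lia]. apply dec_elim in E1.
  replace (dec (Q x)) with true; [simpl; lia|]. symmetry. apply dec_true. auto.
Qed.

Lemma flat_map_length_const {A B} (g : A -> list B) c l :
  (forall a, length (g a) = c) -> length (flat_map g l) = c * length l.
Proof. intros H. induction l as [|a l IH]; simpl; [lia|]. rewrite length_app, H, IH. lia. Qed.

(* [E] is the set of meetings, as sets of positions in the start permutation of a competing solution, a cut [r]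
   in [Rc] separates the positions [r - 1] and [r], and [rk] maps a position to the number of the piece of its
   character. *)
Record layout (d k : nat) (E : list (list nat)) (Rc : list nat) (rk : nat -> nat) : Prop := {
  lay_d : 2 <= d;
  lay_NoDup : forall e, In e E -> NoDup e;
  lay_ne : forall e, In e E -> e <> [];
  lay_size : forall e, In e E -> length e <= d;
  lay_lt : forall e x, In e E -> In x e -> x < k;
  lay_distinct : ForallOrdPairs (fun a b => ~ seteq a b) E;
  lay_cuts : NoDup Rc;
  lay_cut_le : forall r, In r Rc -> r <= k;
  lay_touch : forall f x, In f E -> ~ itv f -> In x f ->
    (exists r, In r Rc /\ x < r /\ r < x + d /\ forall y, x <= y < r -> In y f) \/
    (exists r, In r Rc /\ r <= x /\ S x < r + d /\ forall y, r <= y <= x -> In y f);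
  lay_conn : forall i (A : nat -> bool) x y, x < k -> y < k -> rk x = i -> rk y = i ->
    A x = true -> A y = false ->
    exists h, In h E /\ (forall z, In z h -> rk z <= i) /\
      (exists u, In u h /\ rk u = i /\ A u = true) /\ (exists u, In u h /\ rk u = i /\ A u = false);
  lay_max : forall e x y, In e E -> In x e -> In y e -> rk x < rk y ->
    exists f u v w, In f E /\ u < v < w /\ In u f /\ In w f /\ ~ In v f /\
      forall z, z = u \/ z = v \/ z = w -> z < k /\ (rk z = rk x \/ (In z e /\ rk x <= rk z))
}.

Section Analysis.
Context (d k : nat) (E : list (list nat)) (Rc : list nat) (rk : nat -> nat).
Context (L : layout d k E Rc rk).

Let Hd := lay_d _ _ _ _ _ L.
Let lND := lay_NoDup _ _ _ _ _ L.
Let lsz := lay_size _ _ _ _ _ L.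
Let llt := lay_lt _ _ _ _ _ L.

(** * Positions far from all cuts and clean blocks *)

Definition core i := forall r, In r Rc -> i + d <= r \/ r + d <= S i.

(** At [x = i] both alternatives of [lay_touch] produce a cut that is too close for a core
    position. *)
Lemma core_itv i f : core i -> In f E -> In i f -> itv f.
Proof.
  intros Hc Hf Hi. apply NNPP; intros Hn.
  destruct (lay_touch _ _ _ _ _ L f i Hf Hn Hi) as [(r & Hr & H)|(r & Hr & H)];
    destruct (Hc r Hr); lia.
Qed.

Lemma edge_span e x y : In e E -> itv e -> In x e -> In y e -> y < x + d.
Proof.
  intros He Hi Hx Hy. pose proof (itv_span e x y (lay_NoDup _ _ _ _ _ L e He) Hi Hx Hy).
  pose proof (lay_size _ _ _ _ _ L e He). lia.
Qed.

(** Through [w] the meeting [e] is contiguous and spans less than [d], so a cut inside it would be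
    too close to [w]. *)
Lemma core_no_cut e w x y r : In e E -> In w e -> core w -> In x e -> In y e ->
  In r Rc -> x < r -> r <= y -> False.
Proof.
  intros He Hw Hc Hx Hy Hr H1 H2. pose proof (core_itv w e Hc He Hw) as Hi.
  pose proof (edge_span e x w He Hi Hx Hw). pose proof (edge_span e w y He Hi Hw Hy).
  destruct (Hc r Hr); lia.
Qed.

(** The run of [f] at [x] extends to a cut, and no cut lies inside [e]; hence the run covers [e] on
    one side of [x]. *)
Lemma core_side e w f x : In e E -> In w e -> core w -> In f E -> ~ itv f -> In x e -> In x f ->
  (forall y, In y e -> x <= y -> In y f) \/ (forall y, In y e -> y <= x -> In y f).
Proof.
  intros He Hw Hc Hf Hn Hx Hxf.
  destruct (lay_touch _ _ _ _ _ L f x Hf Hn Hxf) as [(r & Hr & H1 & H2 & H3)|(r & Hr & H1 & H2 & H3)].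
  - left. intros y Hy Hxy. apply H3. split; auto.
    destruct (le_lt_dec r y); auto. exfalso. eapply (core_no_cut e w x y r); eauto.
  - right. intros y Hy Hxy. apply H3. split; auto.
    destruct (le_lt_dec r y); auto. exfalso. eapply (core_no_cut e w y x r); eauto.
Qed.

(** If [f] skipped [z], the run of [x] would reach a cut [r] on the left and that of [y] a cut [s]
    on the right. Since [w] is core, [s - r] is at least [2 * d - 1], while [y - x < d]; the two
    runs would have more than [d] positions. *)
Lemma core_convex e w f x z y : In e E -> In w e -> core w -> In f E ->
  In x e -> In y e -> In z e -> x < z < y -> In x f -> In y f -> In z f.
Proof.
  intros He Hw Hc Hf Hx Hy Hz Hxzy Hxf Hyf.
  destruct (classic (itv f)) as [Hi|Hn]; [now apply (Hi x z y)|].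
  apply NNPP; intros Hzf.
  destruct (lay_touch _ _ _ _ _ L f x Hf Hn Hxf) as [(r & Hr & H1 & H2 & H3)|(r & Hr & H1 & H2 & H3)].
  { apply Hzf, H3. split; [lia|].
    destruct (le_lt_dec r z); auto. exfalso. eapply (core_no_cut e w x z r); eauto. }
  destruct (lay_touch _ _ _ _ _ L f y Hf Hn Hyf) as [(s & Hs & G1 & G2 & G3)|(s & Hs & G1 & G2 & G3)].
  2:{ apply Hzf, G3. split; [|lia].
      destruct (le_lt_dec s z); auto. exfalso. eapply (core_no_cut e w z y s); eauto. }
  assert (r <= w).
  { destruct (le_lt_dec r w); auto. exfalso. eapply (core_no_cut e w w x r); eauto. }
  assert (w < s).
  { destruct (le_lt_dec s w); auto. exfalso. eapply (core_no_cut e w y w s); eauto. }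
  pose proof (edge_span e x y He (core_itv w e Hc He Hw) Hx Hy).
  assert (Hlen : length (seq r (S x - r) ++ seq y (s - y)) <= length f).
  { apply NoDup_incl_length.
    - apply NoDup_app; try apply seq_NoDup. intros a Ha Ha'. apply in_seq in Ha, Ha'. lia.
    - intros a Ha. apply in_app_or in Ha as [Ha|Ha]; apply in_seq in Ha; [apply H3|apply G3]; lia. }
  rewrite length_app, !length_seq in Hlen.
  pose proof (lay_size _ _ _ _ _ L f Hf).
  destruct (Hc r Hr); destruct (Hc s Hs); lia.
Qed.

(** The piece changes at both ends, so a contiguous meeting that leaves the block contains two
    neighbouring positions of different pieces. *)
Definition clean_block lo hi := lo < hi /\ hi <= k /\ (forall i, lo <= i < hi -> core i) /\
  (lo = 0 \/ rk (lo - 1) <> rk lo) /\ (hi = k \/ rk (hi - 1) <> rk hi).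

(* The piece of [j], built before those of [p] and [q], is trapped strictly between them and could still have
   absorbed the meeting [h]. *)
Lemma no_trapped h p j q w : In h E -> In w h -> core w -> In p h -> In q h -> p < j < q ->
  rk j < rk p -> rk j < rk q -> False.
Proof.
  intros Hh Hw Hc Hp Hq Hpjq Hrp Hrq. pose proof (core_itv w h Hc Hh Hw) as Hi.
  assert (Hj : In j h) by (apply (Hi p j q); auto).
  (* The piece of [j] is confined between [p] and [q]: a meeting connecting it to the outside lies
     in pieces no later than its own, hence avoids [p] and [q], yet would have to cover one of
     them. *)
  assert (Hin : forall v, v < k -> rk v = rk j -> p < v < q).
  { intros v Hv Hrv. apply NNPP; intros Hout.
    assert (Hjk : j < k) by (apply (lay_lt _ _ _ _ _ L h); auto).
    destruct (lay_conn _ _ _ _ _ L (rk j) (fun u => dec (p < u < q)) j v) as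
      (h2 & Hh2 & Hle & (u & Hu & Hru & Au) & (u' & Hu' & Hru' & Au')); auto.
    { now apply dec_true. } { now apply dec_false. }
    cbn beta in Au, Au'. apply dec_elim in Au. apply dec_nelim in Au'.
    assert (~ In p h2) by (intros Hx; apply Hle in Hx; lia).
    assert (~ In q h2) by (intros Hx; apply Hle in Hx; lia).
    destruct (classic (itv h2)) as [Hi2|Hn2].
    - destruct (le_lt_dec u' p) as [Hup|Hup].
      + assert (u' <> p) by (intros ->; auto). apply H, (Hi2 u' p u); auto; lia.
      + assert (q <= u') by lia. assert (u' <> q) by (intros ->; auto).
        apply H0, (Hi2 u q u'); auto; lia.
    - destruct (core_side h w h2 u) as [Hs|Hs]; auto.
      { apply (Hi p u q); auto. }
      { apply H0, Hs; auto; lia. }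
      { apply H, Hs; auto; lia. } }
  (* The obstruction to absorbing [h] now lies inside [h], where every trace is convex. *)
  destruct (lay_max _ _ _ _ _ L h j q) as (f & u & v & x & Hf & Huvx & Huf & Hxf & Hvf & Hz); auto.
  assert (Hall : forall z, z = u \/ z = v \/ z = x -> In z h).
  { intros z Hzz. destruct (Hz z Hzz) as (Hzk & [Hr|[Hr _]]); auto.
    apply (Hi p z q); auto. }
  apply Hvf. apply (core_convex h w f u v x); auto.
Qed.

(** Induction on the rank. Once a piece is known to stay inside the block, all its positions are
    core, and this leaves no obstruction to the absorption of a meeting with later members. *)
Lemma far_lemma lo hi : clean_block lo hi -> forall x, lo <= x < hi ->
  (forall y, y < k -> rk y = rk x -> lo <= y < hi) /\
  (forall e y, In e E -> In x e -> In y e -> rk y <= rk x).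
Proof.
  intros (Hlh & Hhk & Hcore & Hlo & Hhi).
  enough (forall n x, rk x = n -> lo <= x < hi ->
    (forall y, y < k -> rk y = n -> lo <= y < hi) /\
    (forall e y, In e E -> In x e -> In y e -> rk y <= n)) as Hmain.
  { intros x Hx. now apply Hmain. }
  induction n as [n IH] using lt_wf_ind. intros x Hxn Hx.
  assert (Hone : forall y, y < k -> rk y = n -> lo <= y < hi).
  { intros y Hy Hyn. apply NNPP; intros Hout.
    destruct (lay_conn _ _ _ _ _ L n (fun u => dec (lo <= u < hi)) x y) as
      (h & Hh & Hle & (z & Hz & Hrz & Az) & (z' & Hz' & Hrz' & Az')); auto; try lia.
    { now apply dec_true. } { now apply dec_false. }
    cbn beta in Az, Az'. apply dec_elim in Az. apply dec_nelim in Az'.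
    assert (Hcz : core z) by (apply Hcore; lia).
    assert (Hi : itv h) by (apply (core_itv z); auto).
    (* Of two neighbours with different ranks, [a] inside and [b] outside, one has rank below [n].
       If it is [a], the induction hypothesis forbids the member [z] of rank [n]; if it is [b], it
       is trapped between [z] and [z']. *)
    assert (Hbd : forall a b, lo <= a < hi -> ~ lo <= b < hi -> In a h -> In b h -> b < k -> rk a <> rk b ->
       (b < a /\ z' <= b) \/ (a < b /\ b <= z') -> False).
    { intros a b Ha Hb Hah Hbh Hbk Hab Hord.
      assert (Han : rk a <= n) by (apply Hle; auto).
      assert (Hbn : rk b <= n) by (apply Hle; auto).
      destruct (Nat.eq_dec (rk a) n) as [Ea|Na].
      - assert (rk b < n) by lia.
        assert (b <> z') by (intros ->; lia).
        destruct Hord as [Hord|Hord].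
        + apply (no_trapped h z' b z z); auto; try lia.
        + apply (no_trapped h z b z' z); auto; try lia.
      - assert (rk a < n) by lia.
        destruct (IH (rk a) H a eq_refl Ha) as (_ & H2).
        specialize (H2 h z Hh Hah Hz). lia. }
    destruct (le_lt_dec lo z') as [Hzl|Hzl].
    - assert (Hz'k : z' < k) by (apply (lay_lt _ _ _ _ _ L h); auto).
      destruct Hhi as [Hhi|Hhi]; [lia|].
      assert (In (hi - 1) h).
      { destruct (Nat.eq_dec z (hi - 1)) as [<-|]; auto. apply (Hi z _ z'); auto; lia. }
      assert (In hi h).
      { destruct (Nat.eq_dec z' hi) as [<-|]; auto. apply (Hi z _ z'); auto; lia. }
      apply (Hbd (hi - 1) hi); auto; lia.
    - destruct Hlo as [Hlo|Hlo]; [lia|].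
      assert (In (lo - 1) h).
      { destruct (Nat.eq_dec z' (lo - 1)) as [<-|]; auto. apply (Hi z' _ z); auto; lia. }
      assert (In lo h).
      { destruct (Nat.eq_dec z lo) as [<-|]; auto. apply (Hi z' _ z); auto; lia. }
      apply (Hbd lo (lo - 1)); auto; lia. }
  split; auto.
  intros e y He Hxe Hye. destruct (le_lt_dec (rk y) n); auto. exfalso. subst n.
  destruct (lay_max _ _ _ _ _ L e x y) as (f & u & v & w & Hf & Huvw & Huf & Hwf & Hvf & Hz); auto.
  assert (Hcx : core x) by (apply Hcore; lia).
  assert (Hnf : ~ itv f) by (intros Hi; apply Hvf, (Hi u v w); auto).
  (* A position of the piece of [x] is core, so a meeting that is not contiguous avoids it; only
     members of [e] remain for [u] and [w]. *)
  assert (Hine : forall z, z = u \/ z = w -> In z f -> In z e).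
  { intros z Hzz Hzf. destruct (Hz z) as (Hzk & [Hr|[Hr _]]); [tauto| |auto].
    exfalso. apply Hnf, (core_itv z); auto. }
  assert (In u e) by auto. assert (In w e) by auto.
  apply Hvf, (core_convex e x f u v w); auto.
  apply (core_itv x e Hcx He Hxe u v w); auto.
Qed.

(** * Breaks and the cuts to which they are charged *)

Definition sbreak b := 1 <= b /\ b < k /\ rk (b - 1) <> rk b /\
  exists e, In e E /\ itv e /\ In (b - 1) e /\ In b e.

(** For cuts to the left this is the condition of [core b], for cuts to the right that of
    [core (b - 1)]. Hence all positions between two far breaks with no cut between them are core. *)
Definition far b := forall r, In r Rc -> r + d <= S b \/ b + d <= S r.

(** [far_lemma], applied at [b - 1] and at [b], gives both inequalities between their ranks. *)
Lemma clean_block_no_break lo hi b : clean_block lo hi -> lo < b < hi -> ~ sbreak b.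
Proof.
  intros Hb Hlt (H1 & H2 & H3 & e & He & Hi & Ha & Hc). apply H3.
  destruct (far_lemma lo hi Hb b) as (_ & G1); [lia|].
  destruct (far_lemma lo hi Hb (b - 1)) as (_ & G2); [lia|].
  specialize (G1 e (b - 1) He Hc Ha). specialize (G2 e b He Ha Hc). lia.
Qed.

(** [r] is the nearest cut on the left and no other far break lies between, so [b] is the only far
    break that charges [r] from this side. [rfree] is the mirror image. *)
Definition lfree r b := In r Rc /\ r <= b /\ (forall r', In r' Rc -> r' <= b -> r' <= r) /\
  forall b', sbreak b' -> far b' -> r <= b' -> b' < b -> False.
Definition rfree r b := In r Rc /\ b <= r /\ (forall r', In r' Rc -> b <= r' -> r <= r') /\
  forall b', sbreak b' -> far b' -> b < b' -> b' <= r -> False.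

Lemma not_lfree b : sbreak b -> far b -> ~ (exists r, lfree r b) ->
  exists lo, lo < b /\ (lo = 0 \/ (sbreak lo /\ far lo)) /\ forall r, In r Rc -> r <= b -> r <= lo /\ 0 < lo.
Proof.
  intros Hs Hf Hn.
  destruct (classic (exists r, In r Rc /\ r <= b)) as [H|H].
  - destruct (exists_max (fun r => r <= b) Rc H) as (r & Hr & Hrb & Hmax).
    apply NNPP; intros Hno. apply Hn. exists r. repeat split; auto.
    intros b' H1 H2 H3 H4. apply Hno. exists b'. split; auto. split; auto.
    intros r' Hr' Hr'b. destruct H1 as (H1 & _). specialize (Hmax r' Hr' Hr'b). lia.
  - exists 0. destruct Hs as (Hs & _). split; [lia|]. split; auto. intros r Hr Hrb. exfalso; eauto.
Qed.

Lemma not_rfree b : sbreak b -> far b -> ~ (exists r, rfree r b) ->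
  exists hi, b < hi /\ hi <= k /\ (hi = k \/ (sbreak hi /\ far hi)) /\
    forall r, In r Rc -> b <= r -> hi <= r /\ sbreak hi /\ far hi.
Proof.
  intros Hs Hf Hn.
  destruct (classic (exists r, In r Rc /\ b <= r)) as [H|H].
  - destruct (exists_min (fun r => b <= r) Rc H) as (r & Hr & Hrb & Hmin).
    apply NNPP; intros Hno. apply Hn. exists r. repeat split; auto.
    intros b' H1 H2 H3 H4. apply Hno. exists b'. split; auto. split; [destruct H1; lia|]. split; auto.
    intros r' Hr' Hr'b. specialize (Hmin r' Hr' Hr'b). split; [lia|auto].
  - exists k. destruct Hs as (Hs & Hs2 & _). split; [lia|]. split; [lia|]. split; auto.
    intros r Hr Hrb. exfalso; eauto.
Qed.

Lemma not_rfree_clean b : sbreak b -> far b -> ~ (exists r, rfree r b) -> exists hi, clean_block b hi.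
Proof.
  intros Hs Hf Hn. destruct (not_rfree b Hs Hf Hn) as (hi & H1 & H2 & H3 & H4).
  exists hi. split; auto. split; auto. split; [|split].
  - intros i Hi r Hr. destruct (Hf r Hr) as [H|H]; [right; lia|].
    destruct (H4 r Hr) as (H5 & _ & H6); [lia|]. destruct (H6 r Hr); lia.
  - right. apply Hs.
  - destruct H3 as [->|[H3 _]]; auto. right. apply H3.
Qed.

Lemma not_lfree_clean b : sbreak b -> far b -> ~ (exists r, lfree r b) -> exists lo, clean_block lo b.
Proof.
  intros Hs Hf Hn. destruct (not_lfree b Hs Hf Hn) as (lo & H1 & H2 & H3).
  exists lo. split; auto. split; [destruct Hs; lia|]. split; [|split].
  - intros i Hi r Hr. destruct (Hf r Hr) as [H|H]; [|left; lia].
    destruct (H3 r Hr) as (H5 & H6); [lia|]. destruct H2 as [->|[_ H2]]; [lia|].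
    destruct (H2 r Hr); lia.
  - destruct H2 as [->|[H2 _]]; auto. right. apply H2.
  - right. apply Hs.
Qed.

(** Otherwise there are clean blocks on both sides of [b], and their union is a clean block with the
    break [b] inside. *)
Lemma lfree_or_rfree b : sbreak b -> far b -> (exists r, lfree r b) \/ (exists r, rfree r b).
Proof.
  intros Hs Hf. apply NNPP; intros Hn. apply not_or_and in Hn as (Hl & Hr).
  destruct (not_lfree_clean b Hs Hf Hl) as (lo & A1 & A2 & A3 & A4 & _).
  destruct (not_rfree_clean b Hs Hf Hr) as (hi & B1 & B2 & B3 & _ & B4).
  apply (clean_block_no_break lo hi b); auto; try lia.
  split; [lia|]. split; auto. split; auto.
  intros i Hi. destruct (le_lt_dec b i); [apply B3|apply A3]; lia.
Qed.

Definition Sl := sel sbreak (seq 0 k).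
Definition FS := sel far Sl.

Lemma in_Sl b : In b Sl <-> sbreak b.
Proof.
  unfold Sl. rewrite in_sel, in_seq. split; [tauto|]. intros H. split; auto. destruct H; lia.
Qed.
Lemma in_FS b : In b FS <-> sbreak b /\ far b.
Proof. unfold FS. now rewrite in_sel, in_Sl. Qed.
Lemma Sl_NoDup : NoDup Sl.
Proof. apply sel_NoDup, seq_NoDup. Qed.
Lemma FS_NoDup : NoDup FS.
Proof. apply sel_NoDup, Sl_NoDup. Qed.

Lemma lfree_inj r b b' : In b FS -> In b' FS -> lfree r b -> lfree r b' -> b = b'.
Proof.
  rewrite !in_FS. intros (H1 & H2) (H3 & H4) (_ & A & _ & A') (_ & B & _ & B').
  destruct (lt_eq_lt_dec b b') as [[H|H]|H]; auto; exfalso; eauto.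
Qed.
Lemma rfree_inj r b b' : In b FS -> In b' FS -> rfree r b -> rfree r b' -> b = b'.
Proof.
  rewrite !in_FS. intros (H1 & H2) (H3 & H4) (_ & A & _ & A') (_ & B & _ & B').
  destruct (lt_eq_lt_dec b b') as [[H|H]|H]; auto; exfalso; eauto.
Qed.

Definition isL b := exists r, lfree r b.
Definition isR b := exists r, rfree r b.

Lemma isL_count : length (sel isL FS) <= length Rc.
Proof.
  apply (rel_inj_length (fun b r => lfree r b)); [apply sel_NoDup, FS_NoDup| |].
  - intros b Hb. apply in_sel in Hb as (_ & r & Hr). exists r. split; auto. apply Hr.
  - intros b b' r Hb Hb'. apply in_sel in Hb as (Hb & _), Hb' as (Hb' & _). now apply lfree_inj.
Qed.
Lemma isR_count : length (sel isR FS) <= length Rc.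
Proof.
  apply (rel_inj_length (fun b r => rfree r b)); [apply sel_NoDup, FS_NoDup| |].
  - intros b Hb. apply in_sel in Hb as (_ & r & Hr). exists r. split; auto. apply Hr.
  - intros b b' r Hb Hb'. apply in_sel in Hb as (Hb & _), Hb' as (Hb' & _). now apply rfree_inj.
Qed.

Definition tightL b := isL b /\ ~ isR b.
Definition tightR b := isR b /\ ~ isL b.

(* A far break is charged in halves to the cuts next to it on its two sides, or to one of them alone (tight). *)
Lemma far_split : length FS = length (sel (fun b => isL b /\ isR b) FS) + length (sel tightL FS) + length (sel tightR FS)
  /\ 2 * length (sel (fun b => isL b /\ isR b) FS) + length (sel tightL FS) + length (sel tightR FS) <= 2 * length Rc.
Proof.
  pose proof isL_count as HL. pose proof isR_count as HR.
  rewrite !sel_length_sumf in *.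
  assert (H1 : length FS = sumf (fun _ => 1) FS) by (rewrite sumf_const; lia).
  rewrite H1. clear H1.
  assert (HH : forall b, In b FS ->
     b2n (dec (isL b /\ isR b)) + b2n (dec (tightL b)) = b2n (dec (isL b)) /\
     b2n (dec (isL b /\ isR b)) + b2n (dec (tightR b)) = b2n (dec (isR b)) /\
     b2n (dec (isL b /\ isR b)) + b2n (dec (tightL b)) + b2n (dec (tightR b)) = 1).
  { intros b Hb. apply in_FS in Hb as (H1 & H2).
    pose proof (lfree_or_rfree b H1 H2) as Ho. fold (isL b) (isR b) in Ho.
    unfold tightL, tightR.
    generalize dependent (isL b). intros P HP. generalize dependent (isR b). intros Q HQ.
    destruct (classic P) as [HP1|HP1]; destruct (classic Q) as [HQ1|HQ1]; try tauto;
      repeat match goal with |- context [dec ?X] =>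
        first [ replace (dec X) with true by (symmetry; apply dec_true; tauto)
              | replace (dec X) with false by (symmetry; apply dec_false; tauto) ] end;
      simpl; lia. }
  assert (G : sumf (fun b => b2n (dec (isL b /\ isR b)) + b2n (dec (tightL b)) + b2n (dec (tightR b))) FS
     = sumf (fun _ => 1) FS /\
     sumf (fun b => b2n (dec (isL b /\ isR b)) + b2n (dec (tightL b))) FS = sumf (fun b => b2n (dec (isL b))) FS /\
     sumf (fun b => b2n (dec (isL b /\ isR b)) + b2n (dec (tightR b))) FS = sumf (fun b => b2n (dec (isR b))) FS).
  { clear HL HR. induction FS as [|b l IH]; [repeat split; reflexivity|].
    destruct IH as (I1 & I2 & I3); [intros; apply HH; now right|].
    destruct (HH b (or_introl eq_refl)) as (J1 & J2 & J3). rewrite !sumf_cons. lia. }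
  rewrite !sumf_add in G. lia.
Qed.

(** * Pieces met by a contiguous meeting *)

Definition np (e : list nat) := length (nodup Nat.eq_dec (map rk e)).
Definition crosses b (e : list nat) := In (b - 1) e /\ In b e.
Definition crs (e : list nat) := length (sel (fun b => crosses b e) Sl).
Definition cr b := length (sel (crosses b) (sel itv E)).

Lemma np_le_length e : np e <= length e.
Proof.
  unfold np. rewrite <- (length_map rk e). apply NoDup_incl_length; [apply NoDup_nodup|].
  intros x Hx. now apply nodup_In in Hx.
Qed.

(** Read from left to right, a contiguous meeting can enter a new piece only at a break that it
    crosses; the leftmost position accounts for the extra one. *)
Lemma np_crs e : In e E -> itv e -> np e <= 1 + crs e.
Proof.
  intros He Hi. destruct e as [|a0 e0] eqn:Ee; [unfold np; simpl; lia|]. rewrite <- Ee in *.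
  destruct (itv_seq e) as (lo & Hlo); auto; [subst; discriminate|].
  assert (Hloe : In lo e).
  { apply Hlo. subst e. simpl. lia. }
  unfold np, crs.
  change (1 + length (sel (fun b => crosses b e) Sl)) with (length (lo :: sel (fun b => crosses b e) Sl)).
  rewrite <- (length_map rk (lo :: _)).
  apply NoDup_incl_length; [apply NoDup_nodup|].
  intros v Hv. apply nodup_In in Hv. apply in_map_iff in Hv as (x & <- & Hx).
  assert (Hx2 := Hx). apply Hlo in Hx2. destruct Hx2 as (Hx2 & Hx3).
  clear Hx. revert Hx3. induction Hx2 as [|x Hx2 IH]; intros Hx3; [now left|].
  destruct (Nat.eq_dec (rk x) (rk (S x))) as [Heq|Hne].
  - rewrite <- Heq. apply IH. lia.
  - right. apply in_map. apply in_sel.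
    assert (In x e) by (apply Hlo; lia). assert (In (S x) e) by (apply Hlo; lia).
    replace x with (S x - 1) in H by lia. split; [|split; auto].
    apply in_Sl. split; [lia|]. split; [eapply llt; eauto|]. split.
    + now replace (S x - 1) with x by lia.
    + exists e; auto.
Qed.

Lemma sum_crs : sumf crs (sel itv E) = sumf cr Sl.
Proof.
  unfold crs, cr.
  transitivity (sumf (fun e => sumf (fun b => b2n (dec (crosses b e))) Sl) (sel itv E)).
  { unfold sumf at 1 2. f_equal. apply map_ext. intros e. apply sel_length_sumf. }
  rewrite sumf_swap. unfold sumf at 1 3. f_equal. apply map_ext. intros b. symmetry. apply sel_length_sumf.
Qed.

Definition pair_list n := flat_map (fun i => map (pair i) (seq 1 (n - i))) (seq 0 n).

Lemma pair_list_length n : 2 * length (pair_list n) = n * (n + 1).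
Proof.
  enough (forall m n, 2 * length (flat_map (fun i => map (pair i) (seq 1 (n + m - i))) (seq m n)) = n * (n + 1)) as H.
  { unfold pair_list. rewrite <- (H 0 n). do 2 f_equal. apply flat_map_ext. intros. now rewrite Nat.add_0_r. }
  clear. intros m n. revert m. induction n as [|n IH]; intros m; [reflexivity|].
  cbn [flat_map seq]. rewrite length_app, length_map, length_seq.
  specialize (IH (S m)). replace (n + S m) with (S n + m) in IH by lia. nia.
Qed.

(** A contiguous meeting across [b] is determined by the number i of its positions before [b - 1]
    and the number j of those from [b] on, where j is positive and i + j is at most [d - 1].
    [pair_list] enumerates these pairs. *)
Lemma cr_le b : sbreak b -> 2 * cr b <= d * (d - 1).
Proof.
  intros Hb. replace (d * (d - 1)) with ((d - 1) * (d - 1 + 1)) by nia.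
  rewrite <- pair_list_length. apply Nat.mul_le_mono_l.
  unfold cr. apply (rel_inj_length (fun e p => exists lo, (forall x, In x e <-> lo <= x < lo + length e) /\
    lo <= b - 1 /\ b < lo + length e /\ p = (b - 1 - lo, lo + length e - b))).
  - do 2 apply sel_NoDup. eapply distinct_NoDup, L.
  - intros e He. apply in_sel in He as (He & H1 & H2). apply in_sel in He as (He & Hi).
    destruct (itv_seq e) as (lo & Hlo); auto; [intros ->; destruct H1|].
    assert (G1 := H1). assert (G2 := H2). apply Hlo in G1, G2.
    exists (b - 1 - lo, lo + length e - b). split.
    + pose proof (lsz e He). destruct Hb as (Hb & _).
      apply in_flat_map. exists (b - 1 - lo). split; [apply in_seq; lia|].
      apply in_map, in_seq. lia.
    + exists lo. repeat split; try apply Hlo; auto; lia.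
  - intros e e' p He He' (lo & A1 & A2 & A3 & A4) (lo' & B1 & B2 & B3 & B4).
    apply in_sel in He as (He & _), He' as (He' & _). apply in_sel in He as (He & _), He' as (He' & _).
    eapply distinct_eq; [apply L| | |]; auto. subst p. injection B4 as E1 E2.
    assert (lo = lo') by lia. subst. assert (length e = length e') by (destruct Hb; lia).
    intros x. rewrite A1, B1. lia.
Qed.

(** A cut [r] keeps [b] from being far only if the two differ by at most [d - 2]. *)
Lemma inner_count : length (sel (fun b => ~ far b) Sl) <= (2 * d - 3) * length Rc.
Proof.
  rewrite <- (flat_map_length_const (fun r => map (fun i => r + i - (d - 2)) (seq 0 (2 * d - 3)))).
  2:{ intros. now rewrite length_map, length_seq. }
  apply NoDup_incl_length; [apply sel_NoDup, Sl_NoDup|].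
  intros b Hb. apply in_sel in Hb as (_ & Hb). unfold far in Hb.
  apply not_all_ex_not in Hb as (r & Hb). apply imply_to_and in Hb as (Hr & Hb).
  apply in_flat_map. exists r. split; auto. apply in_map_iff.
  exists (b + (d - 2) - r). split; [lia|]. apply in_seq. lia.
Qed.

(** Per cut there are at most [2 * d - 3] breaks nearby, and on average at most two far ones. *)
Lemma sbreak_count : length Sl <= (2 * d - 1) * length Rc.
Proof.
  rewrite <- (sel_length far Sl). fold FS. pose proof inner_count.
  pose proof (far_split). nia.
Qed.

Theorem itv_cost : 2 * sumf (fun e => np e - 1) (sel itv E) <= d * (d - 1) * (2 * d - 1) * length Rc.
Proof.
  assert (H : sumf (fun e => np e - 1) (sel itv E) <= sumf crs (sel itv E)).
  { apply sumf_le. intros e He. apply in_sel in He as (He & Hi). pose proof (np_crs e He Hi). lia. }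
  rewrite sum_crs in H.
  assert (2 * sumf cr Sl <= d * (d - 1) * length Sl).
  { rewrite <- sumf_mul, <- sumf_const. apply sumf_le. intros b Hb. apply cr_le. now apply in_Sl in Hb. }
  pose proof sbreak_count. nia.
Qed.

(** * Savings at tight breaks for small meetings *)

(** The piece of [b - 1] is earlier than that of [b] and could not absorb [e]. Since nothing
    obstructs this between [r] and the end of the clean block, the piece must leave [[r, b)], and
    the meeting [h] that connects it to the outside fills the positions from the cut to [w]. *)
Lemma exitL b r hi e : sbreak b -> far b -> lfree r b -> clean_block b hi ->
  In e E -> crosses b e -> (forall x, In x e -> b <= x -> x < hi) ->
  exists h u w, In h E /\ (forall z, In z h -> rk z <= rk (b - 1)) /\
    In w h /\ r <= w < b /\ rk w = rk (b - 1) /\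
    In u h /\ ~ r <= u < b /\ rk u = rk (b - 1) /\ (forall y, r <= y <= w -> In y h).
Proof.
  intros Hs Hf (Hr & Hrb & Hmax & Hno) Hcb He (Hb1 & Hb2) Hext.
  assert (Hrb2 : r < b) by (destruct (Hf r Hr); lia).
  assert (Hcore : forall x, b <= x < hi -> core x) by apply Hcb.
  assert (Hbhi : b < hi) by apply Hcb.
  assert (Hcb0 : core b) by (apply Hcore; lia).
  assert (Hie : itv e) by (apply (core_itv b); auto).
  assert (Hrk : rk (b - 1) < rk b).
  { destruct (far_lemma b hi Hcb b) as (_ & H); [lia|].
    specialize (H e (b - 1) He Hb2 Hb1). destruct Hs as (_ & _ & Hs & _). lia. }
  assert (Hcut : forall s, In s Rc -> r < s -> b < s).
  { intros s Hs' Hlt'. destruct (le_lt_dec s b) as [H|]; auto. specialize (Hmax s Hs' H). lia. }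
  (* A run leaving [r, b) to the right would contain the core position [b]. *)
  assert (Hrun : forall f x, In f E -> ~ itv f -> In x f -> r <= x < hi -> (x < b \/ core x) ->
    forall y, r <= y <= x -> In y f).
  { intros f x Hfe Hnf Hxf Hx Hxb.
    assert (~ core x) by (intros Hc; apply Hnf; eapply core_itv; eauto).
    destruct (lay_touch _ _ _ _ _ L f x Hfe Hnf Hxf) as [(s & Hs' & G1 & G2 & G3)|(s & Hs' & G1 & G2 & G3)].
    - exfalso. assert (b < s) by (apply Hcut; auto; lia).
      apply Hnf. apply (core_itv b); auto. apply G3. destruct Hxb; [lia|tauto].
    - intros y Hy. apply G3. split; [|lia].
      destruct (le_lt_dec s r); [lia|]. assert (b < s) by auto. destruct Hxb; [lia|tauto]. }
  assert (Hel : forall x, In x e -> r <= x).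
  { intros x Hx. destruct (le_lt_dec r x); auto. exfalso.
    apply (core_no_cut e b x b r); auto. }
  (* If the piece stayed in [[r, b)], the obstruction [u < v < w] would lie in [[r, hi)]; there the
     run of [w] extends back to [r] and contains [v]. *)
  assert (HB : exists v, v < k /\ rk v = rk (b - 1) /\ ~ r <= v < b).
  { apply NNPP; intros HnB.
    destruct (lay_max _ _ _ _ _ L e (b - 1) b) as (f & u & v & w & Hfe & Huvw & Huf & Hwf & Hvf & Hz); auto.
    assert (Hnf : ~ itv f) by (intros Hi; apply Hvf, (Hi u v w); auto).
    assert (Hall : forall z, z = u \/ z = v \/ z = w -> r <= z < hi /\ (z < b \/ core z)).
    { intros z Hzz. destruct (Hz z Hzz) as (Hzk & [Hrz|[Hze _]]).
      - destruct (classic (r <= z < b)); [lia|]. exfalso; eauto.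
      - specialize (Hel z Hze). destruct (le_lt_dec b z); [|lia]. specialize (Hext z Hze l).
        split; [lia|]. right. apply Hcore. lia. }
    apply Hvf. apply (Hrun f w); auto; try apply Hall; auto.
    specialize (Hall u). lia. }
  destruct HB as (v & Hvk & Hrv & Hvout).
  assert (Hb1k : b - 1 < k) by (eapply llt; eauto).
  destruct (lay_conn _ _ _ _ _ L (rk (b - 1)) (fun z => dec (r <= z < b)) (b - 1) v) as
    (h & Hh & Hle & (w & Hw & Hrw & Aw) & (u & Hu & Hru & Au)); auto.
  { apply dec_true. lia. } { now apply dec_false. }
  apply dec_elim in Aw. apply dec_nelim in Au.
  exists h, u, w. repeat split; auto; try lia.
  intros y Hy.
  assert (Hbh : ~ In b h) by (intros Hx; apply Hle in Hx; lia).
  destruct (classic (itv h)) as [Hih|Hnh].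
  - assert (u < r). { apply NNPP; intros Hur. apply Hbh.
      destruct (Nat.eq_dec u b) as [<-|]; auto. apply (Hih w b u); auto; lia. }
    destruct (Nat.eq_dec y w) as [->|]; auto. apply (Hih u y w); auto; lia.
  - apply (Hrun h w); auto; lia.
Qed.

(** Mirror image of [exitL]. *)
Lemma exitR b r lo e : sbreak b -> far b -> rfree r b -> clean_block lo b ->
  In e E -> crosses b e -> (forall x, In x e -> x < b -> lo <= x) ->
  exists h u w, In h E /\ (forall z, In z h -> rk z <= rk b) /\
    In w h /\ b <= w < r /\ rk w = rk b /\
    In u h /\ ~ b <= u < r /\ rk u = rk b /\ (forall y, w <= y < r -> In y h).
Proof.
  intros Hs Hf (Hr & Hrb & Hmin & Hno) Hcb He (Hb1 & Hb2) Hext.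
  assert (Hb0 : 1 <= b) by apply Hs.
  assert (Hrb2 : b < r) by (destruct (Hf r Hr); lia).
  assert (Hcore : forall x, lo <= x < b -> core x) by apply Hcb.
  assert (Hblo : lo < b) by apply Hcb.
  assert (Hcb0 : core (b - 1)) by (apply Hcore; lia).
  assert (Hie : itv e) by (apply (core_itv (b - 1)); auto).
  assert (Hrk : rk b < rk (b - 1)).
  { destruct (far_lemma lo b Hcb (b - 1)) as (_ & H); [lia|].
    specialize (H e b He Hb1 Hb2). destruct Hs as (_ & _ & Hs & _). lia. }
  assert (Hcut : forall s, In s Rc -> s < r -> s < b).
  { intros s Hs' Hlt'. destruct (le_lt_dec b s) as [H|]; auto. specialize (Hmin s Hs' H). lia. }
  assert (Hrun : forall f x, In f E -> ~ itv f -> In x f -> lo <= x < r -> (b <= x \/ core x) ->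
    forall y, x <= y < r -> In y f).
  { intros f x Hfe Hnf Hxf Hx Hxb.
    assert (~ core x) by (intros Hc; apply Hnf; eapply core_itv; eauto).
    destruct (lay_touch _ _ _ _ _ L f x Hfe Hnf Hxf) as [(s & Hs' & G1 & G2 & G3)|(s & Hs' & G1 & G2 & G3)].
    - intros y Hy. apply G3. split; [lia|].
      destruct (le_lt_dec r s); [lia|]. assert (s < b) by auto. destruct Hxb; [lia|tauto].
    - exfalso. assert (s < b) by (apply Hcut; auto; lia).
      apply Hnf. apply (core_itv (b - 1)); auto. apply G3. destruct Hxb; [lia|tauto]. }
  assert (Hel : forall x, In x e -> x < r).
  { intros x Hx. destruct (le_lt_dec r x); auto. exfalso.
    apply (core_no_cut e (b - 1) (b - 1) x r); auto. lia. }
  assert (HB : exists v, v < k /\ rk v = rk b /\ ~ b <= v < r).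
  { apply NNPP; intros HnB.
    destruct (lay_max _ _ _ _ _ L e b (b - 1)) as (f & u & v & w & Hfe & Huvw & Huf & Hwf & Hvf & Hz); auto.
    assert (Hnf : ~ itv f) by (intros Hi; apply Hvf, (Hi u v w); auto).
    assert (Hall : forall z, z = u \/ z = v \/ z = w -> lo <= z < r /\ (b <= z \/ core z)).
    { intros z Hzz. destruct (Hz z Hzz) as (Hzk & [Hrz|[Hze _]]).
      - destruct (classic (b <= z < r)); [lia|]. exfalso; eauto.
      - specialize (Hel z Hze). destruct (le_lt_dec b z); [lia|]. specialize (Hext z Hze l).
        split; [lia|]. right. apply Hcore. lia. }
    apply Hvf. apply (Hrun f u); auto; try apply Hall; auto.
    specialize (Hall w). lia. }
  destruct HB as (v & Hvk & Hrv & Hvout).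
  assert (Hbk : b < k) by apply Hs.
  destruct (lay_conn _ _ _ _ _ L (rk b) (fun z => dec (b <= z < r)) b v) as
    (h & Hh & Hle & (w & Hw & Hrw & Aw) & (u & Hu & Hru & Au)); auto.
  { apply dec_true. lia. } { now apply dec_false. }
  apply dec_elim in Aw. apply dec_nelim in Au.
  exists h, u, w. repeat split; auto; try lia.
  intros y Hy.
  assert (Hbh : ~ In (b - 1) h) by (intros Hx; apply Hle in Hx; lia).
  destruct (classic (itv h)) as [Hih|Hnh].
  - assert (r <= u). { apply NNPP; intros Hur. apply Hbh.
      destruct (Nat.eq_dec u (b - 1)) as [<-|]; auto. apply (Hih u (b - 1) w); auto; lia. }
    destruct (Nat.eq_dec y w) as [->|]; auto. apply (Hih w y u); auto; lia.
  - apply (Hrun h w); auto; lia.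
Qed.

Lemma tightL_inv b : In b FS -> tightL b -> exists r hi, lfree r b /\ clean_block b hi /\ sbreak b /\ far b.
Proof.
  intros Hb ((r & Hr) & HnR). apply in_FS in Hb as (Hs & Hf).
  destruct (not_rfree_clean b Hs Hf HnR) as (hi & Hhi). eauto 6.
Qed.

Lemma tightR_inv b : In b FS -> tightR b -> exists r lo, rfree r b /\ clean_block lo b /\ sbreak b /\ far b.
Proof.
  intros Hb ((r & Hr) & HnR). apply in_FS in Hb as (Hs & Hf).
  destruct (not_lfree_clean b Hs Hf HnR) as (hi & Hhi). eauto 6.
Qed.

Lemma lt_of_clean b hi : sbreak b -> clean_block b hi -> rk (b - 1) < rk b.
Proof.
  intros (H1 & H2 & H3 & e & He & Hi & Ha & Hb) Hc.
  assert (b < hi) by apply Hc.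
  destruct (far_lemma b hi Hc b) as (_ & H4); [lia|]. specialize (H4 e (b - 1) He Hb Ha). lia.
Qed.

Lemma gt_of_clean b lo : sbreak b -> clean_block lo b -> rk b < rk (b - 1).
Proof.
  intros (H1 & H2 & H3 & e & He & Hi & Ha & Hb) Hc.
  assert (lo < b) by apply Hc.
  destruct (far_lemma lo b Hc (b - 1)) as (_ & H4); [lia|]. specialize (H4 e b He Ha Hb). lia.
Qed.

(* For [d <= 3] the plain count is too weak: a tight break is compensated by a saving at its cut. *)
Lemma tightL_two b : d = 2 -> In b FS -> tightL b -> exists r, lfree r b /\
  (~ sbreak r \/ exists h, In h E /\ ~ itv h /\ np h <= 1 /\ In r h).
Proof.
  intros D2 Hb Ht. destruct (tightL_inv b Hb Ht) as (r & hi & Hlf & Hc & Hs & Hf).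
  exists r. split; auto.
  assert (Hs' := Hs). destruct Hs' as (Hb0 & Hbk & Hne & e & He & Hie & Ha & Hb1).
  assert (Hbhi : b < hi) by apply Hc.
  destruct (exitL b r hi e) as (h & u & w & Hh & Hle & Hw & Hwr & Hrw & Hu & Hur & Hru & Hrun); auto.
  { now split. }
  { intros x Hx Hbx. pose proof (edge_span e (b - 1) x He Hie Ha Hx). lia. }
  assert (Hr : In r h) by (apply Hrun; lia).
  assert (w = r /\ forall x, In x h -> x = u \/ x = r) as (-> & Hall).
  { pose proof (lsz h Hh) as Hl. pose proof (lND h Hh) as Hn.
    assert (Hx : forall x, In x h -> x = u \/ x = r).
    { intros x Hx. apply NNPP; intros Hnx. assert (3 <= length h); [|lia].
      change 3 with (length [x; u; r]). apply NoDup_incl_length.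
      - repeat constructor; simpl; try tauto; lia.
      - intros z [<-|[<-|[<-|[]]]]; auto. }
    split; auto. destruct (Hx w Hw); lia. }
  assert (Hbh : ~ In b h). { intros Hx. apply Hle in Hx. pose proof (lt_of_clean b hi Hs Hc). lia. }
  (* If [h] is contiguous, it joins [r - 1] and [r] within one piece, so the cut [r] is no break.
     Otherwise [h] is not contiguous but lies in one piece, less than its size suggests. *)
  destruct (classic (itv h)) as [Hih|Hih].
  - left. intros (_ & _ & Hrr & _). apply Hrr.
    assert (u < r). { apply NNPP; intros Hn. apply Hbh. destruct (Nat.eq_dec u b) as [<-|]; auto.
      apply (Hih r b u); auto; lia. }
    assert (u = r - 1) as <-; [|congruence].
    pose proof (edge_span h u r Hh Hih Hu Hr). lia.
  - right. exists h. repeat split; auto. unfold np.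
    change 1 with (length [rk r]). apply NoDup_incl_length; [apply NoDup_nodup|].
    intros x Hx. apply nodup_In, in_map_iff in Hx as (z & <- & Hz). left.
    destruct (Hall z Hz) as [->| ->]; congruence.
Qed.

Lemma tightR_two b : d = 2 -> In b FS -> tightR b -> exists r, rfree r b /\
  (~ sbreak r \/ exists h, In h E /\ ~ itv h /\ np h <= 1 /\ In (r - 1) h).
Proof.
  intros D2 Hb Ht. destruct (tightR_inv b Hb Ht) as (r & lo & Hlf & Hc & Hs & Hf).
  exists r. split; auto.
  assert (Hs' := Hs). destruct Hs' as (Hb0 & Hbk & Hne & e & He & Hie & Ha & Hb1).
  assert (Hblo : lo < b) by apply Hc.
  destruct (exitR b r lo e) as (h & u & w & Hh & Hle & Hw & Hwr & Hrw & Hu & Hur & Hru & Hrun); auto.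
  { now split. }
  { intros x Hx Hbx. pose proof (edge_span e x b He Hie Hx Hb1). lia. }
  assert (Hr : In (r - 1) h) by (apply Hrun; lia).
  assert (w = r - 1 /\ forall x, In x h -> x = u \/ x = r - 1) as (-> & Hall).
  { pose proof (lsz h Hh) as Hl. pose proof (lND h Hh) as Hn.
    assert (Hx : forall x, In x h -> x = u \/ x = r - 1).
    { intros x Hx. apply NNPP; intros Hnx. assert (3 <= length h); [|lia].
      change 3 with (length [x; u; r - 1]). apply NoDup_incl_length.
      - repeat constructor; simpl; try tauto; lia.
      - intros z [<-|[<-|[<-|[]]]]; auto. }
    split; auto. destruct (Hx w Hw); lia. }
  assert (Hbh : ~ In (b - 1) h). { intros Hx. apply Hle in Hx. pose proof (gt_of_clean b lo Hs Hc). lia. }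
  destruct (classic (itv h)) as [Hih|Hih].
  - left. intros (_ & _ & Hrr & _). apply Hrr.
    assert (r <= u). { apply NNPP; intros Hn. apply Hbh. destruct (Nat.eq_dec u (b - 1)) as [<-|]; auto.
      apply (Hih u (b - 1) (r - 1)); auto; lia. }
    assert (u = r) as <-; [|congruence].
    pose proof (edge_span h (r - 1) u Hh Hih Hr Hu). lia.
  - right. exists h. repeat split; auto. unfold np.
    change 1 with (length [rk (r - 1)]). apply NoDup_incl_length; [apply NoDup_nodup|].
    intros x Hx. apply nodup_In, in_map_iff in Hx as (z & <- & Hz). left.
    destruct (Hall z Hz) as [->| ->]; congruence.
Qed.

(** For [d = 3] the three given positions exhaust the meeting, and meetings differ as sets. *)
Lemma cr_one b lo : d = 3 -> (forall e, In e E -> crosses b e -> itv e ->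
   In lo e /\ In (lo + 1) e /\ In (lo + 2) e) -> cr b <= 1.
Proof.
  intros D3 H. unfold cr. change 1 with (length [tt]).
  apply (rel_inj_length (fun _ _ => True)).
  - do 2 apply sel_NoDup. eapply distinct_NoDup, L.
  - intros e _. exists tt. simpl. auto.
  - intros e e' _ He He' _ _.
    apply in_sel in He as (He & H1), He' as (He' & H2). apply in_sel in He as (He & Hi), He' as (He' & Hi').
    eapply distinct_eq; [apply L| | |]; auto.
    assert (Hall : forall f, In f E -> crosses b f -> itv f -> forall x, In x f <-> lo <= x < lo + 3).
    { intros f Hfe Hcf Hif x. destruct (H f Hfe Hcf Hif) as (G1 & G2 & G3). split.
      - intros Hx. pose proof (edge_span f lo x Hfe Hif G1 Hx).
        pose proof (edge_span f x (lo + 2) Hfe Hif Hx G3). lia.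
      - intros Hx. assert (x = lo \/ x = lo + 1 \/ x = lo + 2) as [->|[->| ->]] by lia; auto. }
    intros x. now rewrite !Hall.
Qed.

Lemma three_cover h x y z : d = 3 -> In h E -> In x h -> In y h -> In z h -> x <> y -> x <> z -> y <> z ->
  length h = 3 /\ forall v, In v h -> v = x \/ v = y \/ v = z.
Proof.
  intros D3 Hh Hx Hy Hz H1 H2 H3. pose proof (lsz h Hh) as Hl. pose proof (lND h Hh) as Hn.
  assert (H4 : 3 <= length h).
  { change 3 with (length [x; y; z]). apply NoDup_incl_length.
    - repeat constructor; simpl; try tauto; lia.
    - intros a [<-|[<-|[<-|[]]]]; auto. }
  split; [lia|]. intros v Hv. apply NNPP; intros Hnv.
  assert (4 <= length h); [|lia].
  change 4 with (length [v; x; y; z]). apply NoDup_incl_length.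
  - repeat constructor; simpl; try tauto; lia.
  - intros a [<-|[<-|[<-|[<-|[]]]]]; auto.
Qed.

(** Three ways in which a tight break is compensated: a position next to its cut is not a break, at
    most one meeting crosses the tight break, or the connecting meeting of [exitL] meets fewer
    pieces than it is charged for. *)
Lemma tightL_three b : d = 3 -> In b FS -> tightL b -> exists r, lfree r b /\
  (~ sbreak (r + 1) \/ cr b <= 1 \/
   exists h u, In h E /\ In r h /\ In (r + 1) h /\ In u h /\ u <> r /\ u <> r + 1 /\
     rk u = rk (r + 1) /\ rk r <> rk u /\ (itv h -> r = u + 1)).
Proof.
  intros D3 Hb Ht. destruct (tightL_inv b Hb Ht) as (r & hi & Hlf & Hc & Hs & Hf).
  exists r. split; auto.
  assert (Hbhi : b < hi) by apply Hc.
  assert (Hcb : core b) by (apply Hc; lia).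
  destruct (classic (exists e, In e E /\ crosses b e /\ forall x, In x e -> b <= x -> x < hi)) as [(e & He & Hce & Hext)|Hno].
  (* Every contiguous meeting across [b] leaves the clean block on the right, so it consists of
     [b - 1], [b] and [b + 1]. *)
  2:{ right. left. apply (cr_one b (b - 1)); auto. intros e He Hce Hie.
      assert (Hx : exists x, In x e /\ hi <= x).
      { apply NNPP; intros Hn. apply Hno. exists e. repeat split; auto; try apply Hce. intros x Hx Hbx.
        destruct (le_lt_dec hi x); auto. exfalso; eauto. }
      destruct Hx as (x & Hx & Hhx). destruct Hce as (Ha & Hb1). destruct Hs as (Hb0 & _).
      pose proof (edge_span e (b - 1) x He Hie Ha Hx).
      replace (b - 1 + 1) with b by lia. replace (b - 1 + 2) with x by lia. auto. }
  destruct (exitL b r hi e) as (h & u & w & Hh & Hle & Hw & Hwr & Hrw & Hu & Hur & Hru & Hrun); auto.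
  assert (Hr : In r h) by (apply Hrun; lia).
  assert (Hrf : r + 3 <= S b). { destruct Hlf as (Hr' & Hrb & _). destruct (Hf r Hr'); lia. }
  assert (Hbh : ~ In b h). { intros Hx. apply Hle in Hx. pose proof (lt_of_clean b hi Hs Hc). lia. }
  destruct (Nat.eq_dec (rk r) (rk (b - 1))) as [Heq|Hneq].
  (* Suppose [r + 1] is a break although [r] is in the piece of [b - 1]. The meeting that connects
     this piece across [r + 2] must consist of [r], [r + 1], [r + 2]; then [r + 2] is a far break
     before [b], against the choice of [r]. *)
  - left. intros Hsr. assert (Hner : rk r <> rk (r + 1)).
    { destruct Hsr as (_ & _ & Hsr & _). now replace (r + 1 - 1) with r in Hsr by lia. }
    destruct (Nat.eq_dec b (r + 2)) as [->|Hbr]; [apply Hner; now replace (r + 1) with (r + 2 - 1) by lia|].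
    assert (Hb1k : b - 1 < k) by (destruct Hs; lia).
    assert (Hrk : r < k) by (eapply llt; eauto).
    destruct Hlf as (Hr' & Hrb & Hmax & Hnob).
    assert (Hcut : forall s, In s Rc -> s <= r \/ b + 3 <= S s).
    { intros s Hs'. destruct (le_lt_dec s b) as [H|H]; [left; auto|right].
      destruct (Hf s Hs'); lia. }
    destruct (lay_conn _ _ _ _ _ L (rk (b - 1)) (fun z => dec (r + 2 <= z < b)) (b - 1) r) as
      (h' & Hh' & Hle' & (w' & Hw' & Hrw' & Aw) & (u' & Hu' & Hru' & Au)); auto.
    { apply dec_true. lia. } { apply dec_false. lia. }
    apply dec_elim in Aw. apply dec_nelim in Au.
    assert (Hcw : core w'). { intros s Hs'. destruct (Hcut s Hs'); lia. }
    assert (Hih : itv h') by (apply (core_itv w'); auto).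
    assert (Hbh' : ~ In b h'). { intros Hx. apply Hle' in Hx. pose proof (lt_of_clean b hi Hs Hc). lia. }
    assert (Hu'r : u' < r + 2). { apply NNPP; intros Hn. apply Hbh'.
      destruct (Nat.eq_dec u' b) as [<-|]; auto. apply (Hih w' b u'); auto; lia. }
    assert (u' <> r + 1) by (intros ->; congruence).
    pose proof (edge_span h' u' w' Hh' Hih Hu' Hw').
    assert (u' = r /\ w' = r + 2) as (-> & ->) by lia.
    assert (In (r + 1) h') by (apply (Hih r _ (r + 2)); auto; lia).
    apply (Hnob (r + 2)); try lia.
    + split; [lia|]. split; [lia|]. replace (r + 2 - 1) with (r + 1) by lia. split; [congruence|].
      exists h'. replace (r + 2 - 1) with (r + 1) by lia. auto.
    + intros s Hs'. destruct (Hcut s Hs'); lia.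
  (* Here [h] consists of [r], [r + 1] and [u], and only [r] is outside the piece of the other
     two. *)
  - right. right.
    assert (Hw1 : w <> r) by (intros ->; congruence).
    assert (H1 : In (r + 1) h) by (apply Hrun; lia).
    destruct (three_cover h r (r + 1) u D3 Hh) as (_ & Hall); auto; try lia.
    assert (w = r + 1) as -> by (destruct (Hall w Hw) as [|[|]]; lia).
    exists h, u. repeat split; auto; try lia.
    intros Hih. pose proof (edge_span h u (r + 1) Hh Hih Hu H1).
    pose proof (edge_span h r u Hh Hih Hr Hu).
    destruct (le_lt_dec u r); [lia|]. exfalso. apply Hbh.
    destruct (Nat.eq_dec u b) as [<-|]; auto. apply (Hih (r + 1) b u); auto; lia.
Qed.

Lemma tightR_three b : d = 3 -> In b FS -> tightR b -> exists r, rfree r b /\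
  (~ sbreak (r - 1) \/ cr b <= 1 \/
   exists h u, In h E /\ In (r - 1) h /\ In (r - 2) h /\ In u h /\ u <> r - 1 /\ u <> r - 2 /\
     rk u = rk (r - 2) /\ rk (r - 1) <> rk u /\ (itv h -> u = r)).
Proof.
  intros D3 Hb Ht. destruct (tightR_inv b Hb Ht) as (r & lo & Hlf & Hc & Hs & Hf).
  exists r. split; auto.
  assert (Hblo : lo < b) by apply Hc.
  assert (Hb0 : 1 <= b) by apply Hs.
  assert (Hcb : core (b - 1)) by (apply Hc; lia).
  destruct (classic (exists e, In e E /\ crosses b e /\ forall x, In x e -> x < b -> lo <= x)) as [(e & He & Hce & Hext)|Hno].
  2:{ right. left. apply (cr_one b (b - 2)); auto. intros e He Hce Hie.
      assert (Hx : exists x, In x e /\ x < lo).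
      { apply NNPP; intros Hn. apply Hno. exists e. repeat split; auto; try apply Hce. intros x Hx Hbx.
        destruct (le_lt_dec lo x); auto. exfalso; eauto. }
      destruct Hx as (x & Hx & Hhx). destruct Hce as (Ha & Hb1).
      pose proof (edge_span e x b He Hie Hx Hb1).
      replace (b - 2 + 1) with (b - 1) by lia. replace (b - 2 + 2) with b by lia.
      replace (b - 2) with x by lia. auto. }
  destruct (exitR b r lo e) as (h & u & w & Hh & Hle & Hw & Hwr & Hrw & Hu & Hur & Hru & Hrun); auto.
  assert (Hr : In (r - 1) h) by (apply Hrun; lia).
  assert (Hrf : b + 3 <= S r). { destruct Hlf as (Hr' & Hrb & _). destruct (Hf r Hr'); lia. }
  assert (Hbh : ~ In (b - 1) h). { intros Hx. apply Hle in Hx. pose proof (gt_of_clean b lo Hs Hc). lia. }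
  destruct (Nat.eq_dec (rk (r - 1)) (rk b)) as [Heq|Hneq].
  - left. intros Hsr. assert (Hner : rk (r - 2) <> rk (r - 1)).
    { destruct Hsr as (_ & _ & Hsr & _). now replace (r - 1 - 1) with (r - 2) in Hsr by lia. }
    destruct (Nat.eq_dec b (r - 2)) as [->|Hbr]; [congruence|].
    assert (Hbk : b < k) by apply Hs.
    assert (Hrk : r - 1 < k) by (eapply llt; eauto).
    destruct Hlf as (Hr' & Hrb & Hmin & Hnob).
    assert (Hcut : forall s, In s Rc -> r <= s \/ s + 3 <= S b).
    { intros s Hs'. destruct (le_lt_dec b s) as [H|H]; [left; auto|right].
      destruct (Hf s Hs'); lia. }
    destruct (lay_conn _ _ _ _ _ L (rk b) (fun z => dec (b <= z < r - 2)) b (r - 1)) as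
      (h' & Hh' & Hle' & (w' & Hw' & Hrw' & Aw) & (u' & Hu' & Hru' & Au)); auto.
    { apply dec_true. lia. } { apply dec_false. lia. }
    apply dec_elim in Aw. apply dec_nelim in Au.
    assert (Hcw : core w'). { intros s Hs'. destruct (Hcut s Hs'); lia. }
    assert (Hih : itv h') by (apply (core_itv w'); auto).
    assert (Hbh' : ~ In (b - 1) h'). { intros Hx. apply Hle' in Hx. pose proof (gt_of_clean b lo Hs Hc). lia. }
    assert (Hu'r : r - 2 <= u'). { apply NNPP; intros Hn. apply Hbh'.
      destruct (Nat.eq_dec u' (b - 1)) as [<-|]; auto. apply (Hih u' (b - 1) w'); auto; lia. }
    assert (u' <> r - 2) by (intros ->; congruence).
    pose proof (edge_span h' w' u' Hh' Hih Hw' Hu').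
    assert (u' = r - 1 /\ w' = r - 3) as (-> & ->) by lia.
    assert (In (r - 2) h') by (apply (Hih (r - 3) _ (r - 1)); auto; lia).
    apply (Hnob (r - 2)); try lia.
    + split; [lia|]. split; [lia|]. replace (r - 2 - 1) with (r - 3) by lia. split; [congruence|].
      exists h'. replace (r - 2 - 1) with (r - 3) by lia. auto.
    + intros s Hs'. destruct (Hcut s Hs'); lia.
  - right. right.
    assert (Hw1 : w <> r - 1) by (intros ->; congruence).
    assert (H1 : In (r - 2) h) by (apply Hrun; lia).
    destruct (three_cover h (r - 1) (r - 2) u D3 Hh) as (_ & Hall); auto; try lia.
    assert (w = r - 2) as -> by (destruct (Hall w Hw) as [|[|]]; lia).
    exists h, u. repeat split; auto; try lia.
    intros Hih. pose proof (edge_span h (r - 2) u Hh Hih H1 Hu).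
    pose proof (edge_span h u (r - 1) Hh Hih Hu Hr).
    destruct (le_lt_dec r u); [lia|]. exfalso. apply Hbh.
    destruct (Nat.eq_dec u (b - 1)) as [<-|]; auto. apply (Hih u (b - 1) (r - 2)); auto; lia.
Qed.

(** The excess of the estimate of [np e], by crossed breaks if [e] is contiguous and by its size
    otherwise. It enters [cost_slack] as a gain that pays for tight breaks. *)
Definition slack (e : list nat) := if dec (itv e) then 1 + crs e - np e else length e - np e.

Lemma np_pos e : In e E -> 1 <= np e.
Proof.
  intros He. pose proof (lay_ne _ _ _ _ _ L e He) as Hn. destruct e as [|x e]; [tauto|].
  unfold np. change 1 with (length [rk x]). apply NoDup_incl_length.
  - repeat constructor; simpl; tauto.
  - intros y [<-|[]]. apply nodup_In. now left.
Qed.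

Lemma cost_slack : sumf (fun e => np e - 1) E + sumf slack E <=
  sumf cr Sl + sumf (fun e => length e - 1) (sel (fun e => ~ itv e) E).
Proof.
  rewrite <- sum_crs, <- sumf_add.
  rewrite <- (sumf_sel itv (fun e => np e - 1 + slack e) E).
  apply Nat.add_le_mono; apply sumf_le; intros e He; apply in_sel in He as (He & Hi);
    pose proof (np_pos e He) as Hp; unfold slack.
  - apply dec_true in Hi as Hd'. rewrite Hd'. apply dec_elim in Hd'. pose proof (np_crs e He Hd'). lia.
  - apply dec_false in Hi as Hd'. rewrite Hd'. pose proof (np_le_length e). lia.
Qed.

Lemma sel_or {A} (P Q : A -> Prop) l : length (sel (fun x => P x \/ Q x) l) <= length (sel P l) + length (sel Q l).
Proof.
  rewrite !sel_length_sumf, <- sumf_add. apply sumf_le. intros x Hx.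
  destruct (dec (P x \/ Q x)) eqn:E1; simpl; [|lia]. apply dec_elim in E1.
  destruct E1 as [H|H]; apply dec_true in H; rewrite H; simpl; lia.
Qed.

Lemma sel_or3 {A} (P Q R : A -> Prop) l : length (sel (fun x => P x \/ Q x \/ R x) l) <=
  length (sel P l) + (length (sel Q l) + length (sel R l)).
Proof. pose proof (sel_or P (fun x => Q x \/ R x) l). pose proof (sel_or Q R l). lia. Qed.

Lemma sel_slack : length (sel (fun e => 1 <= slack e) E) <= sumf slack E.
Proof.
  rewrite sel_length_sumf. apply sumf_le. intros e _. destruct (dec (1 <= slack e)) eqn:E1; simpl; [|lia].
  now apply dec_elim in E1.
Qed.

Lemma tight_disjoint (P Q : nat -> Prop) : (forall b, P b -> tightL b) -> (forall b, Q b -> tightR b) ->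
  NoDup (sel P FS ++ sel Q FS).
Proof.
  intros HP HQ. apply NoDup_app; try apply sel_NoDup, FS_NoDup.
  intros b Hb Hb'. apply in_sel in Hb as (_ & Hb), Hb' as (_ & Hb').
  apply HP in Hb. apply HQ in Hb'. destruct Hb, Hb'. tauto.
Qed.

(** A break is crossed by at most one meeting here, and the breaks that are not far are cuts. Half a
    unit per tight break is missing; it comes from cuts that are not breaks, each serving one tight
    break per side, or from slack, where a meeting serves at most two. *)
Theorem two_cost : d = 2 -> sumf (fun e => np e - 1) E <=
  2 * length Rc + sumf (fun e => length e - 1) (sel (fun e => ~ itv e) E).
Proof.
  intros D2. pose proof cost_slack as HC. destruct far_split as (HF1 & HF2).
  assert (Hcr : sumf cr Sl <= length Sl).
  { rewrite <- (Nat.mul_1_l (length Sl)), <- sumf_const. apply sumf_le. intros b Hb.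
    apply in_Sl in Hb. pose proof (cr_le b Hb). nia. }
  pose proof (sel_length far Sl) as HS. fold FS in HS.
  pose proof (sel_length sbreak Rc) as HR.
  assert (Hin : length (sel (fun b => ~ far b) Sl) <= length (sel sbreak Rc)).
  { apply NoDup_incl_length; [apply sel_NoDup, Sl_NoDup|].
    intros b Hb. apply in_sel in Hb as (Hb1 & Hb). apply in_Sl in Hb1. unfold far in Hb.
    apply not_all_ex_not in Hb as (r & Hb). apply imply_to_and in Hb as (Hr & Hb).
    apply in_sel. replace b with r by lia. split; auto. replace r with b by lia. auto. }
  set (TLK := fun b => tightL b /\ exists r, lfree r b /\ ~ sbreak r).
  set (TRK := fun b => tightR b /\ exists r, rfree r b /\ ~ sbreak r).
  set (good := fun h => In h E /\ ~ itv h /\ np h <= 1).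
  set (TLD := fun b => tightL b /\ exists r h, lfree r b /\ good h /\ In r h).
  set (TRD := fun b => tightR b /\ exists r h, rfree r b /\ good h /\ In (r - 1) h).
  assert (HL : length (sel tightL FS) <= length (sel TLK FS) + length (sel TLD FS)).
  { rewrite <- sel_or. apply sel_le. intros b Hb Ht.
    destruct (tightL_two b D2 Hb Ht) as (r & Hr & [H|(h & H1 & H2 & H3 & H4)]).
    - left. split; eauto. - right. split; auto. exists r, h. unfold good. auto. }
  assert (HRR : length (sel tightR FS) <= length (sel TRK FS) + length (sel TRD FS)).
  { rewrite <- sel_or. apply sel_le. intros b Hb Ht.
    destruct (tightR_two b D2 Hb Ht) as (r & Hr & [H|(h & H1 & H2 & H3 & H4)]).
    - left. split; eauto. - right. split; auto. exists r, h. unfold good. auto. }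
  assert (HLK : length (sel TLK FS) <= length (sel (fun r => ~ sbreak r) Rc)).
  { apply (rel_inj_length (fun b r => lfree r b)); [apply sel_NoDup, FS_NoDup| |].
    - intros b Hb. apply in_sel in Hb as (_ & _ & r & Hr & Hn). exists r. rewrite in_sel. repeat split; auto; apply Hr.
    - intros b b' r Hb Hb'. apply in_sel in Hb as (Hb & _), Hb' as (Hb' & _). now apply lfree_inj. }
  assert (HRK : length (sel TRK FS) <= length (sel (fun r => ~ sbreak r) Rc)).
  { apply (rel_inj_length (fun b r => rfree r b)); [apply sel_NoDup, FS_NoDup| |].
    - intros b Hb. apply in_sel in Hb as (_ & _ & r & Hr & Hn). exists r. rewrite in_sel. repeat split; auto; apply Hr.
    - intros b b' r Hb Hb'. apply in_sel in Hb as (Hb & _), Hb' as (Hb' & _). now apply rfree_inj. }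
  (* Each of the two positions of a wasteful meeting is claimed once: a claim from the left and one
     from the right on the same position [x] would need the cuts [x] and [S x], and the first tight
     break would be [x] itself, which is not far. *)
  assert (HD : length (sel TLD FS) + length (sel TRD FS) <= 2 * sumf slack E).
  { transitivity (length (flat_map (fun h => map (pair h) h) (sel (fun e => 1 <= slack e) E))).
    2:{ transitivity (2 * length (sel (fun e => 1 <= slack e) E)); [|pose proof sel_slack; lia].
        assert (Hsub : forall e, In e (sel (fun e => 1 <= slack e) E) -> length e <= 2).
        { intros e He. apply in_sel in He as (He & _). pose proof (lsz e He). lia. }
        induction (sel (fun e => 1 <= slack e) E) as [|e l IH]; simpl; [lia|].
        rewrite length_app, length_map. pose proof (Hsub e (or_introl eq_refl)).
        assert (forall e, In e l -> length e <= 2) by (intros; apply Hsub; now right).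
        specialize (IH H0). lia. }
    rewrite <- length_app.
    assert (Hsl : forall h, good h -> In h (sel (fun e => 1 <= slack e) E)).
    { intros h (H1 & H2 & H3). apply in_sel. split; auto. unfold slack.
      apply dec_false in H2 as H4. rewrite H4. assert (2 <= length h); [|lia].
      destruct h as [|x [|y h]]; simpl; try lia; exfalso; apply H2.
      - intros ? ? ? [].
      - intros ? ? ? [->|[]] [->|[]]. lia. }
    apply (rel_inj_length (fun b p =>
      (tightL b /\ lfree (snd p) b) \/ (tightR b /\ rfree (S (snd p)) b))).
    - apply tight_disjoint; intros b Hb; apply Hb.
    - intros b Hb. apply in_app_or in Hb as [Hb|Hb]; apply in_sel in Hb as (Hb0 & Ht & r & h & Hr & Hg & Hrh).
      + exists (h, r). split; [|left; auto]. apply in_flat_map. exists h. split; auto. now apply in_map.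
      + exists (h, r - 1). split; [apply in_flat_map; exists h; split; [auto|now apply in_map]|].
        right. split; auto. simpl.
        assert (1 <= r). { apply in_FS in Hb0 as ((H1 & _) & _). destruct Hr as (_ & H2 & _). lia. }
        now replace (S (r - 1)) with r by lia.
    - intros b b' (h & x) Hb Hb'.
      assert (HFb : In b FS /\ In b' FS).
      { split; [apply in_app_or in Hb as [Hb|Hb]; now apply in_sel in Hb as (Hb & _)|
          apply in_app_or in Hb' as [Hb'|Hb']; now apply in_sel in Hb' as (Hb' & _)]. }
      destruct HFb as (Fb & Fb'). simpl.
      assert (HxL : forall c, lfree x c -> In x Rc) by (intros c Hc; apply Hc).
      intros [(T1 & H1)|(T1 & H1)] [(T2 & H2)|(T2 & H2)].
      + eapply lfree_inj; eauto.
      + exfalso. pose proof (HxL _ H1) as Hx. assert (HxR : In (S x) Rc) by apply H2.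
        apply in_FS in Fb as (_ & Fb). destruct H1 as (_ & H1 & H1m & _).
        destruct (le_lt_dec (S x) b) as [H|H]; [specialize (H1m _ HxR H); lia|].
        specialize (Fb x Hx). lia.
      + exfalso. pose proof (HxL _ H2) as Hx. assert (HxR : In (S x) Rc) by apply H1.
        apply in_FS in Fb' as (_ & Fb'). destruct H2 as (_ & H2 & H2m & _).
        destruct (le_lt_dec (S x) b') as [H|H]; [specialize (H2m _ HxR H); lia|].
        specialize (Fb' x Hx). lia.
      + eapply rfree_inj; eauto. }
  lia.
Qed.

(** Three positions meet at most two pieces. If they are contiguous, the odd one is in the middle
    and two breaks are crossed. *)
Lemma slack_odd h x y z : d = 3 -> In h E -> In x h -> In y h -> In z h -> x <> y -> x <> z -> y <> z ->
  rk y = rk z -> rk x <> rk z -> (itv h -> y = x + 1 /\ x = z + 1 \/ z = x + 1 /\ x = y + 1) -> 1 <= slack h.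
Proof.
  intros D3 Hh Hx Hy Hz H1 H2 H3 Hr1 Hr2 Hi.
  destruct (three_cover h x y z) as (Hlen & Hall); auto.
  assert (Hnp : np h <= 2).
  { unfold np. change 2 with (length [rk x; rk z]). apply NoDup_incl_length; [apply NoDup_nodup|].
    intros v Hv. apply nodup_In, in_map_iff in Hv as (a & <- & Ha). simpl.
    destruct (Hall a Ha) as [->|[->| ->]]; auto. }
  unfold slack. destruct (dec (itv h)) eqn:Ed; [apply dec_elim in Ed|lia].
  assert (2 <= crs h); [|lia]. unfold crs.
  assert (Hgen : forall p, In p h -> In (p + 1) h -> rk p <> rk (p + 1) -> In (p + 1) (sel (fun b => crosses b h) Sl)).
  { intros p Hp Hp1 Hne. apply in_sel. split.
    - apply in_Sl. split; [lia|]. split; [eapply llt; eauto|]. replace (p + 1 - 1) with p by lia. split; auto.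
      exists h. replace (p + 1 - 1) with p by lia. auto.
    - split; auto. now replace (p + 1 - 1) with p by lia. }
  destruct (Hi Ed) as [(-> & ->)|(-> & ->)];
    [change 2 with (length [z + 1 + 1; z + 1])|change 2 with (length [y + 1 + 1; y + 1])];
    (apply NoDup_incl_length; [repeat constructor; simpl; try tauto; lia|]);
    intros v [<-|[<-|[]]]; apply Hgen; auto; congruence.
Qed.

(** The meeting determines its odd position, hence the cut for which it is claimed; this makes the
    charging to slack injective. *)
Lemma odd_unique h x y z x' y' z' : d = 3 -> In h E -> In x h -> In y h -> In z h -> x <> y -> x <> z -> y <> z ->
  rk y = rk z -> rk x <> rk z ->
  In x' h -> In y' h -> In z' h -> x' <> y' -> x' <> z' -> y' <> z' -> rk y' = rk z' -> rk x' <> rk z' -> x = x'.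
Proof.
  intros D3 Hh. intros.
  destruct (three_cover h x y z) as (_ & Hall); auto.
  destruct (Hall x') as [|[|]]; auto; subst; exfalso;
  destruct (Hall y') as [|[|]]; auto; subst; try congruence;
  destruct (Hall z') as [|[|]]; auto; subst; try congruence.
Qed.

(** Let t be the number of tight breaks, at most [2 * length Rc]. There are at most [length Rc] +
    t/2 far breaks of weight 3, and the breaks near the cuts weigh at most 9 per cut. A tight break
    saves 3, 2 or 1 by [HLA] or [HRA], [HG], [HB], so at least t is saved. Per cut this leaves 3 + 9
    + 1 = 13. *)
Theorem three_cost : d = 3 -> sumf (fun e => np e - 1) E <=
  13 * length Rc + sumf (fun e => length e - 1) (sel (fun e => ~ itv e) E).
Proof.
  intros D3. pose proof cost_slack as HC. destruct far_split as (HF1 & HF2).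
  assert (Hcr3 : forall b, In b Sl -> cr b <= 3).
  { intros b Hb. apply in_Sl in Hb. pose proof (cr_le b Hb). nia. }
  assert (Hcr : sumf cr Sl + 2 * length (sel (fun b => cr b <= 1) FS) <=
      3 * length FS + 3 * length (sel (fun b => ~ far b) Sl)).
  { rewrite <- (sumf_sel far cr Sl). fold FS.
    assert (sumf cr (sel (fun b => ~ far b) Sl) <= 3 * length (sel (fun b => ~ far b) Sl)).
    { rewrite <- sumf_const. apply sumf_le. intros b Hb. apply in_sel in Hb as (Hb & _). auto. }
    assert (sumf cr FS + 2 * length (sel (fun b => cr b <= 1) FS) <= 3 * length FS); [|lia].
    rewrite sel_length_sumf, <- sumf_mul, <- sumf_add, <- sumf_const. apply sumf_le.
    intros b Hb. apply in_sel in Hb as (Hb & _). specialize (Hcr3 b Hb).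
    destruct (dec (cr b <= 1)) eqn:Ed; simpl; [apply dec_elim in Ed|]; lia. }
  pose proof (sel_length far Sl) as HS. fold FS in HS.
  assert (Hin : length (sel (fun b => ~ far b) Sl) + length (sel (fun r => ~ sbreak (r + 1)) Rc) +
      length (sel (fun r => ~ sbreak (r - 1)) Rc) <= 3 * length Rc).
  { assert (Hin : length (sel (fun b => ~ far b) Sl) <=
        length (flat_map (fun r => sel sbreak [r - 1; r; r + 1]) Rc)).
    { apply NoDup_incl_length; [apply sel_NoDup, Sl_NoDup|].
      intros b Hb. apply in_sel in Hb as (Hb1 & Hb). apply in_Sl in Hb1. unfold far in Hb.
      apply not_all_ex_not in Hb as (r & Hb). apply imply_to_and in Hb as (Hr & Hb).
      apply in_flat_map. exists r. split; auto. apply in_sel. split; auto. simpl. destruct Hb1. lia. }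
    assert (Hsum : forall l, length (flat_map (fun r => sel sbreak [r - 1; r; r + 1]) l) +
       length (sel (fun r => ~ sbreak (r + 1)) l) + length (sel (fun r => ~ sbreak (r - 1)) l) <= 3 * length l).
    { induction l as [|r l IH]; [simpl; lia|].
      cbn [flat_map]. rewrite length_app. cbn [length].
      assert (length (sel sbreak [r - 1; r; r + 1]) +
        b2n (dec (~ sbreak (r + 1))) + b2n (dec (~ sbreak (r - 1))) <= 3).
      { rewrite sel_length_sumf. unfold sumf. simpl.
        assert (Hb : forall P, b2n (dec P) + b2n (dec (~ P)) = 1).
        { intros P. destruct (dec P) eqn:E1; destruct (dec (~ P)) eqn:E2; simpl; auto;
            [apply dec_elim in E1; apply dec_elim in E2|apply dec_nelim in E1; apply dec_nelim in E2]; tauto. }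
        pose proof (Hb (sbreak (r - 1))). pose proof (Hb (sbreak (r + 1))). pose proof (Hb (sbreak r)). lia. }
      rewrite !(sel_length_sumf _ (r :: l)), !sumf_cons, <- !sel_length_sumf. lia. }
    specialize (Hsum Rc). lia. }
  set (Lb := fun r h u => In h E /\ In r h /\ In (r + 1) h /\ In u h /\ u <> r /\ u <> r + 1 /\
     rk u = rk (r + 1) /\ rk r <> rk u /\ (itv h -> r = u + 1)).
  set (Rb := fun r h u => In h E /\ In (r - 1) h /\ In (r - 2) h /\ In u h /\ u <> r - 1 /\ u <> r - 2 /\
     rk u = rk (r - 2) /\ rk (r - 1) <> rk u /\ (itv h -> u = r)).
  set (TLA := fun b => tightL b /\ exists r, lfree r b /\ ~ sbreak (r + 1)).
  set (TRA := fun b => tightR b /\ exists r, rfree r b /\ ~ sbreak (r - 1)).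
  set (TLG := fun b => tightL b /\ cr b <= 1).
  set (TRG := fun b => tightR b /\ cr b <= 1).
  set (TLB := fun b => tightL b /\ exists r h u, lfree r b /\ Lb r h u).
  set (TRB := fun b => tightR b /\ exists r h u, rfree r b /\ Rb r h u).
  assert (HL : length (sel tightL FS) <= length (sel TLA FS) + (length (sel TLG FS) + length (sel TLB FS))).
  { eapply Nat.le_trans; [|apply sel_or3]. apply sel_le. intros b Hb Ht.
    destruct (tightL_three b D3 Hb Ht) as (r & Hr & [H|[H|(h & u & H)]]).
    - left. split; eauto. - right. left. split; auto. - right. right. split; auto. exists r, h, u. auto. }
  assert (HRR : length (sel tightR FS) <= length (sel TRA FS) + (length (sel TRG FS) + length (sel TRB FS))).
  { eapply Nat.le_trans; [|apply sel_or3]. apply sel_le. intros b Hb Ht.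
    destruct (tightR_three b D3 Hb Ht) as (r & Hr & [H|[H|(h & u & H)]]).
    - left. split; eauto. - right. left. split; auto. - right. right. split; auto. exists r, h, u. auto. }
  assert (HLA : length (sel TLA FS) <= length (sel (fun r => ~ sbreak (r + 1)) Rc)).
  { apply (rel_inj_length (fun b r => lfree r b)); [apply sel_NoDup, FS_NoDup| |].
    - intros b Hb. apply in_sel in Hb as (_ & _ & r & Hr & Hn). exists r. rewrite in_sel. repeat split; auto; apply Hr.
    - intros b b' r Hb Hb'. apply in_sel in Hb as (Hb & _), Hb' as (Hb' & _). now apply lfree_inj. }
  assert (HRA : length (sel TRA FS) <= length (sel (fun r => ~ sbreak (r - 1)) Rc)).
  { apply (rel_inj_length (fun b r => rfree r b)); [apply sel_NoDup, FS_NoDup| |].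
    - intros b Hb. apply in_sel in Hb as (_ & _ & r & Hr & Hn). exists r. rewrite in_sel. repeat split; auto; apply Hr.
    - intros b b' r Hb Hb'. apply in_sel in Hb as (Hb & _), Hb' as (Hb' & _). now apply rfree_inj. }
  assert (HG : length (sel TLG FS) + length (sel TRG FS) <= length (sel (fun b => cr b <= 1) FS)).
  { rewrite <- length_app. apply NoDup_incl_length.
    - apply tight_disjoint; intros b Hb; apply Hb.
    - intros b Hb. apply in_app_or in Hb as [Hb|Hb]; apply in_sel in Hb as (Hb & _ & Hc); now apply in_sel. }
  assert (HB : length (sel TLB FS) + length (sel TRB FS) <= sumf slack E).
  { rewrite <- sel_slack, <- length_app.
    assert (Hr2 : forall b r, In b FS -> rfree r b -> b + 2 <= r /\ 1 <= b).
    { intros b r Hb (Hr & Hbr & _). apply in_FS in Hb as ((Hb & _) & Hf). destruct (Hf r Hr); lia. }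
    apply (rel_inj_length (fun b h =>
      (exists r u, lfree r b /\ Lb r h u) \/ (exists r u, rfree r b /\ Rb r h u))).
    - apply tight_disjoint; intros b Hb; apply Hb.
    - intros b Hb. apply in_app_or in Hb as [Hb|Hb]; apply in_sel in Hb as (Hb & _ & r & h & u & Hr & Hg);
        exists h; (split; [|eauto 6]); apply in_sel; assert (Hg' := Hg);
        destruct Hg' as (H1 & H2 & H3 & H4 & H5 & H6 & H7 & H8 & H9); split; auto.
      + apply (slack_odd h r (r + 1) u); auto; try lia.
      + destruct (Hr2 b r Hb Hr). apply (slack_odd h (r - 1) (r - 2) u); auto; try lia.
        intros Hi. specialize (H9 Hi). lia.
    - intros b b' h Hb Hb'.
      assert (HFb : In b FS /\ In b' FS).
      { split; [apply in_app_or in Hb as [Hb|Hb]; now apply in_sel in Hb as (Hb & _)|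
          apply in_app_or in Hb' as [Hb'|Hb']; now apply in_sel in Hb' as (Hb' & _)]. }
      destruct HFb as (Fb & Fb').
      assert (HLR : forall c c' r r' u u', In c FS -> In c' FS -> lfree r c -> Lb r h u -> rfree r' c' -> Rb r' h u' -> False).
      { intros c c' r r' u u' Fc Fc' H1 (A1 & A2 & A3 & A4 & A5 & A6 & A7 & A8 & A9) H2 (_ & B2 & B3 & B4 & B5 & B6 & B7 & B8 & B9).
        destruct (Hr2 c' r' Fc' H2).
        assert (r = r' - 1) by (apply (odd_unique h r (r + 1) u (r' - 1) (r' - 2) u'); auto; lia).
        apply in_FS in Fc as (_ & Fc). destruct H1 as (H1 & H1b & H1m & _).
        assert (HxR : In r' Rc) by apply H2.
        assert (r' <= r); [|lia]. apply H1m; auto. destruct (Fc r H1); lia. }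
      intros [(r & u & H1 & B1)|(r & u & H1 & B1)] [(r' & u' & H2 & B2)|(r' & u' & H2 & B2)].
      + apply (lfree_inj r); auto. replace r with r'; auto. symmetry.
        destruct B1 as (A1 & A2 & A3 & A4 & A5 & A6 & A7 & A8 & A9), B2 as (_ & C2 & C3 & C4 & C5 & C6 & C7 & C8 & C9).
        apply (odd_unique h r (r + 1) u r' (r' + 1) u'); auto; lia.
      + exfalso. eapply (HLR b b'); eauto.
      + exfalso. eapply (HLR b' b); eauto.
      + apply (rfree_inj r); auto. replace r with r'; auto. symmetry.
        destruct (Hr2 b r Fb H1), (Hr2 b' r' Fb' H2).
        destruct B1 as (A1 & A2 & A3 & A4 & A5 & A6 & A7 & A8 & A9), B2 as (_ & C2 & C3 & C4 & C5 & C6 & C7 & C8 & C9).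
        assert (r - 1 = r' - 1); [|lia].
        apply (odd_unique h (r - 1) (r - 2) u (r' - 1) (r' - 2) u'); auto; lia. }
  lia.
Qed.

(** The plain counts add up to [8 * T * (d * (d - 1) * (2 * d - 1))], which is within the bound
    exactly when 8(2d - 1) does not exceed 3d(d + 1), for integers from d = 4 on. For d = 2 and d =
    3 the refined counts give 36T and 216T, the right-hand side itself. *)
Theorem cost_bound T : length Rc <= 3 * T ->
  6 * sumf (fun e => length e - 1) (sel (fun e => ~ itv e) E) <= 3 * T * (d * (d - 1) * (2 * d - 1)) ->
  4 * sumf (fun e => np e - 1) E <= 3 * (d * d - 1) * (d * d) * T.
Proof.
  intros HT HD.
  destruct (Nat.eq_dec d 2) as [D2|D2]; [pose proof (two_cost D2); subst; nia|].
  destruct (Nat.eq_dec d 3) as [D3|D3]; [pose proof (three_cost D3); subst; nia|].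
  pose proof itv_cost as Hi. rewrite <- (sumf_sel itv (fun e => np e - 1) E).
  assert (sumf (fun e => np e - 1) (sel (fun e => ~ itv e) E) <= sumf (fun e => length e - 1) (sel (fun e => ~ itv e) E)).
  { apply sumf_le. intros e _. pose proof (np_le_length e). lia. }
  assert (d * (d - 1) * (2 * d - 1) * length Rc <= d * (d - 1) * (2 * d - 1) * (3 * T)) by (now apply Nat.mul_le_mono_l).
  (* After this substitution the comparison is coefficientwise in [c]. *)
  assert (exists c, d = c + 4) as (c & Hc) by (pose proof (lay_d _ _ _ _ _ L); exists (d - 4); lia).
  clear - HD H H0 Hc Hi.
  assert (G : 8 * T * (d * (d - 1) * (2 * d - 1)) <= 3 * (d * d - 1) * (d * d) * T).
  { subst d. replace (c + 4 - 1) with (c + 3) by lia. replace (2 * (c + 4) - 1) with (2 * c + 7) by lia.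
    replace ((c + 4) * (c + 4) - 1) with (c * c + 8 * c + 15) by nia. nia. }
  nia.
Qed.

End Analysis.

(** * Splicing two admissible orders *)

Fixpoint bf (l : list nat) (x y : nat) : Prop :=
  match l with
  | [] => False
  | a :: l' => (x = a /\ In y l') \/ bf l' x y
  end.

Definition cv (h l : list nat) := forall x y z, bf l x y -> bf l y z -> In x h -> In z h -> In y h.
Definition okl (M : list (list nat)) (l : list nat) := forall h, In h M -> cv h l.

Lemma bf_in l x y : bf l x y -> In x l /\ In y l.
Proof. induction l as [|a l IH]; simpl; [tauto|]. intros [(-> & H)|H]; [auto|]. apply IH in H. tauto. Qed.

Lemma bf_app A B x y : bf (A ++ B) x y <-> bf A x y \/ (In x A /\ In y B) \/ bf B x y.
Proof.
  induction A as [|a A IH]; simpl; [tauto|]. rewrite IH, in_app_iff. intuition (subst; auto).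
Qed.

Lemma bf_total l x y : In x l -> In y l -> x <> y -> bf l x y \/ bf l y x.
Proof. induction l as [|a l IH]; simpl; [tauto|]. intros [->|Hx] [->|Hy] Hn; tauto. Qed.

Lemma bf_irrefl l x : NoDup l -> ~ bf l x x.
Proof. induction l as [|a l IH]; simpl; [tauto|]. intros ND. inversion_clear ND. intros [(-> & Hi)|Hb]; auto. now apply IH. Qed.

Lemma bf_trans l x y z : NoDup l -> bf l x y -> bf l y z -> bf l x z.
Proof.
  induction l as [|a l IH]; simpl; [tauto|]. intros ND. inversion_clear ND.
  intros [(-> & Hy)|Hxy] [(-> & Hz)|Hyz]; auto.
  - left. split; auto. now apply bf_in in Hyz.
  - exfalso. apply H. now apply bf_in in Hxy.
Qed.

Lemma bf_asym l x y : NoDup l -> bf l x y -> bf l y x -> False.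
Proof. intros ND H1 H2. apply (bf_irrefl l x ND). eapply bf_trans; eauto. Qed.

Lemma bf_filter g l x y : bf (filter g l) x y -> bf l x y.
Proof.
  induction l as [|a l IH]; simpl; [tauto|]. destruct (g a); simpl; [|auto].
  intros [(-> & H)|H]; auto. left. split; auto. now apply filter_In in H.
Qed.

Lemma bf_nth l i j : i < j -> j < length l -> bf l (nth i l 0) (nth j l 0).
Proof.
  revert i j. induction l as [|a l IH]; simpl; intros i j H1 H2; [lia|].
  destruct j as [|j]; [lia|]. destruct i as [|i].
  - left. split; auto. apply nth_In. lia.
  - right. apply IH; lia.
Qed.

Lemma bf_rev l x y : bf (rev l) x y <-> bf l y x.
Proof.
  induction l as [|a l IH]; simpl; [tauto|]. rewrite bf_app, IH, <- in_rev. simpl. intuition (subst; auto).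
Qed.

Lemma NoDup_app_disj {A} (l l' : list A) : NoDup (l ++ l') -> forall x, In x l -> ~ In x l'.
Proof.
  induction l as [|a l IH]; simpl; [tauto|]. intros ND x [->|Hx] Hx'; inversion_clear ND.
  - apply H, in_or_app; auto.
  - exact (IH H0 x Hx Hx').
Qed.

Lemma okl_rev M l : okl M l -> okl M (rev l).
Proof. intros H h Hh x y z H1 H2 Hx Hz. apply (proj1 (bf_rev _ _ _)) in H1, H2. exact (H h Hh z y x H2 H1 Hz Hx). Qed.

Lemma bf_nth_inv l x y : bf l x y -> exists i j, i < j /\ j < length l /\ nth i l 0 = x /\ nth j l 0 = y.
Proof.
  induction l as [|a l IH]; simpl; [tauto|]. intros [(-> & H)|H].
  - apply (In_nth _ _ 0) in H as (j & Hj & <-). exists 0, (S j). repeat split; lia.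
  - destruct (IH H) as (i & j & H1 & H2 & H3 & H4). exists (S i), (S j). repeat split; auto; lia.
Qed.

Lemma step_between (P : nat -> Prop) (l : list nat) i j :
  i <= j -> j < length l -> P (nth i l 0) -> ~ P (nth j l 0) ->
  exists t, i < t <= j /\ P (nth (t - 1) l 0) /\ ~ P (nth t l 0).
Proof.
  intros Hij. induction Hij as [|j Hij IH]; intros Hj Hi Hnj; [tauto|].
  destruct (classic (P (nth j l 0))) as [H|H].
  - exists (S j). replace (S j - 1) with j by lia. repeat split; auto; lia.
  - destruct IH as (t & H1 & H2 & H3); auto; try lia. exists t. repeat split; auto; lia.
Qed.

Lemma in_firstn_nth (l : list nat) m x : In x (firstn m l) <-> exists i, i < m /\ i < length l /\ nth i l 0 = x.
Proof.
  split.
  - intros H. apply (In_nth _ _ 0) in H as (i & Hi & <-). rewrite length_firstn in Hi.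
    exists i. rewrite nth_firstn. replace (i <? m) with true by (symmetry; apply Nat.ltb_lt; lia).
    repeat split; lia.
  - intros (i & H1 & H2 & <-).
    replace (nth i l 0) with (nth i (firstn m l) 0).
    + apply nth_In. rewrite length_firstn. lia.
    + rewrite nth_firstn. now replace (i <? m) with true by (symmetry; apply Nat.ltb_lt; lia).
Qed.

Lemma NoDup_nth_inj (l : list nat) i j : NoDup l -> i < length l -> j < length l -> nth i l 0 = nth j l 0 -> i = j.
Proof. intros ND Hi Hj H. rewrite NoDup_nth in ND. eapply ND; eauto. Qed.

(** The two ends and all characters between them belong to the contiguous [h]; this is how the size
    bound [d] turns into a bound on distances. *)
Lemma bf_length h l x y m : NoDup l -> cv h l -> In x h -> In y h ->
  (forall z, In z m -> bf l x z /\ bf l z y) -> NoDup m -> bf l x y -> length m + 2 <= length h.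
Proof.
  intros ND Hc Hx Hy Hm NDm Hxy. change (length m + 2) with (length m + length [x; y]).
  rewrite <- length_app. apply NoDup_incl_length.
  - apply NoDup_app; auto.
    + constructor; [|constructor; [intros []|constructor]]. intros [->|[]]. now apply (bf_irrefl l x).
    + intros z Hz Hz2. destruct (Hm z Hz) as (H1 & H2). destruct Hz2 as [Hz2|[Hz2|[]]]; subst z; eapply (bf_irrefl l); eauto.
  - intros z Hz. apply in_app_or in Hz as [Hz|[<-|[<-|[]]]]; auto.
    destruct (Hm z Hz) as (H1 & H2). eapply Hc; eauto.
Qed.

Lemma firstn_split {A} (l : list A) i j : i <= j -> firstn j l = firstn i l ++ firstn (j - i) (skipn i l).
Proof.
  intros H. rewrite <- (firstn_skipn i (firstn j l)), firstn_firstn, skipn_firstn_comm.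
  now rewrite Nat.min_l by lia.
Qed.

Section Splice.
Context (d : nat) (M : list (list nat)) (rho sigma nu e : list nat).
Context (Hd : 2 <= d) (Hsz : forall h, In h M -> length h <= d).
Context (NDr : NoDup rho) (NDs : NoDup sigma) (NDn : NoDup nu).
Context (Hdisj : forall x, In x rho -> ~ In x nu).
Context (Hs : forall x, In x sigma <-> In x rho \/ In x nu).
Context (Okr : okl M rho) (Oks : okl M sigma).
Context (Hadj : forall t, 0 < t -> t < length rho -> exists h, In h M /\ In (nth (t - 1) rho 0) h /\ In (nth t rho 0) h).
Context (He : In e M) (Hnu : forall x, In x nu -> In x e).
Context (i0 : nat) (Hi0 : i0 < length rho) (Hx0 : In (nth i0 rho 0) e).

Let q := length rho.
Notation A i := (firstn i rho).

(* A long enough good prefix of [rho] is an initial or a final segment of [sigma] on the characters of [rho]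
   ([good_side]), so the two orders can be spliced there. *)
Definition good i := i <= q /\ forall t, 0 < t -> t < i ->
  exists h, In h M /\ In (nth (t - 1) rho 0) h /\ In (nth t rho 0) h /\ forall x, In x rho -> In x h -> In x (A i).

(** Stop at the last position [j] that a meeting touching the first [m] characters reaches. This
    meeting is contiguous, so [j] is close to [m], and it joins all consecutive pairs beyond [m];
    those before [m] are joined by meetings that do not get past [j]. *)
Lemma good_exists m : 1 <= m -> m <= q -> exists i, m <= i /\ i < m + d /\ good i.
Proof.
  intros H1 H2.
  set (P := fun j => j < m \/ exists h x, In h M /\ In x (A m) /\ In x h /\ In (nth j rho 0) h).
  destruct (exists_max P (seq 0 q)) as (j & Hj & Pj & Hmax).
  { exists (m - 1). split; [apply in_seq; lia|]. left. lia. }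
  apply in_seq in Hj.
  assert (Hmj : m - 1 <= j). { apply Hmax; [apply in_seq; lia|left; lia]. }
  assert (Hmeet : forall h, In h M -> (exists x, In x (A m) /\ In x h) ->
     forall x, In x rho -> In x h -> In x (A (S j))).
  { intros h Hh (y & Hy & Hyh) x Hx Hxh. apply (In_nth _ _ 0) in Hx as (i & Hi & <-).
    apply in_firstn_nth. exists i. repeat split; auto.
    assert (i <= j); [|lia]. apply Hmax; [apply in_seq; unfold q; lia|]. right. exists h, y. auto. }
  exists (S j). split; [lia|].
  assert (Hin : forall i, i < m -> In (nth i rho 0) (A m)).
  { intros i Hi. apply in_firstn_nth. exists i. repeat split; auto. unfold q in *; lia. }
  split; [|split; [lia|]].
  - destruct Pj as [Pj|(h & x & Hh & Hx & Hxh & Hjh)]; [lia|].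
    destruct (le_lt_dec m j) as [Hle|]; [|lia].
    apply in_firstn_nth in Hx as (i & Hi & Hi' & <-).
    assert (Hlen : length (seq (S i) (j - S i)) + 2 <= length h).
    { rewrite <- (length_map (fun z => nth z rho 0)).
      apply (bf_length h rho (nth i rho 0) (nth j rho 0)); auto.
      - intros z Hz. apply in_map_iff in Hz as (y & <- & Hy). apply in_seq in Hy.
        split; apply bf_nth; unfold q in *; lia.
      - apply NoDup_map_NoDup_ForallPairs; [|apply seq_NoDup].
        intros y z Hy Hz Hyz. apply in_seq in Hy, Hz. apply (NoDup_nth_inj rho); auto; unfold q in *; lia.
      - apply bf_nth; unfold q in *; lia. }
    rewrite length_seq in Hlen. specialize (Hsz h Hh). lia.
  - intros t Ht Htj. destruct (le_lt_dec t m) as [Htm|Htm].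
    + destruct (Hadj t Ht) as (h & Hh & Ha & Hb); [unfold q in *; lia|].
      exists h. repeat split; auto. apply Hmeet; auto. exists (nth (t - 1) rho 0). split; auto. apply Hin. lia.
    + destruct Pj as [Pj|(h & x & Hh & Hx & Hxh & Hjh)]; [lia|].
      exists h. split; auto.
      apply in_firstn_nth in Hx as Hx'. destruct Hx' as (i & Hi & Hi' & <-).
      assert (Hmid : forall s, i < s -> s <= j -> In (nth s rho 0) h).
      { intros s Hs1 Hs2. destruct (Nat.eq_dec s j) as [->|]; auto.
        apply (Okr h Hh (nth i rho 0) _ (nth j rho 0)); auto; apply bf_nth; unfold q in *; lia. }
      repeat split; try (apply Hmid; lia). apply Hmeet; auto. exists (nth i rho 0). auto.
Qed.

Definition Lside i := forall a y, In a (A i) -> In y rho -> ~ In y (A i) -> bf sigma a y.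
Definition Rside i := forall a y, In a (A i) -> In y rho -> ~ In y (A i) -> bf sigma y a.

Lemma nth_notin i t : i <= t -> t < q -> ~ In (nth t rho 0) (A i).
Proof.
  intros H1 H2 H. apply in_firstn_nth in H as (s & Hs1 & Hs2 & Heq).
  apply (NoDup_nth_inj rho) in Heq; auto. lia.
Qed.

Lemma notin_nth i y : In y rho -> ~ In y (A i) -> exists t, i <= t /\ t < q /\ nth t rho 0 = y.
Proof.
  intros Hy Hn. apply (In_nth _ _ 0) in Hy as (t & Ht & <-). exists t. repeat split; auto.
  destruct (le_lt_dec i t); auto. exfalso. apply Hn, in_firstn_nth. eauto.
Qed.

(** If [y] split the prefix in [sigma], it would separate two consecutive characters of the prefix.
    Their common meeting is contiguous in [sigma] and would contain [y], although it does not leave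
    the prefix within [rho]. *)
Lemma good_block i : good i -> forall y, In y rho -> ~ In y (A i) ->
  (forall a, In a (A i) -> bf sigma a y) \/ (forall a, In a (A i) -> bf sigma y a).
Proof.
  intros (Hiq & Hg) y Hy Hn.
  destruct (classic (forall a, In a (A i) -> bf sigma a y)) as [H|H]; [now left|right].
  intros a Ha. apply NNPP; intros Hna.
  assert (Hor : forall c, In c (A i) -> bf sigma c y \/ bf sigma y c).
  { intros c Hc. apply bf_total; [apply Hs; left| apply Hs; now left|intros ->; auto].
    apply in_firstn_nth in Hc as (s & _ & Hs2 & <-). now apply nth_In. }
  assert (Ha' : bf sigma a y) by (destruct (Hor a Ha); tauto).
  apply not_all_ex_not in H as (c & H). apply imply_to_and in H as (Hc & Hcy).
  assert (Hc' : bf sigma y c) by (destruct (Hor c Hc); tauto).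
  apply in_firstn_nth in Ha as (s & Hs1 & Hs2 & <-). apply in_firstn_nth in Hc as (s' & Hs1' & Hs2' & <-).
  assert (Hstep : exists t, 0 < t /\ t < i /\
    (bf sigma (nth (t - 1) rho 0) y /\ bf sigma y (nth t rho 0) \/
     bf sigma y (nth (t - 1) rho 0) /\ bf sigma (nth t rho 0) y)).
  { destruct (le_lt_dec s s') as [Hl|Hl].
    - destruct (step_between (fun x => bf sigma x y) rho s s') as (t & T1 & T2 & T3); auto.
      exists t. repeat split; try lia. left. split; auto.
      destruct (Hor (nth t rho 0)) as [|]; auto; [|tauto].
      apply in_firstn_nth. exists t. repeat split; auto; lia.
    - destruct (step_between (fun x => bf sigma y x) rho s' s) as (t & T1 & T2 & T3); auto; try lia.
      exists t. repeat split; try lia. right. split; auto.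
      destruct (Hor (nth t rho 0)) as [|]; auto; [|tauto].
      apply in_firstn_nth. exists t. repeat split; auto; lia. }
  destruct Hstep as (t & T1 & T2 & T3).
  destruct (Hg t T1 T2) as (h & Hh & Ha & Hb & Hsub).
  apply Hn, Hsub; auto.
  destruct T3 as [(T3 & T4)|(T3 & T4)].
  - exact (Oks h Hh _ _ _ T3 T4 Ha Hb).
  - exact (Oks h Hh _ _ _ T4 T3 Hb Ha).
Qed.

(** With outside characters on both sides, two consecutive ones in [rho] would lie on different
    sides, and in [sigma] a meeting containing both would enclose the whole prefix: more than [d]
    characters. *)
Lemma good_side i : good i -> d <= S i -> Lside i \/ Rside i.
Proof.
  intros Hg Hdi. destruct (classic (Lside i)) as [H|H]; [now left|right].
  unfold Lside in H. apply not_all_ex_not in H as (a & H). apply not_all_ex_not in H as (y & H).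
  apply imply_to_and in H as (Ha & H). apply imply_to_and in H as (Hy & H). apply imply_to_and in H as (Hny & H).
  assert (Hyb : forall c, In c (A i) -> bf sigma y c).
  { destruct (good_block i Hg y Hy Hny) as [G|G]; auto. exfalso; auto. }
  intros c z Hc Hz Hnz.
  destruct (good_block i Hg z Hz Hnz) as [G|G]; auto. exfalso.
  apply notin_nth in Hny as (s & Hs1 & Hs2 & <-); auto. apply notin_nth in Hnz as (s' & Hs1' & Hs2' & <-); auto.
  set (Q := fun x => forall c, In c (A i) -> bf sigma x c).
  assert (HQ : forall t, i <= t -> t < q -> ~ Q (nth t rho 0) -> forall c, In c (A i) -> bf sigma c (nth t rho 0)).
  { intros t Ht1 Ht2 HnQ. destruct (good_block i Hg (nth t rho 0)) as [G1|G1]; auto.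
    - now apply nth_In.
    - now apply nth_notin.
    - exfalso; auto. }
  assert (HnQ : ~ Q (nth s' rho 0)).
  { intros HQ'. apply (bf_asym sigma c (nth s' rho 0)); auto. }
  assert (Hstep : exists t, i < t /\ t < q /\ (Q (nth (t - 1) rho 0) /\ ~ Q (nth t rho 0) \/ ~ Q (nth (t - 1) rho 0) /\ Q (nth t rho 0))).
  { destruct (le_lt_dec s s') as [Hl|Hl].
    - destruct (step_between Q rho s s') as (t & T1 & T2 & T3); auto. exists t. repeat split; try lia. auto.
    - destruct (step_between (fun x => ~ Q x) rho s' s) as (t & T1 & T2 & T3); auto; try lia.
      apply NNPP in T3. exists t. repeat split; try lia. auto. }
  destruct Hstep as (t & T1 & T2 & T3).
  destruct (Hadj t) as (h & Hh & Hh1 & Hh2); try lia.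
  assert (Hbig : exists u v, In u h /\ In v h /\ forall c, In c (A i) -> bf sigma u c /\ bf sigma c v).
  { destruct T3 as [(T3 & T4)|(T3 & T4)].
    - exists (nth (t - 1) rho 0), (nth t rho 0). repeat split; auto. apply HQ; auto; lia.
    - exists (nth t rho 0), (nth (t - 1) rho 0). repeat split; auto. apply HQ; auto; lia. }
  destruct Hbig as (u & v & Hu & Hv & Hall).
  assert (Hlen : length (A i) + 2 <= length h).
  { apply (bf_length h sigma u v); auto.
    - rewrite <- (firstn_skipn i rho) in NDr. now apply NoDup_app_remove_r in NDr.
    - destruct (Hall c Hc). eapply bf_trans; eauto. }
  rewrite length_firstn in Hlen. specialize (Hsz h Hh). destruct Hg as (Hiq & _). unfold q in *. lia.
Qed.

Lemma in_A_mono i j x : i <= j -> In x (A i) -> In x (A j).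
Proof. intros Hij H. apply in_firstn_nth in H as (s & H1 & H2 & H3). apply in_firstn_nth. exists s. repeat split; auto; lia. Qed.

Lemma in_A_rho i x : In x (A i) -> In x rho.
Proof. intros H. apply in_firstn_nth in H as (s & H1 & H2 & <-). now apply nth_In. Qed.

(** The first character, which is in both prefixes, and one beyond both of them decide the side. *)
Lemma Lside_all i j : good i -> d <= S i -> i < q -> Lside i -> good j -> d <= S j -> j < q -> Lside j.
Proof.
  intros Hgi Hi Hiq HL Hgj Hj Hjq. destruct (good_side j Hgj Hj) as [H|H]; auto. exfalso.
  assert (Hm : Nat.max i j < q) by lia.
  assert (Ha : In (nth 0 rho 0) rho) by (apply nth_In; unfold q in *; lia).
  assert (Hai : In (nth 0 rho 0) (A i)) by (apply in_firstn_nth; exists 0; repeat split; unfold q in *; lia).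
  assert (Haj : In (nth 0 rho 0) (A j)) by (apply in_firstn_nth; exists 0; repeat split; unfold q in *; lia).
  assert (Hy : In (nth (Nat.max i j) rho 0) rho) by (apply nth_In; unfold q in *; lia).
  apply (bf_asym sigma (nth 0 rho 0) (nth (Nat.max i j) rho 0)); auto;
    [apply HL|apply H]; auto; apply nth_notin; lia.
Qed.

(** In the outer parts contiguity comes from [rho], in the middle part from [sigma]. The mixed case
    is a middle character that is new and unknown to [rho]; the conditions on [nu] provide an old
    character on its inner side to argue with in its place. *)
Lemma splice_oriented i i' :
  i <= i' -> i' <= q -> (i = 0 \/ Lside i) -> (i' = q \/ Lside i') ->
  (i = 0 \/ forall z, In z nu -> exists c, In c rho /\ ~ In c (A i) /\ bf sigma c z) ->
  (i' = q \/ forall z, In z nu -> exists c, In c (A i') /\ bf sigma z c) ->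
  exists mid, (forall x, In x mid <-> In x sigma /\ ~ In x (A i) /\ ~ In x (skipn i' rho)) /\ NoDup mid /\
    okl M (A i ++ mid ++ skipn i' rho).
Proof.
  intros Hii Hi'q HL HL' HS HS'.
  set (g := fun x => andb (negb (dec (In x (A i)))) (negb (dec (In x (skipn i' rho))))).
  assert (Hg : forall x, g x = true <-> ~ In x (A i) /\ ~ In x (skipn i' rho)).
  { intros x. unfold g. rewrite Bool.andb_true_iff, !Bool.negb_true_iff, !dec_false. tauto. }
  exists (filter g sigma). split; [|split].
  - intros x. rewrite filter_In, Hg. tauto.
  - now apply NoDup_filter.
  - intros h Hh x y z Hxy Hyz Hx Hz.
    assert (Hr3 : exists R, rho = A i ++ R ++ skipn i' rho /\ forall x, In x R <-> In x rho /\ ~ In x (A i) /\ ~ In x (skipn i' rho)).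
    { exists (firstn (i' - i) (skipn i rho)).
      assert (Heq : rho = A i ++ firstn (i' - i) (skipn i rho) ++ skipn i' rho).
      { replace (skipn i' rho) with (skipn (i' - i) (skipn i rho)) by (rewrite skipn_skipn; f_equal; lia).
        now rewrite firstn_skipn, firstn_skipn. }
      split; auto. intros w. assert (ND2 := NDr). rewrite Heq in ND2.
      split.
      - intros Hw. split; [rewrite Heq, !in_app_iff; auto|].
        split; intros Hw2.
        + apply (NoDup_app_disj _ _ ND2 w); auto. rewrite in_app_iff; auto.
        + apply NoDup_app_remove_l in ND2. apply (NoDup_app_disj _ _ ND2 w); auto.
      - intros (Hw & Hw1 & Hw2). rewrite Heq, !in_app_iff in Hw. tauto. }
    destruct Hr3 as (R & HR & HRin).
    set (P3 := skipn i' rho) in *.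
    assert (HP3 : forall w, In w P3 -> In w rho /\ ~ In w (A i')).
    { intros w Hw. split; [rewrite HR, !in_app_iff; auto|]. intros Hw2.
      assert (ND2 := NDr). rewrite <- (firstn_skipn i' rho) in ND2. apply (NoDup_app_disj _ _ ND2 w); auto. }
    assert (Hmid : forall w, In w (filter g sigma) <-> (In w rho \/ In w nu) /\ ~ In w (A i) /\ ~ In w P3).
    { intros w. rewrite filter_In, Hg, Hs. tauto. }
    assert (HAi' : forall w, In w rho -> ~ In w P3 -> In w (A i')).
    { intros w Hw Hn. rewrite <- (firstn_skipn i' rho), in_app_iff in Hw. tauto. }
    assert (HAP : forall w, In w (A i) -> ~ In w P3).
    { intros w Hw Hw3. apply HP3 in Hw3 as (_ & Hw3). apply Hw3. eapply in_A_mono; eauto. }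
    assert (Hin0 : forall w, In w (A i) -> i <> 0) by (intros w Hw ->; destruct Hw).
    assert (Hiq : forall w, In w P3 -> i' <> q).
    { intros w Hw ->. unfold P3, q in Hw. rewrite skipn_all in Hw. destruct Hw. }
    assert (Hrho : forall u v, bf rho u v <-> bf (A i) u v \/ (In u (A i) /\ In v (R ++ P3)) \/ bf (R ++ P3) u v).
    { intros u v. rewrite HR at 1. apply bf_app. }
    assert (S12 : forall u v, In u (A i) -> In v (filter g sigma) -> bf sigma u v).
    { intros u v Hu Hv. destruct HL as [HL|HL]; [exfalso; eapply Hin0; eauto|].
      apply Hmid in Hv as ([Hv|Hv] & Hv1 & Hv2); [now apply HL|].
      destruct HS as [HS|HS]; [exfalso; eapply Hin0; eauto|].
      destruct (HS v Hv) as (c & Hc1 & Hc2 & Hc3). eapply bf_trans; eauto. }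
    assert (S23 : forall u v, In u (filter g sigma) -> In v P3 -> bf sigma u v).
    { intros u v Hu Hv. destruct HL' as [HL'|HL']; [exfalso; eapply Hiq; eauto|].
      destruct (HP3 v Hv) as (Hv1 & Hv2).
      apply Hmid in Hu as ([Hu|Hu] & Hu1 & Hu2); [apply HL'; auto|].
      destruct HS' as [HS'|HS']; [exfalso; eapply Hiq; eauto|].
      destruct (HS' u Hu) as (c & Hc1 & Hc3). eapply bf_trans; eauto. }
    rewrite !bf_app in Hxy, Hyz. rewrite !in_app_iff in Hxy, Hyz.
    assert (Hcase : In y (A i) \/ In y (filter g sigma) \/ In y P3).
    { destruct Hxy as [H|[H|[H|[H|H]]]]; [apply bf_in in H|tauto|apply bf_in in H|tauto|apply bf_in in H]; tauto. }
    assert (NA : forall w, In w (A i) -> ~ In w (filter g sigma)) by (intros w Hw Hw2; apply Hmid in Hw2; tauto).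
    assert (NP : forall w, In w P3 -> ~ In w (filter g sigma)) by (intros w Hw Hw2; apply Hmid in Hw2; tauto).
    destruct Hcase as [Hy|[Hy|Hy]].
    + assert (Hxr : bf rho x y).
      { apply Hrho. destruct Hxy as [H|[(_ & [H|H])|[H|[(_ & H)|H]]]]; auto.
        - exfalso; apply (NA y); auto. - exfalso; apply (HAP y); auto.
        - exfalso; apply bf_in in H as (_ & H); apply (NA y); auto.
        - exfalso; apply (HAP y); auto.
        - exfalso; apply bf_in in H as (_ & H); apply (HAP y); auto. }
      assert (Hxi : In x (A i)).
      { destruct Hxy as [H|[(H & _)|[H|[(_ & H)|H]]]]; auto.
        - now apply bf_in in H. - exfalso; apply bf_in in H as (_ & H); apply (NA y); auto.
        - exfalso; apply (HAP y); auto.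
        - exfalso; apply bf_in in H as (_ & H); apply (HAP y); auto. }
      assert (Hz3 : bf (A i) y z \/ In z (filter g sigma) \/ In z P3).
      { destruct Hyz as [H|[(_ & H)|[H|[(H & _)|H]]]]; auto.
        - exfalso; apply bf_in in H as (H & _); apply (NA y); auto.
        - exfalso; apply (NA y); auto.
        - exfalso; apply bf_in in H as (H & _); apply (HAP y); auto. }
      destruct Hz3 as [Hz3|[Hz3|Hz3]].
      * eapply (Okr h Hh); eauto. apply Hrho; auto.
      * apply Hmid in Hz3 as ([Hzr|Hzn] & Hz1 & Hz2).
        -- apply (Okr h Hh x y z); auto. apply Hrho. right. left. split; auto. apply in_or_app. left. apply HRin. auto.
        (* The new [z] is replaced by an old [c] outside the prefix that precedes it in [sigma]:
           since [x] and [z] are in [h], so is [c], and [rho] can be applied to [x], [y], [c]. *)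
        -- destruct HS as [HS|HS]; [exfalso; eapply Hin0; eauto|].
           destruct (HS z Hzn) as (c & Hc1 & Hc2 & Hc3).
           destruct HL as [HL|HL]; [exfalso; eapply Hin0; eauto|].
           assert (In c h) by (apply (Oks h Hh x c z); auto).
           apply (Okr h Hh x y c); auto. apply Hrho. right. left. split; auto.
           rewrite HR, !in_app_iff in Hc1. apply in_or_app. tauto.
      * apply (Okr h Hh x y z); auto. apply Hrho. right. left. split; auto. apply in_or_app. auto.
    + assert (Hx1 : bf sigma x y).
      { destruct Hxy as [H|[(H & _)|[H|[(_ & H)|H]]]]; auto.
        - exfalso; apply bf_in in H as (_ & H); apply (NA y); auto.
        - now apply bf_filter in H.
        - exfalso; apply (NP y); auto.
        - exfalso; apply bf_in in H as (_ & H); apply (NP y); auto. }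
      assert (Hz1 : bf sigma y z).
      { destruct Hyz as [H|[(H & _)|[H|[(_ & H)|H]]]]; auto.
        - exfalso; apply bf_in in H as (H & _); apply (NA y); auto.
        - exfalso; apply (NA y); auto.
        - now apply bf_filter in H.
        - exfalso; apply bf_in in H as (H & _); apply (NP y); auto. }
      eapply (Oks h Hh); eauto.
    + assert (HP3r : forall u v, In u (A i) \/ In u R -> In v P3 -> bf rho u v).
      { intros u v Hu Hv. apply Hrho. destruct Hu as [Hu|Hu].
        - right; left. split; auto. apply in_or_app; auto.
        - right; right. apply bf_app. auto. }
      assert (Hzr : bf rho y z /\ In z P3).
      { destruct Hyz as [H|[(H & _)|[H|[(H & _)|H]]]].
        - exfalso; apply bf_in in H as (H & _); apply (HAP y); auto.
        - exfalso; apply (HAP y); auto.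
        - exfalso; apply bf_in in H as (H & _); apply (NP y); auto.
        - exfalso; apply (NP y); auto.
        - split; [|now apply bf_in in H]. apply Hrho. right; right. apply bf_app. auto. }
      destruct Hzr as (Hzr & Hz3).
      assert (Hx3 : In x (A i) \/ In x (filter g sigma) \/ bf P3 x y).
      { destruct Hxy as [H|[(H & _)|[H|[(H & _)|H]]]]; auto.
        - exfalso; apply bf_in in H as (_ & H); apply (HAP y); auto.
        - exfalso; apply bf_in in H as (_ & H); apply (NP y); auto. }
      destruct Hx3 as [Hx3|[Hx3|Hx3]].
      * apply (Okr h Hh x y z); auto.
      * apply Hmid in Hx3 as ([Hxr|Hxn] & Hx1 & Hx2).
        -- apply (Okr h Hh x y z); auto. apply HP3r; auto. right. apply HRin. auto.
        -- destruct HS' as [HS'|HS']; [exfalso; eapply Hiq; eauto|].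
           destruct (HS' x Hxn) as (c & Hc1 & Hc3).
           destruct HL' as [HL'|HL']; [exfalso; eapply Hiq; eauto|].
           destruct (HP3 y Hy) as (_ & Hy2). destruct (HP3 z Hz3) as (Hz4 & Hz5).
           assert (In c h). { apply (Oks h Hh x c z); auto. }
           apply (Okr h Hh c y z); auto. apply HP3r; auto.
           apply in_A_rho in Hc1 as Hc4. rewrite HR, !in_app_iff in Hc4.
           destruct Hc4 as [|[|Hc4]]; auto. exfalso. apply HP3 in Hc4. tauto.
      * apply (Okr h Hh x y z); auto. apply Hrho. right; right. apply bf_app. auto.
Qed.

Lemma middle_seq i j : i <= j -> j <= q ->
  let m := firstn (j - i) (skipn i rho) in
  NoDup m /\ length m = j - i /\ forall c, In c m -> In c (A j) /\ ~ In c (A i).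
Proof.
  intros H1 H2 m.
  assert (Heq : A j = A i ++ m).
  { unfold m. now apply firstn_split. }
  assert (ND : NoDup (A j)).
  { rewrite <- (firstn_skipn j rho) in NDr. now apply NoDup_app_remove_r in NDr. }
  rewrite Heq in ND. split; [|split].
  - now apply NoDup_app_remove_l in ND.
  - unfold m. rewrite length_firstn, length_skipn. unfold q in *. lia.
  - intros c Hc. split; [rewrite Heq; apply in_or_app; auto|].
    intros Hc'. exact (NoDup_app_disj _ _ ND c Hc' Hc).
Qed.

(** On each side of [i0], good prefixes are taken near the distances [3 * d] and [d]; each may end
    up to [d] late, which gives the reach [4 * d]. At least [d] characters lie between the two. A
    new character on the wrong side of the outer end would enclose them together with the anchor,
    and [e] would be too large. *)
Lemma complete_oriented : (forall i, good i -> d <= i -> i < q -> Lside i) ->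
  let a := i0 - 4 * d in
  let b := Nat.min q (a + (8 * d + 1)) in
  exists w, Permutation w (firstn (b - a) (skipn a rho) ++ nu) /\ okl M (firstn a rho ++ w ++ skipn b rho).
Proof.
  intros HLs a b.
  set (x0 := nth i0 rho 0).
  assert (Hx0r : In x0 rho) by (apply nth_In; auto).
  assert (Hzc : forall z c, In z nu -> In c rho -> bf sigma z c \/ bf sigma c z).
  { intros z c Hz Hc. apply bf_total; [apply Hs; auto|apply Hs; auto|]. intros ->. eapply Hdisj; eauto. }
  assert (Hleft : exists i, a <= i /\ i <= i0 /\ (i = 0 \/ Lside i) /\
    (i = 0 \/ forall z, In z nu -> exists c, In c rho /\ ~ In c (A i) /\ bf sigma c z)).
  { destruct (le_lt_dec (4 * d) i0) as [Hl|Hl].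
    - destruct (good_exists (i0 - 3 * d)) as (i & I1 & I2 & I3); [lia|unfold q; lia|].
      destruct (good_exists (i0 - d)) as (i2 & J1 & J2 & J3); [lia|unfold q; lia|].
      exists i. repeat split; [unfold a; lia|lia|right; apply HLs; auto; unfold q; lia|right].
      intros z Hz. apply NNPP. intros Hno.
      destruct (middle_seq i i2) as (M1 & M2 & M3); [lia|unfold q; lia|].
      set (m := firstn (i2 - i) (skipn i rho)) in *.
      assert (Hm : forall c, In c m -> bf sigma z c /\ bf sigma c x0).
      { intros c Hc. destruct (M3 c Hc) as (Hc1 & Hc2). pose proof (in_A_rho _ _ Hc1) as Hc3. split.
        - destruct (Hzc z c Hz Hc3); auto. exfalso. apply Hno. eauto.
        - apply (HLs i2); auto; [lia|unfold q; lia|]. apply nth_notin; unfold q; lia. }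
      assert (length m + 2 <= length e).
      { apply (bf_length e sigma z x0); auto.
        destruct m as [|c m']; [simpl in M2; lia|]. destruct (Hm c (or_introl eq_refl)). eapply bf_trans; eauto. }
      specialize (Hsz e He). lia.
    - exists 0. repeat split; auto; unfold a; lia. }
  assert (Hright : exists i', i0 < i' /\ i' <= b /\ (i' = q \/ Lside i') /\
    (i' = q \/ forall z, In z nu -> exists c, In c (A i') /\ bf sigma z c)).
  { destruct (le_lt_dec (i0 + 4 * d) q) as [Hl|Hl].
    - destruct (good_exists (i0 + 3 * d)) as (i & I1 & I2 & I3); [lia|lia|].
      destruct (good_exists (i0 + d)) as (i2 & J1 & J2 & J3); [lia|lia|].
      exists i. repeat split; [lia|unfold b, a; lia|right; apply HLs; auto; lia|right].
      intros z Hz. apply NNPP. intros Hno.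
      destruct (middle_seq i2 i) as (M1 & M2 & M3); [lia|lia|].
      set (m := firstn (i - i2) (skipn i2 rho)) in *.
      assert (Hx0i : In x0 (A i2)).
      { apply in_firstn_nth. exists i0. repeat split; auto; lia. }
      assert (Hm : forall c, In c m -> bf sigma x0 c /\ bf sigma c z).
      { intros c Hc. destruct (M3 c Hc) as (Hc1 & Hc2). pose proof (in_A_rho _ _ Hc1) as Hc3. split.
        - apply (HLs i2); auto; lia.
        - destruct (Hzc z c Hz Hc3); auto. exfalso. apply Hno. eauto. }
      assert (length m + 2 <= length e).
      { apply (bf_length e sigma x0 z); auto.
        destruct m as [|c m']; [simpl in M2; lia|]. destruct (Hm c (or_introl eq_refl)). eapply bf_trans; eauto. }
      specialize (Hsz e He). lia.
    - exists q. repeat split; auto; unfold b, a, q in *; lia. }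
  destruct Hleft as (i & L1 & L2 & L3 & L4). destruct Hright as (i' & R1 & R2 & R3 & R4).
  assert (Hi'q : i' <= q) by (unfold b in R2; lia).
  destruct (splice_oriented i i') as (mid & Hmid & NDmid & Hok); auto; [lia|].
  exists (firstn (i - a) (skipn a rho) ++ mid ++ firstn (b - i') (skipn i' rho)).
  assert (Hbq : b <= q) by (unfold b; lia).
  assert (Hcut : forall s t, s <= t -> skipn s rho = firstn (t - s) (skipn s rho) ++ skipn t rho).
  { intros s t Hst. replace (skipn t rho) with (skipn (t - s) (skipn s rho)) by (rewrite skipn_skipn; f_equal; lia).
    now rewrite firstn_skipn. }
  assert (Heq : firstn a rho ++ (firstn (i - a) (skipn a rho) ++ mid ++ firstn (b - i') (skipn i' rho)) ++ skipn b rho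
     = A i ++ mid ++ skipn i' rho).
  { rewrite (Hcut i' b) at 2 by lia. rewrite <- !app_assoc. rewrite (app_assoc (firstn a rho)). f_equal.
    symmetry. now apply firstn_split. }
  split; [|now rewrite Heq].
  assert (NDA : NoDup (A i)).
  { rewrite <- (firstn_skipn i rho) in NDr. now apply NoDup_app_remove_r in NDr. }
  assert (Hd3 : forall x, In x (A i) -> ~ In x (skipn i' rho)).
  { intros x Hx. apply (in_A_mono i i') in Hx; [|lia]. rewrite <- (firstn_skipn i' rho) in NDr.
    exact (NoDup_app_disj _ _ NDr x Hx). }
  assert (HP : Permutation (A i ++ mid ++ skipn i' rho) (rho ++ nu)).
  { apply NoDup_Permutation.
    - apply NoDup_app; auto; [apply NoDup_app; auto|].
      + rewrite <- (firstn_skipn i' rho) in NDr. now apply NoDup_app_remove_l in NDr.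
      + intros x Hx. apply Hmid in Hx. tauto.
      + intros x Hx. rewrite in_app_iff. intros [Hx'|Hx']; [apply Hmid in Hx'; tauto|eapply Hd3; eauto].
    - now apply NoDup_app.
    - intros x. rewrite !in_app_iff, Hmid, Hs.
      assert (In x (A i) -> In x rho) by apply in_A_rho.
      assert (In x (skipn i' rho) -> In x rho).
      { intros Hx. rewrite <- (firstn_skipn i' rho). apply in_or_app; auto. }
      destruct (classic (In x (A i))), (classic (In x (skipn i' rho))); tauto. }
  rewrite <- Heq in HP.
  apply (Permutation_app_inv_l (firstn a rho)). apply (Permutation_app_inv_r (skipn b rho)).
  rewrite <- !app_assoc in *. rewrite HP.
  rewrite <- (firstn_skipn a rho) at 1. rewrite <- app_assoc. apply Permutation_app_head.
  rewrite (Hcut a b) at 1 by (unfold b, q; lia). rewrite <- app_assoc. apply Permutation_app_head.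
  apply Permutation_app_comm.
Qed.

End Splice.

(* Reversing [sigma] exchanges the two sides. *)
Lemma splice_complete d M rho sigma nu e i0 :
  2 <= d -> (forall h, In h M -> length h <= d) ->
  NoDup rho -> NoDup sigma -> NoDup nu -> (forall x, In x rho -> ~ In x nu) ->
  (forall x, In x sigma <-> In x rho \/ In x nu) -> okl M rho -> okl M sigma ->
  (forall t, 0 < t -> t < length rho -> exists h, In h M /\ In (nth (t - 1) rho 0) h /\ In (nth t rho 0) h) ->
  In e M -> (forall x, In x nu -> In x e) -> i0 < length rho -> In (nth i0 rho 0) e ->
  let a := i0 - 4 * d in
  let b := Nat.min (length rho) (a + (8 * d + 1)) in
  exists w, Permutation w (firstn (b - a) (skipn a rho) ++ nu) /\ okl M (firstn a rho ++ w ++ skipn b rho).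
Proof.
  intros Hd Hsz NDr NDs NDn Hdisj Hs Okr Oks Hadj He Hnu Hi0 Hx0.
  destruct (classic (exists i, good M rho i /\ d <= i /\ i < length rho /\ Lside rho sigma i)) as [(i & G1 & G2 & G3 & G4)|Hno].
  - apply (complete_oriented d M rho sigma nu e); auto.
    intros j Hj Hjd Hjq. apply (Lside_all d M rho sigma nu Hd Hsz NDr NDs Hs Oks Hadj i0 Hi0 i j); auto.
  - assert (NDs' : NoDup (rev sigma)) by now apply NoDup_rev.
    apply (complete_oriented d M rho (rev sigma) nu e); auto.
    + intros x. rewrite <- in_rev. apply Hs.
    + now apply okl_rev.
    + intros j Hj Hjd Hjq u y Hu Hy Hny. apply bf_rev.
      destruct (good_side d M rho sigma nu Hd Hsz NDr NDs Hs Oks Hadj i0 Hi0 j) as [H|H]; auto.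
      exfalso. apply Hno. eauto.
Qed.

(** Connectivity, applied to a prefix, yields a meeting with members on both sides of its end; being
    contiguous, it contains the two characters at the boundary. *)
Lemma conn_adjacent M rho : NoDup rho -> okl M rho ->
  (forall A : nat -> bool, forall x y, In x rho -> In y rho -> A x = true -> A y = false ->
    exists h u v, In h M /\ In u h /\ In v h /\ In u rho /\ In v rho /\ A u = true /\ A v = false) ->
  forall t, 0 < t -> t < length rho -> exists h, In h M /\ In (nth (t - 1) rho 0) h /\ In (nth t rho 0) h.
Proof.
  intros ND Hok Hc t Ht Htq.
  destruct (Hc (fun x => dec (In x (firstn t rho))) (nth (t - 1) rho 0) (nth t rho 0)) as (h & u & v & Hh & Hu & Hv & Hur & Hvr & HA & HB);
    try (apply nth_In; lia).
  - apply dec_true. apply in_firstn_nth. exists (t - 1). repeat split; lia.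
  - apply dec_false. intros H. apply in_firstn_nth in H as (s & H1 & H2 & H3). apply NoDup_nth_inj in H3; auto; lia.
  - apply dec_elim in HA. apply dec_nelim in HB. exists h. split; auto.
    apply in_firstn_nth in HA as (i & Hi & Hi' & <-). apply (In_nth _ _ 0) in Hvr as (j & Hj & <-).
    assert (Hjt : t <= j). { destruct (le_lt_dec t j); auto. exfalso. apply HB, in_firstn_nth. eauto. }
    split.
    + destruct (Nat.eq_dec i (t - 1)) as [<-|]; auto.
      apply (Hok h Hh (nth i rho 0) _ (nth j rho 0)); auto; apply bf_nth; lia.
    + destruct (Nat.eq_dec j t) as [<-|]; auto.
      apply (Hok h Hh (nth i rho 0) _ (nth j rho 0)); auto; apply bf_nth; lia.
Qed.

(** * A loop language compiled to the RAM *)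

(* Parameters change only between phases and are the only variable loop limits, so that a time bound can be read
   off the syntax ([tick_bound]). *)
Inductive par := pL | pN | pK | pK1 | pS | pD.
(* aI: input; aO: output; aM: meetings, padded with 0 to length d; aP: current order, preceded by a dummy 0;
   aS: 1-based places in aP, or 0; aK: marks of the rejected meetings; aC: candidate order; aW: window;
   aE: membership in the current meeting. *)
Inductive fld := aI | aO | aM | aP | aS | aK | aC | aW | aE.
Inductive var :=
| vPtr | vN | vI | vJ | vC | vX | vB | vQ | vP | vE | vF | vI0 | vA | vW | vM | vG
| vMn | vMx | vCnt | vBad | vO | vH | vPS | vPC | vCC | vAn | vRs | vLen | vS | vT.

Scheme Equality for par.
Scheme Equality for fld.
Scheme Equality for var.

Definition par_cell (p : par) : nat :=
  match p with pL => 7 | pN => 9 | pK => 10 | pK1 => 11 | pS => 12 | pD => 13 end.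
Definition fld_off (f : fld) : nat :=
  match f with aI => 0 | aO => 1 | aM => 2 | aP => 3 | aS => 4 | aK => 5 | aC => 6 | aW => 7 | aE => 8 end.
Definition var_cell (v : var) : nat := 14 +
  match v with
  | vPtr => 0 | vN => 1 | vI => 2 | vJ => 3 | vC => 4 | vX => 5 | vB => 6 | vQ => 7 | vP => 8
  | vE => 9 | vF => 10 | vI0 => 11 | vA => 12 | vW => 14 | vM => 15 | vG => 16
  | vMn => 17 | vMx => 18 | vCnt => 19 | vBad => 20 | vO => 21 | vH => 22 | vPS => 23 | vPC => 24
  | vCC => 25 | vAn => 26 | vRs => 27 | vLen => 28 | vS => 29 | vT => 30
  end.
Definition n_fields := 9.
Definition base_cell := 8.
Definition temp0 := 45.

Inductive exp :=
| EV (v : var) | EP (p : par) | EN (n : nat)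
| EAdd (a b : exp) | ESub (a b : exp) | EMul (c : nat) (a : exp) | EA (f : fld) (i : exp).

Inductive lim := LN (n : nat) | LP (p : par).

Inductive cmd :=
| CSkip
| CSet (v : var) (e : exp)
| CPut (f : fld) (i e : exp)
| CSeq (a b : cmd)
| CIf (e : exp) (a b : cmd)
| CFor (v : var) (l : lim) (body : cmd).

Record st := mkSt { vr : var -> nat; ar : fld -> nat -> nat }.

Definition set_var (s : st) (v : var) (x : nat) : st :=
  mkSt (fun w => if var_beq w v then x else vr s w) (ar s).
Definition set_arr (s : st) (f : fld) (i x : nat) : st :=
  mkSt (vr s) (fun g j => if andb (fld_beq g f) (Nat.eqb j i) then x else ar s g j).

Fixpoint ex (p : par -> nat) (s : st) (e : exp) : nat :=
  match e with
  | EV v => vr s v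
  | EP q => p q
  | EN n => n
  | EAdd a b => ex p s a + ex p s b
  | ESub a b => ex p s a - ex p s b
  | EMul c a => c * ex p s a
  | EA f i => ar s f (ex p s i)
  end.

Definition lm (p : par -> nat) (l : lim) : nat := match l with LN n => n | LP q => p q end.

Fixpoint loop {S : Type} (f : nat -> S -> S) (n : nat) (s : S) : S :=
  match n with 0 => s | S m => f m (loop f m s) end.

Fixpoint eval (p : par -> nat) (c : cmd) (s : st) : st :=
  match c with
  | CSkip => s
  | CSet v e => set_var s v (ex p s e)
  | CPut f i e => set_arr s f (ex p s i) (ex p s e)
  | CSeq a b => eval p b (eval p a s)
  | CIf e a b => if Nat.eqb (ex p s e) 0 then eval p b s else eval p a s
  | CFor v l body => loop (fun j s' => eval p body (set_var s' v j)) (lm p l) s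
  end.

Fixpoint ticks (p : par -> nat) (c : cmd) (s : st) : nat :=
  match c with
  | CSkip | CSet _ _ | CPut _ _ _ => 0
  | CSeq a b => ticks p a s + ticks p b (eval p a s)
  | CIf e a b => if Nat.eqb (ex p s e) 0 then ticks p b s else ticks p a s
  | CFor v l body =>
      list_sum (map (fun m => 1 + ticks p body
        (set_var (loop (fun j s' => eval p body (set_var s' v j)) m s) v m)) (seq 0 (lm p l)))
  end.

Fixpoint tick_bound (p : par -> nat) (c : cmd) : nat :=
  match c with
  | CSkip | CSet _ _ | CPut _ _ _ => 0
  | CSeq a b => tick_bound p a + tick_bound p b
  | CIf e a b => tick_bound p a + tick_bound p b
  | CFor v l body => lm p l * (1 + tick_bound p body)
  end.

Lemma ticks_le p c s : ticks p c s <= tick_bound p c.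
Proof.
  revert s. induction c; intros s; simpl; try lia.
  - specialize (IHc1 s). specialize (IHc2 (eval p c1 s)). lia.
  - specialize (IHc1 s). specialize (IHc2 s). destruct (_ =? 0); lia.
  - generalize 0. induction (lm p l) as [|m IH]; intros a; simpl; [lia|].
    specialize (IH (S a)). specialize (IHc (set_var (loop (fun j s' => eval p c (set_var s' v j)) a s) v a)). lia.
Qed.

(** The machine has no multiplication; constant factors are unfolded into additions. A register is
    copied by adding it to a cleared one. *)
Fixpoint exp_code (t : nat) (e : exp) : list instr :=
  match e with
  | EV v => [IConst t 0; IAdd t t (var_cell v)]
  | EP q => [IConst t 0; IAdd t t (par_cell q)]
  | EN n => [IConst t n]
  | EAdd a b => exp_code t a ++ exp_code (S t) b ++ [IAdd t t (S t)]
  | ESub a b => exp_code t a ++ exp_code (S t) b ++ [ISub t t (S t)]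
  | EMul c a => exp_code (S t) a ++ IConst t 0 :: repeat (IAdd t t (S t)) c
  | EA f i => exp_code (S t) i ++ IConst t (fld_off f) :: repeat (IAdd t t (S t)) n_fields
                ++ [IAdd t t base_cell; ILoad t t]
  end.

Definition addr_code (t : nat) (f : fld) (i : exp) : list instr :=
  exp_code (S t) i ++ IConst t (fld_off f) :: repeat (IAdd t t (S t)) n_fields ++ [IAdd t t base_cell].

Fixpoint exp_depth (e : exp) : nat :=
  match e with
  | EV _ | EP _ | EN _ => 1
  | EAdd a b | ESub a b => Nat.max (exp_depth a) (S (exp_depth b))
  | EMul _ a | EA _ a => S (exp_depth a)
  end.

Definition lim_exp (l : lim) : exp := match l with LN n => EN n | LP q => EP q end.

Fixpoint exp_len (e : exp) : nat :=
  match e with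
  | EV _ | EP _ => 2
  | EN _ => 1
  | EAdd a b | ESub a b => exp_len a + (exp_len b + 1)
  | EMul c a => exp_len a + (1 + c)
  | EA _ i => exp_len i + S (n_fields + 2)
  end.

Fixpoint cmd_len (c : cmd) : nat :=
  match c with
  | CSkip => 0
  | CSet _ e => exp_len e + 2
  | CPut _ i e => exp_len i + S (n_fields + 1) + (exp_len e + 1)
  | CSeq a b => cmd_len a + cmd_len b
  | CIf e a b => exp_len e + (1 + (cmd_len a + (2 + cmd_len b)))
  | CFor _ l body => exp_len (lim_exp l) + (1 + (2 + (2 + (cmd_len body + 4))))
  end.

(* The counter and the limit of a loop live in the temporaries [t] and [S t]. *)
Fixpoint cmd_code (pc t : nat) (c : cmd) : list instr :=
  match c with
  | CSkip => []
  | CSet v e => exp_code t e ++ [IConst (S t) 0; IAdd (var_cell v) t (S t)]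
  | CPut f i e => addr_code t f i ++ exp_code (S t) e ++ [IStore t (S t)]
  | CSeq a b => cmd_code pc t a ++ cmd_code (pc + cmd_len a) t b
  | CIf e a b =>
      let p1 := pc + exp_len e + 1 in
      let p2 := p1 + cmd_len a + 2 in
      exp_code t e ++ [IJz t p2] ++ cmd_code p1 t a
        ++ [IConst t 0; IJz t (p2 + cmd_len b)] ++ cmd_code p2 t b
  | CFor v l body =>
      let p1 := pc + exp_len (lim_exp l) + 1 in
      let p2 := p1 + 4 in
      exp_code (S t) (lim_exp l) ++ [IConst t 0]
        ++ [ISub (S (S t)) (S t) t; IJz (S (S t)) (p2 + cmd_len body + 4)]
        ++ [IConst (S (S t)) 0; IAdd (var_cell v) t (S (S t))]
        ++ cmd_code p2 (S (S t)) body
        ++ [IConst (S (S t)) 1; IAdd t t (S (S t)); IConst (S (S t)) 0; IJz (S (S t)) p1]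
  end.

Fixpoint cmd_depth (c : cmd) : nat :=
  match c with
  | CSkip => 0
  | CSet _ e => Nat.max (exp_depth e) 2
  | CPut _ i e => S (Nat.max (exp_depth i) (exp_depth e))
  | CSeq a b => Nat.max (cmd_depth a) (cmd_depth b)
  | CIf e a b => Nat.max (exp_depth e) (Nat.max (cmd_depth a) (cmd_depth b))
  | CFor _ _ body => 3 + cmd_depth body
  end.

Lemma exp_depth_pos e : 1 <= exp_depth e.
Proof. induction e; simpl; lia. Qed.

Lemma exp_code_length t e : length (exp_code t e) = exp_len e.
Proof.
  revert t. induction e; intros t; simpl; rewrite ?length_app; simpl; rewrite ?repeat_length, ?IHe, ?IHe1, ?IHe2; auto.
Qed.

Lemma cmd_code_length pc t c : length (cmd_code pc t c) = cmd_len c.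
Proof.
  revert pc t. induction c; intros pc t; simpl; auto; unfold addr_code;
    rewrite ?length_app; simpl; rewrite ?length_app; simpl;
    rewrite ?exp_code_length, ?IHc, ?IHc1, ?IHc2; lia.
Qed.

Local Opaque n_fields.

(** Being uniform in the remaining fuel, runs compose and their step counts add. *)
Definition goes (P : program) (n pc : nat) (m : nat -> nat) (pc' : nat) (m' : nat -> nat) : Prop :=
  forall f, run P (n + f) pc m = run P f pc' m'.

Lemma goes_refl P pc m : goes P 0 pc m pc m.
Proof. intros f. reflexivity. Qed.

Lemma goes_trans P n1 n2 pc1 m1 pc2 m2 pc3 m3 :
  goes P n1 pc1 m1 pc2 m2 -> goes P n2 pc2 m2 pc3 m3 -> goes P (n1 + n2) pc1 m1 pc3 m3.
Proof. intros H1 H2 f. rewrite <- Nat.add_assoc. rewrite H1. apply H2. Qed.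

Definition code_at (P : program) (pc : nat) (c : list instr) : Prop :=
  forall i, i < length c -> nth_error P (pc + i) = nth_error c i.

Lemma code_at_app P pc a b : code_at P pc (a ++ b) <-> code_at P pc a /\ code_at P (pc + length a) b.
Proof.
  split.
  - intros H. split; intros i Hi.
    + rewrite H by (rewrite length_app; lia). now apply nth_error_app1.
    + rewrite <- Nat.add_assoc, H by (rewrite length_app; lia).
      rewrite nth_error_app2 by lia. f_equal. lia.
  - intros (Ha & Hb) i Hi. rewrite length_app in Hi.
    destruct (le_lt_dec (length a) i).
    + rewrite nth_error_app2 by lia. rewrite <- Hb by lia. f_equal. lia.
    + rewrite nth_error_app1 by lia. apply Ha. lia.
Qed.

Lemma code_at_cons P pc x c : code_at P pc (x :: c) <-> nth_error P pc = Some x /\ code_at P (S pc) c.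
Proof.
  change (x :: c) with ([x] ++ c). rewrite code_at_app. simpl. rewrite Nat.add_1_r.
  split; intros (H1 & H2); split; auto.
  - specialize (H1 0). simpl in H1. rewrite Nat.add_0_r in H1. auto.
  - intros i Hi. simpl in Hi. assert (i = 0) by lia. subst. now rewrite Nat.add_0_r.
Qed.

Lemma go_const P pc m r v : nth_error P pc = Some (IConst r v) -> goes P 1 pc m (S pc) (upd m r v).
Proof. intros H f. simpl. now rewrite H. Qed.
Lemma go_add P pc m r a b : nth_error P pc = Some (IAdd r a b) -> goes P 1 pc m (S pc) (upd m r (m a + m b)).
Proof. intros H f. simpl. now rewrite H. Qed.
Lemma go_sub P pc m r a b : nth_error P pc = Some (ISub r a b) -> goes P 1 pc m (S pc) (upd m r (m a - m b)).
Proof. intros H f. simpl. now rewrite H. Qed.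
Lemma go_load P pc m r a : nth_error P pc = Some (ILoad r a) -> goes P 1 pc m (S pc) (upd m r (m (m a))).
Proof. intros H f. simpl. now rewrite H. Qed.
Lemma go_store P pc m a b : nth_error P pc = Some (IStore a b) -> goes P 1 pc m (S pc) (upd m (m a) (m b)).
Proof. intros H f. simpl. now rewrite H. Qed.
Lemma go_jz0 P pc m r l : nth_error P pc = Some (IJz r l) -> m r = 0 -> goes P 1 pc m l m.
Proof. intros H E f. simpl. now rewrite H, E. Qed.
Lemma go_jz1 P pc m r l : nth_error P pc = Some (IJz r l) -> m r <> 0 -> goes P 1 pc m (S pc) m.
Proof. intros H E f. simpl. rewrite H. apply Nat.eqb_neq in E. now rewrite E. Qed.

Lemma upd_eq m a v : upd m a v a = v.
Proof. unfold upd. now rewrite Nat.eqb_refl. Qed.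
Lemma upd_neq m a v b : b <> a -> upd m a v b = m b.
Proof. intros H. unfold upd. apply Nat.eqb_neq in H. now rewrite H. Qed.

Lemma go_muladd P pc m t c : code_at P pc (repeat (IAdd t t (S t)) c) ->
  exists m', goes P c pc m (pc + c) m' /\ m' t = m t + c * m (S t) /\ forall a, a <> t -> m' a = m a.
Proof.
  revert pc m. induction c as [|c IH]; intros pc m H.
  - exists m. rewrite Nat.add_0_r. split; [apply goes_refl|]. split; [lia|auto].
  - cbn [repeat] in H. apply code_at_cons in H as (H1 & H2).
    destruct (IH (S pc) (upd m t (m t + m (S t))) H2) as (m' & G & E & F).
    exists m'. split; [|split].
    + replace (pc + S c) with (S pc + c) by lia. apply (goes_trans P 1 c _ _ _ _ _ _ (go_add _ _ _ _ _ _ H1) G).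
    + rewrite E, upd_eq, upd_neq by lia. lia.
    + intros a Ha. rewrite F by auto. now apply upd_neq.
Qed.

(** The arrays are interleaved with stride [n_fields], because none of their lengths is bounded in
    advance. Their common base [AB] depends on the input length and is itself kept in a register. *)
Definition rep (p : par -> nat) (s : st) (AB : nat) (m : nat -> nat) : Prop :=
  (forall q, m (par_cell q) = p q) /\ m base_cell = AB /\ (forall v, m (var_cell v) = vr s v) /\
  forall f i, m (AB + n_fields * i + fld_off f) = ar s f i.

Lemma par_cell_lt q : par_cell q < temp0. Proof. unfold temp0. destruct q; simpl; lia. Qed.
Lemma var_cell_lt v : var_cell v < temp0. Proof. unfold temp0, var_cell. destruct v; lia. Qed.
Lemma var_cell_inj v w : var_cell v = var_cell w -> v = w.
Proof. unfold var_cell. destruct v, w; intros H; try reflexivity; discriminate H. Qed.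
Lemma var_par_cell v q : var_cell v <> par_cell q. Proof. unfold var_cell, par_cell. destruct q; lia. Qed.
Lemma par_cell_inj v w : par_cell v = par_cell w -> v = w.
Proof. destruct v, w; simpl; intros H; try reflexivity; discriminate H. Qed.
Local Transparent n_fields.
Lemma fld_off_lt f : fld_off f < n_fields. Proof. unfold n_fields. destruct f; simpl; lia. Qed.
Lemma fld_off_inj v w : fld_off v = fld_off w -> v = w.
Proof. destruct v, w; simpl; intros H; try reflexivity; discriminate H. Qed.
Lemma var_base_cell v : var_cell v <> base_cell. Proof. unfold base_cell, var_cell. lia. Qed.
Lemma par_base_cell q : par_cell q <> base_cell. Proof. unfold base_cell. destruct q; simpl; lia. Qed.
Lemma base_cell_lt : base_cell < temp0. Proof. unfold base_cell, temp0. lia. Qed.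

Lemma field_addr_inj AB i f j g :
  AB + n_fields * i + fld_off f = AB + n_fields * j + fld_off g -> i = j /\ f = g.
Proof.
  intros H. pose proof (fld_off_lt f). pose proof (fld_off_lt g). unfold n_fields in *.
  assert (i = j) by lia. subst. split; auto. apply fld_off_inj. lia.
Qed.

Local Opaque n_fields.

Lemma rep_frame p s AB m m' : temp0 <= AB -> rep p s AB m ->
  (forall a, a < temp0 \/ AB <= a -> m' a = m a) -> rep p s AB m'.
Proof.
  intros HAB (R1 & R2 & R3 & R4) H. repeat split.
  - intros q. rewrite H; auto. left. apply par_cell_lt.
  - rewrite H; auto. left. apply base_cell_lt.
  - intros v. rewrite H; auto. left. apply var_cell_lt.
  - intros f i. rewrite H; auto. right. lia.
Qed.

Lemma rep_set_var p s AB m v x : temp0 <= AB -> rep p s AB m -> rep p (set_var s v x) AB (upd m (var_cell v) x).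
Proof.
  intros HAB (R1 & R2 & R3 & R4). repeat split.
  - intros q. rewrite upd_neq; auto. intros E. symmetry in E. now apply var_par_cell in E.
  - rewrite upd_neq; auto. intros E. symmetry in E. now apply var_base_cell in E.
  - intros w. simpl. destruct (var_beq w v) eqn:E.
    + apply internal_var_dec_bl in E. subst. apply upd_eq.
    + rewrite upd_neq; auto. intros E2. apply var_cell_inj in E2. subst.
      rewrite internal_var_dec_lb in E; congruence.
  - intros f i. rewrite upd_neq; [apply R4|]. pose proof (var_cell_lt v). lia.
Qed.

Lemma rep_set_arr p s AB m f i x : temp0 <= AB -> rep p s AB m ->
  rep p (set_arr s f i x) AB (upd m (AB + n_fields * i + fld_off f) x).
Proof.
  intros HAB (R1 & R2 & R3 & R4). repeat split.
  - intros q. rewrite upd_neq; auto. pose proof (par_cell_lt q). lia.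
  - rewrite upd_neq; auto. pose proof base_cell_lt. lia.
  - intros w. simpl. rewrite upd_neq; auto. pose proof (var_cell_lt w). lia.
  - intros g j. cbn [set_arr ar]. destruct (fld_beq g f) eqn:E; cbn [andb]; [destruct (j =? i) eqn:E2|].
    + apply internal_fld_dec_bl in E. apply Nat.eqb_eq in E2. subst. apply upd_eq.
    + apply Nat.eqb_neq in E2. rewrite upd_neq; auto. intros E3. now apply field_addr_inj in E3.
    + rewrite upd_neq; auto. intros E3. apply field_addr_inj in E3 as (_ & ->).
      rewrite internal_fld_dec_lb in E; congruence.
Qed.

Lemma exp_code_ok P p s AB e : forall pc t m,
  code_at P pc (exp_code t e) -> rep p s AB m -> temp0 <= t -> t + exp_depth e <= AB ->
  exists m', goes P (exp_len e) pc m (pc + exp_len e) m' /\ m' t = ex p s e /\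
    forall a, a < t \/ t + exp_depth e <= a -> m' a = m a.
Proof.
  induction e; intros pc t m HC HR Ht Hd; simpl in *.
  - apply code_at_cons in HC as (H1 & HC). apply code_at_cons in HC as (H2 & _).
    eexists. split; [|split].
    + eapply (goes_trans P 1 1); [apply (go_const _ _ _ _ _ H1)|].
      replace (pc + 2) with (S (S pc)) by lia. apply (go_add _ _ _ _ _ _ H2).
    + rewrite upd_eq, upd_eq, upd_neq by (pose proof (var_cell_lt v); lia). apply HR.
    + intros a Ha. rewrite !upd_neq by lia. auto.
  - apply code_at_cons in HC as (H1 & HC). apply code_at_cons in HC as (H2 & _).
    eexists. split; [|split].
    + eapply (goes_trans P 1 1); [apply (go_const _ _ _ _ _ H1)|].
      replace (pc + 2) with (S (S pc)) by lia. apply (go_add _ _ _ _ _ _ H2).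
    + rewrite upd_eq, upd_eq, upd_neq by (pose proof (par_cell_lt p0); lia). apply HR.
    + intros a Ha. rewrite !upd_neq by lia. auto.
  - apply code_at_cons in HC as (H1 & _).
    eexists. split; [|split].
    + replace (pc + 1) with (S pc) by lia. apply (go_const _ _ _ _ _ H1).
    + apply upd_eq.
    + intros a Ha. rewrite upd_neq by lia. auto.
  - apply code_at_app in HC as (H1 & HC). apply code_at_app in HC as (H2 & HC). apply code_at_cons in HC as (H3 & _).
    rewrite !exp_code_length in *.
    destruct (IHe1 pc t m H1 HR) as (m1 & G1 & E1 & F1); try lia.
    assert (HR1 : rep p s AB m1) by (apply (rep_frame p s AB m); auto; [lia|intros; apply F1; lia]).
    destruct (IHe2 _ (S t) m1 H2 HR1) as (m2 & G2 & E2 & F2); try lia.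
    eexists. split; [|split].
    + eapply goes_trans; [exact G1|]. eapply goes_trans; [exact G2|].
      rewrite !Nat.add_assoc, Nat.add_1_r. apply (go_add _ _ _ _ _ _ H3).
    + rewrite upd_eq, F2, E1, E2 by lia. reflexivity.
    + intros a Ha. rewrite upd_neq, F2, F1 by lia. auto.
  - apply code_at_app in HC as (H1 & HC). apply code_at_app in HC as (H2 & HC). apply code_at_cons in HC as (H3 & _).
    rewrite !exp_code_length in *.
    destruct (IHe1 pc t m H1 HR) as (m1 & G1 & E1 & F1); try lia.
    assert (HR1 : rep p s AB m1) by (apply (rep_frame p s AB m); auto; [lia|intros; apply F1; lia]).
    destruct (IHe2 _ (S t) m1 H2 HR1) as (m2 & G2 & E2 & F2); try lia.
    eexists. split; [|split].
    + eapply goes_trans; [exact G1|]. eapply goes_trans; [exact G2|].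
      rewrite !Nat.add_assoc, Nat.add_1_r. apply (go_sub _ _ _ _ _ _ H3).
    + rewrite upd_eq, F2, E1, E2 by lia. reflexivity.
    + intros a Ha. rewrite upd_neq, F2, F1 by lia. auto.
  - apply code_at_app in HC as (H1 & HC). apply code_at_cons in HC as (H2 & HC).
    rewrite !exp_code_length in *.
    destruct (IHe pc (S t) m H1 HR) as (m1 & G1 & E1 & F1); try lia.
    destruct (go_muladd P _ (upd m1 t 0) t c HC) as (m2 & G2 & E2 & F2).
    exists m2. split; [|split].
    + eapply goes_trans; [exact G1|]. eapply (goes_trans P 1 c); [apply (go_const _ _ _ _ _ H2)|].
      replace (pc + (exp_len e + S c)) with (S (pc + exp_len e) + c) by lia. exact G2.
    + rewrite E2, upd_eq, upd_neq, E1 by lia. lia.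
    + intros a Ha. rewrite F2, upd_neq, F1 by lia. auto.
  - apply code_at_app in HC as (H1 & HC). apply code_at_cons in HC as (H2 & HC).
    apply (code_at_app P _ (repeat (IAdd t t (S t)) n_fields)) in HC as (H3 & HC).
    apply code_at_cons in HC as (H4 & HC). apply code_at_cons in HC as (H5 & _).
    rewrite !exp_code_length, !repeat_length in *.
    destruct (IHe pc (S t) m H1 HR) as (m1 & G1 & E1 & F1); try lia.
    destruct (go_muladd P _ (upd m1 t (fld_off f)) t _ H3) as (m2 & G2 & E2 & F2).
    assert (HB : m2 base_cell = AB).
    { pose proof base_cell_lt. rewrite F2, upd_neq, F1 by lia. apply HR. }
    assert (HV : m2 t = n_fields * ex p s e + fld_off f) by (rewrite E2, upd_eq, upd_neq, E1 by lia; lia).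
    eexists. split; [|split].
    + eapply goes_trans; [exact G1|]. eapply (goes_trans P 1 (n_fields + 2)); [apply (go_const _ _ _ _ _ H2)|].
      eapply (goes_trans P n_fields 2); [exact G2|].
      eapply (goes_trans P 1 1); [apply (go_add _ _ _ _ _ _ H4)|].
      replace (pc + (exp_len e + S (n_fields + 2))) with (S (S (S (pc + exp_len e) + n_fields))) by lia.
      apply (go_load _ _ _ _ _ H5).
    + rewrite !upd_eq, HB, HV. rewrite upd_neq by lia. rewrite F2, upd_neq, F1 by lia.
      replace (n_fields * ex p s e + fld_off f + AB) with (AB + n_fields * ex p s e + fld_off f) by lia. apply HR.
    + intros a Ha. rewrite !upd_neq by lia. rewrite F2, upd_neq, F1 by lia. auto.
Qed.

Lemma addr_code_ok P p s AB f i pc t m :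
  code_at P pc (addr_code t f i) -> rep p s AB m -> temp0 <= t -> t + S (exp_depth i) <= AB ->
  exists m', goes P (exp_len i + S (n_fields + 1)) pc m (pc + (exp_len i + S (n_fields + 1))) m' /\
    m' t = AB + n_fields * ex p s i + fld_off f /\
    forall a, a < t \/ t + S (exp_depth i) <= a -> m' a = m a.
Proof.
  intros HC HR Ht Hd. unfold addr_code in HC.
  apply code_at_app in HC as (H1 & HC). apply code_at_cons in HC as (H2 & HC).
  apply (code_at_app P _ (repeat (IAdd t t (S t)) n_fields)) in HC as (H3 & HC).
  apply code_at_cons in HC as (H4 & _).
  rewrite !exp_code_length, !repeat_length in *.
  destruct (exp_code_ok P p s AB i pc (S t) m H1 HR) as (m1 & G1 & E1 & F1); try lia.
  destruct (go_muladd P _ (upd m1 t (fld_off f)) t _ H3) as (m2 & G2 & E2 & F2).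
  assert (HB : m2 base_cell = AB).
  { pose proof base_cell_lt. rewrite F2, upd_neq, F1 by lia. apply HR. }
  assert (HV : m2 t = n_fields * ex p s i + fld_off f) by (rewrite E2, upd_eq, upd_neq, E1 by lia; lia).
  eexists. split; [|split].
  - eapply goes_trans; [exact G1|]. eapply (goes_trans P 1 (n_fields + 1)); [apply (go_const _ _ _ _ _ H2)|].
    eapply (goes_trans P n_fields 1); [exact G2|].
    replace (pc + (exp_len i + S (n_fields + 1))) with (S (S (pc + exp_len i) + n_fields)) by lia.
    apply (go_add _ _ _ _ _ _ H4).
  - rewrite upd_eq, HB, HV. lia.
  - intros a Ha. rewrite !upd_neq by lia. rewrite F2, upd_neq, F1 by lia. auto.
Qed.

(** Between two ticks no instruction is executed twice, so the code length times one plus the number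
    of ticks bounds the time. The untouched lower temporaries are the counters and limits of the
    enclosing loops. *)
Lemma cmd_code_ok P p AB c : forall pc t m s,
  code_at P pc (cmd_code pc t c) -> rep p s AB m -> temp0 <= t -> t + cmd_depth c <= AB ->
  exists n m', n <= cmd_len c * (1 + ticks p c s) /\ goes P n pc m (pc + cmd_len c) m' /\
    rep p (eval p c s) AB m' /\ forall a, temp0 <= a < t -> m' a = m a.
Proof.
  induction c; intros pc t m s HC HR Ht Hd; cbn [cmd_code cmd_depth cmd_len ticks eval] in *.
  - exists 0, m. replace (pc + 0) with pc by lia. split; [lia|]. split; [apply goes_refl|]. auto.
  - apply code_at_app in HC as (H1 & HC). apply code_at_cons in HC as (H2 & HC). apply code_at_cons in HC as (H3 & _).
    rewrite !exp_code_length in *.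
    destruct (exp_code_ok P p s AB e pc t m H1 HR) as (m1 & G1 & E1 & F1); try lia.
    assert (HR1 : rep p s AB (upd m1 (S t) 0)).
    { apply (rep_frame p s AB m); auto; [lia|]. intros a Ha. rewrite upd_neq by lia. apply F1. lia. }
    exists (exp_len e + 2), (upd (upd m1 (S t) 0) (var_cell v) (ex p s e)). split; [lia|]. split; [|split].
    + eapply goes_trans; [exact G1|]. eapply (goes_trans P 1 1); [apply (go_const _ _ _ _ _ H2)|].
      replace (pc + (exp_len e + 2)) with (S (S (pc + exp_len e))) by lia.
      replace (ex p s e) with (upd m1 (S t) 0 t + upd m1 (S t) 0 (S t)).
      * apply (go_add _ _ _ _ _ _ H3).
      * rewrite upd_eq, upd_neq by lia. lia.
    + apply rep_set_var; auto. lia.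
    + intros a Ha. pose proof (var_cell_lt v). rewrite !upd_neq by lia. apply F1. lia.
  - apply code_at_app in HC as (H1 & HC). apply code_at_app in HC as (H2 & HC). apply code_at_cons in HC as (H3 & _).
    assert (HAL : length (addr_code t f i) = exp_len i + S (n_fields + 1)).
    { unfold addr_code. rewrite length_app. cbn [length]. rewrite length_app, repeat_length, exp_code_length. reflexivity. }
    rewrite HAL, !exp_code_length in *.
    destruct (addr_code_ok P p s AB f i pc t m H1 HR) as (m1 & G1 & E1 & F1); try lia.
    assert (HR1 : rep p s AB m1) by (apply (rep_frame p s AB m); auto; [lia|intros; apply F1; lia]).
    destruct (exp_code_ok P p s AB e _ (S t) m1 H2 HR1) as (m2 & G2 & E2 & F2); try lia.
    assert (HR2 : rep p s AB m2) by (apply (rep_frame p s AB m1); auto; [lia|intros; apply F2; lia]).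
    exists (exp_len i + S (n_fields + 1) + (exp_len e + 1)), (upd m2 (AB + n_fields * ex p s i + fld_off f) (ex p s e)).
    split; [lia|]. split; [|split].
    + eapply goes_trans; [exact G1|]. eapply goes_trans; [exact G2|].
      replace (pc + (exp_len i + S (n_fields + 1) + (exp_len e + 1))) with (S (pc + (exp_len i + S (n_fields + 1)) + exp_len e)) by lia.
      replace (AB + n_fields * ex p s i + fld_off f) with (m2 t) by (rewrite F2 by lia; auto).
      rewrite <- E2. apply (go_store _ _ _ _ _ H3).
    + apply rep_set_arr; auto. lia.
    + intros a Ha. rewrite upd_neq by lia. rewrite F2 by lia. apply F1. lia.
  - apply code_at_app in HC as (H1 & H2). rewrite cmd_code_length in H2.
    destruct (IHc1 pc t m s H1 HR) as (n1 & m1 & B1 & G1 & R1 & F1); try lia.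
    destruct (IHc2 _ t m1 _ H2 R1) as (n2 & m2 & B2 & G2 & R2 & F2); try lia.
    exists (n1 + n2), m2. split; [|split; [|split]]; auto.
    + rewrite Nat.mul_add_distr_r. nia.
    + rewrite Nat.add_assoc. eapply goes_trans; eauto.
    + intros a Ha. rewrite F2, F1; auto.
  - apply code_at_app in HC as (H1 & HC). apply code_at_cons in HC as (H2 & HC).
    apply (code_at_app P _ (cmd_code _ t c1)) in HC as (H3 & HC).
    apply code_at_cons in HC as (H4 & HC). apply code_at_cons in HC as (H5 & H6).
    rewrite !exp_code_length, !cmd_code_length in *.
    destruct (exp_code_ok P p s AB e pc t m H1 HR) as (m1 & G1 & E1 & F1); try lia.
    assert (HR1 : rep p s AB m1) by (apply (rep_frame p s AB m); auto; [lia|intros; apply F1; lia]).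
    replace (S (pc + exp_len e)) with (pc + exp_len e + 1) in * by lia.
    destruct (ex p s e =? 0) eqn:E0.
    + apply Nat.eqb_eq in E0.
      replace (S (S (pc + exp_len e + 1 + cmd_len c1))) with (pc + exp_len e + 1 + cmd_len c1 + 2) in H6 by lia.
      destruct (IHc2 _ t m1 s H6 HR1) as (n2 & m2 & B2 & G2 & R2 & F2); try lia.
      exists (exp_len e + (1 + n2)), m2. split; [|split; [|split]]; auto.
      * nia.
      * eapply goes_trans; [exact G1|]. eapply goes_trans; [apply (go_jz0 _ _ _ _ _ H2); congruence|].
        replace (pc + (exp_len e + (1 + (cmd_len c1 + (2 + cmd_len c2))))) with (pc + exp_len e + 1 + cmd_len c1 + 2 + cmd_len c2) by lia.
        exact G2.
      * intros a Ha. rewrite F2 by lia. apply F1. lia.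
    + apply Nat.eqb_neq in E0.
      destruct (IHc1 _ t m1 s H3 HR1) as (n2 & m2 & B2 & G2 & R2 & F2); try lia.
      exists (exp_len e + (1 + (n2 + 2))), (upd m2 t 0). split; [|split; [|split]].
      * nia.
      * eapply goes_trans; [exact G1|]. eapply (goes_trans P 1); [apply (go_jz1 _ _ _ _ _ H2); congruence|].
        replace (S (pc + exp_len e)) with (pc + exp_len e + 1) by lia.
        eapply goes_trans; [exact G2|]. eapply (goes_trans P 1 1); [apply (go_const _ _ _ _ _ H4)|].
        replace (pc + (exp_len e + (1 + (cmd_len c1 + (2 + cmd_len c2))))) with (pc + exp_len e + 1 + cmd_len c1 + 2 + cmd_len c2) by lia.
        apply (go_jz0 _ _ _ _ _ H5). apply upd_eq.
      * apply (rep_frame p _ AB m2); auto; [lia|]. intros a Ha. rewrite upd_neq; auto.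
        pose proof (exp_depth_pos e). lia.
      * intros a Ha. rewrite upd_neq by lia. rewrite F2 by lia. apply F1. lia.
  - apply code_at_app in HC as (H1 & HC). apply code_at_cons in HC as (H2 & HC).
    apply code_at_cons in HC as (H3 & HC). apply code_at_cons in HC as (H4 & HC).
    apply code_at_cons in HC as (H5 & HC). apply code_at_cons in HC as (H6 & HC).
    apply (code_at_app P _ (cmd_code _ (S (S t)) c)) in HC as (H7 & HC).
    apply code_at_cons in HC as (H8 & HC). apply code_at_cons in HC as (H9 & HC).
    apply code_at_cons in HC as (H10 & HC). apply code_at_cons in HC as (H11 & _).
    rewrite !exp_code_length, !cmd_code_length in *.
    assert (HL : ex p s (lim_exp l) = lm p l) by (destruct l; reflexivity).
    assert (HLd : exp_depth (lim_exp l) = 1) by (destruct l; reflexivity).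
    destruct (exp_code_ok P p s AB _ pc (S t) m H1 HR) as (m1 & G1 & E1 & F1); try lia.
    set (p1 := pc + exp_len (lim_exp l) + 1) in *.
    replace (S (pc + exp_len (lim_exp l))) with p1 in * by (unfold p1; lia).
    replace (S (S (S (S p1)))) with (p1 + 4) in * by lia.
    set (F := fun j s' => eval p c (set_var s' v j)) in *.
    set (tk := fun j => 1 + ticks p c (set_var (loop F j s) v j)) in *.
    assert (Hloop : forall j, j <= lm p l -> exists n m', n <= (8 + cmd_len c) * list_sum (map tk (seq 0 j)) /\
       goes P n p1 (upd m1 t 0) p1 m' /\ rep p (loop F j s) AB m' /\ m' t = j /\ m' (S t) = lm p l /\
       forall a, temp0 <= a < t -> m' a = m a).
    { induction j as [|j IHj]; intros Hj.
      - exists 0, (upd m1 t 0). split; [lia|]. split; [apply goes_refl|]. split; [|split; [|split]].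
        + apply (rep_frame p s AB m); auto; [lia|]. intros a Ha. rewrite upd_neq by lia. apply F1. lia.
        + apply upd_eq.
        + rewrite upd_neq by lia. congruence.
        + intros a Ha. rewrite upd_neq by lia. apply F1. lia.
      - destruct IHj as (n & m2 & B2 & G2 & R2 & T2 & L2 & F2); [lia|].
        set (m3 := upd (upd (upd m2 (S (S t)) (m2 (S t) - m2 t)) (S (S t)) 0) (var_cell v) j).
        assert (R3 : rep p (set_var (loop F j s) v j) AB m3).
        { apply rep_set_var; [lia|]. apply (rep_frame p _ AB m2); auto; [lia|]. intros a Ha. rewrite !upd_neq by lia. auto. }
        pose proof (var_cell_lt v) as Hv.
        destruct (IHc _ (S (S t)) m3 _ H7 R3) as (n4 & m4 & B4 & G4 & R4 & F4); try lia.
        exists (n + (4 + (n4 + 4))), (upd (upd (upd m4 (S (S t)) 1) t (S j)) (S (S t)) 0).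
        assert (T4 : m4 t = j). { rewrite F4 by lia. unfold m3. rewrite !upd_neq by lia. auto. }
        split; [|split; [|split; [|split; [|split]]]].
        + rewrite seq_S, map_app, list_sum_app. cbn [map list_sum fold_right Nat.add].
          set (X := list_sum _) in *. fold (tk j).
          assert (n4 <= cmd_len c * tk j) by exact B4. assert (1 <= tk j) by (unfold tk; lia). cbn [list_sum] in *. nia.
        + eapply goes_trans; [exact G2|]. apply (goes_trans P 4 (n4 + 4) _ _ (p1 + 4) m3).
          * replace (p1 + 4) with (S (S (S (S p1)))) by lia.
            eapply (goes_trans P 1 3); [apply (go_sub _ _ _ _ _ _ H3)|].
            eapply (goes_trans P 1 2); [apply (go_jz1 _ _ _ _ _ H4); rewrite upd_eq; lia|].
            eapply (goes_trans P 1 1); [apply (go_const _ _ _ _ _ H5)|].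
            pose proof (go_add _ _ (upd (upd m2 (S (S t)) (m2 (S t) - m2 t)) (S (S t)) 0) _ _ _ H6) as G.
            rewrite upd_eq, !upd_neq, T2, Nat.add_0_r in G by lia. unfold m3. rewrite T2. exact G.
          * eapply goes_trans; [exact G4|].
            eapply (goes_trans P 1 3); [apply (go_const _ _ _ _ _ H8)|].
            eapply (goes_trans P 1 2).
            { pose proof (go_add _ _ (upd m4 (S (S t)) 1) _ _ _ H9) as G.
              replace (upd m4 (S (S t)) 1 t + upd m4 (S (S t)) 1 (S (S t))) with (S j) in G; [exact G|].
              rewrite upd_eq, upd_neq by lia. lia. }
            eapply (goes_trans P 1 1); [apply (go_const _ _ _ _ _ H10)|].
            apply (go_jz0 _ _ _ _ _ H11). apply upd_eq.
        + cbn [loop]. apply (rep_frame p _ AB m4); auto; [lia|]. intros a Ha. rewrite !upd_neq by lia. auto.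
        + rewrite upd_neq by lia. apply upd_eq.
        + rewrite !upd_neq by lia. rewrite F4 by lia. unfold m3. rewrite !upd_neq by lia. auto.
        + intros a Ha. rewrite !upd_neq by lia. rewrite F4 by lia. unfold m3. rewrite !upd_neq by lia. auto. }
    destruct (Hloop (lm p l)) as (n & m2 & B2 & G2 & R2 & T2 & L2 & F2); [lia|].
    exists (exp_len (lim_exp l) + (1 + (n + 2))), (upd m2 (S (S t)) 0). split; [|split; [|split]].
    + fold F. change (list_sum _) with (list_sum (map tk (seq 0 (lm p l)))). set (X := list_sum _) in *. nia.
    + eapply goes_trans; [exact G1|]. eapply (goes_trans P 1); [apply (go_const _ _ _ _ _ H2)|].
      replace (S (pc + exp_len (lim_exp l))) with p1 by (unfold p1; lia).
      eapply goes_trans; [exact G2|].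
      pose proof (go_sub _ _ m2 _ _ _ H3) as G3. replace (m2 (S t) - m2 t) with 0 in G3 by lia.
      eapply (goes_trans P 1 1); [exact G3|].
      replace (pc + (exp_len (lim_exp l) + (1 + (2 + (2 + (cmd_len c + 4)))))) with (p1 + 4 + cmd_len c + 4) by (unfold p1; lia).
      apply (go_jz0 _ _ _ _ _ H4). apply upd_eq.
    + apply (rep_frame p _ AB m2); auto; [lia|]. intros a Ha. rewrite upd_neq by lia. auto.
    + intros a Ha. rewrite upd_neq by lia. auto.
Qed.

(** * Moving the input out of the register area *)

Definition exec1 (m : nat -> nat) (i : instr) : nat -> nat :=
  match i with
  | IConst r v => upd m r v
  | IAdd r a b => upd m r (m a + m b)
  | ISub r a b => upd m r (m a - m b)
  | ILoad r a => upd m r (m (m a))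
  | IStore a b => upd m (m a) (m b)
  | _ => m
  end.

Definition is_straight (i : instr) : bool := match i with IJz _ _ | IHalt => false | _ => true end.

Lemma straight_ok P c : forall pc m, code_at P pc c -> forallb is_straight c = true ->
  goes P (length c) pc m (pc + length c) (fold_left exec1 c m).
Proof.
  induction c as [|i c IH]; intros pc m HC HS; simpl.
  - replace (pc + 0) with pc by lia. apply goes_refl.
  - simpl in HS. apply andb_prop in HS as (HS1 & HS2). apply code_at_cons in HC as (H1 & H2).
    replace (pc + S (length c)) with (S pc + length c) by lia.
    apply (goes_trans P 1 (length c) _ _ (S pc) (exec1 m i)); [|apply IH; auto].
    destruct i; try discriminate HS1; simpl;
      [apply go_const|apply go_add|apply go_sub|apply go_load|apply go_store]; auto.
Qed.

Ltac far_from a := repeat match goal with |- context [a =? ?b] => destruct (Nat.eqb_spec a b); [exfalso; lia|] end.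

(* Cells 0,1,2: source, destination, count; 3: scratch; 4,5: strides; 6: the constant 1. *)
Definition copy_code (pc : nat) : list instr :=
  [IJz 2 (pc + 8); ILoad 3 0; IStore 1 3; IAdd 0 0 4; IAdd 1 1 5; ISub 2 2 6; IConst 3 0; IJz 3 pc].

(** The last hypothesis says that no cell is overwritten before it is read. Overlap is otherwise
    allowed, which permits compacting the output in place. *)
Lemma copy_ok P pc : code_at P pc (copy_code pc) -> forall cnt m src dst sx sy,
  m 0 = src -> m 1 = dst -> m 2 = cnt -> m 4 = sx -> m 5 = sy -> m 6 = 1 ->
  7 <= src -> 7 <= dst -> 1 <= sy ->
  (forall i j, i < j -> j < cnt -> dst + sy * i <> src + sx * j) ->
  exists m', goes P (cnt * 8 + 1) pc m (pc + 8) m' /\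
    (forall i, i < cnt -> m' (dst + sy * i) = m (src + sx * i)) /\
    (forall a, 7 <= a -> (forall i, i < cnt -> a <> dst + sy * i) -> m' a = m a).
Proof.
  intros HC. assert (HC' := HC). unfold copy_code in HC'.
  apply code_at_cons in HC' as (H1 & HC').
  apply (code_at_app P (S pc) [ILoad 3 0; IStore 1 3; IAdd 0 0 4; IAdd 1 1 5; ISub 2 2 6; IConst 3 0] [IJz 3 pc]) in HC' as (H2 & H3).
  apply code_at_cons in H3 as (H3 & _).
  induction cnt as [|cnt IH]; intros m src dst sx sy M0 M1 M2 M4 M5 M6 Hs Hd Hy Hne.
  - exists m. split; [apply (go_jz0 _ _ _ _ _ H1 M2)|]. split; [intros; lia|auto].
  - set (m1 := fold_left exec1 [ILoad 3 0; IStore 1 3; IAdd 0 0 4; IAdd 1 1 5; ISub 2 2 6; IConst 3 0] m).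
    pose proof (straight_ok P _ _ m H2 eq_refl) as G1. fold m1 in G1.
    assert (E : forall a, m1 a = if a =? 3 then 0 else if a =? 2 then cnt else if a =? 1 then dst + sy
       else if a =? 0 then src + sx else if a =? dst then m src else m a).
    { intros a. unfold m1. cbn [fold_left exec1].
      set (u := upd (upd m 3 (m (m 0))) (upd m 3 (m (m 0)) 1) (upd m 3 (m (m 0)) 3)).
      assert (Hu : forall b, b <> 3 -> u b = if b =? dst then m src else m b).
      { intros b Hb. unfold u. rewrite upd_eq. rewrite (upd_neq _ 3 _ 1) by lia. rewrite M1.
        unfold upd. destruct (b =? dst) eqn:Eb; [now rewrite M0|]. apply Nat.eqb_neq in Hb. now rewrite Hb. }
      clearbody u. unfold upd. simpl.
      assert (Hlow : forall b, b < 7 -> b <> 3 -> u b = m b).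
      { intros b Hb Hb3. rewrite Hu by auto. destruct (Nat.eqb_spec b dst); auto. lia. }
      destruct (Nat.eqb_spec a 3); auto. destruct (Nat.eqb_spec a 2); [rewrite !Hlow by lia; lia|].
      destruct (Nat.eqb_spec a 1); [rewrite !Hlow by lia; lia|].
      destruct (Nat.eqb_spec a 0); [rewrite !Hlow by lia; lia|]. now apply Hu. }
    assert (E46 : forall a, 4 <= a < 7 -> m1 a = m a).
    { intros a Ha. rewrite E. far_from a. auto. }
    destruct (IH m1 (src + sx) (dst + sy) sx sy) as (m' & G2 & V & F); try (rewrite E; reflexivity);
      try (rewrite E46 by lia; auto; fail); try lia.
    + intros i j Hij Hj. specialize (Hne (S i) (S j)). lia.
    + exists m'. split; [|split].
      * replace (S cnt * 8 + 1) with (1 + (6 + (1 + (cnt * 8 + 1)))) by lia.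
        eapply goes_trans; [apply (go_jz1 _ _ _ _ _ H1); lia|]. eapply goes_trans; [exact G1|].
        eapply goes_trans; [|exact G2]. apply (go_jz0 _ _ _ _ _ H3). now rewrite E.
      * intros [|i] Hi.
        -- rewrite !Nat.mul_0_r, !Nat.add_0_r. rewrite F; [|lia|intros; nia].
           rewrite E. rewrite Nat.eqb_refl.
           far_from dst. auto.
        -- replace (dst + sy * S i) with (dst + sy + sy * i) by lia. rewrite V by lia.
           rewrite E. replace (src + sx + sx * i) with (src + sx * S i) by lia.
           specialize (Hne 0 (S i)).
           far_from (src + sx * S i). auto.
      * intros a Ha Hn. rewrite F; auto.
        -- rewrite E. specialize (Hn 0).
           far_from a. auto.
        -- intros i Hi. specialize (Hn (S i)). lia.
Qed.

(* The input starts at cell 0, so the registers must be saved behind it, at a place that is known only after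
   scanning it with working cells.  Cells 1 and 2 are sacrificed: the number of meetings is recovered by the scan,
   and the length of the first meeting is remembered by branching to one of [d + 1] copies of the code. *)
Definition dispatch_code (d : nat) (tgt : nat -> nat) (j : nat) : list instr :=
  flat_map (fun i => [IConst 1 i; ISub 1 2 1; IJz 1 (tgt i)]) (seq j (S d - j)).

Lemma dispatch_ok P d tgt : forall r pc j m, j + r = m 2 -> m 2 <= d -> code_at P pc (dispatch_code d tgt j) ->
  exists n m', n <= 3 * (r + 1) /\ goes P n pc m (tgt (m 2)) m' /\ forall a, a <> 1 -> m' a = m a.
Proof.
  induction r as [|r IH]; intros pc j m Hj Hd HC; unfold dispatch_code in HC;
    replace (S d - j) with (S (d - j)) in HC by lia; cbn [seq flat_map app] in HC;
    apply code_at_cons in HC as (H1 & HC); apply code_at_cons in HC as (H2 & HC); apply code_at_cons in HC as (H3 & HC).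
  - exists 3, (upd (upd m 1 j) 1 0). split; [lia|]. split.
    + eapply (goes_trans P 1 2); [apply (go_const _ _ _ _ _ H1)|].
      pose proof (go_sub _ _ (upd m 1 j) _ _ _ H2) as G. rewrite upd_eq, (upd_neq _ _ _ 2) in G by lia.
      replace (m 2 - j) with 0 in G by lia.
      eapply (goes_trans P 1 1); [exact G|]. replace (m 2) with j by lia. apply (go_jz0 _ _ _ _ _ H3). apply upd_eq.
    + intros a Ha. now rewrite !upd_neq by lia.
  - destruct (IH (S (S (S pc))) (S j) (upd (upd m 1 j) 1 (m 2 - j))) as (n & m' & Hn & G' & F).
    + rewrite !upd_neq by lia. lia.
    + rewrite !upd_neq by lia. lia.
    + unfold dispatch_code. now replace (S d - S j) with (d - j) by lia.
    + exists (3 + n), m'. split; [lia|]. split.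
      * eapply (goes_trans P 3 n); [|rewrite !upd_neq in G' by lia; exact G'].
        eapply (goes_trans P 1 2); [apply (go_const _ _ _ _ _ H1)|].
        pose proof (go_sub _ _ (upd m 1 j) _ _ _ H2) as G. rewrite upd_eq, (upd_neq _ _ _ 2) in G by lia.
        eapply (goes_trans P 1 1); [exact G|]. apply (go_jz1 _ _ _ _ _ H3). rewrite upd_eq. lia.
      * intros a Ha. rewrite F by auto. now rewrite !upd_neq by lia.
Qed.

Definition scan_code (s : nat) : list instr :=
  [ILoad 2 1; IJz 2 (s + 7); IAdd 1 1 2; IConst 2 1; IAdd 1 1 2; IConst 2 0; IJz 2 s].

(** Memory behind the input is 0 and no meeting has length 0, so the first zero length marks the
    end. The prefix [pre] carries the induction; cells 1 and 2 are excluded as working cells. *)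
Lemma scan_code_ok P pc enc : code_at P pc (scan_code pc) -> forall M pre m,
  Forall (fun x : list nat => 2 <= length x) M -> 2 <= length pre -> m 1 = length pre ->
  (forall a, 3 <= a -> m a = nth a enc 0) -> m (length pre) = nth (length pre) enc 0 ->
  enc = pre ++ concat (map (fun x => length x :: x) M) ->
  exists n m', n <= 7 * length M + 2 /\ goes P n pc m (pc + 7) m' /\ m' 1 = length enc /\
    forall a, a <> 1 -> a <> 2 -> m' a = m a.
Proof.
  intros HC. assert (HC' := HC). unfold scan_code in HC'.
  apply code_at_cons in HC' as (H1 & HC'). apply code_at_cons in HC' as (H2 & HC').
  apply (code_at_app P (S (S pc)) [IAdd 1 1 2; IConst 2 1; IAdd 1 1 2; IConst 2 0] [IJz 2 pc]) in HC' as (H3 & H4).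
  apply code_at_cons in H4 as (H4 & _).
  induction M as [|x M IH]; intros pre m HM Hpre M1 Hm Hmp Henc.
  - exists 2, (upd m 2 0). simpl in Henc. rewrite app_nil_r in Henc. subst enc.
    rewrite nth_overflow in Hmp by lia. split; [lia|]. split; [|split].
    + pose proof (go_load _ _ m _ _ H1) as G. rewrite M1, Hmp in G.
      eapply (goes_trans P 1 1); [exact G|]. apply (go_jz0 _ _ _ _ _ H2). apply upd_eq.
    + now rewrite upd_neq by lia.
    + intros. now rewrite upd_neq by lia.
  - inversion_clear HM as [|? ? Hx HM'].
    assert (Hlen : m (length pre) = length x).
    { rewrite Hmp, Henc, app_nth2, Nat.sub_diag by lia. reflexivity. }
    set (m1 := upd m 2 (length x)).
    set (m2 := fold_left exec1 [IAdd 1 1 2; IConst 2 1; IAdd 1 1 2; IConst 2 0] m1).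
    assert (E1 : m2 1 = length (pre ++ length x :: x)).
    { unfold m2, m1. cbn [fold_left exec1]. unfold upd. simpl. rewrite length_app. simpl. lia. }
    assert (E2 : forall a, a <> 1 -> a <> 2 -> m2 a = m a).
    { intros a Ha Hb. unfold m2, m1. cbn [fold_left exec1]. now rewrite !upd_neq by auto. }
    destruct (IH (pre ++ length x :: x) m2) as (n & m' & Hn & G & V & F); auto.
    + rewrite length_app. simpl. lia.
    + intros a Ha. rewrite E2 by lia. now apply Hm.
    + rewrite length_app. simpl. rewrite E2 by lia. apply Hm. lia.
    + rewrite Henc. simpl. rewrite <- app_assoc. reflexivity.
    + exists (7 + n), m'. split; [simpl; lia|]. split; [|split]; auto.
      * eapply (goes_trans P 7 n); [|exact G].
        pose proof (go_load _ _ m _ _ H1) as G1. rewrite M1, Hlen in G1. fold m1 in G1.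
        eapply (goes_trans P 1 6); [exact G1|].
        eapply (goes_trans P 1 5); [apply (go_jz1 _ _ _ _ _ H2); unfold m1; rewrite upd_eq; lia|].
        eapply (goes_trans P 4 1); [apply (straight_ok P _ _ m1 H3 eq_refl)|].
        apply (go_jz0 _ _ _ _ _ H4). fold m2. unfold m2. cbn [fold_left exec1]. apply upd_eq.
      * intros a Ha Hb. rewrite F, E2; auto.
Qed.

Definition save_code (r t : nat) : list instr := flat_map (fun i => [IAdd 1 1 0; IStore 1 i]) (seq r t).

Lemma save_ok t : forall r m b, m 0 = 1 -> m 1 = b -> 3 <= r -> r + t <= b ->
  forall m', m' = fold_left exec1 (save_code r t) m ->
    m' 0 = 1 /\ m' 1 = b + t /\ (forall i, i < t -> m' (b + 1 + i) = m (r + i)) /\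
    forall a, a <> 1 -> (a <= b \/ b + t < a) -> m' a = m a.
Proof.
  induction t as [|t IH]; intros r m b M0 M1 Hr Hb m' ->.
  - simpl. rewrite Nat.add_0_r. repeat split; auto. intros; lia.
  - unfold save_code. cbn [seq flat_map app fold_left exec1].
    rewrite upd_eq, (upd_neq _ _ _ r) by lia. rewrite M0, M1.
    set (m1 := upd (upd m 1 (b + 1)) (b + 1) (m r)).
    assert (E0 : m1 0 = 1) by (unfold m1; rewrite !upd_neq by lia; auto).
    assert (E1 : m1 1 = b + 1) by (unfold m1; rewrite upd_neq, upd_eq by lia; auto).
    destruct (IH (S r) m1 (b + 1) E0 E1 ltac:(lia) ltac:(lia) _ eq_refl) as (A0 & A1 & A2 & A3).
    unfold save_code in *. split; [auto|]. split; [lia|]. split.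
    + intros [|i] Hi.
      * rewrite !Nat.add_0_r. rewrite A3 by lia. unfold m1. now rewrite upd_eq.
      * replace (b + 1 + S i) with (b + 1 + 1 + i) by lia. rewrite A2 by lia.
        unfold m1. rewrite !upd_neq by lia. f_equal. lia.
    + intros a Ha Hc. rewrite A3 by lia. unfold m1. now rewrite !upd_neq by lia.
Qed.

Lemma save_straight r t : forallb is_straight (save_code r t) = true.
Proof.
  unfold save_code. apply forallb_forall. intros i Hi. apply in_flat_map in Hi as (x & _ & [<-|[<-|[]]]); reflexivity.
Qed.

Lemma save_length r t : length (save_code r t) = 2 * t.
Proof. unfold save_code. revert r. induction t as [|t IH]; intros r; simpl; auto. rewrite IH. lia. Qed.

(** * Phases, between which the loop limits change *)

Definition phase := (cmd * par * exp)%type.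

Definition set_par (p : par -> nat) (q : par) (x : nat) : par -> nat := fun r => if par_beq r q then x else p r.

Definition phase_code (pc : nat) (ph : phase) : list instr :=
  let '(c, q, e) := ph in
  cmd_code pc temp0 c ++ exp_code temp0 e ++ [IConst (S temp0) 0; IAdd (par_cell q) temp0 (S temp0)].

Definition phase_len (ph : phase) : nat := let '(c, q, e) := ph in cmd_len c + (exp_len e + 2).
Definition phase_depth (ph : phase) : nat := let '(c, q, e) := ph in Nat.max (cmd_depth c) (S (exp_depth e)).

Fixpoint phases_code (pc : nat) (l : list phase) : list instr :=
  match l with [] => [] | ph :: l' => phase_code pc ph ++ phases_code (pc + phase_len ph) l' end.

Definition phases_len (l : list phase) : nat := list_sum (map phase_len l).

Fixpoint phases_eval (l : list phase) (p : par -> nat) (s : st) : (par -> nat) * st :=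
  match l with
  | [] => (p, s)
  | (c, q, e) :: l' => phases_eval l' (set_par p q (ex p (eval p c s) e)) (eval p c s)
  end.

Fixpoint phases_ticks (l : list phase) (p : par -> nat) (s : st) : nat :=
  match l with
  | [] => 0
  | (c, q, e) :: l' => 1 + tick_bound p c + phases_ticks l' (set_par p q (ex p (eval p c s) e)) (eval p c s)
  end.

Lemma phase_code_length pc ph : length (phase_code pc ph) = phase_len ph.
Proof. destruct ph as ((c & q) & e). simpl. rewrite !length_app, cmd_code_length, exp_code_length. reflexivity. Qed.

Lemma phases_code_length l : forall pc, length (phases_code pc l) = phases_len l.
Proof. induction l as [|ph l IH]; intros pc; simpl; auto. rewrite length_app, phase_code_length, IH. reflexivity. Qed.

Lemma rep_set_par p s AB m q x : temp0 <= AB -> rep p s AB m -> rep (set_par p q x) s AB (upd m (par_cell q) x).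
Proof.
  intros HAB (R1 & R2 & R3 & R4). repeat split.
  - intros r. unfold set_par. destruct (par_beq r q) eqn:E.
    + apply internal_par_dec_bl in E. subst. apply upd_eq.
    + rewrite upd_neq; auto. intros E2. apply par_cell_inj in E2. subst.
      rewrite internal_par_dec_lb in E; congruence.
  - rewrite upd_neq; auto. intros E. symmetry in E. now apply par_base_cell in E.
  - intros v. rewrite upd_neq; auto. apply var_par_cell.
  - intros f i. rewrite upd_neq; [apply R4|]. pose proof (par_cell_lt q). lia.
Qed.

Lemma phases_ok P AB l : forall pc p s m,
  code_at P pc (phases_code pc l) -> rep p s AB m ->
  (forall ph, In ph l -> temp0 + phase_depth ph <= AB) ->
  exists n m', n <= phases_len l * (1 + phases_ticks l p s) /\ goes P n pc m (pc + phases_len l) m' /\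
    rep (fst (phases_eval l p s)) (snd (phases_eval l p s)) AB m'.
Proof.
  induction l as [|ph l IH]; intros pc p s m HC HR Hd.
  - exists 0, m. change (phases_len []) with 0. replace (pc + 0) with pc by lia. split; [lia|]. split; [apply goes_refl|auto].
  - pose proof (Hd ph (or_introl eq_refl)) as Hd1.
    destruct ph as ((c & q) & e). cbn [phases_code phase_code phases_eval phases_ticks phase_depth] in *.
    apply code_at_app in HC as (HC & H4). apply code_at_app in HC as (H1 & HC). apply code_at_app in HC as (H2 & HC).
    rewrite !length_app, !cmd_code_length, !exp_code_length in *. cbn [length] in H4.
    apply code_at_cons in HC as (H3 & HC). apply code_at_cons in HC as (H5 & _).
    pose proof (exp_depth_pos e). assert (HAB : temp0 <= AB) by lia.
    destruct (cmd_code_ok P p AB c pc temp0 m s H1 HR) as (n1 & m1 & B1 & G1 & R1 & _); try lia.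
    destruct (exp_code_ok P p _ AB e _ temp0 m1 H2 R1) as (m2 & G2 & E2 & F2); try lia.
    set (s1 := eval p c s) in *. set (x := ex p s1 e) in *.
    assert (R2 : rep p s1 AB (upd m2 (S temp0) 0)).
    { apply (rep_frame p s1 AB m1); auto. intros a Ha. rewrite upd_neq by lia. apply F2. lia. }
    apply (rep_set_par _ _ _ _ q x HAB) in R2.
    destruct (IH _ _ _ _ H4 R2) as (n3 & m3 & B3 & G3 & R3); [intros; apply Hd; now right|].
    exists (n1 + (exp_len e + (2 + n3))), m3. split; [|split]; auto.
    + match goal with |- context [phases_len (?a :: l)] => change (phases_len (a :: l)) with (cmd_len c + (exp_len e + 2) + phases_len l) end.
      pose proof (ticks_le p c s).
      set (tk := phases_ticks l (set_par p q x) s1) in *.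
      assert (n1 <= cmd_len c * (1 + tick_bound p c)).
      { eapply Nat.le_trans; [exact B1|]. apply Nat.mul_le_mono_l. lia. }
      nia.
    + eapply goes_trans; [exact G1|]. eapply goes_trans; [exact G2|].
      match goal with |- context [phases_len (?a :: l)] => change (phases_len (a :: l)) with (cmd_len c + (exp_len e + 2) + phases_len l) end.
      cbn [phase_len] in G3. replace (pc + (cmd_len c + (exp_len e + 2) + phases_len l)) with (pc + (cmd_len c + (exp_len e + 2)) + phases_len l) by lia.
      eapply (goes_trans P 2 n3); [|exact G3].
      eapply (goes_trans P 1 1); [apply (go_const _ _ _ _ _ H3)|].
      pose proof (go_add _ _ (upd m2 (S temp0) 0) _ _ _ H5) as G.
      rewrite upd_eq, upd_neq, E2, Nat.add_0_r in G by lia.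
      replace (pc + (cmd_len c + (exp_len e + 2))) with (S (S (pc + cmd_len c + exp_len e))) by lia. exact G.
Qed.

(** * Start, end and time of the machine program *)

Definition block_code (R common pc j : nat) : list instr :=
  [IConst 1 2] ++ scan_code (S pc)
  ++ ([IConst 2 R; IAdd 1 1 2; IStore 1 0; IConst 0 1; IAdd 1 1 0; IAdd 1 1 0; IConst 2 j; IStore 1 2]
      ++ save_code 3 (R - 3) ++ [IConst 2 0])
  ++ [IJz 2 common].

Definition block_len (R : nat) : nat := 8 + (8 + 2 * (R - 3) + 1) + 1.

Lemma block_length R common pc j : length (block_code R common pc j) = block_len R.
Proof. unfold block_code, block_len, scan_code. rewrite !length_app, save_length. simpl. lia. Qed.

(** Entry 1, the number of meetings, is lost in the scan; the parser counts the meetings anew. *)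
Definition enc_inp (enc : list nat) (i : nat) : nat := if i =? 1 then 0 else nth i enc 0.

(** The first [R] entries are saved from cell [length enc + R] on: behind the input, and outside the
    registers even if the input is shorter than [R]. *)
Lemma block_ok P R common pc j k M m :
  code_at P pc (block_code R common pc j) -> 7 <= R ->
  Forall (fun x : list nat => 2 <= length x) M ->
  let enc := encode_instance k M in
  (forall a, a <> 1 -> m a = nth a enc 0) -> m 2 = j ->
  exists n m', n <= 7 * length M + block_len R + 10 /\ goes P n pc m common m' /\
    m' 0 = 1 /\ m' 1 + 1 = length enc + 2 * R /\
    (forall i, i < R -> m' (length enc + R + i) = enc_inp enc i) /\
    (forall a, R <= a -> (a < length enc \/ length enc + 2 * R <= a) -> m' a = nth a enc 0).
Proof.
  intros HC HR HM enc Hm Hj. unfold block_code in HC.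
  apply code_at_app in HC as (H1 & HC). apply code_at_app in HC as (H2 & HC).
  apply code_at_app in HC as (H3 & H4).
  cbn [length] in *. replace (pc + 1) with (S pc) in * by lia.
  apply code_at_cons in H1 as (H1 & _). apply code_at_cons in H4 as (H4 & _).
  assert (HL2 : 2 <= length enc) by (unfold enc, encode_instance; simpl; lia).
  destruct (scan_code_ok P (S pc) enc H2 M [k; length M] (upd m 1 2)) as (n1 & m1 & B1 & G1 & E1 & F1); auto.
  { intros a Ha. rewrite upd_neq by lia. apply Hm. lia. }
  { simpl. rewrite upd_neq by lia. apply Hm. lia. }
  set (pre := [IConst 2 R; IAdd 1 1 2; IStore 1 0; IConst 0 1; IAdd 1 1 0; IAdd 1 1 0; IConst 2 j; IStore 1 2]) in *.
  set (m2 := fold_left exec1 pre m1).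
  set (L := length enc) in *.
  assert (E2 : m2 0 = 1 /\ m2 1 = L + R + 2 /\ forall a, 3 <= a -> m2 a = if a =? L + R + 2 then j else if a =? L + R then nth 0 enc 0 else m1 a).
  { assert (M1 : m1 0 = nth 0 enc 0) by (rewrite F1, upd_neq, Hm by lia; auto).
    unfold m2, pre. cbn [fold_left exec1].
    set (u1 := upd (upd m1 2 R) 1 (upd m1 2 R 1 + upd m1 2 R 2)).
    assert (U1 : u1 1 = L + R /\ u1 0 = nth 0 enc 0 /\ forall a, 3 <= a -> u1 a = m1 a).
    { unfold u1. rewrite !upd_eq, (upd_neq _ 2 _ 1) by lia. split; [lia|]. split; [now rewrite !upd_neq by lia|].
      intros a Ha. now rewrite !upd_neq by lia. }
    clearbody u1. destruct U1 as (U1 & U2 & U3). rewrite U1, U2.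
    set (u2 := upd u1 (L + R) (nth 0 enc 0)).
    assert (V : u2 1 = L + R /\ forall a, 3 <= a -> u2 a = if a =? L + R then nth 0 enc 0 else m1 a).
    { unfold u2. rewrite upd_neq by lia. split; auto. intros a Ha. unfold upd. destruct (Nat.eqb_spec a (L + R)); auto. }
    clearbody u2. destruct V as (V1 & V2).
    set (u3 := upd (upd (upd u2 0 1) 1 (upd u2 0 1 1 + upd u2 0 1 0)) 1
                   (upd (upd u2 0 1) 1 (upd u2 0 1 1 + upd u2 0 1 0) 1 + upd (upd u2 0 1) 1 (upd u2 0 1 1 + upd u2 0 1 0) 0)).
    assert (W : u3 0 = 1 /\ u3 1 = L + R + 2 /\ forall a, 3 <= a -> u3 a = u2 a).
    { split; [reflexivity|]. split; [unfold u3; repeat first [rewrite upd_eq | rewrite upd_neq by lia]; lia|]. intros a Ha. unfold u3. now rewrite !upd_neq by lia. }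
    clearbody u3. destruct W as (W1 & W2 & W3).
    rewrite (upd_neq _ 2 _ 1), W2, upd_eq by lia.
    split; [now rewrite !upd_neq by lia|]. split; [now rewrite !upd_neq by lia|].
    intros a Ha. unfold upd at 1. destruct (Nat.eqb_spec a (L + R + 2)); auto.
    rewrite upd_neq, W3, V2 by lia. auto. }
  destruct E2 as (E20 & E21 & E2).
  destruct (save_ok (R - 3) 3 m2 _ E20 E21 ltac:(lia) ltac:(lia) _ eq_refl) as (S0 & S1 & S2 & S3).
  set (m3 := fold_left exec1 (save_code 3 (R - 3)) m2) in *.
  assert (E3 : forall a, 3 <= a -> a < L + R -> m1 a = nth a enc 0) by (intros a Ha _; rewrite F1, upd_neq, Hm by lia; auto).
  assert (HE1 : forall a, 3 <= a -> m1 a = nth a enc 0) by (intros a Ha; rewrite F1, upd_neq, Hm by lia; auto).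
  exists (1 + (n1 + (length (pre ++ save_code 3 (R - 3) ++ [IConst 2 0]) + 1))), (upd m3 2 0).
  rewrite !length_app, save_length. cbn [length].
  split; [unfold block_len, pre in *; cbn [length]; lia|]. split; [|split; [|split; [|split]]].
  - eapply (goes_trans P 1); [apply (go_const _ _ _ _ _ H1)|]. eapply goes_trans; [exact G1|].
    replace (S pc + length (scan_code (S pc))) with (S pc + 7) in * by reflexivity.
    assert (HSt : forallb is_straight (pre ++ save_code 3 (R - 3) ++ [IConst 2 0]) = true).
    { rewrite !forallb_app, save_straight. reflexivity. }
    pose proof (straight_ok P _ _ m1 H3 HSt) as G3. rewrite !fold_left_app in G3. fold m2 in G3. fold m3 in G3.
    cbn [fold_left exec1] in G3. rewrite !length_app, save_length in *. cbn [length] in G3, H4.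
    eapply goes_trans; [exact G3|]. apply (go_jz0 _ _ _ _ _ H4). apply upd_eq.
  - rewrite upd_neq by lia. auto.
  - rewrite upd_neq by lia. lia.
  - intros i Hi. rewrite upd_neq by lia. unfold enc_inp.
    destruct (le_lt_dec 3 i) as [Hi3|Hi3].
    + replace (L + R + i) with (L + R + 2 + 1 + (i - 3)) by lia. rewrite S2 by lia.
      replace (3 + (i - 3)) with i by lia. rewrite E2 by lia. far_from i. rewrite HE1 by lia. auto.
    + rewrite S3 by lia. rewrite E2 by lia.
      destruct i as [|[|[|i]]]; [| | |lia].
      * replace (L + R + 0) with (L + R) by lia. far_from (L + R). now rewrite Nat.eqb_refl.
      (* The pointer skips this cell when saving; it lies behind the input and holds the 0 that
         [enc_inp] prescribes. *)
      * far_from (L + R + 1). rewrite HE1 by lia. rewrite nth_overflow by (fold L; lia). auto.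
      * rewrite Nat.eqb_refl. rewrite <- Hj. apply Hm. lia.
  - intros a Ha Ha2. rewrite upd_neq by lia. rewrite S3 by lia. rewrite E2 by lia. far_from a. apply HE1. lia.
Qed.

Lemma code_at_flat_map P (f : nat -> list instr) len : (forall j, length (f j) = len) ->
  forall n a pc, code_at P pc (flat_map f (seq a n)) -> forall j, j < n -> code_at P (pc + j * len) (f (a + j)).
Proof.
  intros Hf. induction n as [|n IH]; intros a pc HC j Hj; [lia|].
  cbn [seq flat_map] in HC. apply code_at_app in HC as (H1 & H2). rewrite Hf in H2.
  destruct j as [|j].
  - simpl. rewrite !Nat.add_0_r. exact H1.
  - specialize (IH _ _ H2 j ltac:(lia)). replace (pc + S j * len) with (pc + len + j * len) by lia.
    replace (a + S j) with (S a + j) by lia. exact IH.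
Qed.

Lemma clear_ok n : forall a m x, fold_left exec1 (map (fun r => IConst r 0) (seq a n)) m x =
  if andb (a <=? x) (x <? a + n) then 0 else m x.
Proof.
  induction n as [|n IH]; intros a m x; simpl.
  - destruct (Nat.leb_spec a x), (Nat.ltb_spec x (a + 0)); simpl; auto; lia.
  - rewrite IH. unfold upd.
    destruct (Nat.leb_spec (S a) x), (Nat.ltb_spec x (S a + n)), (Nat.leb_spec a x), (Nat.ltb_spec x (a + S n)), (Nat.eqb_spec x a); simpl; auto; lia.
Qed.

(** Two copies are made into the field [aI]: the first [R] entries come from the saved area, the
    others, if any, from their original cells. *)
Definition setup1 (R : nat) : list instr :=
  [IConst 0 1; IAdd 8 1 0; IConst 3 (2 * R); ISub 7 8 3; IConst 3 R; IAdd 0 7 3; IConst 1 0; IAdd 1 1 8;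
   IConst 2 R; IConst 4 1; IConst 5 n_fields; IConst 6 1].
Definition setup2 (R : nat) : list instr :=
  [IConst 0 R; IConst 3 (n_fields * R); IAdd 1 8 3; IConst 3 R; ISub 2 7 3; IConst 4 1; IConst 5 n_fields; IConst 6 1].
Definition clear_code : list instr := map (fun r => IConst r 0) (seq 9 (temp0 - 9)).
Definition common_code (R pc : nat) : list instr :=
  setup1 R ++ copy_code (pc + 12) ++ setup2 R ++ copy_code (pc + 28) ++ clear_code.

Definition init_par (L : nat) (q : par) : nat := match q with pL => L | _ => 0 end.
Definition init_st (enc : list nat) : st :=
  mkSt (fun _ => 0) (fun f i => match f with aI => enc_inp enc i | _ => 0 end).

Lemma common_ok P R pc enc m : code_at P pc (common_code R pc) -> temp0 <= R -> 2 <= length enc ->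
  m 0 = 1 -> m 1 + 1 = length enc + 2 * R ->
  (forall i, i < R -> m (length enc + R + i) = enc_inp enc i) ->
  (forall a, R <= a -> (a < length enc \/ length enc + 2 * R <= a) -> m a = nth a enc 0) ->
  exists n m', n <= 8 * (R + length enc) + 70 /\ goes P n pc m (pc + 72) m' /\
    rep (init_par (length enc)) (init_st enc) (length enc + 2 * R) m'.
Proof.
  intros HC HR HL2 M0 M1 Hsv Hm. set (L := length enc) in *. set (AB := L + 2 * R) in *.
  assert (HR7 : 45 <= R) by exact HR.
  unfold common_code in HC.
  apply code_at_app in HC as (H1 & HC). apply code_at_app in HC as (H2 & HC).
  apply code_at_app in HC as (H3 & HC). apply code_at_app in HC as (H4 & H5).
  cbn [length setup1 setup2 copy_code] in H2, H3, H4, H5.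
  replace (pc + 12 + 8) with (pc + 20) in * by lia. replace (pc + 20 + 8) with (pc + 28) in * by lia.
  replace (pc + 28 + 8) with (pc + 36) in * by lia.
  pose proof (straight_ok P _ _ m H1 eq_refl) as G1. change (length (setup1 R)) with 12 in G1.
  set (m1 := fold_left exec1 (setup1 R) m) in *.
  assert (E1 : m1 0 = L + R /\ m1 1 = AB /\ m1 2 = R /\ m1 4 = 1 /\ m1 5 = n_fields /\ m1 6 = 1 /\ m1 7 = L /\ m1 8 = AB
     /\ forall a, 9 <= a -> m1 a = m a).
  { unfold m1, setup1. cbn [fold_left exec1].
    repeat split; try (repeat first [rewrite upd_eq | rewrite upd_neq by lia]; lia).
    intros a Ha. repeat rewrite upd_neq by lia. auto. }
  clearbody m1. destruct E1 as (A0 & A1 & A2 & A4 & A5 & A6 & A7 & A8 & A9).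
  Local Transparent n_fields.
  destruct (copy_ok P _ H2 R m1 (L + R) AB 1 n_fields) as (m2 & G2 & V2 & F2); auto; try (unfold AB, n_fields; lia).
  pose proof (straight_ok P _ _ m2 H3 eq_refl) as G3. change (length (setup2 R)) with 8 in G3.
  set (m3 := fold_left exec1 (setup2 R) m2) in *.
  assert (B7 : m2 7 = L) by (rewrite F2; [auto|lia|unfold AB; intros; lia]).
  assert (B8 : m2 8 = AB) by (rewrite F2; [auto|lia|unfold AB; intros; lia]).
  assert (E3 : m3 0 = R /\ m3 1 = AB + n_fields * R /\ m3 2 = L - R /\ m3 4 = 1 /\ m3 5 = n_fields /\ m3 6 = 1
     /\ forall a, 7 <= a -> m3 a = m2 a).
  { unfold m3, setup2. cbn [fold_left exec1].
    repeat split; try (repeat first [rewrite upd_eq | rewrite upd_neq by lia]; lia).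
    intros a Ha. repeat rewrite upd_neq by lia. auto. }
  clearbody m3. destruct E3 as (C0 & C1 & C2 & C4 & C5 & C6 & C9).
  destruct (copy_ok P _ H4 (L - R) m3 R (AB + n_fields * R) 1 n_fields) as (m4 & G4 & V4 & F4); auto; try (unfold AB, n_fields; lia).
  assert (HSt : forallb is_straight clear_code = true) by reflexivity.
  pose proof (straight_ok P _ _ m4 H5 HSt) as G5. change (length clear_code) with 36 in G5.
  set (m5 := fold_left exec1 clear_code m4) in *.
  assert (E5 : forall a, m5 a = if andb (9 <=? a) (a <? temp0) then 0 else m4 a) by (intros a; apply clear_ok).
  assert (Hhi : forall a, AB <= a -> m5 a = m4 a).
  { intros a Ha. rewrite E5. destruct (Nat.ltb_spec a temp0); [unfold AB in Ha; lia|]. now rewrite Bool.andb_false_r. }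
  assert (H78 : forall a, 7 <= a < 9 -> m5 a = m1 a).
  { intros a Ha. rewrite E5. destruct (Nat.leb_spec 9 a); [lia|]. simpl.
    rewrite F4, C9, F2; auto; try lia; unfold AB; intros; lia. }
  assert (H9 : forall a, 9 <= a < temp0 -> m5 a = 0).
  { intros a Ha. rewrite E5. destruct (Nat.leb_spec 9 a), (Nat.ltb_spec a temp0); simpl; auto; lia. }
  exists (12 + ((R * 8 + 1) + (8 + (((L - R) * 8 + 1) + 36)))), m5. split; [lia|]. split.
  - eapply goes_trans; [exact G1|]. replace (pc + 20) with (pc + 12 + 8) in * by lia.
    eapply goes_trans; [exact G2|]. eapply goes_trans; [exact G3|].
    replace (pc + 12 + 8 + 8) with (pc + 28) in * by lia. eapply goes_trans; [exact G4|].
    replace (pc + 72) with (pc + 36 + 36) by lia. replace (pc + 28 + 8) with (pc + 36) by lia. exact G5.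
  - split; [|split; [|split]].
    + intros q. destruct q; simpl; try (apply H9; unfold temp0; lia). rewrite H78; auto; lia.
    + unfold base_cell. rewrite H78; auto; lia.
    + intros v. simpl. apply H9. pose proof (var_cell_lt v). unfold var_cell in *. lia.
    + intros f i. rewrite Hhi by lia. cbn [init_st ar].
      destruct f; cbn [fld_off]; try (
        rewrite F4; [|lia|unfold n_fields; intros; lia]; rewrite C9 by lia;
        rewrite F2; [|lia|unfold n_fields; intros; lia]; rewrite A9 by lia; rewrite Hm by (fold AB; lia);
        apply nth_overflow; fold L; unfold AB; lia).
      rewrite Nat.add_0_r. destruct (le_lt_dec R i) as [Hi|Hi].
      * unfold enc_inp. far_from i. destruct (le_lt_dec L i) as [Hi2|Hi2].
        -- rewrite nth_overflow by auto.
           rewrite F4; [|lia|unfold n_fields; intros; lia]. rewrite C9 by lia.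
           rewrite F2; [|lia|unfold n_fields; intros; lia]. rewrite A9 by lia. rewrite Hm by (fold AB; lia).
           apply nth_overflow; fold L; unfold AB; lia.
        -- replace (AB + n_fields * i) with (AB + n_fields * R + n_fields * (i - R)) by (unfold n_fields; lia).
           rewrite V4 by lia. replace (R + 1 * (i - R)) with i by lia. rewrite C9 by lia.
           rewrite F2; [|lia|unfold AB; intros; lia]. rewrite A9 by lia. apply Hm; lia.
      * rewrite F4; [|lia|unfold n_fields; intros; lia]. rewrite C9 by lia.
        rewrite V2 by auto. rewrite A9 by lia. replace (L + R + 1 * i) with (L + R + i) by lia. apply Hsv; auto.
Qed.
Local Opaque n_fields.

(** The field [aO] is compacted from stride [n_fields] to stride 1, both starting at [AB + 1]; then
    cell [AB] receives the length and cell 0 the address [AB], as [read_output] expects. *)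
Definition finish1 : list instr :=
  [IConst 0 1; IAdd 0 0 8; IConst 1 1; IAdd 1 1 8; IConst 2 0; IAdd 2 2 (var_cell vO);
   IConst 4 n_fields; IConst 5 1; IConst 6 1].
Definition finish2 : list instr :=
  [IConst 1 0; IAdd 1 1 8; IConst 2 0; IAdd 2 2 (var_cell vO); IStore 1 2; IConst 0 0; IAdd 0 0 8].
Definition finish_code (pc : nat) : list instr := finish1 ++ copy_code (pc + 9) ++ finish2 ++ [IHalt].

Lemma finish_ok P p s AB pc m : code_at P pc (finish_code pc) -> rep p s AB m -> temp0 <= AB ->
  exists mem, (forall f, run P (8 * vr s vO + 18 + f) pc m = Some mem) /\
    read_output mem = map (ar s aO) (seq 0 (vr s vO)).
Proof.
  intros HC HR HAB. assert (HAB7 : 45 <= AB) by exact HAB.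
  unfold finish_code in HC.
  apply code_at_app in HC as (H1 & HC). apply code_at_app in HC as (H2 & HC). apply code_at_app in HC as (H3 & H4).
  cbn [length finish1 finish2 copy_code] in H2, H3, H4.
  replace (pc + 9 + 8) with (pc + 17) in * by lia. replace (pc + 17 + 7) with (pc + 24) in * by lia.
  apply code_at_cons in H4 as (H4 & _).
  destruct HR as (R1 & R2 & R3 & R4). unfold base_cell in R2.
  assert (HvO : var_cell vO = 35) by reflexivity.
  pose proof (R3 vO) as R3'. rewrite HvO in R3'.
  pose proof (straight_ok P _ _ m H1 eq_refl) as G1. change (length finish1) with 9 in G1.
  set (m1 := fold_left exec1 finish1 m) in *.
  set (o := vr s vO) in *.
  assert (E1 : m1 0 = AB + 1 /\ m1 1 = AB + 1 /\ m1 2 = o /\ m1 4 = n_fields /\ m1 5 = 1 /\ m1 6 = 1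
     /\ forall a, 7 <= a -> m1 a = m a).
  { unfold m1, finish1. rewrite HvO. cbn [fold_left exec1].
    repeat split; try (repeat first [rewrite upd_eq | rewrite upd_neq by lia]; lia).
    intros a Ha. repeat rewrite upd_neq by lia. auto. }
  clearbody m1. destruct E1 as (A0 & A1 & A2 & A4 & A5 & A6 & A9).
  destruct (copy_ok P _ H2 o m1 (AB + 1) (AB + 1) n_fields 1) as (m2 & G2 & V2 & F2); auto; try lia.
  { Local Transparent n_fields. unfold n_fields. lia. }
  pose proof (straight_ok P _ _ m2 H3 eq_refl) as G3. change (length finish2) with 7 in G3.
  set (m3 := fold_left exec1 finish2 m2) in *.
  assert (B8 : m2 8 = AB) by (rewrite F2 by lia; rewrite A9 by lia; auto).
  assert (BO : m2 35 = o) by (rewrite F2 by lia; rewrite A9 by lia; auto).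
  assert (E3 : m3 0 = AB /\ m3 AB = o /\ forall a, AB < a -> m3 a = m2 a).
  { unfold m3, finish2. rewrite HvO. cbn [fold_left exec1].
    set (u := upd (upd (upd (upd m2 1 0) 1 _) 2 0) 2 _).
    assert (U : u 1 = AB /\ u 2 = o /\ u 8 = AB /\ forall a, 7 <= a -> u a = m2 a).
    { unfold u. repeat split; try (repeat first [rewrite upd_eq | rewrite upd_neq by lia]; lia).
      intros a Ha. repeat rewrite upd_neq by lia. auto. }
    clearbody u. destruct U as (U1 & U2 & U8 & U). rewrite U1, U2.
    split; [repeat first [rewrite upd_eq | rewrite upd_neq by lia]; lia|].
    split; [repeat first [rewrite upd_eq | rewrite upd_neq by lia]; lia|].
    intros a Ha. repeat rewrite upd_neq by lia. apply U. lia. }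
  exists m3. split.
  - intros f. assert (G : goes P (9 + ((o * 8 + 1) + 7)) pc m (pc + 24) m3).
    { eapply goes_trans; [exact G1|]. replace (pc + 17) with (pc + 9 + 8) in * by lia.
      eapply goes_trans; [exact G2|]. replace (pc + 24) with (pc + 9 + 8 + 7) by lia. exact G3. }
    replace (8 * o + 18 + f) with (9 + ((o * 8 + 1) + 7) + S f) by lia. rewrite G. simpl. now rewrite H4.
  - destruct E3 as (E30 & E31 & E3). unfold read_output. rewrite E30, E31.
    apply map_ext_in. intros i Hi. apply in_seq in Hi. rewrite E3 by lia.
    replace (AB + 1 + i) with (AB + 1 + 1 * i) by lia. rewrite V2 by lia. rewrite A9 by lia.
    rewrite <- R4. f_equal. unfold fld_off. lia.
Qed.

Definition reg_count (phs : list phase) : nat := temp0 + list_sum (map phase_depth phs).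

Definition ram_program (d : nat) (phs : list phase) : program :=
  let R := reg_count phs in
  let blk := fun j => 3 * S d + j * block_len R in
  let com := blk (S d) in
  dispatch_code d blk 0 ++ flat_map (fun j => block_code R com (blk j) j) (seq 0 (S d))
  ++ common_code R com ++ phases_code (com + 72) phs ++ finish_code (com + 72 + phases_len phs).

Theorem ram_main d phs : exists C, forall k M,
  storyline_instance k M -> meetings_at_most d M ->
  let enc := encode_instance k M in
  let p0 := init_par (length enc) in
  let s0 := init_st enc in
  let s := snd (phases_eval phs p0 s0) in
  exists mem, (forall f, C * (1 + length enc + phases_ticks phs p0 s0 + vr s vO) <= f ->
                run (ram_program d phs) f 0 (init_mem enc) = Some mem) /\
    read_output mem = map (ar s aO) (seq 0 (vr s vO)).
Proof.
  set (R := reg_count phs).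
  exists (3 * S d + block_len R + 8 * R + phases_len phs + 200).
  intros k M HM Hd enc p0 s0 s.
  set (blk := fun j => 3 * S d + j * block_len R).
  set (com := blk (S d)).
  set (P := ram_program d phs).
  assert (HC : code_at P 0 (dispatch_code d blk 0 ++ flat_map (fun j => block_code R com (blk j) j) (seq 0 (S d))
    ++ common_code R com ++ phases_code (com + 72) phs ++ finish_code (com + 72 + phases_len phs)))
    by (intros i _; reflexivity).
  apply code_at_app in HC as (H1 & HC).
  assert (HDL : length (dispatch_code d blk 0) = 3 * S d).
  { unfold dispatch_code. rewrite (flat_map_length_const _ 3), length_seq by reflexivity. lia. }
  rewrite HDL in HC. apply code_at_app in HC as (H2 & HC).
  assert (HBL : length (flat_map (fun j => block_code R com (blk j) j) (seq 0 (S d))) = S d * block_len R).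
  { rewrite (flat_map_length_const _ (block_len R)), length_seq; [lia|]. intros; apply block_length. }
  rewrite HBL in HC. replace (0 + 3 * S d + S d * block_len R) with com in HC by (unfold com, blk; lia).
  apply code_at_app in HC as (H3 & HC). change (length (common_code R com)) with 72 in HC.
  apply code_at_app in HC as (H4 & H5). rewrite phases_code_length in H5.
  assert (HF : Forall (fun x : list nat => 2 <= length x) M).
  { eapply Forall_impl; [|exact HM]. intros a (_ & H & _); auto. }
  assert (Hn : length M <= length enc).
  { unfold enc, encode_instance. cbn [length]. rewrite length_concat, map_map. cbn [length].
    clear. induction M as [|x M IH]; simpl; lia. }
  assert (HL2 : 2 <= length enc) by (unfold enc, encode_instance; simpl; lia).
  assert (Hlen1 : nth 2 enc 0 <= d).
  { unfold enc, encode_instance. destruct M as [|x M']; simpl; [lia|]. now inversion_clear Hd. }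
  destruct (dispatch_ok P d blk (nth 2 enc 0) 0 0 (init_mem enc)) as (n1 & m1 & B1 & G1 & F1); auto.
  change (init_mem enc 2) with (nth 2 enc 0) in G1. set (j := nth 2 enc 0) in *.
  assert (HR : temp0 <= R) by (unfold R, reg_count; lia). assert (HR7 : 7 <= R) by (unfold temp0 in HR; lia).
  pose proof (code_at_flat_map P _ _ (fun j => block_length R com (blk j) j) _ _ _ H2 j ltac:(lia)) as H2j.
  cbn beta in H2j. replace (0 + 3 * S d + j * block_len R) with (blk j) in H2j by (unfold blk; lia).
  destruct (block_ok P R com (blk j) j k M m1 H2j HR7 HF) as (n2 & m2 & B2 & G2 & E0 & E1 & E2 & E3).
  { intros a Ha. now rewrite F1. }
  { now rewrite F1 by lia. }
  fold enc in E1, E2, E3.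
  destruct (common_ok P R com enc m2 H3 HR HL2 E0 E1 E2 E3) as (n3 & m3 & B3 & G3 & R3).
  destruct (phases_ok P _ phs _ _ _ _ H4 R3) as (n4 & m4 & B4 & G4 & R4).
  { intros ph Hph. assert (phase_depth ph <= list_sum (map phase_depth phs)).
    { clear - Hph. induction phs as [|a l IH]; simpl in *; [tauto|]. destruct Hph as [->|H]; [lia|]. specialize (IH H). lia. }
    unfold R, reg_count. lia. }
  destruct (finish_ok P _ _ _ _ _ H5 R4) as (mem & G5 & HO); [lia|].
  exists mem. fold p0 s0 s in HO, G5, B4. split; auto.
  intros f Hf.
  assert (G : goes P (n1 + (n2 + (n3 + n4))) 0 (init_mem enc) (com + 72 + phases_len phs) m4).
  { eapply goes_trans; [exact G1|]. eapply goes_trans; [exact G2|]. eapply goes_trans; [exact G3|]. exact G4. }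
  set (T := phases_ticks phs p0 s0) in *.
  assert (Hfuel : n1 + (n2 + (n3 + n4)) + (8 * vr s vO + 18) <= f).
  { eapply Nat.le_trans; [|exact Hf]. set (X := 1 + length enc + T + vr s vO).
    assert (HX : 1 <= X) by (unfold X; lia).
    assert (block_len R * 1 <= block_len R * X) by (now apply Nat.mul_le_mono_l).
    assert (8 * R * 1 <= 8 * R * X) by (now apply Nat.mul_le_mono_l).
    assert (3 * S d * 1 <= 3 * S d * X) by (now apply Nat.mul_le_mono_l).
    assert (phases_len phs * (1 + T) <= phases_len phs * X) by (apply Nat.mul_le_mono_l; unfold X; lia).
    rewrite !Nat.mul_add_distr_r. unfold X in *. lia. }
  replace f with (n1 + (n2 + (n3 + n4)) + (8 * vr s vO + 18 + (f - (n1 + (n2 + (n3 + n4)) + (8 * vr s vO + 18))))) by lia.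
  rewrite G. apply G5.
Qed.

Local Transparent n_fields.

(** * The program *)

(** A syntactic frame condition: that a command leaves a variable alone is then settled by
    computation, however deep the command is. *)
Fixpoint mod_var (c : cmd) (v : var) : bool :=
  match c with
  | CSkip | CPut _ _ _ => false
  | CSet w _ => var_beq v w
  | CSeq a b | CIf _ a b => orb (mod_var a v) (mod_var b v)
  | CFor w _ a => orb (var_beq v w) (mod_var a v)
  end.

Fixpoint mod_fld (c : cmd) (f : fld) : bool :=
  match c with
  | CSkip | CSet _ _ => false
  | CPut g _ _ => fld_beq f g
  | CSeq a b | CIf _ a b => orb (mod_fld a f) (mod_fld b f)
  | CFor _ _ a => mod_fld a f
  end.

Lemma loop_inv {S : Type} (I : nat -> S -> Prop) (f : nat -> S -> S) n s :
  I 0 s -> (forall j s', j < n -> I j s' -> I (1 + j) (f j s')) -> I n (loop f n s).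
Proof. intros H0 HS. induction n as [|n IH]; simpl; auto. apply (HS n); [lia|]. apply IH. auto. Qed.

Lemma for_inv p v l body s (I : nat -> st -> Prop) :
  I 0 s -> (forall j t, j < lm p l -> I j t -> I (S j) (eval p body (set_var t v j))) ->
  I (lm p l) (eval p (CFor v l body) s).
Proof. intros H0 HS. apply (loop_inv I); auto. Qed.

Lemma frame_var p c v : mod_var c v = false -> forall s, vr (eval p c s) v = vr s v.
Proof.
  induction c; cbn [mod_var eval]; intros H s; auto.
  - cbn [set_var vr]. now rewrite H.
  - apply Bool.orb_false_elim in H as (H1 & H2). rewrite IHc2, IHc1; auto.
  - apply Bool.orb_false_elim in H as (H1 & H2). destruct (_ =? 0); auto.
  - apply Bool.orb_false_elim in H as (H1 & H2).
    apply (loop_inv (fun _ s' => vr s' v = vr s v)); auto.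
    intros j s' _ E. rewrite IHc by auto. cbn [set_var vr]. now rewrite H1.
Qed.

Lemma frame_fld p c f : mod_fld c f = false -> forall s i, ar (eval p c s) f i = ar s f i.
Proof.
  induction c; cbn [mod_fld eval]; intros H s j; auto.
  - cbn [set_arr ar]. now rewrite H.
  - apply Bool.orb_false_elim in H as (H1 & H2). rewrite IHc2, IHc1; auto.
  - apply Bool.orb_false_elim in H as (H1 & H2). destruct (_ =? 0); auto.
  - apply (loop_inv (fun _ s' => ar s' f j = ar s f j)); auto.
    intros i s' _ E. rewrite IHc by auto. auto.
Qed.

Coercion EV : var >-> exp.
Coercion EN : nat >-> exp.
Notation "a ;; b" := (CSeq a b) (at level 60, right associativity).
Notation "'when' e 'do' a" := (CIf e a CSkip) (at level 50, e at level 9, a at level 9).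
Notation "a :+ b" := (EAdd a b) (at level 40, left associativity).
Notation "a :- b" := (ESub a b) (at level 40, left associativity).

Section Program.
Context (d : nat).

Definition char_at (j : exp) : exp := EA aM (EMul d j :+ vC).

Definition parse_inner : cmd :=
  CFor vC (LN d) (when (EA aI vPtr :- vC) do (CPut aM (EMul d vN :+ vC) (EA aI (vPtr :+ (EN 1 :+ vC))))).

Definition parse_body : cmd :=
  when (EA aI vPtr) do (
    parse_inner;;
    CSet vPtr (vPtr :+ (EN 1 :+ EA aI vPtr));;
    CSet vN (vN :+ EN 1)).

Definition parse_cmd : cmd := CSet vPtr 2;; CFor vI (LP pL) parse_body.

(* With more than [2 * d * k] meetings no step is made, and the identity serves as the order. *)
Definition init_cmd : cmd :=
  CPut aS 0 1;; CSet vB 1;; CSet vQ 1;; CSet vP 1;;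
  CIf (EP pN :- EMul (2 * d) (EP pK)) (CSet vS 0) (CSet vS (EMul 2 (EP pK) :+ 1 :+ EMul (S d) (EP pN))).

(** Places above [vB] belong to the current piece and place 0 means unplaced: [vCnt] reports a
    member of the first kind, [vBad] one of the second. *)
Definition touch_cmd : cmd :=
  CFor vC (LN d) (
    CSet vX (EA aS (char_at vJ));;
    CIf vX (when (vX :- vB) do (CSet vCnt 1)) (CSet vBad 1)).

Definition find_body : cmd :=
  when (EN 1 :- EA aK vJ) do (
    CSet vCnt 0;; CSet vBad 0;;
    touch_cmd;;
    when vCnt do (when vBad do (CSet vF 1;; CSet vE vJ))).

Definition find_cmd : cmd := CSet vF 0;; CFor vJ (LP pN) find_body.

Definition place_cmd : cmd :=
  CPut aP vQ vP;; CPut aS vP (vQ :+ 1);; CSet vQ (vQ :+ 1).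

Definition unmark_cmd : cmd := CFor vJ (LP pN) (CPut aK vJ 0).

(** Only the candidate [vP] is examined, and the new piece stays empty if it is already placed.
    Searching for the next unplaced character would make a step depend on [k]. *)
Definition next_piece_cmd : cmd :=
  CSet vB vQ;;
  unmark_cmd;;
  when (EP pK1 :- vP) do (
    CIf (EA aS vP) CSkip place_cmd;;
    CSet vP (vP :+ 1)).

Definition anchor_cmd : cmd :=
  CFor vC (LN d) (when (EA aS (char_at vE) :- vB) do (CSet vI0 (EA aS (char_at vE) :- 1))).

Definition slice_cmd : cmd :=
  CFor vJ (LN (8 * d + 1)) (when (vQ :- (vA :+ vJ)) do (CPut aW vW (EA aP (vA :+ vJ));; CSet vW (vW :+ 1))).

Definition fresh_cmd : cmd :=
  CFor vC (LN d) (CIf (EA aS (char_at vE)) CSkip (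
    CPut aW vW (char_at vE);; CSet vW (vW :+ 1);; CSet vM (vM :+ 1))).

Definition window_cmd : cmd :=
  anchor_cmd;;
  CSet vA (vB :+ (vI0 :- vB :- EN (4 * d)));;
  CSet vW 0;;
  slice_cmd;;
  CSet vM 0;;
  fresh_cmd.

(** From [vA] on everything moves by [vM] to make room for the new characters; what lands in the
    window is overwritten by [write_cmd]. *)
Definition shift_cmd : cmd :=
  CFor vJ (LP pD) (when (vQ :- (vB :+ vJ)) do (
    CIf (vA :- (vB :+ vJ)) (CPut aC (vB :+ vJ) (EA aP (vB :+ vJ)))
                           (CPut aC (vB :+ vJ :+ vM) (EA aP (vB :+ vJ))))).

Fixpoint write_cmd (t : nat) (l : list nat) : cmd :=
  match l with
  | [] => CSkip
  | i :: l' => CPut aC (vA :+ EN t) (EA aW (EN i));; write_cmd (S t) l'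
  end.

Definition setpos_cmd (f : fld) (len : exp) : cmd :=
  CFor vJ (LP pD) (when (len :- (vB :+ vJ)) do (CPut aS (EA f (vB :+ vJ)) (vB :+ vJ :+ 1))).

(* By truncation, [a - (a - b)] is the minimum and [a + (b - a)] the maximum of [a] and [b]. *)
Definition range_cmd : cmd :=
  CFor vC (LN d) (
    CSet vX (EA aS (char_at vJ));;
    when (vX :- vB) do (
      CSet vMn (vMn :- (vMn :- vX));; CSet vMx (vMx :+ (vX :- vMx));; CSet vCnt (vCnt :+ 1))).

(** A trace is contiguous when its extreme places differ by at most its size minus one. [vMn] starts
    above all places, so that an empty trace contributes 0 by truncation. *)
Definition test_body : cmd :=
  CSet vMn (vQ :+ vM :+ 1);; CSet vMx 0;; CSet vCnt 0;;
  range_cmd;;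
  CSet vBad (vBad :+ (vMx :- vMn :- (vCnt :- 1))).

Definition test_cmd : cmd := CSet vBad 0;; CFor vJ (LP pN) test_body.

Definition copy_cmd : cmd :=
  CFor vJ (LP pD) (when (vQ :- (vB :+ vJ)) do (CPut aP (vB :+ vJ) (EA aC (vB :+ vJ)))).

Definition commit_cmd : cmd := CSet vQ (vQ :+ vM);; copy_cmd;; CSet vG 1.

Definition cand_cmd (l : list nat) : cmd :=
  shift_cmd;; write_cmd 0 l;; setpos_cmd aC (vQ :+ vM);; test_cmd;; CIf vBad CSkip commit_cmd.

Definition guard_cmd (l : list nat) : cmd :=
  CIf vG CSkip (CIf (EN (length l) :- vW) CSkip (CIf (vW :- EN (length l)) CSkip (cand_cmd l))).

Definition all_cands (L : list (list nat)) : cmd := fold_right (fun l c => guard_cmd l;; c) CSkip L.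

Definition unplace_cmd : cmd :=
  CFor vJ (LN d) (when (vM :- vJ) do (CPut aS (EA aW (vW :- vM :+ vJ)) 0)).

(** A failed candidate has spoilt only the places in [aS]; the order in [aP] changes at a commit
    alone and serves to restore them. *)
Definition undo_cmd : cmd :=
  unplace_cmd;;
  setpos_cmd aP vQ;;
  CPut aK vE 1.

Fixpoint lists (n w : nat) : list (list nat) :=
  match n with 0 => [[]] | S n' => flat_map (fun x => map (cons x) (lists n' w)) (seq 0 w) end.

(* A window holds at most [8 * d + 1] characters of the piece and [d] new ones. *)
Definition max_window := 9 * d + 1.

(** The permutations are unrolled into the program text. The length of the window is known only at
    run time, so all lengths up to the maximum occur and [guard_cmd] selects. *)
Definition tables : list (list nat) :=
  sel (fun l => Permutation l (seq 0 (length l))) (flat_map (fun n => lists n max_window) (seq 0 (S max_window))).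

Definition extend_cmd : cmd :=
  window_cmd;; CSet vG 0;; all_cands tables;; CIf vG CSkip undo_cmd.

Definition step_cmd : cmd := find_cmd;; CIf vF extend_cmd next_piece_cmd.

Definition order_cmd : cmd := CFor vI (LP pS) step_cmd.

Definition fill_cmd : cmd := CFor vJ (LP pK1) (CPut aP vJ vJ).

Definition ident_cmd : cmd := when (EP pN :- EMul (2 * d) (EP pK)) do fill_cmd.

Definition put_out (e : exp) : cmd := CPut aO vO e;; CSet vO (vO :+ 1).

(** Executed when a run of members ends. The first run becomes the block that starts at [vAn], where
    0 stands for none; a later run is exchanged with the gap between it and the block. *)
Definition flush_cmd : cmd :=
  when vLen do (
    CIf vAn
      (put_out (vAn :+ vCnt);; put_out (vRs :- 1);; put_out (vRs :+ vLen :- 1);;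
       CSet vCC (vCC :+ 1);; CSet vCnt (vCnt :+ vLen))
      (CSet vAn vRs;; CSet vCnt vLen);;
    CSet vLen 0).

Definition scan_body : cmd :=
  CIf (EA aE (EA aP (vJ :+ 1)))
    (CIf vLen CSkip (CSet vRs (vJ :+ 1));; CSet vLen (vLen :+ 1))
    flush_cmd.

Definition scan_cmd : cmd := CFor vJ (LP pK) scan_body;; flush_cmd.

Definition member_cmd (b : nat) : cmd :=
  CFor vC (LN d) (when (char_at vI) do (CPut aE (char_at vI) (EN b))).

(** The crossings of the previous meeting are read back from the output, last one first, and their
    inverses in the sense of [inv_bc] are appended. *)
Definition revert_cmd : cmd :=
  CFor vJ (LN d) (when (vPC :- vJ) do (
    CSet vT (vPS :+ EMul 3 (vPC :- 1 :- vJ));;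
    put_out (EA aO vT);;
    put_out (EA aO vT :+ EA aO (vT :+ 2) :- EA aO (vT :+ 1) :- 1);;
    put_out (EA aO (vT :+ 2)))).

(** The number of crossings precedes them in the output but is known only afterwards, so a cell is
    reserved at [vH] and filled at the end. *)
Definition meeting_cmd : cmd :=
  CSet vH vO;; CSet vO (vO :+ 1);;
  revert_cmd;;
  CSet vPS vO;; CSet vCC 0;; CSet vAn 0;; CSet vLen 0;;
  member_cmd 1;; scan_cmd;; member_cmd 0;;
  CPut aO vH (vPC :+ vCC);;
  CSet vPC vCC.

Definition put_order_cmd : cmd := CFor vJ (LP pK) (put_out (EA aP (vJ :+ 1))).

Definition output_cmd : cmd := put_order_cmd;; CSet vPS vO;; CFor vI (LP pN) meeting_cmd.

Definition phases : list phase :=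
  [(parse_cmd, pN, EV vN); (CSkip, pK, EA aI 0); (CSkip, pK1, EP pK :+ 1);
   (CSkip, pD, EMul d (EP pN) :+ 1); (init_cmd, pS, EV vS); (order_cmd, pL, EN 0);
   (ident_cmd;; output_cmd, pL, EN 0)].

End Program.

(** * Construction of the pieces *)

(* 1-based position of [x] in [l], or 0. *)
Fixpoint idx (l : list nat) (x : nat) : nat :=
  match l with
  | [] => 0
  | a :: l' => if x =? a then 1 else match idx l' x with 0 => 0 | S i => S (S i) end
  end.

Lemma idx_notin l x : ~ In x l -> idx l x = 0.
Proof.
  induction l as [|a l IH]; simpl; auto. intros H. destruct (Nat.eqb_spec x a) as [->|]; [tauto|].
  rewrite IH; auto.
Qed.

Lemma idx_nth l i : NoDup l -> i < length l -> idx l (nth i l 0) = S i.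
Proof.
  revert i. induction l as [|a l IH]; simpl; intros i ND Hi; [lia|]. inversion_clear ND.
  destruct i as [|i]; [now rewrite Nat.eqb_refl|].
  destruct (Nat.eqb_spec (nth i l 0) a) as [E|E].
  - exfalso. apply H. rewrite <- E. apply nth_In. lia.
  - rewrite IH by (auto; lia). reflexivity.
Qed.

Lemma idx_in l x : In x l -> exists i, i < length l /\ nth i l 0 = x /\ idx l x = S i.
Proof.
  induction l as [|a l IH]; simpl; [tauto|]. intros H. destruct (Nat.eqb_spec x a) as [->|E].
  - exists 0. repeat split; lia.
  - destruct IH as (i & H1 & H2 & H3); [destruct H; congruence|].
    exists (S i). rewrite H3. repeat split; auto; lia.
Qed.

Lemma idx_zero l x : idx l x = 0 <-> ~ In x l.
Proof.
  split; [|apply idx_notin]. intros H Hi. apply idx_in in Hi as (i & _ & _ & E). lia.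
Qed.

Lemma idx_app_gt l l' x : NoDup (l ++ l') -> length l < idx (l ++ l') x <-> In x l'.
Proof.
  intros ND. split.
  - intros H. destruct (classic (In x (l ++ l'))) as [Hi|Hi]; [|rewrite idx_notin in H by auto; lia].
    apply idx_in in Hi as (i & H1 & H2 & H3). rewrite H3 in H. rewrite app_nth2 in H2 by lia.
    rewrite <- H2. apply nth_In. rewrite length_app in H1. lia.
  - intros H. apply (In_nth _ _ 0) in H as (i & Hi & <-).
    replace (nth i l' 0) with (nth (length l + i) (l ++ l') 0).
    + rewrite idx_nth; auto; [lia|]. rewrite length_app. lia.
    + rewrite app_nth2 by lia. f_equal. lia.
Qed.

Lemma idx_app_l l l' x : In x l -> idx (l ++ l') x = idx l x.
Proof.
  induction l as [|a l IH]; simpl; [tauto|]. intros H. destruct (Nat.eqb_spec x a); auto.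
  rewrite IH; auto. destruct H; congruence.
Qed.

Lemma idx_app_r l l' x : NoDup (l ++ l') -> In x l' -> idx (l ++ l') x = length l + idx l' x.
Proof.
  intros ND H. apply (In_nth _ _ 0) in H as (i & Hi & <-).
  rewrite (idx_nth l') by (auto; now apply NoDup_app_remove_l in ND).
  replace (nth i l' 0) with (nth (length l + i) (l ++ l') 0) by (rewrite app_nth2 by lia; f_equal; lia).
  rewrite idx_nth by (auto; rewrite length_app; lia). lia.
Qed.

Lemma idx_inj l x y : In x l -> idx l x = idx l y -> x = y.
Proof.
  intros Hx H. destruct (idx_in l x Hx) as (i & Hi & <- & E).
  destruct (classic (In y l)) as [Hy|Hy]; [|rewrite (idx_notin l y Hy) in H; lia].
  destruct (idx_in l y Hy) as (j & Hj & <- & E'). f_equal. lia.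
Qed.

Lemma bf_idx l x y : NoDup l -> bf l x y <-> 0 < idx l x < idx l y.
Proof.
  intros ND. split.
  - intros H. apply bf_nth_inv in H as (i & j & H1 & H2 & <- & <-). rewrite !idx_nth by (auto; lia). lia.
  - intros (H1 & H2). assert (Hx : In x l) by (apply NNPP; intros H; apply idx_notin in H; lia).
    assert (Hy : In y l) by (apply NNPP; intros H; apply idx_notin in H; lia).
    apply idx_in in Hx as (i & Hi & E1 & E2). apply idx_in in Hy as (j & Hj & E3 & E4).
    rewrite <- E1, <- E3. apply bf_nth; lia.
Qed.

(* The contiguity test that the program performs on the trace [g] of the meeting [h]. *)
Lemma cv_span l h g mn mx : NoDup l -> NoDup g -> (forall x, In x g <-> In x h /\ In x l) ->
  (forall x, In x g -> mn <= idx l x <= mx) ->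
  (g = [] \/ ((exists x, In x g /\ idx l x = mn) /\ exists x, In x g /\ idx l x = mx)) ->
  (g = [] \/ mx - mn <= length g - 1) <-> cv h l.
Proof.
  intros ND NDg Hg Hb [->|((x0 & Hx0 & E0) & (x1 & Hx1 & E1))].
  - split; auto. intros _ x y z Hxy _ Hx _. apply bf_in in Hxy as (Hxl & _). exfalso.
    apply (proj2 (Hg x)). auto.
  - assert (Hlen : g <> [] /\ mn <= mx). { split; [intros ->; destruct Hx0|]. specialize (Hb _ Hx0). lia. }
    assert (NDm : NoDup (map (idx l) g)).
    { apply NoDup_map_NoDup_ForallPairs; auto. intros y z Hy Hz E. apply Hg in Hy. now apply (idx_inj l). }
    assert (Hinc : incl (map (idx l) g) (seq mn (S (mx - mn)))).
    { intros q Hq. apply in_map_iff in Hq as (y & <- & Hy). apply in_seq. specialize (Hb _ Hy). lia. }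
    assert (Hl1 : 1 <= length g) by (destruct g; simpl; [tauto|lia]).
    split.
    + intros [H|H]; [tauto|]. intros x y z Hxy Hyz Hx Hz.
      assert (Hinc2 : incl (seq mn (S (mx - mn))) (map (idx l) g)).
      { apply NoDup_length_incl; auto. rewrite length_seq, length_map. lia. }
      apply (bf_in l x y) in Hxy as Hin. apply (bf_in l y z) in Hyz as Hin2.
      apply bf_idx in Hxy; auto. apply bf_idx in Hyz; auto.
      assert (Hq : In (idx l y) (map (idx l) g)).
      { apply Hinc2, in_seq. assert (In x g) by (apply Hg; tauto). assert (In z g) by (apply Hg; tauto).
        pose proof (Hb x H0). pose proof (Hb z H1). lia. }
      apply in_map_iff in Hq as (y' & E & Hy'). apply Hg in Hy' as (Hy1 & Hy2).
      apply idx_inj in E; auto. congruence.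
    + intros Hc. right.
      assert (Hinc2 : incl (seq mn (S (mx - mn))) (map (idx l) g)).
      { intros q Hq. apply in_seq in Hq. apply Hg in Hx0 as (Hx0h & Hx0l). apply Hg in Hx1 as (Hx1h & Hx1l).
        assert (Hp : 0 < mn). { apply idx_in in Hx0l as (i & _ & _ & Ei). lia. }
        assert (Hq1 : q - 1 < length l). { apply idx_in in Hx1l as (i & Hi & _ & Ei). lia. }
        assert (Eq : idx l (nth (q - 1) l 0) = q) by (rewrite idx_nth by auto; lia).
        apply in_map_iff. exists (nth (q - 1) l 0). split; auto. apply Hg. split; [|now apply nth_In].
        destruct (Nat.eq_dec q mn) as [->|Hn1].
        { replace (nth (mn - 1) l 0) with x0; auto. apply (idx_inj l); auto. lia. }
        destruct (Nat.eq_dec q mx) as [->|Hn2].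
        { replace (nth (mx - 1) l 0) with x1; auto. apply (idx_inj l); auto. lia. }
        apply (Hc x0 _ x1); auto; apply bf_idx; auto; lia. }
      assert (length (seq mn (S (mx - mn))) <= length (map (idx l) g)).
      { apply NoDup_incl_length; auto. apply seq_NoDup. }
      rewrite length_seq, length_map in H. lia.
Qed.

Definition arr (A : nat -> nat) (l : list nat) := forall t, t < length l -> A t = nth t l 0.

Lemma arr_snoc A A' l x : arr A l -> A' (length l) = x -> (forall t, t < length l -> A' t = A t) -> arr A' (l ++ [x]).
Proof.
  intros H E F t Ht. rewrite length_app in Ht. simpl in Ht.
  destruct (Nat.eq_dec t (length l)) as [->|].
  - rewrite nth_middle. auto.
  - rewrite F, H, app_nth1 by lia. auto.
Qed.

Lemma nth_map_nth (l w : list nat) i : i < length l -> nth i (map (fun j => nth j w 0) l) 0 = nth (nth i l 0) w 0.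
Proof.
  intros Hi. rewrite (nth_indep (map _ l) 0 (nth 0 w 0)) by (rewrite length_map; lia).
  now rewrite (map_nth (fun j => nth j w 0)).
Qed.

Lemma sel_app {A} (Q : A -> Prop) l l' : sel Q (l ++ l') = sel Q l ++ sel Q l'.
Proof. apply filter_app. Qed.

Lemma firstn_succ {A} (l : list A) x0 i : i < length l -> firstn (S i) l = firstn i l ++ [nth i l x0].
Proof.
  revert i. induction l as [|a l IH]; intros i Hi; simpl in *; [lia|]. destruct i as [|i]; [reflexivity|].
  simpl. f_equal. apply (IH i). lia.
Qed.

Lemma in_lists w l : forall m, In l (lists m w) <-> length l = m /\ forall x, In x l -> x < w.
Proof.
  induction l as [|a l IH]; intros m; destruct m as [|m]; simpl.
  - split; auto. intros _. split; auto. tauto.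
  - split; [|intros (H & _); discriminate H]. intros H. apply in_flat_map in H as (x & _ & H).
    apply in_map_iff in H as (y & H & _). discriminate H.
  - split; [intros [H|[]]; discriminate H|intros (H & _); discriminate H].
  - rewrite in_flat_map. split.
    + intros (x & Hx & H). apply in_map_iff in H as (y & H & Hy). injection H as -> ->.
      apply IH in Hy as (H1 & H2). split; [lia|]. intros z [<-|Hz]; auto. apply in_seq in Hx. lia.
    + intros (H1 & H2). exists a. split; [apply in_seq; specialize (H2 a); lia|].
      apply in_map_iff. exists l. split; auto. apply IH. split; [lia|]. intros; apply H2; auto.
Qed.

Lemma permuted_by_index (w v : list nat) : Permutation w v ->
  exists l, Permutation l (seq 0 (length v)) /\ w = map (fun i => nth i v 0) l.
Proof.
  intros H. assert (E : v = map (fun i => nth i v 0) (seq 0 (length v))).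
  { clear. induction v as [|x v IH]; simpl; auto. f_equal. rewrite <- seq_shift, map_map. exact IH. }
  rewrite E in H at 1. apply Permutation_map_inv in H as (l & H1 & H2). exists l. split; auto. now symmetry.
Qed.

Lemma cv_filter h g l : cv h l -> cv h (filter g l).
Proof. intros H x y z Hxy Hyz. apply bf_filter in Hxy, Hyz. eauto. Qed.

Lemma sumf_lt {A} (g h : A -> nat) l x : In x l -> (forall y, In y l -> g y <= h y) -> g x < h x -> sumf g l < sumf h l.
Proof.
  induction l as [|a l IH]; intros Hx Hle Hlt; [destruct Hx|]. rewrite !sumf_cons.
  assert (sumf g l <= sumf h l) by (apply sumf_le; intros; apply Hle; now right).
  pose proof (Hle a (or_introl eq_refl)). destruct Hx as [->|Hx]; [lia|].
  assert (sumf g l < sumf h l) by (apply IH; auto; intros; apply Hle; now right). lia.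
Qed.

Lemma sel_length_lt {A} (P Q : A -> Prop) l y : In y l -> ~ P y -> Q y -> (forall x, In x l -> P x -> Q x) ->
  length (sel P l) < length (sel Q l).
Proof.
  intros Hy HP HQ H. rewrite !sel_length_sumf. apply (sumf_lt _ _ _ y); auto.
  - intros x Hx. destruct (dec (P x)) eqn:E; simpl; [|lia]. apply dec_elim in E. now rewrite (proj2 (dec_true (Q x)) (H x Hx E)).
  - rewrite (proj2 (dec_false (P y)) HP), (proj2 (dec_true (Q y)) HQ). simpl. lia.
Qed.

Ltac ev := cbn [eval ex lm set_var set_arr vr ar var_beq fld_beq andb char_at].
Ltac zb := repeat match goal with
  | |- context [?a =? 0] => destruct (Nat.eqb_spec a 0)
  end.

Lemma lt_S_or j (P : nat -> Prop) : (exists i, i < S j /\ P i) <-> (exists i, i < j /\ P i) \/ P j.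
Proof.
  split.
  - intros (i & Hi & Hp). destruct (Nat.eq_dec i j); [subst; auto|left; exists i; split; auto; lia].
  - intros [(i & Hi & Hp)|H]; eauto.
Qed.

Section Steps.
Context (d k : nat) (M : list (list nat)) (p : par -> nat).
Context (Hd : 2 <= d) (HM : storyline_instance k M) (HMd : meetings_at_most d M).
Notation n := (length M).
Context (HpN : p pN = n) (HpK : p pK = k) (HpK1 : p pK1 = k + 1) (HpD : p pD = d * n + 1).

Notation edge j := (nth j M []).
Definition mm j c := nth c (nth j M []) 0.

Lemma edge_facts j : j < n -> NoDup (edge j) /\ 2 <= length (edge j) <= d /\ forall x, In x (edge j) -> 1 <= x <= k.
Proof.
  intros Hj. assert (Hin : In (edge j) M) by now apply nth_In.
  unfold storyline_instance, meetings_at_most in *. rewrite Forall_forall in HM, HMd.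
  destruct (HM _ Hin) as (H1 & H2 & H3). rewrite Forall_forall in H3. auto.
Qed.

Lemma mm_edge j c : j < n -> c < d -> mm j c <> 0 -> In (mm j c) (edge j).
Proof.
  intros Hj Hc H. unfold mm in *. destruct (le_lt_dec (length (edge j)) c).
  - rewrite nth_overflow in H by auto. tauto.
  - now apply nth_In.
Qed.

Lemma edge_mm j x : j < n -> In x (edge j) -> exists c, c < d /\ mm j c = x.
Proof.
  intros Hj H. apply (In_nth _ _ 0) in H as (c & Hc & E). exists c. split; auto.
  destruct (edge_facts j Hj) as (_ & H & _). lia.
Qed.

Definition static (s : st) := forall j c, j < n -> c < d -> ar s aM (d * j + c) = mm j c.
Definition posn (s : st) (l : list nat) := forall x, ar s aS x = idx l x.
Definition holds (s : st) (fin cur : list nat) :=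
  vr s vB = length fin /\ vr s vQ = length fin + length cur /\
  (forall i, i < length (fin ++ cur) -> ar s aP i = nth i (fin ++ cur) 0) /\ static s.

(* Cell 0 of [aP] is a dummy finished character, so padding entries of a meeting are neither current nor unplaced. *)
Definition wf (fin cur : list nat) := NoDup (fin ++ cur) /\ In 0 fin.

Definition touching fin cur (e : list nat) :=
  (exists x, In x e /\ In x cur) /\ (exists x, In x e /\ ~ In x (fin ++ cur)).

Definition touch_inv s fin cur j c t :=
  (vr t vCnt <> 0 <-> exists c', c' < c /\ length fin < idx (fin ++ cur) (mm j c')) /\
  (vr t vBad <> 0 <-> exists c', c' < c /\ idx (fin ++ cur) (mm j c') = 0) /\
  vr t vB = length fin /\ vr t vJ = j /\ (forall x, ar t aS x = idx (fin ++ cur) x) /\ ar t aM = ar s aM.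

Lemma touch_cmd_ok s fin cur j : j < n -> static s -> posn s (fin ++ cur) ->
  vr s vB = length fin -> vr s vJ = j -> vr s vCnt = 0 -> vr s vBad = 0 ->
  touch_inv s fin cur j d (eval p (touch_cmd d) s).
Proof.
  intros Hj Hst Hpos HB HJ H1 H2. apply (for_inv p vC (LN d) _ s (touch_inv s fin cur j)).
  - unfold touch_inv. rewrite H1, H2. repeat split; auto; try lia; intros (c' & Hc' & _); lia.
  - intros c t Hc (A1 & A2 & A3 & A4 & A5 & A6). unfold touch_inv. rewrite !lt_S_or, <- A1, <- A2. cbn [lm] in Hc.
    ev. rewrite A4, A6, Hst, A5, A3 by lia.
    zb; ev; repeat split; auto; lia.
Qed.

Lemma find_body_ok s fin cur j : wf fin cur -> j < n -> static s -> posn s (fin ++ cur) ->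
  vr s vB = length fin -> vr s vJ = j ->
  let s' := eval p (find_body d) s in
  (ar s aK j = 0 /\ touching fin cur (edge j) /\ vr s' vF = 1 /\ vr s' vE = j) \/
  (~ (ar s aK j = 0 /\ touching fin cur (edge j)) /\ vr s' vF = vr s vF /\ vr s' vE = vr s vE).
Proof.
  intros (ND & H0) Hj Hst Hpos HB HJ s'. unfold s', find_body. ev. rewrite HJ.
  destruct (Nat.eqb_spec (1 - ar s aK j) 0); [right; split; [|auto]; lia|].
  assert (Hk : ar s aK j = 0) by lia.
  match goal with |- context [eval p (touch_cmd d) ?a] => set (s0 := a) end.
  pose proof (touch_cmd_ok s0 fin cur j Hj Hst Hpos HB HJ eq_refl eq_refl) as (A1 & A2 & A3 & A4 & A5 & A6).
  assert (AF : vr (eval p (touch_cmd d) s0) vF = vr s vF) by (now rewrite frame_var).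
  assert (AE : vr (eval p (touch_cmd d) s0) vE = vr s vE) by (now rewrite frame_var).
  set (t := eval p (touch_cmd d) s0) in *. clearbody t.
  assert (T1 : vr t vCnt <> 0 <-> exists x, In x (edge j) /\ In x cur).
  { rewrite A1. split.
    - intros (c & Hc & H). exists (mm j c). rewrite <- (idx_app_gt fin cur (mm j c) ND). split; auto.
      apply mm_edge; auto. intros E. rewrite E in H. apply idx_app_gt in H; auto.
      exact (NoDup_app_disj _ _ ND 0 H0 H).
    - intros (x & Hx & Hc). apply edge_mm in Hx as (c & Hc' & <-); auto. exists c. split; auto. now apply idx_app_gt. }
  assert (T2 : vr t vBad <> 0 <-> exists x, In x (edge j) /\ ~ In x (fin ++ cur)).
  { rewrite A2. split.
    - intros (c & Hc & H). exists (mm j c). apply idx_zero in H. split; auto.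
      apply mm_edge; auto. intros E. apply H. rewrite E. apply in_or_app; auto.
    - intros (x & Hx & Hc). apply edge_mm in Hx as (c & Hc' & <-); auto. exists c. split; auto. now apply idx_zero. }
  unfold touching. zb; ev; auto.
  - right. split; [|auto]. intros (_ & H & _). apply T1 in H. lia.
  - right. split; [|auto]. intros (_ & _ & H). apply T2 in H. lia.
  - left. rewrite <- T1, <- T2. auto.
Qed.

Lemma find_ok s fin cur : wf fin cur -> holds s fin cur -> posn s (fin ++ cur) ->
  let s' := eval p (find_cmd d) s in
  (vr s' vF = 1 /\ vr s' vE < n /\ ar s aK (vr s' vE) = 0 /\ touching fin cur (edge (vr s' vE))) \/
  (vr s' vF = 0 /\ forall j, j < n -> ~ (ar s aK j = 0 /\ touching fin cur (edge j))).
Proof.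
  intros Hwf (HB & HQ & HP & Hst) Hpos s'. unfold s', find_cmd. cbn [eval].
  set (s0 := set_var s vF (ex p s 0)).
  set (I := fun c t => ((vr t vF = 1 /\ vr t vE < c /\ ar s aK (vr t vE) = 0 /\ touching fin cur (edge (vr t vE))) \/
      (vr t vF = 0 /\ forall j, j < c -> ~ (ar s aK j = 0 /\ touching fin cur (edge j)))) /\
     vr t vB = length fin /\ (forall x, ar t aS x = ar s aS x) /\ (forall x, ar t aM x = ar s aM x) /\ (forall x, ar t aK x = ar s aK x)).
  assert (HI : I n (eval p (CFor vJ (LP pN) (find_body d)) s0)); [|apply HI].
  rewrite <- HpN. change (p pN) with (lm p (LP pN)). apply for_inv.
  - unfold I. repeat split; auto. right. split; auto. intros; lia.
  - intros c t Hc (A1 & A2 & A3 & A4 & A5). cbn [lm] in Hc. rewrite HpN in Hc. unfold I.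
    set (t1 := set_var t vJ c).
    assert (HF : vr (eval p (find_body d) t1) vB = length fin /\ (forall x, ar (eval p (find_body d) t1) aS x = ar s aS x) /\
       (forall x, ar (eval p (find_body d) t1) aM x = ar s aM x) /\ (forall x, ar (eval p (find_body d) t1) aK x = ar s aK x)).
    { rewrite frame_var by reflexivity. repeat split; auto; intros x; rewrite frame_fld by reflexivity; cbn [t1 set_var ar]; auto. }
    split; [|exact HF].
    destruct (find_body_ok t1 fin cur c) as [(B1 & B2 & B3 & B4)|(B1 & B2 & B3)]; auto; try lia.
    + intros j c' Hj Hc'. cbn [t1 set_var ar]. rewrite A4. now apply Hst.
    + intros x. cbn [t1 set_var ar]. rewrite A3. apply Hpos.
    + left. rewrite B3, B4. repeat split; try apply B2; auto; try lia. rewrite <- A5. exact B1.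
    + rewrite B2, B3. cbn [t1 set_var vr var_beq]. destruct A1 as [(C1 & C2 & C3 & C4)|(C1 & C2)]; [left|right].
      * auto.
      * split; auto. intros j Hj. destruct (Nat.eq_dec j c) as [->|]; [|apply C2; lia].
        intros (D1 & D2). apply B1. split; auto. cbn [t1 set_var ar]. now rewrite A5.
Qed.

Lemma static_eq s s' : static s -> (forall x, ar s' aM x = ar s aM x) -> static s'.
Proof. intros H E j c Hj Hc. rewrite E. now apply H. Qed.

Lemma unmark_ok s : let s' := eval p unmark_cmd s in forall j, j < n -> ar s' aK j = 0.
Proof.
  intros s' j Hj. rewrite <- HpN in Hj. revert j Hj. change (p pN) with (lm p (LP pN)).
  apply (for_inv p vJ (LP pN) _ s (fun c t => forall j, j < c -> ar t aK j = 0)); [intros; lia|].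
  intros c t Hc H j Hj. ev. destruct (Nat.eqb_spec j c); auto. apply H. lia.
Qed.

Lemma next_piece_ok s fin cur P : wf fin cur -> holds s fin cur -> posn s (fin ++ cur) -> vr s vP = P ->
  let s' := eval p next_piece_cmd s in
  (forall j, j < n -> ar s' aK j = 0) /\
  exists cur', holds s' (fin ++ cur) cur' /\ posn s' ((fin ++ cur) ++ cur') /\
  ((P <= k /\ ~ In P (fin ++ cur) /\ cur' = [P] /\ vr s' vP = P + 1) \/
   (P <= k /\ In P (fin ++ cur) /\ cur' = [] /\ vr s' vP = P + 1) \/
   (k < P /\ cur' = [] /\ vr s' vP = P)).
Proof.
  intros (ND & H0) (HB & HQ & HP & Hst) Hpos HvP s'.
  unfold s', next_piece_cmd. cbn [eval]. set (s0 := set_var s vB (ex p s vQ)).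
  assert (U : let t := eval p unmark_cmd s0 in (forall j, j < n -> ar t aK j = 0) /\ vr t vB = length (fin ++ cur) /\
     vr t vQ = length (fin ++ cur) /\ vr t vP = P /\ ar t aP = ar t aP /\ (forall x, ar t aP x = ar s aP x) /\
     (forall x, ar t aS x = ar s aS x) /\ (forall x, ar t aM x = ar s aM x)).
  { cbn zeta. rewrite length_app. split; [apply unmark_ok|].
    repeat split; try (intros x; now rewrite frame_fld); rewrite frame_var by reflexivity; unfold s0; ev; lia. }
  cbn zeta in U. set (t := eval p unmark_cmd s0) in *. clearbody t.
  destruct U as (U1 & U2 & U3 & U4 & _ & U5 & U6 & U7).
  assert (Hmain : holds t (fin ++ cur) [] /\ posn t ((fin ++ cur) ++ [])).
  { rewrite app_nil_r. split.
    - split; auto. split; [simpl; lia|]. split; [|eapply static_eq; eauto].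
      intros i Hi. rewrite app_nil_r in *. rewrite U5. auto.
    - intros x. rewrite U6. apply Hpos. }
  destruct Hmain as (K1 & K2).
  ev. rewrite HpK1, U4. destruct (Nat.eqb_spec (k + 1 - P) 0).
  - split; auto. exists []. split; auto. split; auto. right. right. repeat split; auto; lia.
  - rewrite U6, Hpos. destruct (Nat.eqb_spec (idx (fin ++ cur) P) 0) as [E|E].
    + apply idx_zero in E. unfold place_cmd. ev. rewrite U3, U4. split; auto.
      exists [P].
      assert (NDP : NoDup ((fin ++ cur) ++ [P])).
      { apply NoDup_app; auto; [repeat constructor; intros []|]. intros x Hx [<-|[]]. auto. }
      split; [|split].
      * split; [ev; auto|]. split; [ev; simpl; lia|]. split; [|eapply static_eq; eauto].
        apply (arr_snoc (ar t aP)); ev.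
        -- intros i Hi. rewrite U5. auto.
        -- now rewrite Nat.eqb_refl.
        -- intros i Hi. destruct (Nat.eqb_spec i (length (fin ++ cur))); auto; lia.
      * intros x. ev. destruct (Nat.eqb_spec x P) as [->|].
        -- rewrite idx_app_r by (simpl; auto). simpl. now rewrite Nat.eqb_refl.
        -- rewrite U6, Hpos. destruct (classic (In x (fin ++ cur))).
           ++ symmetry. now apply idx_app_l.
           ++ rewrite !idx_notin; auto. rewrite in_app_iff. intros [|[|[]]]; auto.
      * left. repeat split; auto; try lia.
    + ev. split; auto. exists []. split; [|split].
      * destruct K1 as (K & K' & K'' & K3). repeat split; ev; auto.
      * intros x. ev. apply K2.
      * right. left. assert (In P (fin ++ cur)) by (apply NNPP; intros H; apply E; now apply idx_zero).
        repeat split; auto; try lia.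
Qed.

Definition fresh_of (l e : list nat) : list nat := sel (fun x => ~ In x l) e.

(** The window of [splice_complete] with the new characters appended; a candidate is a permutation
    of this list put back in its place. *)
Definition window_of (cur e fin : list nat) (i0 : nat) : list nat :=
  let a := i0 - 4 * d in
  let b := Nat.min (length cur) (a + (8 * d + 1)) in
  firstn (b - a) (skipn a cur) ++ fresh_of (fin ++ cur) e.

Lemma anchor_ok s fin cur : wf fin cur -> holds s fin cur -> posn s (fin ++ cur) -> vr s vE < n ->
  touching fin cur (edge (vr s vE)) ->
  exists i0, i0 < length cur /\ In (nth i0 cur 0) (edge (vr s vE)) /\
    vr (eval p (anchor_cmd d) s) vI0 = length fin + i0.
Proof.
  intros (ND & H0) (HB & HQ & HP & Hst) Hpos HE ((x & Hx & Hxc) & _). set (j := vr s vE) in *.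
  set (I := fun c t => vr t vE = j /\ vr t vB = length fin /\ (forall x, ar t aS x = ar s aS x) /\ (forall x, ar t aM x = ar s aM x) /\
    ((forall c', c' < c -> ~ length fin < idx (fin ++ cur) (mm j c')) \/
     exists c', c' < d /\ length fin < idx (fin ++ cur) (mm j c') /\ vr t vI0 = idx (fin ++ cur) (mm j c') - 1)).
  assert (HI : I (lm p (LN d)) (eval p (anchor_cmd d) s)).
  { apply (for_inv p vC (LN d) _ s I); unfold I.
    - repeat split; auto. left. intros; lia.
    - intros c t Hc (A1 & A2 & A3 & A4 & A5). cbn [lm] in Hc.
      assert (HX : ar t aS (ar t aM (d * vr t vE + c)) = idx (fin ++ cur) (mm j c)) by (rewrite A1, A4, Hst, A3 by auto; apply Hpos).
      ev. rewrite HX, A2.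
      destruct (Nat.eqb_spec (idx (fin ++ cur) (mm j c) - length fin) 0); ev; (split; [auto|split; [auto|split; [auto|split; [auto|]]]]).
      + destruct A5 as [A5|A5]; [left|right; auto]. intros c' Hc'. destruct (Nat.eq_dec c' c) as [->|]; [lia|]. apply A5. lia.
      + right. exists c. split; [auto|]. split; [lia|]. reflexivity. }
  destruct HI as (_ & _ & _ & _ & [H|(c & Hc & H1 & H2)]).
  - exfalso. destruct (edge_mm j x HE Hx) as (c & Hc & <-). apply (H c Hc). now apply idx_app_gt.
  - pose proof (proj1 (idx_app_gt _ _ _ ND) H1) as Hin. rewrite idx_app_r in H2 by auto.
    apply idx_in in Hin as Hi. destruct Hi as (i & Hi & E1 & E2).
    exists i. split; auto. rewrite E1. split; [|lia]. apply mm_edge; auto.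
    intros E. rewrite E in Hin. exact (NoDup_app_disj _ _ ND 0 H0 Hin).
Qed.

Lemma slice_ok s fin cur a : holds s fin cur -> vr s vA = length fin + a -> vr s vW = 0 ->
  let b := Nat.min (length cur) (a + (8 * d + 1)) in
  let t := eval p (slice_cmd d) s in
  arr (ar t aW) (firstn (b - a) (skipn a cur)) /\ vr t vW = length (firstn (b - a) (skipn a cur)).
Proof.
  intros (HB & HQ & HP & Hst) HA HW b t.
  set (I := fun c t => vr t vQ = length fin + length cur /\ vr t vA = length fin + a /\ (forall x, ar t aP x = ar s aP x) /\
    vr t vW = Nat.min c (length cur - a) /\ forall i, i < vr t vW -> ar t aW i = nth (a + i) cur 0).
  assert (HI : I (lm p (LN (8 * d + 1))) t).
  { apply (for_inv p vJ (LN (8 * d + 1)) _ s I); unfold I.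
    - rewrite HW. repeat split; auto; try lia.
    - intros c u Hc (A1 & A2 & A3 & A4 & A5). ev. rewrite A1, A2.
      destruct (Nat.eqb_spec (length fin + length cur - (length fin + a + c)) 0); ev; (split; [auto|split; [auto|split; [auto|split]]]).
      + lia.
      + intros i Hi. apply A5. lia.
      + lia.
      + intros i Hi. rewrite A3. destruct (Nat.eqb_spec i (vr u vW)) as [->|].
        * rewrite HP by (rewrite length_app; lia). rewrite app_nth2 by lia. f_equal. lia.
        * apply A5. lia. }
  destruct HI as (_ & _ & _ & H1 & H2). cbn [lm] in H1.
  assert (HL : length (firstn (b - a) (skipn a cur)) = vr t vW).
  { rewrite length_firstn, length_skipn. unfold b. lia. }
  split; auto. intros i Hi. rewrite HL in Hi. rewrite H2 by auto.
  rewrite nth_firstn, nth_skipn. destruct (Nat.ltb_spec i (b - a)); auto. unfold b in *. lia.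
Qed.

Lemma fresh_ok s l sl : In 0 l -> static s -> posn s l -> vr s vE < n ->
  arr (ar s aW) sl -> vr s vW = length sl -> vr s vM = 0 ->
  let nu := fresh_of l (edge (vr s vE)) in
  let t := eval p (fresh_cmd d) s in
  arr (ar t aW) (sl ++ nu) /\ vr t vW = length (sl ++ nu) /\ vr t vM = length nu.
Proof.
  intros H0 Hst Hpos HE Harr HW HM0 nu t. set (j := vr s vE) in *.
  set (nuc := fun c => fresh_of l (firstn c (edge j))).
  set (I := fun c t => vr t vE = j /\ (forall x, ar t aS x = ar s aS x) /\ (forall x, ar t aM x = ar s aM x) /\
    arr (ar t aW) (sl ++ nuc c) /\ vr t vW = length (sl ++ nuc c) /\ vr t vM = length (nuc c)).
  assert (HI : I (lm p (LN d)) t).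
  { apply (for_inv p vC (LN d) _ s I); unfold I.
    - unfold nuc. simpl. rewrite app_nil_r. repeat split; auto.
    - intros c u Hc (A1 & A2 & A3 & A4 & A5 & A6). cbn [lm] in Hc.
      assert (HX : ar u aS (ar u aM (d * vr u vE + c)) = idx l (mm j c)) by (rewrite A1, A3, Hst, A2 by auto; apply Hpos).
      assert (HY : ar u aM (d * vr u vE + c) = mm j c) by (rewrite A1, A3, Hst by auto; auto).
      ev. rewrite HX.
      assert (HS : nuc (S c) = nuc c ++ if idx l (mm j c) =? 0 then [mm j c] else []).
      { unfold nuc. destruct (le_lt_dec (length (edge j)) c) as [Hl|Hl].
        - rewrite (@firstn_all2 nat (S c)), (@firstn_all2 nat c) by lia. assert (E0 : mm j c = 0) by (apply nth_overflow; auto). rewrite E0.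
          destruct (Nat.eqb_spec (idx l 0) 0) as [E|E]; [|now rewrite app_nil_r]. apply idx_zero in E. tauto.
        - rewrite (firstn_succ _ 0) by auto. unfold fresh_of. rewrite sel_app. f_equal. fold (mm j c).
          unfold sel. simpl. destruct (dec (~ In (mm j c) l)) eqn:D; destruct (Nat.eqb_spec (idx l (mm j c)) 0) as [E|E]; auto.
          + apply dec_elim in D. exfalso. apply E. now apply idx_zero.
          + apply dec_nelim in D. exfalso. apply D. now apply idx_zero. }
      rewrite HS. destruct (idx l (mm j c) =? 0) eqn:E; ev.
      + rewrite ?HY.
        split; [auto|split; [auto|split; [auto|split; [|split]]]].
        * rewrite app_assoc. apply (arr_snoc (ar u aW)); auto.
          -- now rewrite A5, Nat.eqb_refl.
          -- intros i Hi. rewrite A5. destruct (Nat.eqb_spec i (length (sl ++ nuc c))); auto; lia.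
        * rewrite A5, !length_app. simpl. lia.
        * rewrite A6, !length_app. simpl. lia.
      + rewrite app_nil_r. repeat split; auto. }
  destruct HI as (_ & _ & _ & H1 & H2 & H3). cbn [lm] in *.
  assert (Hall : nuc d = nu).
  { unfold nuc. rewrite firstn_all2; auto. destruct (edge_facts j HE) as (_ & H & _). lia. }
  rewrite Hall in *. auto.
Qed.

Lemma window_ok s fin cur : wf fin cur -> holds s fin cur -> posn s (fin ++ cur) -> vr s vE < n ->
  touching fin cur (edge (vr s vE)) ->
  exists i0, i0 < length cur /\ In (nth i0 cur 0) (edge (vr s vE)) /\
    let t := eval p (window_cmd d) s in
    let win := window_of cur (edge (vr s vE)) fin i0 in
    vr t vA = length fin + (i0 - 4 * d) /\ vr t vW = length win /\
    vr t vM = length (fresh_of (fin ++ cur) (edge (vr s vE))) /\ arr (ar t aW) win.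
Proof.
  intros Hwf Hh Hpos HE Ht.
  destruct (anchor_ok s fin cur Hwf Hh Hpos HE Ht) as (i0 & H1 & H2 & H3).
  exists i0. split; auto. split; auto. cbn zeta. unfold window_cmd. cbn [eval].
  pose proof (frame_var p (anchor_cmd d) vB eq_refl s) as FB.
  pose proof (frame_var p (anchor_cmd d) vQ eq_refl s) as FQ.
  pose proof (frame_var p (anchor_cmd d) vE eq_refl s) as FE.
  pose proof (frame_fld p (anchor_cmd d) aP eq_refl s) as FP.
  pose proof (frame_fld p (anchor_cmd d) aS eq_refl s) as FS.
  pose proof (frame_fld p (anchor_cmd d) aM eq_refl s) as FM.
  set (t1 := eval p (anchor_cmd d) s) in *. clearbody t1.
  destruct Hh as (HB & HQ & HP & Hst).
  match goal with |- context [eval p (slice_cmd d) ?a] => set (t2 := a) end.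
  assert (Hh2 : holds t2 fin cur).
  { unfold t2, holds. ev. rewrite FB, FQ. repeat split; auto.
    - intros i Hi. rewrite FP; auto. - intros j c Hj Hc. ev. rewrite FM. now apply Hst. }
  assert (HA2 : vr t2 vA = length fin + (i0 - 4 * d)) by (unfold t2; ev; rewrite FB, H3, HB; lia).
  destruct (slice_ok t2 fin cur (i0 - 4 * d) Hh2 HA2 eq_refl) as (S1 & S2).
  pose proof (frame_var p (slice_cmd d) vA eq_refl t2) as GA.
  pose proof (frame_var p (slice_cmd d) vE eq_refl t2) as GE.
  pose proof (frame_fld p (slice_cmd d) aS eq_refl t2) as GS.
  pose proof (frame_fld p (slice_cmd d) aM eq_refl t2) as GM.
  set (t3 := eval p (slice_cmd d) t2) in *. clearbody t3.
  match goal with |- context [eval p (fresh_cmd d) ?a] => set (t4 := a) end.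
  assert (E4 : vr t4 vE = vr s vE) by (unfold t4; ev; rewrite GE; unfold t2; ev; auto).
  destruct (fresh_ok t4 (fin ++ cur) (firstn (Nat.min (length cur) (i0 - 4 * d + (8 * d + 1)) - (i0 - 4 * d)) (skipn (i0 - 4 * d) cur))) as (R1 & R2 & R3); auto.
  - apply in_or_app. left. apply Hwf.
  - intros j c Hj Hc. unfold t4. ev. rewrite GM. unfold t2. ev. rewrite FM. now apply Hst.
  - intros x. unfold t4. ev. rewrite GS. unfold t2. ev. rewrite FS. apply Hpos.
  - rewrite E4. auto.
  - rewrite E4 in *. split; [|auto]. rewrite frame_var by reflexivity. unfold t4. ev. rewrite GA. auto.
Qed.

Lemma write_ok l : forall t s a win, vr s vA = a -> arr (ar s aW) win -> (forall i, In i l -> i < length win) ->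
  let u := eval p (write_cmd t l) s in
  (forall i, i < length l -> ar u aC (a + t + i) = nth (nth i l 0) win 0) /\
  (forall x, x < a + t \/ a + t + length l <= x -> ar u aC x = ar s aC x).
Proof.
  induction l as [|i0 l IH]; intros t s a win HA HW Hl u; unfold u; cbn [write_cmd eval].
  - split; [simpl; intros; lia|auto].
  - match goal with |- context [eval p (write_cmd (S t) l) ?z] => set (s1 := z) end.
    destruct (IH (S t) s1 a win) as (H1 & H2); auto; [intros; apply Hl; now right|].
    split.
    + intros [|i] Hi; simpl in Hi.
      * rewrite H2 by lia. unfold s1. ev. rewrite HA, Nat.add_0_r, Nat.eqb_refl. apply HW, Hl. now left.
      * replace (a + t + S i) with (a + S t + i) by lia. rewrite H1 by lia. reflexivity.
    + intros x Hx. simpl in Hx. rewrite H2 by lia. unfold s1. ev. rewrite HA.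
      destruct (Nat.eqb_spec x (a + t)); auto; lia.
Qed.

Lemma setpos_ok f len s l : f <> aS -> vr s vB + length l = ex p s len -> mod_var (setpos_cmd f len) vB = false ->
  (forall u, vr u vB = vr s vB -> vr u vQ = vr s vQ -> vr u vM = vr s vM -> ex p u len = ex p s len) ->
  NoDup l -> length l <= p pD -> (forall i, i < length l -> ar s f (vr s vB + i) = nth i l 0) ->
  let t := eval p (setpos_cmd f len) s in
  (forall x, In x l -> ar t aS x = vr s vB + idx l x) /\ (forall x, ~ In x l -> ar t aS x = ar s aS x).
Proof.
  intros Hf Hlen _ Hex ND HlD Harr t.
  set (I := fun c u => vr u vB = vr s vB /\ vr u vQ = vr s vQ /\ vr u vM = vr s vM /\ (forall x, ar u f x = ar s f x) /\
    (forall x, In x (firstn c l) -> ar u aS x = vr s vB + idx l x) /\ (forall x, ~ In x l -> ar u aS x = ar s aS x)).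
  assert (HI : I (lm p (LP pD)) t).
  { apply (for_inv p vJ (LP pD) _ s I); unfold I.
    - repeat split; auto. simpl. tauto.
    - intros c u Hc (A1 & A2 & A3 & A4 & A5 & A6). cbn [lm] in Hc. cbn [eval].
      assert (E : ex p (set_var u vJ c) (len :- (vB :+ vJ)) = vr s vB + length l - (vr s vB + c)).
      { cbn [ex]. rewrite Hex by auto. rewrite <- Hlen. ev. now rewrite A1. }
      rewrite E. destruct (Nat.eqb_spec (vr s vB + length l - (vr s vB + c)) 0) as [E2|E2]; ev.
      + repeat split; auto. intros x Hx. apply A5. rewrite firstn_all2 in * by lia. auto.
      + assert (Hff : fld_beq f aS = false) by (destruct f; auto; congruence).
        rewrite A1, A4, Hff. cbn [andb]. rewrite Harr by lia.
        repeat split; auto.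
        * intros x Hx. rewrite (firstn_succ _ 0) in Hx by lia.
          destruct (Nat.eqb_spec x (nth c l 0)) as [->|Hn].
          -- rewrite idx_nth by (auto; lia). lia.
          -- apply A5. apply in_app_or in Hx as [Hx|[Hx|[]]]; congruence.
        * intros x Hx. destruct (Nat.eqb_spec x (nth c l 0)) as [->|Hn]; auto.
          exfalso. apply Hx, nth_In. lia. }
  destruct HI as (_ & _ & _ & _ & H1 & H2). split; auto.
  intros x Hx. apply H1. rewrite firstn_all2 by auto. auto.
Qed.

Lemma shift_ok s fin cur a : holds s fin cur -> vr s vA = length fin + a -> length cur <= p pD ->
  let t := eval p shift_cmd s in
  forall i, i < length cur -> ar t aC (if i <? a then length fin + i else length fin + i + vr s vM) = nth i cur 0.
Proof.
  intros (HB & HQ & HP & Hst) HA HD t.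
  set (m := vr s vM).
  set (I := fun c u => vr u vB = length fin /\ vr u vQ = length fin + length cur /\ vr u vA = length fin + a /\ vr u vM = m /\
    (forall x, ar u aP x = ar s aP x) /\
    forall i, i < c -> i < length cur -> ar u aC (if i <? a then length fin + i else length fin + i + m) = nth i cur 0).
  assert (HI : I (lm p (LP pD)) t).
  { apply (for_inv p vJ (LP pD) _ s I); unfold I.
    - repeat split; auto. intros; lia.
    - intros c u Hc (A1 & A2 & A3 & A4 & A5 & A6). ev. rewrite A1, A2, A3.
      destruct (Nat.eqb_spec (length fin + length cur - (length fin + c)) 0);
        [|destruct (Nat.eqb_spec (length fin + a - (length fin + c)) 0)]; ev; rewrite ?A1, ?A4, ?A5;
        (split; [auto|split; [auto|split; [auto|split; [auto|split; [auto|]]]]]); intros i Hi Hil.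
      + apply A6; auto. lia.
      + assert (HPc : ar s aP (length fin + c) = nth c cur 0).
        { rewrite HP by (rewrite length_app; lia). rewrite app_nth2 by lia. f_equal. lia. }
        destruct (Nat.eq_dec i c) as [->|Hn].
        * destruct (Nat.ltb_spec c a); [lia|]. now rewrite Nat.eqb_refl.
        * destruct (Nat.eqb_spec (if i <? a then length fin + i else length fin + i + m) (length fin + c + m)) as [E|E];
            [destruct (Nat.ltb_spec i a); lia|]. apply A6; lia.
      + assert (HPc : ar s aP (length fin + c) = nth c cur 0).
        { rewrite HP by (rewrite length_app; lia). rewrite app_nth2 by lia. f_equal. lia. }
        destruct (Nat.eq_dec i c) as [->|Hn].
        * destruct (Nat.ltb_spec c a); [|lia]. now rewrite Nat.eqb_refl.
        * destruct (Nat.eqb_spec (if i <? a then length fin + i else length fin + i + m) (length fin + c)) as [E|E];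
            [destruct (Nat.ltb_spec i a); lia|]. apply A6; lia. }
  destruct HI as (_ & _ & _ & _ & _ & H). intros i Hi. apply H; auto. cbn [lm]. lia.
Qed.

Lemma range_ok s fin cl j top : NoDup (fin ++ cl) -> In 0 fin -> j < n -> static s -> posn s (fin ++ cl) ->
  vr s vB = length fin -> vr s vJ = j -> vr s vCnt = 0 -> vr s vMx = 0 -> vr s vMn = top -> length (fin ++ cl) <= top ->
  let t := eval p (range_cmd d) s in
  let g := sel (fun x => In x cl) (edge j) in
  vr t vCnt = length g /\ (forall x, In x g -> vr t vMn <= idx (fin ++ cl) x <= vr t vMx) /\
  (g = [] /\ vr t vMx = 0 \/ ((exists x, In x g /\ idx (fin ++ cl) x = vr t vMn) /\ exists x, In x g /\ idx (fin ++ cl) x = vr t vMx)).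
Proof.
  intros ND H0 Hj Hst Hpos HB HJ HC HX HN Htop t g.
  set (gc := fun c => sel (fun x => In x cl) (firstn c (edge j))).
  set (I := fun c u => vr u vB = length fin /\ vr u vJ = j /\ (forall x, ar u aS x = ar s aS x) /\ (forall x, ar u aM x = ar s aM x) /\
    vr u vCnt = length (gc c) /\ (forall x, In x (gc c) -> vr u vMn <= idx (fin ++ cl) x <= vr u vMx) /\
    (gc c = [] /\ vr u vMx = 0 /\ vr u vMn = top \/
     ((exists x, In x (gc c) /\ idx (fin ++ cl) x = vr u vMn) /\ exists x, In x (gc c) /\ idx (fin ++ cl) x = vr u vMx))).
  assert (HI : I (lm p (LN d)) t).
  { apply (for_inv p vC (LN d) _ s I); unfold I.
    - unfold gc. simpl. repeat split; auto; tauto.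
    - intros c u Hc (A1 & A2 & A3 & A4 & A5 & A6 & A7). cbn [lm] in Hc.
      assert (HX2 : ar u aS (ar u aM (d * vr u vJ + c)) = idx (fin ++ cl) (mm j c)) by (rewrite A2, A4, Hst, A3 by auto; apply Hpos).
      assert (HS : gc (S c) = gc c ++ if idx (fin ++ cl) (mm j c) - length fin =? 0 then [] else [mm j c]).
      { unfold gc. destruct (le_lt_dec (length (edge j)) c) as [Hl|Hl].
        - rewrite (@firstn_all2 nat (S c)), (@firstn_all2 nat c) by lia. assert (E0 : mm j c = 0) by (apply nth_overflow; auto).
          rewrite E0, idx_app_l by auto. apply idx_in in H0 as (i & Hi & _ & ->).
          destruct (Nat.eqb_spec (S i - length fin) 0); [now rewrite app_nil_r|lia].
        - rewrite (firstn_succ _ 0) by auto. rewrite sel_app. f_equal. fold (mm j c).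
          unfold sel. simpl. pose proof (idx_app_gt fin cl (mm j c) ND) as G.
          destruct (dec (In (mm j c) cl)) eqn:D; destruct (Nat.eqb_spec (idx (fin ++ cl) (mm j c) - length fin) 0) as [E|E]; auto.
          + apply dec_elim in D. apply G in D. lia.
          + apply dec_nelim in D. exfalso. apply D, G. lia. }
      assert (Hxt : idx (fin ++ cl) (mm j c) <= top).
      { destruct (classic (In (mm j c) (fin ++ cl))) as [Hi|Hi]; [|rewrite idx_notin by auto; lia].
        apply idx_in in Hi as (i & Hi & _ & ->). lia. }
      rewrite HS. ev. rewrite HX2, A1. set (X := idx (fin ++ cl) (mm j c)) in *.
      destruct (Nat.eqb_spec (X - length fin) 0); ev.
      + rewrite app_nil_r. repeat split; auto; apply A6; auto.
      + split; [auto|split; [auto|split; [auto|split; [auto|split; [|split]]]]].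
        * rewrite length_app, A5. simpl. lia.
        * intros x Hx. apply in_app_or in Hx as [Hx|[<-|[]]]; [specialize (A6 x Hx); lia|fold X; lia].
        * right. destruct A7 as [(B1 & B2 & B3)|((x1 & B1 & B2) & (x2 & B3 & B4))].
          -- split; exists (mm j c); (split; [apply in_or_app; right; now left|fold X; lia]).
          -- pose proof (A6 x1 B1). pose proof (A6 x2 B3). split.
             ++ destruct (le_lt_dec X (vr u vMn)).
                ** exists (mm j c). split; [apply in_or_app; right; now left|fold X; lia].
                ** exists x1. split; [apply in_or_app; auto|lia].
             ++ destruct (le_lt_dec X (vr u vMx)).
                ** exists x2. split; [apply in_or_app; auto|lia].
                ** exists (mm j c). split; [apply in_or_app; right; now left|fold X; lia]. }
  assert (Hall : gc d = g).
  { unfold gc. rewrite firstn_all2; auto. destruct (edge_facts j Hj) as (_ & H & _). lia. }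
  destruct HI as (_ & _ & _ & _ & H1 & H2 & H3). cbn [lm] in *. rewrite Hall in *.
  split; auto. split; auto. destruct H3 as [(H3 & H4 & _)|H3]; auto.
Qed.

Lemma test_ok s fin cl : NoDup (fin ++ cl) -> In 0 fin -> static s -> posn s (fin ++ cl) ->
  vr s vB = length fin -> vr s vQ + vr s vM = length fin + length cl ->
  vr (eval p (test_cmd d) s) vBad = 0 <-> okl M cl.
Proof.
  intros ND H0 Hst Hpos HB HQ.
  assert (Hokl : okl M cl <-> forall j, j < n -> cv (edge j) cl).
  { split; [intros H j Hj; apply H, nth_In; auto|]. intros H h Hh. apply (In_nth _ _ []) in Hh as (j & Hj & <-). auto. }
  rewrite Hokl. unfold test_cmd. cbn [eval]. set (s0 := set_var s vBad (ex p s 0)).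
  set (I := fun c u => vr u vB = length fin /\ vr u vQ = vr s vQ /\ vr u vM = vr s vM /\ (forall x, ar u aS x = ar s aS x) /\
    (forall x, ar u aM x = ar s aM x) /\ (vr u vBad = 0 <-> forall j, j < c -> cv (edge j) cl)).
  assert (HI : I (lm p (LP pN)) (eval p (CFor vJ (LP pN) (test_body d)) s0)).
  { apply (for_inv p vJ (LP pN) _ s0 I); unfold I.
    - repeat split; auto; intros; lia.
    - intros c u Hc (A1 & A2 & A3 & A4 & A5 & A6). cbn [lm] in Hc. rewrite HpN in Hc.
      rewrite !frame_var by reflexivity. ev. split; [auto|split; [auto|split; [auto|]]].
      split; [intros x; rewrite frame_fld by reflexivity; ev; auto|].
      split; [intros x; rewrite frame_fld by reflexivity; ev; auto|].
      unfold test_body. cbn [eval].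
      match goal with |- context [eval p (range_cmd d) ?z] => set (u1 := z) end.
      assert (HB1 : vr (eval p (range_cmd d) u1) vBad = vr u vBad) by (rewrite frame_var by reflexivity; reflexivity).
      destruct (range_ok u1 fin cl c (vr u vQ + vr u vM + 1)) as (R1 & R2 & R3); auto.
      { eapply static_eq; [exact Hst|exact A5]. }
      { intros x. unfold u1. ev. rewrite A4. apply Hpos. }
      { rewrite length_app. lia. }
      set (t := eval p (range_cmd d) u1) in *. clearbody t. ev. rewrite HB1.
      set (g := sel (fun x => In x cl) (edge c)) in *.
      destruct (edge_facts c Hc) as (NDe & _ & _).
      assert (Hspan : (g = [] \/ vr t vMx - vr t vMn <= length g - 1) <-> cv (edge c) cl).
      { destruct R3 as [(G1 & G2)|R3].
        - rewrite <- (cv_span cl (edge c) g 0 0); auto; [tauto| | | |].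
          + now apply NoDup_app_remove_l in ND. + now apply sel_NoDup. + intros x. exact (in_sel (fun x => In x cl) (edge c) x).
          + rewrite G1. intros x [].
        - rewrite <- (cv_span cl (edge c) g (vr t vMn - length fin) (vr t vMx - length fin)).
          + assert (g <> []) by (destruct R3 as ((x & Hx & _) & _); intros E; rewrite E in Hx; destruct Hx).
            destruct R3 as ((x & Hx & E) & _). apply in_sel in Hx as (_ & Hx). apply idx_app_gt with (l := fin) in Hx; auto.
            split; (intros [|]; [tauto|right; lia]).
          + now apply NoDup_app_remove_l in ND. + now apply sel_NoDup. + intros x. exact (in_sel (fun x => In x cl) (edge c) x).
          + intros x Hx. specialize (R2 x Hx). apply in_sel in Hx as (_ & Hx). rewrite idx_app_r in R2 by auto. lia.
          + right. destruct R3 as ((x & Hx & E) & (y & Hy & E')).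
            assert (Hx' := Hx). assert (Hy' := Hy). apply in_sel in Hx' as (_ & Hx'). apply in_sel in Hy' as (_ & Hy').
            rewrite idx_app_r in E, E' by auto. split; [exists x|exists y]; split; auto; lia. }
      assert (Hterm : vr t vMx - vr t vMn - (vr t vCnt - 1) = 0 <-> cv (edge c) cl).
      { rewrite <- Hspan, R1. split; [|intros [->|H]; [|lia]].
        - intros H. destruct g as [|z g']; [now left|right]. simpl in *. lia.
        - destruct R3 as [(_ & G2)|R3]; [rewrite G2; lia|]. destruct R3 as ((x & [] & _) & _). }
      split.
      + intros H j Hj. destruct (Nat.eq_dec j c) as [->|]; [apply Hterm; lia|]. apply A6; lia.
      + intros H. assert (vr u vBad = 0) by (apply A6; intros; apply H; lia).
        assert (vr t vMx - vr t vMn - (vr t vCnt - 1) = 0) by (apply Hterm, H; lia). lia. }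
  destruct HI as (_ & _ & _ & _ & _ & H). cbn [lm] in H. rewrite HpN in H. exact H.
Qed.

Lemma write_mod_fld l f : f <> aC -> forall t, mod_fld (write_cmd t l) f = false.
Proof.
  intros Hf. induction l as [|i l IH]; intros t; simpl; auto. rewrite IH. destruct f; auto; congruence.
Qed.

Lemma write_mod_var l v : forall t, mod_var (write_cmd t l) v = false.
Proof. induction l as [|i l IH]; intros t; simpl; auto. Qed.

Lemma cand_mod_fld l f : f <> aC -> mod_fld (cand_cmd d l) f = mod_fld (cand_cmd d []) f.
Proof. intros Hf. unfold cand_cmd. cbn [mod_fld]. now rewrite !write_mod_fld. Qed.

Lemma cand_mod_var l v : mod_var (cand_cmd d l) v = mod_var (cand_cmd d []) v.
Proof. unfold cand_cmd. cbn [mod_var]. now rewrite !write_mod_var. Qed.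

Lemma all_cands_mod_fld L f : f <> aC -> mod_fld (cand_cmd d []) f = false -> mod_fld (all_cands d L) f = false.
Proof.
  intros Hf H. induction L as [|l L IH]; auto. unfold all_cands, guard_cmd in *. cbn [fold_right mod_fld].
  rewrite cand_mod_fld by auto. now rewrite H, IH.
Qed.

Lemma all_cands_mod_var L v : mod_var (cand_cmd d []) v = false -> mod_var (all_cands d L) v = false.
Proof.
  intros H. induction L as [|l L IH]; auto. unfold all_cands, guard_cmd in *. cbn [fold_right mod_var].
  rewrite cand_mod_var. now rewrite H, IH.
Qed.

Section Candidates.
Context (fin cur e : list nat) (i0 : nat).
Notation nu := (fresh_of (fin ++ cur) e).
Notation win := (window_of cur e fin i0).
Notation a := (i0 - 4 * d).
Notation b := (Nat.min (length cur) (a + (8 * d + 1))).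
Context (Hwf : wf fin cur) (NDe : NoDup e) (Hi0 : i0 < length cur) (HD : length cur + length nu <= p pD).

Definition cand (l : list nat) := firstn a cur ++ map (fun i => nth i win 0) l ++ skipn b cur.

(** The state in which a candidate can be tried. Nothing is required of the places of the current
    piece and of the new characters, since the previous candidate has overwritten them. *)
Definition ready s := holds s fin cur /\ vr s vA = length fin + a /\ vr s vW = length win /\ vr s vM = length nu /\
  arr (ar s aW) win /\ (forall x, In x fin -> ar s aS x = idx fin x) /\
  (forall x, ~ In x (fin ++ cur ++ nu) -> ar s aS x = 0).

Lemma slice_split : firstn a cur ++ firstn (b - a) (skipn a cur) ++ skipn b cur = cur.
Proof.
  replace (skipn b cur) with (skipn (b - a) (skipn a cur)) by (rewrite skipn_skipn; f_equal; lia).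
  now rewrite firstn_skipn, firstn_skipn.
Qed.

Lemma splice_perm w : Permutation w win -> Permutation (firstn a cur ++ w ++ skipn b cur) (cur ++ nu).
Proof.
  intros H. rewrite H. unfold window_of.
  replace (cur ++ nu) with ((firstn a cur ++ firstn (b - a) (skipn a cur) ++ skipn b cur) ++ nu) by (now rewrite slice_split).
  rewrite <- !app_assoc.
  apply Permutation_app_head, Permutation_app_head, Permutation_app_comm.
Qed.

Lemma cand_perm l : Permutation l (seq 0 (length win)) -> Permutation (cand l) (cur ++ nu).
Proof.
  intros H. apply splice_perm. rewrite H. clear. induction win as [|x w IH]; simpl; auto.
  rewrite <- seq_shift, map_map. cbn [nth]. rewrite IH. reflexivity.
Qed.

Lemma all_NoDup : NoDup (fin ++ cur ++ nu).
Proof.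
  rewrite app_assoc. apply NoDup_app; [apply Hwf|now apply sel_NoDup|].
  intros x Hx Hx'. apply in_sel in Hx'. tauto.
Qed.

Lemma cand_nth l u : Permutation l (seq 0 (length win)) -> ready u ->
  let t := eval p (write_cmd 0 l) (eval p shift_cmd u) in
  forall i, i < length (cand l) -> ar t aC (length fin + i) = nth i (cand l) 0.
Proof.
  intros Hl (Hh & HA & HW & HM0 & Harr & _) t i Hi.
  assert (Hll : length l = length win) by (rewrite (Permutation_length Hl); apply length_seq).
  assert (Hwl : length win = b - a + length nu).
  { unfold window_of. rewrite length_app, length_firstn, length_skipn. lia. }
  pose proof (shift_ok u fin cur a Hh HA ltac:(lia)) as HS.
  destruct (write_ok l 0 (eval p shift_cmd u) (length fin + a) win) as (W1 & W2).
  - now rewrite frame_var by reflexivity.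
  - intros j Hj. rewrite frame_fld by reflexivity. now apply Harr.
  - intros j Hj. assert (In j (seq 0 (length win))) by (eapply Permutation_in; eauto). apply in_seq in H. lia.
  - fold t in W1, W2. unfold cand in *. rewrite !length_app, length_firstn, length_map, length_skipn in Hi.
    assert (Hal : length (firstn a cur) = a) by (rewrite length_firstn; lia).
    destruct (le_lt_dec a i) as [Hai|Hai].
    + rewrite app_nth2 by lia. rewrite Hal.
      destruct (le_lt_dec (a + length win) i) as [Hw|Hw].
      * rewrite app_nth2 by (rewrite length_map; lia). rewrite length_map, nth_skipn, W2 by lia.
        specialize (HS (i - length nu)). destruct (Nat.ltb_spec (i - length nu) a); [lia|].
        rewrite HM0 in HS. replace (length fin + i) with (length fin + (i - length nu) + length nu) by lia.
        rewrite HS by lia. f_equal. lia.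
      * rewrite app_nth1 by (rewrite length_map; lia).
        replace (length fin + i) with (length fin + a + 0 + (i - a)) by lia. rewrite W1 by lia.
        symmetry. apply nth_map_nth. lia.
    + rewrite app_nth1 by lia. rewrite W2 by lia. specialize (HS i).
      destruct (Nat.ltb_spec i a); [|lia]. rewrite HS by lia. rewrite nth_firstn.
      destruct (Nat.ltb_spec i a); auto; lia.
Qed.

Lemma copy_cmd_ok s cl : vr s vB = length fin -> vr s vQ = length fin + length cl -> length cl <= p pD ->
  (forall i, i < length cl -> ar s aC (length fin + i) = nth i cl 0) ->
  (forall i, i < length fin -> ar s aP i = nth i fin 0) ->
  let t := eval p copy_cmd s in arr (ar t aP) (fin ++ cl).
Proof.
  intros HB HQ Hl HC HF t.
  set (I := fun c u => vr u vB = length fin /\ vr u vQ = length fin + length cl /\ (forall x, ar u aC x = ar s aC x) /\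
    (forall i, i < length fin -> ar u aP i = nth i fin 0) /\ forall i, i < c -> i < length cl -> ar u aP (length fin + i) = nth i cl 0).
  assert (HI : I (lm p (LP pD)) t).
  { apply (for_inv p vJ (LP pD) _ s I); unfold I.
    - repeat split; auto; intros; lia.
    - intros c u Hc (A1 & A2 & A3 & A4 & A5). ev. rewrite A1, A2.
      destruct (Nat.eqb_spec (length fin + length cl - (length fin + c)) 0); ev; (split; [auto|split; [auto|split; [auto|split]]]).
      + auto.
      + intros i Hi Hil. apply A5; lia.
      + intros i Hi. destruct (Nat.eqb_spec i (length fin + c)); auto; lia.
      + intros i Hi Hil. rewrite A3. destruct (Nat.eqb_spec (length fin + i) (length fin + c)).
        * replace i with c by lia. apply HC. lia.
        * apply A5; lia. }
  destruct HI as (_ & _ & _ & H1 & H2). intros i Hi. rewrite length_app in Hi. cbn [lm] in H2.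
  destruct (le_lt_dec (length fin) i).
  - rewrite app_nth2 by lia. rewrite <- H2 by lia. f_equal. lia.
  - rewrite app_nth1 by lia. auto.
Qed.

Lemma cand_ok s l : ready s -> vr s vG = 0 -> Permutation l (seq 0 (length win)) ->
  let t := eval p (cand_cmd d l) s in
  (okl M (cand l) /\ vr t vG = 1 /\ holds t fin (cand l) /\ posn t (fin ++ cand l)) \/
  (~ okl M (cand l) /\ vr t vG = 0 /\ ready t).
Proof.
  intros Hr HG Hl t. pose proof (cand_nth l s Hl Hr) as HN.
  destruct Hr as ((HB & HQ & HP & Hst) & HA & HW & HM0 & Harr & Hfin & Hout).
  pose proof (cand_perm l Hl) as Hcp. set (cl := cand l) in *.
  assert (Hcl : length cl = length cur + length nu) by (rewrite (Permutation_length Hcp); apply length_app).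
  assert (NDcl : NoDup (fin ++ cl)) by (rewrite Hcp; apply all_NoDup).
  assert (H0 : In 0 fin) by apply Hwf.
  unfold t, cand_cmd. cbn [eval].
  set (s2 := eval p (write_cmd 0 l) (eval p shift_cmd s)) in *.
  assert (FV : forall v, mod_var shift_cmd v = false -> vr s2 v = vr s v).
  { intros v Hv. unfold s2. rewrite frame_var by apply write_mod_var. now apply frame_var. }
  assert (FF : forall f, f <> aC -> mod_fld shift_cmd f = false -> forall x, ar s2 f x = ar s f x).
  { intros f Hf1 Hf2 x. unfold s2. rewrite frame_fld by (now apply write_mod_fld). now apply frame_fld. }
  clearbody s2.
  destruct (setpos_ok aC (vQ :+ vM) s2 cl) as (P1 & P2); auto.
  { discriminate. } { ev. rewrite !FV by reflexivity. lia. } { intros u _ U1 U2. ev. now rewrite U1, U2. }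
  { now apply NoDup_app_remove_l in NDcl. } { lia. } { intros i Hi. rewrite FV, HB by reflexivity. now apply HN. }
  set (s3 := eval p (setpos_cmd aC (vQ :+ vM)) s2) in *.
  assert (FV3 : forall v, mod_var (setpos_cmd aC (vQ :+ vM);; shift_cmd) v = false -> vr s3 v = vr s v).
  { intros v Hv. cbn [mod_var] in Hv. apply Bool.orb_false_elim in Hv as (Hv1 & Hv2).
    unfold s3. rewrite frame_var by auto. auto. }
  assert (FF3 : forall f, f <> aC -> f <> aS -> mod_fld shift_cmd f = false -> forall x, ar s3 f x = ar s f x).
  { intros f Hf1 Hf2 Hf3 x. unfold s3. rewrite frame_fld by (destruct f; auto; congruence). auto. }
  assert (FC3 : forall x, ar s3 aC x = ar s2 aC x) by (intros x; unfold s3; now rewrite frame_fld).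
  clearbody s3.
  rewrite FV, HB in P1 by reflexivity.
  assert (Hpos3 : posn s3 (fin ++ cl)).
  { intros x. destruct (classic (In x cl)) as [Hx|Hx]; [rewrite P1, idx_app_r; auto|].
    rewrite P2, FF by (auto; discriminate).
    destruct (classic (In x fin)) as [Hx2|Hx2]; [rewrite idx_app_l, Hfin; auto|].
    rewrite (idx_notin (fin ++ cl)) by (rewrite in_app_iff; tauto). apply Hout.
    rewrite in_app_iff, <- Hcp. tauto. }
  assert (Hst3 : static s3). { eapply static_eq; [exact Hst|]. apply FF3; auto; discriminate. }
  assert (HB3 : vr s3 vB = length fin) by (rewrite FV3; auto).
  assert (HQ3 : vr s3 vQ + vr s3 vM = length fin + length cl) by (rewrite !FV3 by auto; lia).
  pose proof (test_ok s3 fin cl NDcl H0 Hst3 Hpos3 HB3 HQ3) as HT.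
  set (s4 := eval p (test_cmd d) s3) in *.
  assert (FV4 : forall v, mod_var (test_cmd d) v = false -> vr s4 v = vr s3 v) by (intros; now apply frame_var).
  assert (FF4 : forall f x, ar s4 f x = ar s3 f x) by (intros f x; now apply frame_fld).
  clearbody s4.
  destruct (Nat.eqb_spec (ex p s4 vBad) 0) as [E|E]; cbn [ex] in E.
  - left. split; [now apply HT|]. unfold commit_cmd. cbn [eval].
    set (s5 := set_var s4 vQ (ex p s4 (vQ :+ vM))).
    assert (HB5 : vr s5 vB = length fin) by (unfold s5; ev; rewrite FV4; auto).
    assert (HQ5 : vr s5 vQ = length fin + length cl) by (unfold s5; ev; rewrite !FV4; auto).
    pose proof (copy_cmd_ok s5 cl HB5 HQ5 ltac:(lia)) as HK.
    split; [reflexivity|]. split.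
    + split; [ev; rewrite frame_var; auto|]. split; [ev; rewrite frame_var; auto|]. split.
      * intros i Hi. ev. apply HK; auto.
        -- intros i2 Hi2. unfold s5. ev. rewrite FF4, FC3. now apply HN.
        -- intros i2 Hi2. unfold s5. ev. rewrite FF4, FF3 by (auto; discriminate). rewrite HP by (rewrite length_app; lia).
           now rewrite app_nth1.
      * eapply static_eq; [exact Hst3|]. intros x. ev. rewrite frame_fld by reflexivity. unfold s5. ev. apply FF4.
    + intros x. ev. rewrite frame_fld by reflexivity. unfold s5. ev. rewrite FF4. apply Hpos3.
  - right. split; [intros H; apply E, HT, H|]. cbn [eval].
    split; [rewrite FV4, FV3; auto|].
    assert (HSame : forall x, ar s4 aS x = idx (fin ++ cl) x) by (intros x; rewrite FF4; apply Hpos3).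
    split; [|split; [|split; [|split; [|split; [|split]]]]].
    + split; [rewrite FV4, FV3; auto|]. split; [rewrite FV4, FV3; auto|]. split.
      * intros i Hi. rewrite FF4, FF3 by (auto; discriminate). auto.
      * eapply static_eq; [exact Hst3|]. intros x. apply FF4.
    + rewrite FV4, FV3; auto. + rewrite FV4, FV3; auto. + rewrite FV4, FV3; auto.
    + intros i Hi. rewrite FF4, FF3 by (auto; discriminate). auto.
    + intros x Hx. rewrite HSame. now apply idx_app_l.
    + intros x Hx. rewrite HSame. apply idx_notin. rewrite in_app_iff in *. rewrite Hcp. tauto.
Qed.

Lemma all_cands_ok L : (forall l, In l L -> Permutation l (seq 0 (length l))) -> forall s, ready s -> vr s vG = 0 ->
  let t := eval p (all_cands d L) s in
  (vr t vG = 1 /\ exists cl, Permutation cl (cur ++ nu) /\ okl M cl /\ holds t fin cl /\ posn t (fin ++ cl)) \/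
  (vr t vG = 0 /\ ready t /\ forall l, In l L -> length l = length win -> ~ okl M (cand l)).
Proof.
  induction L as [|l L IH]; intros HL s Hr HG.
  - right. repeat split; auto; apply Hr.
  - unfold all_cands. cbn [fold_right]. fold (all_cands d L). cbn [eval]. unfold guard_cmd. cbn [eval ex].
    rewrite HG. cbn [Nat.eqb].
    assert (HLL : forall l, In l L -> Permutation l (seq 0 (length l))) by (intros; apply HL; now right).
    assert (HW : vr s vW = length win) by apply Hr.
    assert (Hskip : length l <> length win ->
      let t := eval p (all_cands d L) s in
      (vr t vG = 1 /\ exists cl, Permutation cl (cur ++ nu) /\ okl M cl /\ holds t fin cl /\ posn t (fin ++ cl)) \/
      (vr t vG = 0 /\ ready t /\ forall l', In l' (l :: L) -> length l' = length win -> ~ okl M (cand l'))).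
    { intros Hn. destruct (IH HLL s Hr HG) as [H|(H1 & H2 & H3)]; [now left|right].
      split; auto. split; auto. intros l' [<-|Hl'] E; [tauto|auto]. }
    rewrite HW. destruct (Nat.eqb_spec (length l - length win) 0); [|apply Hskip; lia].
    destruct (Nat.eqb_spec (length win - length l) 0); [|apply Hskip; lia].
    assert (El : length l = length win) by lia.
    assert (Hl : Permutation l (seq 0 (length win))) by (rewrite <- El; apply HL; now left).
    destruct (cand_ok s l Hr HG Hl) as [(C1 & C2 & C3 & C4)|(C1 & C2 & C3)].
    + left. set (t := eval p (cand_cmd d l) s) in *. clearbody t.
      assert (Hstop : eval p (all_cands d L) t = t).
      { clear - C2. induction L as [|l2 L IH]; auto. unfold all_cands, guard_cmd in *. cbn [fold_right eval ex].
        rewrite C2. cbn [Nat.eqb eval]. exact IH. }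
      rewrite Hstop. split; auto. exists (cand l). repeat split; auto; try apply C3. now apply cand_perm.
    + destruct (IH HLL _ C3 C2) as [H|(H1 & H2 & H3)]; [now left|right].
      split; auto. split; auto. intros l' [<-|Hl'] E; auto.
Qed.

End Candidates.

Lemma in_tables l : In l (tables d) <-> length l <= max_window d /\ Permutation l (seq 0 (length l)).
Proof.
  unfold tables. rewrite in_sel, in_flat_map. split.
  - intros ((m & Hm & H) & HP). apply in_lists in H as (H & _). apply in_seq in Hm. split; auto. lia.
  - intros (H & HP). split; auto. exists (length l). split; [apply in_seq; lia|]. apply in_lists. split; auto.
    intros x Hx. assert (In x (seq 0 (length l))) by (eapply Permutation_in; eauto). apply in_seq in H0. lia.
Qed.

Lemma unplace_ok s l sl : vr s vW = length (sl ++ l) -> vr s vM = length l -> length l <= d -> arr (ar s aW) (sl ++ l) ->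
  let t := eval p (unplace_cmd d) s in
  forall x, (In x l -> ar t aS x = 0) /\ (~ In x l -> ar t aS x = ar s aS x).
Proof.
  intros HW HM0 Hl Harr t.
  set (I := fun c u => vr u vW = vr s vW /\ vr u vM = length l /\ (forall x, ar u aW x = ar s aW x) /\
    forall x, (In x (firstn c l) -> ar u aS x = 0) /\ (~ In x l -> ar u aS x = ar s aS x)).
  assert (HI : I (lm p (LN d)) t).
  { apply (for_inv p vJ (LN d) _ s I); unfold I.
    - repeat split; auto. simpl. tauto.
    - intros c u Hc (A1 & A2 & A3 & A4). ev. rewrite A2.
      destruct (Nat.eqb_spec (length l - c) 0) as [E|E]; ev; (split; [auto|split; [auto|split; [auto|]]]); intros x.
      + destruct (A4 x) as (B1 & B2). split; auto. rewrite firstn_all2 by lia. rewrite firstn_all2 in B1 by lia. auto.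
      + rewrite A1, A3, HW, length_app, Harr by (rewrite length_app; lia).
        rewrite app_nth2 by lia. replace (length sl + length l - length l + c - length sl) with c by lia.
        rewrite (firstn_succ _ 0) by lia. destruct (A4 x) as (B1 & B2).
        destruct (Nat.eqb_spec x (nth c l 0)) as [->|Hn]; split; auto.
        * intros H. exfalso. apply H, nth_In. lia.
        * intros H. apply B1. apply in_app_or in H as [H|[H|[]]]; congruence. }
  destruct HI as (_ & _ & _ & H). intros x. destruct (H x) as (H1 & H2). split; auto.
  intros Hx. apply H1. cbn [lm]. now rewrite firstn_all2.
Qed.

(** A failure is stated for all orders of the window, free of tables and places, which is the form
    in which it contradicts [splice_complete]. *)
Lemma extend_ok s fin cur : wf fin cur -> holds s fin cur -> posn s (fin ++ cur) -> vr s vE < n ->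
  touching fin cur (edge (vr s vE)) ->
  let e := edge (vr s vE) in
  let nu := fresh_of (fin ++ cur) e in
  length cur + length nu <= p pD ->
  let t := eval p (extend_cmd d) s in
  ((exists cl, Permutation cl (cur ++ nu) /\ okl M cl /\ holds t fin cl /\ posn t (fin ++ cl)) /\
   (forall j, ar t aK j = ar s aK j)) \/
  ((exists i0, i0 < length cur /\ In (nth i0 cur 0) e /\
      forall w, Permutation w (window_of cur e fin i0) ->
        ~ okl M (firstn (i0 - 4 * d) cur ++ w ++ skipn (Nat.min (length cur) (i0 - 4 * d + (8 * d + 1))) cur)) /\
   holds t fin cur /\ posn t (fin ++ cur) /\
   (forall j, ar t aK j = if j =? vr s vE then 1 else ar s aK j)).
Proof.
  intros Hwf Hh Hpos HE Ht e nu HD t.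
  destruct (window_ok s fin cur Hwf Hh Hpos HE Ht) as (i0 & I1 & I2 & W1 & W2 & W3 & W4).
  destruct (edge_facts _ HE) as (NDe & Hlen & _). fold e in I2, W2, W3, W4, NDe, Hlen.
  unfold t, extend_cmd. cbn [eval].
  set (s1 := eval p (window_cmd d) s) in *.
  assert (FV1 : forall v, mod_var (window_cmd d) v = false -> vr s1 v = vr s v) by (intros; now apply frame_var).
  assert (FF1 : forall f, f <> aW -> forall x, ar s1 f x = ar s f x).
  { intros f Hf x. apply frame_fld. destruct f; auto; congruence. }
  clearbody s1.
  assert (Hnu : length nu <= d).
  { assert (length nu <= length e); [|lia]. apply NoDup_incl_length; [now apply sel_NoDup|].
    intros x Hx. now apply in_sel in Hx. }
  set (s2 := set_var s1 vG (ex p s1 0)).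
  assert (Hr : ready fin cur e i0 s2).
  { destruct Hh as (HB & HQ & HP & Hst). split; [|split; [|split; [|split; [|split; [|split]]]]]; auto.
    - split; [unfold s2; ev; rewrite FV1; auto|]. split; [unfold s2; ev; rewrite FV1; auto|]. split.
      + intros i Hi. unfold s2. ev. rewrite FF1 by discriminate. auto.
      + eapply static_eq; [exact Hst|]. intros x. unfold s2. ev. apply FF1. discriminate.
    - intros x Hx. unfold s2. ev. rewrite FF1 by discriminate. rewrite Hpos. now apply idx_app_l.
    - intros x Hx. unfold s2. ev. rewrite FF1 by discriminate. rewrite Hpos. apply idx_notin.
      rewrite app_assoc, in_app_iff in Hx. tauto. }
  assert (HT : forall l, In l (tables d) -> Permutation l (seq 0 (length l))) by (intros l Hl; now apply in_tables).
  destruct (all_cands_ok fin cur e i0 Hwf NDe I1 HD (tables d) HT s2 Hr eq_refl) as [(G & C)|(G & Hr3 & Hno)].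
  - left. set (s3 := eval p (all_cands d (tables d)) s2) in *. cbn [ex]. rewrite G. cbn [Nat.eqb eval]. split; auto.
    intros j. unfold s3. rewrite frame_fld by (apply all_cands_mod_fld; [discriminate|reflexivity]).
    unfold s2. ev. apply FF1. discriminate.
  - right.
    assert (FK : forall j, ar (eval p (all_cands d (tables d)) s2) aK j = ar s aK j).
    { intros j. rewrite frame_fld by (apply all_cands_mod_fld; [discriminate|reflexivity]). unfold s2. ev. apply FF1. discriminate. }
    assert (FE : vr (eval p (all_cands d (tables d)) s2) vE = vr s vE).
    { rewrite frame_var by (apply all_cands_mod_var; reflexivity). unfold s2. ev. now apply FV1. }
    set (s3 := eval p (all_cands d (tables d)) s2) in *. clearbody s3. cbn [ex]. rewrite G. cbn [Nat.eqb eval].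
    destruct Hr3 as ((HB & HQ & HP & Hst) & HA & HW & HM0 & Harr & Hfin & Hout).
    split.
    { exists i0. split; auto. split; auto. intros w Hw.
      destruct (permuted_by_index _ _ Hw) as (l & Hl & ->).
      assert (Hll : length l = length (window_of cur e fin i0)) by (rewrite (Permutation_length Hl); apply length_seq).
      apply (Hno l); auto. apply in_tables. rewrite Hll. split; auto.
      unfold window_of, max_window. rewrite length_app, length_firstn. fold nu. lia. }
    unfold undo_cmd. cbn [eval].
    destruct Hwf as (ND & H0).
    set (s4 := eval p (unplace_cmd d) s3).
    pose proof (unplace_ok s3 nu (firstn (Nat.min (length cur) (i0 - 4 * d + (8 * d + 1)) - (i0 - 4 * d)) (skipn (i0 - 4 * d) cur)) HW HM0 Hnu Harr) as HU.
    cbn zeta in HU. fold s4 in HU.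
    assert (FV4 : forall v, mod_var (unplace_cmd d) v = false -> vr s4 v = vr s3 v) by (intros; now apply frame_var).
    assert (FF4 : forall f, f <> aS -> forall x, ar s4 f x = ar s3 f x).
    { intros f Hf x. apply frame_fld. destruct f; auto; congruence. }
    clearbody s4.
    destruct (setpos_ok aP vQ s4 cur) as (P1 & P2); auto.
    { discriminate. } { ev. rewrite !FV4 by reflexivity. lia. }
    { now apply NoDup_app_remove_l in ND. } { lia. }
    { intros i Hi. rewrite FV4, HB, FF4, HP by (auto; try discriminate; rewrite length_app; lia).
      rewrite app_nth2 by lia. f_equal. lia. }
    set (s5 := eval p (setpos_cmd aP vQ) s4) in *.
    assert (FV5 : forall v, mod_var (setpos_cmd aP vQ;; unplace_cmd d) v = false -> vr s5 v = vr s3 v).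
    { intros v Hv. cbn [mod_var] in Hv. apply Bool.orb_false_elim in Hv as (Hv1 & Hv2). unfold s5. rewrite frame_var; auto. }
    assert (FF5 : forall f, f <> aS -> forall x, ar s5 f x = ar s3 f x).
    { intros f Hf x. unfold s5. rewrite frame_fld by (destruct f; auto; congruence). auto. }
    clearbody s5. rewrite FV4, HB in P1 by reflexivity.
    split; [|split].
    + split; [ev; rewrite FV5; auto|]. split; [ev; rewrite FV5; auto|]. split.
      * intros i Hi. ev. rewrite FF5 by discriminate. auto.
      * eapply static_eq; [exact Hst|]. intros x. ev. apply FF5. discriminate.
    + intros x. ev. destruct (classic (In x cur)) as [Hx|Hx]; [rewrite P1, idx_app_r; auto|].
      rewrite P2 by auto. destruct (HU x) as (U1 & U2).
      destruct (classic (In x fin)) as [Hx2|Hx2].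
      * rewrite U2, Hfin, idx_app_l; auto. intros Hx3. apply in_sel in Hx3. rewrite in_app_iff in Hx3. tauto.
      * rewrite (idx_notin (fin ++ cur)) by (rewrite in_app_iff; tauto).
        destruct (classic (In x nu)) as [Hx3|Hx3]; [auto|]. rewrite U2 by auto. apply Hout.
        rewrite !in_app_iff. tauto.
    + intros j. ev. rewrite FF5, FK, FV5, FE by (auto; discriminate). reflexivity.
Qed.

Lemma step_frame_P s : vr (eval p (find_cmd d) s) vP = vr s vP /\ vr (eval p (extend_cmd d) s) vP = vr s vP.
Proof.
  split; [now apply frame_var|]. apply frame_var. unfold extend_cmd. cbn [mod_var].
  rewrite all_cands_mod_var; reflexivity.
Qed.

(** * Maximal pieces and the invariant of their construction *)

(** Connectivity is expressed through divisions of the piece, each crossed by a meeting inside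
    [D ++ P]. In this form it survives absorption and yields [lay_conn] directly. *)
Definition piece_ok (D P : list nat) := okl M P /\
  forall (A : nat -> bool) x y, In x P -> In y P -> A x = true -> A y = false ->
    exists h, In h M /\ (forall z, In z h -> In z (D ++ P)) /\
      (exists u, In u h /\ In u P /\ A u = true) /\ (exists v, In v h /\ In v P /\ A v = false).

(** [sigma] may be any order of the enlarged piece, so it can later be cut out of the start
    permutation of a competing solution. *)
Definition blocked (D P e : list nat) :=
  ~ exists sigma, NoDup sigma /\ (forall x, In x sigma <-> In x P \/ (In x e /\ ~ In x D)) /\ okl M sigma.

Definition closed (D P : list nat) := forall e, In e M -> touching D P e -> blocked D P e.

Fixpoint pieces_ok (D : list nat) (ps : list (list nat)) : Prop :=
  match ps with [] => True | P :: r => piece_ok D P /\ closed D P /\ pieces_ok (D ++ P) r end.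

Lemma pieces_ok_snoc ps : forall D P, pieces_ok D ps -> piece_ok (D ++ concat ps) P -> closed (D ++ concat ps) P ->
  pieces_ok D (ps ++ [P]).
Proof.
  induction ps as [|Q ps IH]; intros D P; simpl; [rewrite app_nil_r; tauto|].
  intros (H1 & H2 & H3) H4 H5. split; auto. split; auto. apply IH; auto; now rewrite <- app_assoc.
Qed.

(** Restricting an admissible order to the smaller piece keeps it admissible; therefore marks remain
    valid while the piece grows. *)
Lemma blocked_mono D P P' e : (forall x, In x P -> In x P') -> blocked D P e -> blocked D P' e.
Proof.
  intros Hs Hb (sigma & H1 & H2 & H3). apply Hb.
  exists (sel (fun x => In x P \/ (In x e /\ ~ In x D)) sigma). split; [now apply sel_NoDup|]. split.
  - intros x. rewrite in_sel, H2. split; [tauto|]. intros [H|H]; auto.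
  - intros h Hh. apply cv_filter. auto.
Qed.

(** Every new character shares [e] with the old character [c0]. A division is crossed by [e] if it
    separates a new character from [c0], and otherwise it already divides the old piece. *)
Lemma piece_ok_extend D P P' e : piece_ok D P -> okl M P' -> In e M -> touching D P e -> (forall x, In x P -> ~ In x D) ->
  (forall x, In x P' <-> In x P \/ (In x e /\ ~ In x (D ++ P))) -> piece_ok D P'.
Proof.
  intros (_ & Hc) Hok He ((c0 & Hc0 & Hc1) & _) HD HP'. split; auto.
  assert (Hin : forall z, In z e -> In z (D ++ P')).
  { intros z Hz. rewrite in_app_iff, HP', !in_app_iff. destruct (classic (In z D)); [auto|].
    destruct (classic (In z P)); tauto. }
  assert (Hold : forall (A : nat -> bool) x y, In x P -> In y P -> A x = true -> A y = false ->
    exists h, In h M /\ (forall z, In z h -> In z (D ++ P')) /\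
      (exists u, In u h /\ In u P' /\ A u = true) /\ (exists v, In v h /\ In v P' /\ A v = false)).
  { intros A x y Hx Hy HAx HAy. destruct (Hc A x y Hx Hy HAx HAy) as (h & Hh & H1 & (u & U1 & U2 & U3) & (v & V1 & V2 & V3)).
    exists h. split; auto. split.
    - intros z Hz. specialize (H1 z Hz). rewrite in_app_iff in *. rewrite HP'. tauto.
    - split; [exists u|exists v]; rewrite HP'; auto. }
  assert (Hc0' : In c0 P') by (rewrite HP'; auto).
  assert (Hnew : forall (A : nat -> bool) z, In z P' -> ~ In z P -> A z <> A c0 ->
    exists h, In h M /\ (forall z, In z h -> In z (D ++ P')) /\
      (exists u, In u h /\ In u P' /\ A u = true) /\ (exists v, In v h /\ In v P' /\ A v = false)).
  { intros A z Hz Hzn HA. apply HP' in Hz as Hz2. destruct Hz2 as [|(Hze & _)]; [tauto|].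
    exists e. split; auto. split; auto.
    destruct (A c0) eqn:E0, (A z) eqn:Ez; try congruence; split; eauto. }
  intros A x y Hx Hy HAx HAy.
  destruct (classic (In x P)) as [Hxp|Hxp], (classic (In y P)) as [Hyp|Hyp].
  - exact (Hold A x y Hxp Hyp HAx HAy).
  - destruct (Bool.bool_dec (A c0) (A y)); [|apply (Hnew A y); auto]. apply (Hold A x c0); auto. congruence.
  - destruct (Bool.bool_dec (A c0) (A x)); [|apply (Hnew A x); auto]. apply (Hold A c0 y); auto. congruence.
  - destruct (Bool.bool_dec (A c0) (A x)); [|apply (Hnew A x); auto]. apply (Hnew A y); auto. congruence.
Qed.

(** By [splice_complete] any admissible order of the enlarged piece gives one that differs from the
    present order in the window only, and all those have failed. *)
Lemma rejected_blocked D P e i0 : wf D P -> In e M -> piece_ok D P -> i0 < length P -> In (nth i0 P 0) e ->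
  (forall w, Permutation w (window_of P e D i0) ->
     ~ okl M (firstn (i0 - 4 * d) P ++ w ++ skipn (Nat.min (length P) (i0 - 4 * d + (8 * d + 1))) P)) ->
  blocked D P e.
Proof.
  intros (ND & _) He (Hok & Hc) Hi0 Hx0 Hno (sigma & NDs & Hs & Oks).
  assert (HMe := He). apply (In_nth _ _ []) in HMe as (j & Hj & Ej). destruct (edge_facts j Hj) as (NDe & _ & _). rewrite Ej in NDe.
  assert (NDP : NoDup P) by now apply NoDup_app_remove_l in ND.
  destruct (splice_complete d M P sigma (fresh_of (D ++ P) e) e i0) as (w & Hw & Hokw); auto.
  - intros h Hh. apply (In_nth _ _ []) in Hh as (j' & Hj' & <-). destruct (edge_facts j' Hj') as (_ & H & _). lia.
  - now apply sel_NoDup.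
  - intros x Hx Hx'. apply in_sel in Hx' as (_ & Hx'). apply Hx', in_or_app. auto.
  - intros x. rewrite Hs. unfold fresh_of. rewrite in_sel, in_app_iff.
    pose proof (NoDup_app_disj _ _ ND x). destruct (classic (In x P)), (classic (In x D)); tauto.
  - apply conn_adjacent; auto. intros A x y Hx Hy HA HB.
    destruct (Hc A x y Hx Hy HA HB) as (h & Hh & _ & (u & U1 & U2 & U3) & (v & V1 & V2 & V3)).
    exists h, u, v. auto 8.
  - intros x Hx. now apply in_sel in Hx.
  - apply (Hno w); auto.
Qed.

Definition inside D P := sel (fun j => (exists x, In x (edge j) /\ In x P) /\ forall x, In x (edge j) -> In x (D ++ P)) (seq 0 n).

(** The last clause bounds the piece: each absorbed meeting lies inside it from then on and brings
    at most [d] characters. This makes [d * n + 1] a sufficient limit for the loops over a piece. *)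
Definition inv s ps cur q :=
  let fin := [0] ++ concat ps in
  (wf fin cur /\ (forall x, In x (fin ++ cur) -> x <= k) /\ holds s fin cur /\ posn s (fin ++ cur) /\ vr s vP = q) /\
  1 <= q <= k + 1 /\ (forall x, 1 <= x < q -> In x (fin ++ cur)) /\
  pieces_ok [0] ps /\ piece_ok fin cur /\
  (forall j, j < n -> ar s aK j <> 0 -> (exists x, In x (edge j) /\ In x cur) /\ blocked fin cur (edge j)) /\
  length cur <= 1 + d * length (inside fin cur).

(* A step places a character, marks a meeting, or begins the next piece; in the last case the marks are erased,
   which is paid for because each marked meeting has a character in the finished piece. *)
Definition unfinished (D e : list nat) := length (sel (fun x => ~ In x D) e).
Definition potential s ps cur q :=
  (k + 1 - q) + (1 + k - length (([0] ++ concat ps) ++ cur)) +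
  sumf (fun j => unfinished ([0] ++ concat ps) (edge j) + b2n (ar s aK j =? 0)) (seq 0 n).

(** Once [q = k + 1], all characters are placed and the goal is reached; steps made after that need
    not lower the potential. *)
Lemma step_ok s ps cur q : inv s ps cur q ->
  let t := eval p (step_cmd d) s in
  exists ps' cur' q', inv t ps' cur' q' /\ (potential t ps' cur' q' < potential s ps cur q \/ q' = k + 1) /\ q <= q'.
Proof.
  intros ((Hwf & Hk & Hh & Hpos & HP) & Hq & Hpl & Hps & Hpc & Hmk & Hlen) t.
  set (fin := [0] ++ concat ps) in *.
  unfold t, step_cmd. cbn [eval ex].
  pose proof (find_ok s fin cur Hwf Hh Hpos) as HF. cbn zeta in HF.
  pose proof (proj1 (step_frame_P s)) as FP1.
  assert (FV : forall v, mod_var (find_cmd d) v = false -> vr (eval p (find_cmd d) s) v = vr s v) by (intros; now apply frame_var).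
  assert (FF : forall f x, ar (eval p (find_cmd d) s) f x = ar s f x) by (intros; now apply frame_fld).
  set (s1 := eval p (find_cmd d) s) in *. clearbody s1.
  assert (Hh1 : holds s1 fin cur).
  { destruct Hh as (HB & HQ & HPi & Hst). split; [now rewrite FV|]. split; [now rewrite FV|]. split.
    - intros i Hi. rewrite FF. auto. - eapply static_eq; [exact Hst|]. intros; apply FF. }
  assert (Hpos1 : posn s1 (fin ++ cur)) by (intros x; rewrite FF; apply Hpos).
  assert (ND : NoDup (fin ++ cur)) by apply Hwf.
  destruct HF as [(F1 & HE & HK & Ht)|(F0 & Hnone)].
  - rewrite F1. cbn [Nat.eqb]. set (j0 := vr s1 vE) in *. set (e := edge j0) in *.
    destruct (edge_facts j0 HE) as (NDe & Hel & Her). fold e in NDe, Hel, Her.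
    assert (HeM : In e M) by now apply nth_In.
    set (nu := fresh_of (fin ++ cur) e).
    assert (Hnu : length nu <= d).
    { assert (length nu <= length e); [|lia]. apply NoDup_incl_length; [now apply sel_NoDup|].
      intros x Hx. now apply in_sel in Hx. }
    assert (Hnin : ~ In j0 (inside fin cur)).
    { intros H. apply in_sel in H as (_ & _ & H). destruct Ht as (_ & y & Hy & Hny). apply Hny, H, Hy. }
    assert (NDin : NoDup (j0 :: inside fin cur)) by (constructor; auto; apply sel_NoDup, seq_NoDup).
    (* The meeting [j0] still has unplaced members and is not inside, so there is room for one more
       meeting below the limit [pD]. *)
    assert (Hcard : S (length (inside fin cur)) <= n).
    { replace n with (length (seq 0 n)) by apply length_seq.
      change (length (j0 :: inside fin cur) <= length (seq 0 n)). apply NoDup_incl_length; auto.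
      intros x [<-|Hx]; [apply in_seq; lia|]. now apply in_sel in Hx. }
    assert (HD : length cur + length nu <= p pD) by (rewrite HpD; nia).
    pose proof (proj2 (step_frame_P s1)) as FP2.
    destruct (extend_ok s1 fin cur Hwf Hh1 Hpos1 HE Ht HD) as [((cl & C1 & C2 & C3 & C4) & C5)|((i0 & I1 & I2 & I3) & R1 & R2 & R3)];
      set (t2 := eval p (extend_cmd d) s1) in *; clearbody t2.
    + fold j0 e nu in C1.
      assert (Hcl : forall x, In x cl <-> In x cur \/ In x nu) by (intros x; rewrite C1; apply in_app_iff).
      assert (Hnu1 : exists y, In y nu) by (destruct Ht as (_ & y & Hy & Hny); exists y; now apply in_sel).
      assert (NDall : NoDup (fin ++ cl)).
      { rewrite C1, app_assoc. apply NoDup_app; auto; [now apply sel_NoDup|]. intros x Hx Hx'. apply in_sel in Hx'. tauto. }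
      assert (Hkl : forall x, In x (fin ++ cl) -> x <= k).
      { intros x. rewrite in_app_iff, Hcl. intros [H|[H|H]]; [apply Hk, in_or_app; auto|apply Hk, in_or_app; auto|].
        apply in_sel in H as (H & _). apply Her in H. lia. }
      assert (Hclen : length cl = length cur + length nu) by (rewrite (Permutation_length C1); apply length_app).
      assert (Hnl : 1 <= length nu) by (destruct Hnu1 as (y & Hy); destruct nu; [destruct Hy|simpl; lia]).
      exists ps, cl, q. split; [|split; [left|lia]].
      * split; [|split; [auto|split; [|split; [auto|split; [|split]]]]].
        -- split; [split; [auto|apply Hwf]|]. split; auto. split; auto. split; auto. lia.
        -- intros x Hx. specialize (Hpl x Hx). fold fin. rewrite in_app_iff in *. rewrite Hcl. tauto.
        -- apply (piece_ok_extend fin cur cl e); auto.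
           ++ intros x Hx Hx'. exact (NoDup_app_disj _ _ ND x Hx' Hx).
           ++ intros x. rewrite Hcl. unfold nu, fresh_of. rewrite in_sel. tauto.
        -- intros j Hj Hnz. rewrite C5, FF in Hnz. destruct (Hmk j Hj Hnz) as ((x & X1 & X2) & Hb).
           split; [exists x; rewrite Hcl; auto|]. apply (blocked_mono fin cur); auto. intros; rewrite Hcl; auto.
        -- fold fin. assert (S (length (inside fin cur)) <= length (inside fin cl)); [|nia].
           change (length (j0 :: inside fin cur) <= length (inside fin cl)). apply NoDup_incl_length; auto.
           intros j [<-|Hj].
           ++ apply in_sel. split; [apply in_seq; lia|]. destruct Ht as ((x & X1 & X2) & _). split.
              ** exists x. rewrite Hcl; auto.
              ** intros y Hy. rewrite in_app_iff, Hcl. destruct (classic (In y (fin ++ cur))) as [H|H].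
                 --- rewrite in_app_iff in H. tauto.
                 --- right; right. now apply in_sel.
           ++ apply in_sel in Hj as (J1 & (x & X1 & X2) & J2). apply in_sel. split; auto. split.
              ** exists x. rewrite Hcl; auto.
              ** intros y Hy. specialize (J2 y Hy). rewrite in_app_iff in *. rewrite Hcl. tauto.
      * unfold potential. fold fin. rewrite !length_app, Hclen.
        assert (Hbig : length (fin ++ cl) <= 1 + k).
        { rewrite <- (length_seq (1 + k) 0). apply NoDup_incl_length; auto. intros x Hx. apply in_seq. specialize (Hkl x Hx). lia. }
        rewrite length_app, Hclen in Hbig.
        assert (Hsum : sumf (fun j => unfinished fin (edge j) + b2n (ar t2 aK j =? 0)) (seq 0 n) <=
                sumf (fun j => unfinished fin (edge j) + b2n (ar s aK j =? 0)) (seq 0 n)).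
        { apply sumf_le. intros j _. rewrite C5, FF. lia. }
        lia.
    + fold j0 e nu in I2, I3, R3.
      exists ps, cur, q. split; [|split; [left|lia]].
      * split; [|split; [auto|split; [auto|split; [auto|split; [auto|split; [|auto]]]]]].
        -- split; auto. split; auto. split; auto. split; auto. lia.
        -- intros j Hj Hnz. rewrite R3 in Hnz. destruct (Nat.eqb_spec j j0) as [->|Hne].
           ++ split; [apply Ht|]. apply (rejected_blocked fin cur e i0); auto.
           ++ rewrite FF in Hnz. apply Hmk; auto.
      * unfold potential. fold fin.
        assert (Hsum : sumf (fun j => unfinished fin (edge j) + b2n (ar t2 aK j =? 0)) (seq 0 n) <
                sumf (fun j => unfinished fin (edge j) + b2n (ar s aK j =? 0)) (seq 0 n)).
        { apply (sumf_lt _ _ _ j0); [apply in_seq; lia| |].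
          - intros j _. rewrite R3. destruct (Nat.eqb_spec j j0) as [->|]; [simpl; lia|rewrite FF; lia].
          - rewrite R3, Nat.eqb_refl, HK. simpl. lia. }
        lia.
  - rewrite F0. cbn [Nat.eqb].
    destruct (next_piece_ok s1 fin cur q Hwf Hh1 Hpos1 ltac:(lia)) as (HK0 & cur' & N1 & N2 & N3).
    set (t2 := eval p next_piece_cmd s1) in *. clearbody t2.
    assert (Hfin' : [0] ++ concat (ps ++ [cur]) = fin ++ cur).
    { unfold fin. rewrite concat_app. simpl. now rewrite app_nil_r, app_comm_cons. }
    (* The search found no unmarked meeting that touches the piece, so all touching ones are marked
       and hence blocked. *)
    assert (Hclosed : closed fin cur).
    { intros e He Ht. apply (In_nth _ _ []) in He as (j & Hj & <-). apply Hmk; auto.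
      intros E. apply (Hnone j Hj). split; auto. }
    assert (Hcur' : cur' = [] \/ cur' = [q] /\ q <= k /\ ~ In q (fin ++ cur)) by tauto.
    set (q' := vr t2 vP).
    assert (Hq' : (q <= k /\ q' = q + 1 /\ In q ((fin ++ cur) ++ cur')) \/ (q = k + 1 /\ q' = q)).
    { unfold q'. destruct N3 as [(A1 & A2 & -> & A3)|[(A1 & A2 & -> & A3)|(A1 & -> & A3)]].
      - left. repeat split; auto. apply in_or_app. right. now left.
      - left. repeat split; auto. apply in_or_app. now left.
      - right. split; auto. lia. }
    exists (ps ++ [cur]), cur', q'. split; [|split; [|lia]].
    + unfold inv. rewrite Hfin'.
      split; [|split; [lia|split; [|split; [|split; [|split]]]]].
      * split; [|split; [|split; [auto|split; [auto|reflexivity]]]].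
        -- split; [|apply in_or_app; left; apply Hwf]. apply NoDup_app; auto.
           ++ destruct Hcur' as [->|(-> & _)]; repeat constructor; intros [].
           ++ intros x Hx. destruct Hcur' as [->|(-> & _ & H)]; [intros []|intros [<-|[]]; auto].
        -- intros x Hx. apply in_app_or in Hx as [Hx|Hx]; [auto|]. destruct Hcur' as [->|(-> & H & _)]; [destruct Hx|].
           destruct Hx as [<-|[]]; auto.
      * intros x Hx. destruct Hq' as [(B1 & B2 & B3)|(B1 & B2)].
        -- destruct (Nat.eq_dec x q) as [->|]; auto. apply in_or_app. left. apply Hpl. lia.
        -- apply in_or_app. left. apply Hpl. lia.
      * apply pieces_ok_snoc; auto.
      * split.
        -- intros h _ x y z Hxy Hyz. exfalso. destruct Hcur' as [->|(-> & _)]; simpl in Hxy; tauto.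
        -- intros A x y Hx Hy HA HB. exfalso. destruct Hcur' as [->|(-> & _)]; [destruct Hx|].
           destruct Hx as [<-|[]], Hy as [<-|[]]. congruence.
      * intros j Hj Hnz. rewrite HK0 in Hnz by auto. tauto.
      * destruct Hcur' as [->|(-> & _)]; simpl; lia.
    + destruct Hq' as [(B1 & B2 & B3)|(B1 & B2)]; [left|right; lia].
      unfold potential. rewrite Hfin'. fold fin. rewrite (length_app (fin ++ cur) cur').
      assert (Hsum : sumf (fun j => unfinished (fin ++ cur) (edge j) + b2n (ar t2 aK j =? 0)) (seq 0 n) <=
              sumf (fun j => unfinished fin (edge j) + b2n (ar s aK j =? 0)) (seq 0 n)).
      { apply sumf_le. intros j Hj. apply in_seq in Hj. rewrite HK0 by lia. cbn [Nat.eqb b2n]. unfold unfinished.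
        assert (Hinc : forall x, In x (edge j) -> ~ In x (fin ++ cur) -> ~ In x fin) by (intros x _ H H'; apply H, in_or_app; auto).
        destruct (Nat.eqb_spec (ar s aK j) 0) as [E|E]; cbn [b2n].
        - pose proof (sel_le _ _ _ Hinc). lia.
        - destruct (Hmk j ltac:(lia) E) as ((x & X1 & X2) & _).
          assert (length (sel (fun x => ~ In x (fin ++ cur)) (edge j)) < length (sel (fun x => ~ In x fin) (edge j))); [|lia].
          apply (sel_length_lt _ _ _ x); auto.
          + intros H. apply H, in_or_app. auto.
          + intros H. exact (NoDup_app_disj _ _ ND x H X2). }
      lia.
Qed.

(** Were [q] still at most [k], the potential would be positive through its first term although it
    has dropped in each of the [p pS] steps. *)
Lemma order_ok s ps cur q : inv s ps cur q -> potential s ps cur q <= p pS ->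
  exists ps' cur' , inv (eval p (order_cmd d) s) ps' cur' (k + 1).
Proof.
  intros Hi Hp.
  assert (HI : (fun c t => exists ps' cur' q', inv t ps' cur' q' /\ (potential t ps' cur' q' + c <= potential s ps cur q \/ q' = k + 1))
    (lm p (LP pS)) (eval p (order_cmd d) s)).
  { apply (for_inv p vI (LP pS) _ s (fun c t => exists ps' cur' q', inv t ps' cur' q' /\
      (potential t ps' cur' q' + c <= potential s ps cur q \/ q' = k + 1))).
    - exists ps, cur, q. split; auto. left. lia.
    - intros c t Hc (ps1 & cur1 & q1 & I1 & D1).
      assert (I2 : inv (set_var t vI c) ps1 cur1 q1) by exact I1.
      destruct (step_ok _ _ _ _ I2) as (ps2 & cur2 & q2 & I3 & D2 & D3).
      exists ps2, cur2, q2. split; auto.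
      assert (Hq2 : q2 <= k + 1) by (destruct I3 as (_ & H & _); lia).
      change (potential (set_var t vI c) ps1 cur1 q1) with (potential t ps1 cur1 q1) in D2.
      destruct D1 as [D1|D1]; [|right; lia]. destruct D2 as [D2|D2]; [left; lia|now right]. }
  destruct HI as (ps1 & cur1 & q1 & I1 & D1). exists ps1, cur1. cbn [lm] in D1.
  assert (q1 = k + 1); [|subst; auto].
  destruct D1 as [D1|D1]; auto. unfold potential in D1 at 1. destruct I1 as (_ & H & _). lia.
Qed.
End Steps.

(** * Gathering a meeting *)

(** A block crossing exchanges two adjacent blocks [G] and [R]; together with [bc_shape] this
    replaces position arithmetic in what follows. *)
Lemma bc_split (A G R Y : list nat) : G <> [] ->
  block_crossing (A ++ G ++ R ++ Y) (length A + 1) (length A + length G) (length A + length G + length R) = A ++ R ++ G ++ Y.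
Proof.
  intros HG. assert (1 <= length G) by (destruct G; simpl; [congruence|lia]). unfold block_crossing.
  replace (length A + 1 - 1) with (length A) by lia.
  replace (length A + length G + length R - (length A + length G)) with (length R) by lia.
  replace (length A + length G - (length A + 1) + 1) with (length G) by lia.
  assert (E1 : firstn (length A) (A ++ G ++ R ++ Y) = A).
  { rewrite firstn_app, Nat.sub_diag, firstn_all. now rewrite firstn_O, app_nil_r. }
  assert (E2 : skipn (length A) (A ++ G ++ R ++ Y) = G ++ R ++ Y).
  { rewrite skipn_app, Nat.sub_diag, skipn_all. reflexivity. }
  assert (E3 : skipn (length A + length G) (A ++ G ++ R ++ Y) = R ++ Y).
  { rewrite Nat.add_comm, <- skipn_skipn, E2. rewrite skipn_app, Nat.sub_diag, skipn_all. reflexivity. }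
  assert (E4 : skipn (length A + length G + length R) (A ++ G ++ R ++ Y) = Y).
  { rewrite Nat.add_comm, <- skipn_skipn, E3. rewrite skipn_app, Nat.sub_diag, skipn_all. reflexivity. }
  rewrite E1, E2, E3, E4. f_equal.
  rewrite firstn_app, Nat.sub_diag, firstn_all, firstn_O, app_nil_r. f_equal.
  rewrite firstn_app, Nat.sub_diag, firstn_all, firstn_O, app_nil_r. reflexivity.
Qed.

Lemma bc_shape k (pi : list nat) a b c : length pi = k -> valid_bc k (a, b, c) -> exists A G R Y : list nat,
  pi = A ++ G ++ R ++ Y /\ G <> [] /\ R <> [] /\ a = length A + 1 /\ b = length A + length G /\
  c = length A + length G + length R.
Proof.
  intros Hl (H1 & H2 & H3 & H4).
  exists (firstn (a - 1) pi), (firstn (b - a + 1) (skipn (a - 1) pi)), (firstn (c - b) (skipn b pi)), (skipn c pi).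
  rewrite !length_firstn, !length_skipn.
  split; [|split; [|split; [|lia]]].
  - replace (skipn c pi) with (skipn (c - b) (skipn b pi)) by (rewrite skipn_skipn; f_equal; lia).
    rewrite firstn_skipn. replace (skipn b pi) with (skipn (b - a + 1) (skipn (a - 1) pi)) by (rewrite skipn_skipn; f_equal; lia).
    now rewrite firstn_skipn, firstn_skipn.
  - intros E. apply (f_equal (@length nat)) in E. rewrite length_firstn, length_skipn in E. simpl in E. lia.
  - intros E. apply (f_equal (@length nat)) in E. rewrite length_firstn, length_skipn in E. simpl in E. lia.
Qed.

(** Exchanging back: the first block is now the former second one, of length [c - b], so it ends at
    [a + (c - b) - 1]. *)
Definition inv_bc (t : triple) : triple := let '(a, b, c) := t in (a, a + c - b - 1, c).

Lemma apply_one pi t : apply_bcs pi [t] = let '(a, b, c) := t in block_crossing pi a b c.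
Proof. destruct t as ((a & b) & c). reflexivity. Qed.

Lemma apply_app pi B B' : apply_bcs pi (B ++ B') = apply_bcs (apply_bcs pi B) B'.
Proof. apply fold_left_app. Qed.

Lemma bc_length k pi t : length pi = k -> valid_bc k t -> length (apply_bcs pi [t]) = k.
Proof.
  intros Hl Hv. destruct t as ((a & b) & c). destruct (bc_shape k pi a b c Hl Hv) as (A & G & R & Y & -> & HG & HR & -> & -> & ->).
  rewrite apply_one, bc_split by auto. rewrite !length_app in *. lia.
Qed.

Lemma bc_perm k pi t : length pi = k -> valid_bc k t -> Permutation (apply_bcs pi [t]) pi.
Proof.
  intros Hl Hv. destruct t as ((a & b) & c). destruct (bc_shape k pi a b c Hl Hv) as (A & G & R & Y & -> & HG & HR & -> & -> & ->).
  rewrite apply_one, bc_split by auto. apply Permutation_app_head. rewrite !app_assoc. apply Permutation_app_tail, Permutation_app_comm.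
Qed.

Lemma bc_inverse k pi t : length pi = k -> valid_bc k t ->
  valid_bc k (inv_bc t) /\ apply_bcs (apply_bcs pi [t]) [inv_bc t] = pi.
Proof.
  intros Hl Hv. destruct t as ((a & b) & c). destruct (bc_shape k pi a b c Hl Hv) as (A & G & R & Y & E & HG & HR & -> & -> & ->).
  assert (1 <= length G) by (destruct G; simpl; [congruence|lia]). assert (1 <= length R) by (destruct R; simpl; [congruence|lia]).
  split.
  - unfold valid_bc in *. simpl. subst pi. rewrite !length_app in Hl. lia.
  - rewrite !apply_one, E, bc_split by auto. simpl.
    replace (length A + 1 + (length A + length G + length R) - (length A + length G) - 1) with (length A + length R) by lia.
    replace (length A + length G + length R) with (length A + length R + length G) by lia. now rewrite bc_split.
Qed.

Lemma apply_bcs_perm k B : forall pi, length pi = k -> Forall (valid_bc k) B -> Permutation (apply_bcs pi B) pi.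
Proof.
  induction B as [|t B IH]; intros pi Hl HB; [reflexivity|]. inversion_clear HB.
  change (t :: B) with ([t] ++ B). rewrite apply_app. rewrite IH; auto; [|now apply bc_length]. now apply (bc_perm k).
Qed.

Lemma revert_ok k B : forall pi, length pi = k -> Forall (valid_bc k) B ->
  Forall (valid_bc k) (map inv_bc (rev B)) /\ apply_bcs (apply_bcs pi B) (map inv_bc (rev B)) = pi.
Proof.
  induction B as [|t B IH]; intros pi Hl HB; [simpl; auto|]. inversion_clear HB.
  change (t :: B) with ([t] ++ B) at 2. rewrite apply_app. cbn [rev]. rewrite map_app, apply_app. cbn [map].
  destruct (IH (apply_bcs pi [t])) as (H1 & H2); [now apply bc_length|auto|].
  destruct (bc_inverse k pi t) as (H3 & H4); auto. split.
  - apply Forall_app. split; auto.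
  - now rewrite H2.
Qed.

Definition flat (B : list triple) : list nat := concat (map (fun t : triple => let '(a, b, c) := t in [a; b; c]) B).

Lemma flat_app B B' : flat (B ++ B') = flat B ++ flat B'.
Proof. unfold flat. now rewrite map_app, concat_app. Qed.

Lemma flat_length B : length (flat B) = 3 * length B.
Proof. induction B as [|((a & b) & c) B IH]; simpl; auto. fold (flat B). rewrite IH. lia. Qed.

Definition out_blocks (Bs : list (list triple)) : list nat := concat (map (fun B => length B :: flat B) Bs).

Lemma parse_flat B r : parse_triples (length B) (flat B ++ r) = Some (B, r).
Proof. induction B as [|((a & b) & c) B IH]; simpl; auto. fold (flat B). now rewrite IH. Qed.

Lemma parse_out Bs : parse_blocks (length Bs) (out_blocks Bs) = Some Bs.
Proof.
  induction Bs as [|B Bs IH]; simpl; auto. fold (out_blocks Bs). now rewrite parse_flat, IH.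
Qed.

Lemma decode_out k pi Bs : length pi = k -> decode_solution k (length Bs) (pi ++ out_blocks Bs) = Some (mkSolution pi Bs).
Proof.
  intros Hl. unfold decode_solution. rewrite length_app, Hl.
  destruct (Nat.ltb_spec (k + length (out_blocks Bs)) k); [lia|].
  rewrite skipn_app, firstn_app, <- Hl, Nat.sub_diag, skipn_all, firstn_all. simpl. now rewrite parse_out, app_nil_r.
Qed.

Lemma perm_length k pi : is_perm k pi -> length pi = k.
Proof. intros H. rewrite (Permutation_length H). apply length_seq. Qed.

Lemma perm_NoDup k pi : is_perm k pi -> NoDup pi.
Proof. intros H. rewrite H. apply seq_NoDup. Qed.

Lemma perm_in k pi : is_perm k pi -> forall x, In x pi <-> 1 <= x <= k.
Proof. intros H x. rewrite H, in_seq. lia. Qed.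

Definition separated (pi e : list nat) (x z : nat) := exists y, ~ In y e /\ bf pi x y /\ bf pi y z.

(* [hs] holds one element of every maximal run of [e] in [pi], from right to left. *)
Definition gathers (k : nat) (pi e : list nat) (B : list triple) := Forall (valid_bc k) B /\ supports (apply_bcs pi B) e /\
  exists hs, length hs = S (length B) /\ NoDup hs /\ incl hs e /\ ForallOrdPairs (fun z x => separated pi e x z) hs.

Fixpoint assemble (prev : list triple) (Ts : list (list triple)) : list (list triple) :=
  match Ts with [] => [] | T :: r => (map inv_bc (rev prev) ++ T) :: assemble T r end.

Lemma assemble_run k pi M Ts : length pi = k -> forall prev, Forall (valid_bc k) prev -> Forall2 (gathers k pi) M Ts ->
  valid_run k (apply_bcs pi prev) M (assemble prev Ts).
Proof.
  intros Hl prev Hp H. revert prev Hp. induction H as [|e T M Ts (H1 & H2 & _) H IH]; intros prev Hp; simpl; auto.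
  destruct (revert_ok k prev pi Hl Hp) as (R1 & R2). rewrite apply_app, R2.
  split; [apply Forall_app; auto|]. split; auto.
Qed.

(** Every gathering is paid for when it is made and once more when it is undone: the factor 2. *)
Lemma assemble_cost Ts : forall prev,
  list_sum (map (@length triple) (assemble prev Ts)) <= length prev + 2 * list_sum (map (@length triple) Ts).
Proof.
  induction Ts as [|T Ts IH]; intros prev; simpl; [lia|].
  rewrite length_app, length_map, length_rev. specialize (IH T). lia.
Qed.

Lemma assemble_length Ts : forall prev, length (assemble prev Ts) = length Ts.
Proof. induction Ts as [|T Ts IH]; intros prev; simpl; auto. Qed.

(** The representatives of different runs are separated by a non-member, hence have different ranks;
    there is one more of them than there are crossings. *)
Lemma gathers_np k pi e B rk : gathers k pi e B ->
  (forall x z, In x e -> In z e -> separated pi e x z -> rk x <> rk z) -> S (length B) <= np rk e.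
Proof.
  intros (_ & _ & hs & Hl & _ & Hi & Hs) Hr. rewrite <- Hl, <- (length_map rk hs). unfold np.
  apply NoDup_incl_length.
  - assert (Hi2 := Hi). clear Hl Hi. induction Hs as [|x hs Hx Hs IH]; simpl; constructor.
    + intros H. apply in_map_iff in H as (z & E & Hz). rewrite Forall_forall in Hx.
      apply (Hr z x); auto; apply Hi2; simpl; auto.
    + apply IH. intros y Hy. apply Hi2. now right.
  - intros r H. apply in_map_iff in H as (x & <- & Hx). apply nodup_In, in_map. auto.
Qed.

Lemma gathers_length k pi e B : gathers k pi e B -> S (length B) <= length e.
Proof. intros (_ & _ & hs & Hl & Hn & Hi & _). rewrite <- Hl. now apply NoDup_incl_length. Qed.

Lemma assemble_snoc Ts T : forall prev,
  assemble prev (Ts ++ [T]) = assemble prev Ts ++ [map inv_bc (rev (last Ts prev)) ++ T].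
Proof.
  induction Ts as [|U Ts IH]; intros prev; [reflexivity|]. cbn [app assemble]. rewrite IH. simpl. do 3 f_equal.
  destruct Ts as [|V Ts]; auto. do 2 f_equal. clear IH. revert V. induction Ts as [|W Ts IH2]; intros V; auto. exact (IH2 W).
Qed.

Lemma out_blocks_snoc Bs B : out_blocks (Bs ++ [B]) = out_blocks Bs ++ length B :: flat B.
Proof. unfold out_blocks. rewrite map_app, concat_app. simpl. now rewrite app_nil_r. Qed.

Lemma flat_nth T : forall i r a b c, i < length T -> nth i T (0, 0, 0) = (a, b, c) ->
  nth (3 * i) (flat T ++ r) 0 = a /\ nth (3 * i + 1) (flat T ++ r) 0 = b /\ nth (3 * i + 2) (flat T ++ r) 0 = c.
Proof.
  induction T as [|((a0 & b0) & c0) T IH]; intros i r a b c Hi E; simpl in Hi; [lia|].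
  destruct i as [|i].
  - simpl in E. injection E as -> -> ->. auto.
  - simpl in E. replace (3 * S i) with (S (S (S (3 * i)))) by lia. cbn [flat map concat app nth].
    apply IH; auto. lia.
Qed.

(** * Correctness of the output *)

Section Output.
Context (d k : nat) (M : list (list nat)) (p : par -> nat) (pi : list nat).
Context (Hd : 2 <= d) (HM : storyline_instance k M) (HMd : meetings_at_most d M).
Notation n := (length M).
Context (HpN : p pN = n) (HpK : p pK = k) (Hpi : is_perm k pi).
Notation edge j := (nth j M []).

Definition outs t os := vr t vO = length os /\ arr (ar t aO) os.
Definition order_in t := forall i, i < k -> ar t aP (i + 1) = nth i pi 0.

Lemma put_out_ok t os e : outs t os -> outs (eval p (put_out e) t) (os ++ [ex p t e]).
Proof.
  intros (H1 & H2). split.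
  - unfold put_out. ev. rewrite length_app. simpl. lia.
  - apply (arr_snoc (ar t aO)); auto; unfold put_out; ev; rewrite H1.
    + now rewrite Nat.eqb_refl.
    + intros i Hi. destruct (Nat.eqb_spec i (length os)); auto; lia.
Qed.

Lemma put_out_var t e v : v <> vO -> vr (eval p (put_out e) t) v = vr t v.
Proof. intros H. apply frame_var. destruct v; auto; congruence. Qed.

Lemma put_out_fld t e f x : f <> aO -> ar (eval p (put_out e) t) f x = ar t f x.
Proof. intros H. apply frame_fld. destruct f; auto; congruence. Qed.

(** The first [j] positions are rearranged into non-members [A], the block [Bk], the gap [G] and the
    unfinished run [R]. The crossings so far act on this prefix only, so the scan may go on reading
    the original order. *)
Definition scan_state e os0 j t A Bk G R T hs :=
  outs t (os0 ++ flat T) /\ vr t vCC = length T /\ Forall (valid_bc k) T /\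
  apply_bcs pi T = A ++ Bk ++ G ++ R ++ skipn j pi /\
  (forall x, In x A \/ In x G -> ~ In x e) /\ (forall x, In x Bk \/ In x R -> In x e) /\
  length A + length Bk + length G + length R = j /\ Permutation (A ++ Bk ++ G ++ R) (firstn j pi) /\
  vr t vLen = length R /\ (R <> [] -> vr t vRs + length R = j + 1) /\
  ((vr t vAn = 0 /\ Bk = [] /\ G = [] /\ T = []) \/ (vr t vAn = length A + 1 /\ Bk <> [] /\ vr t vCnt = length Bk)) /\
  length hs = length T + b2n (negb (vr t vAn =? 0)) + b2n (negb (length R =? 0)) /\
  NoDup hs /\ incl hs e /\ incl hs (firstn j pi) /\ ForallOrdPairs (fun z x => separated pi e x z) hs.

(** A non-empty gap keeps the exchanged blocks non-empty, and the non-member before a new run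
    separates it from the earlier representatives. *)
Definition scan_inv e os0 j t := exists A Bk G R T hs, scan_state e os0 j t A Bk G R T hs /\
  (vr t vAn = 0 \/ G <> []) /\ (R = [] -> 0 < j -> ~ In (nth (j - 1) pi 0) e).

Definition flushed e os0 j t := exists A Bk G T hs, scan_state e os0 j t A Bk G [] T hs.

Lemma flush_ok e os0 j t : scan_inv e os0 j t -> flushed e os0 j (eval p flush_cmd t).
Proof.
  intros (A & Bk & G & R & T & hs & (H1 & H2 & H3 & H4 & H5 & H6 & H7 & H8 & H9 & H10 & H11 & H12 & H13 & H14 & H15 & H16) & HG & _).
  unfold flush_cmd. cbn [eval ex]. rewrite H9.
  destruct (Nat.eqb_spec (length R) 0) as [E|E].
  - exists A, Bk, G, T, hs. destruct R; [|discriminate E]. unfold scan_state. auto 20.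
  - assert (HR : R <> []) by (intros ->; now apply E). specialize (H10 HR).
    destruct H11 as [(A1 & -> & -> & ->)|(A1 & A2 & A3)].
    + rewrite A1. cbn [Nat.eqb]. exists A, R, [], [], hs. unfold scan_state. ev.
      rewrite A1 in H12. destruct (Nat.eqb_spec (length R) 0); [tauto|].
      assert (HA : vr t vRs = length A + 1) by (simpl in H7; lia).
      split; [exact H1|split; [auto|split; [auto|split; [|split; [|split; [|split; [|split; [|split; [|split]]]]]]]]].
      * exact H4.
      * intros x [Hx|[]]; auto.
      * intros x [Hx|[]]; auto.
      * simpl in *. lia.
      * simpl in *. rewrite app_nil_r. auto.
      * reflexivity.
      * intros []. reflexivity.
      * split; [right; rewrite HA; auto|]. split; [|auto]. rewrite HA. simpl in *. destruct (Nat.eqb_spec (length A + 1) 0); simpl; lia.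
    + destruct (Nat.eqb_spec (vr t vAn) 0) as [E0|E0]; [lia|]. destruct HG as [HG|HG]; [lia|].
      set (t1 := eval p (put_out (vAn :+ vCnt)) t). set (t2 := eval p (put_out (vRs :- 1)) t1).
      set (t3 := eval p (put_out (vRs :+ vLen :- 1)) t2).
      pose proof (put_out_ok t _ (vAn :+ vCnt) H1) as O1. fold t1 in O1.
      pose proof (put_out_ok t1 _ (vRs :- 1) O1) as O2. fold t2 in O2.
      pose proof (put_out_ok t2 _ (vRs :+ vLen :- 1) O2) as O3. fold t3 in O3.
      assert (V1 : forall v, v <> vO -> vr t1 v = vr t v) by (intros; now apply put_out_var).
      assert (V2 : forall v, v <> vO -> vr t2 v = vr t v) by (intros; unfold t2; rewrite put_out_var; auto).
      assert (V3 : forall v, v <> vO -> vr t3 v = vr t v) by (intros; unfold t3; rewrite put_out_var; auto).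
      (* This crossing exchanges [G] with [R], so that the run joins the block. *)
      set (a := length A + length Bk + 1). set (b := length A + length Bk + length G). set (c := b + length R).
      assert (OO : outs t3 (os0 ++ flat (T ++ [(a, b, c)]))).
      { rewrite flat_app. cbn [flat map concat app]. rewrite <- !app_assoc in O3. cbn [app] in O3.
        cbn [ex] in O3. rewrite !V1, !V2, A1, A3, H9 in O3 by discriminate.
        replace (length A + 1 + length Bk) with a in O3 by (unfold a; lia).
        replace (vr t vRs - 1) with b in O3 by (unfold b; lia).
        replace (vr t vRs + length R - 1) with c in O3 by (unfold c, b; lia). exact O3. }
      clearbody t1 t2. exists A, (Bk ++ R), G, (T ++ [(a, b, c)]), hs. unfold scan_state. cbn [eval ex].
      assert (HGl : 1 <= length G) by (destruct G; simpl; [congruence|lia]).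
      assert (HRl : 1 <= length R) by lia.
      split; [exact OO|]. split; [ev; rewrite V3 by discriminate; rewrite length_app; simpl; lia|].
      split.
      { apply Forall_app. split; auto. constructor; auto.
        assert (Hj : length (firstn j pi) = j) by (rewrite <- (Permutation_length H8), !length_app; lia).
        rewrite length_firstn, (perm_length k pi Hpi) in Hj. unfold valid_bc. unfold a, b, c. lia. }
      split.
      { rewrite apply_app, H4. rewrite apply_one.
        replace (A ++ Bk ++ G ++ R ++ skipn j pi) with ((A ++ Bk) ++ G ++ R ++ skipn j pi) by (now rewrite <- app_assoc).
        unfold a, b, c, b. rewrite <- length_app. rewrite bc_split by auto. now rewrite <- !app_assoc. }
      split; [intros x [Hx|Hx]; auto|].
      split; [intros x [Hx|[]]; apply in_app_or in Hx as [Hx|Hx]; auto|].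
      split; [rewrite length_app; simpl; lia|].
      split.
      { rewrite app_nil_r, <- app_assoc. rewrite <- H8. apply Permutation_app_head, Permutation_app_head, Permutation_app_comm. }
      split; [reflexivity|]. split; [intros []; reflexivity|].
      split.
      { right. ev. rewrite !V3 by discriminate. split; auto. split; [destruct Bk; [congruence|discriminate]|].
        rewrite length_app, A3, H9. auto. }
      split; [|auto]. ev. rewrite V3 by discriminate. rewrite length_app. cbn [length].
      destruct (Nat.eqb_spec (length R) 0); [lia|]. destruct (Nat.eqb_spec (vr t vAn) 0); [lia|]. simpl in *. lia.
Qed.

Lemma nth_skipn_cons (l : list nat) j : j < length l -> skipn j l = nth j l 0 :: skipn (S j) l.
Proof.
  revert j. induction l as [|a l IH]; intros j Hj; simpl in *; [lia|]. destruct j as [|j]; [reflexivity|].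
  simpl. apply IH. lia.
Qed.

Lemma scan_body_ok e os0 j t : j < k -> order_in t -> (forall x, ar t aE x <> 0 <-> In x e) -> vr t vJ = j ->
  scan_inv e os0 j t -> scan_inv e os0 (S j) (eval p scan_body t).
Proof.
  intros Hj Hord HE HJ HI. unfold scan_body. cbn [eval ex]. rewrite HJ, Hord by auto.
  set (x := nth j pi 0). pose proof (perm_length k pi Hpi) as HL. pose proof (perm_NoDup k pi Hpi) as ND.
  assert (Hsk : skipn j pi = x :: skipn (S j) pi) by (apply nth_skipn_cons; lia).
  assert (Hfs : firstn (S j) pi = firstn j pi ++ [x]) by (apply firstn_succ; lia).
  destruct (Nat.eqb_spec (ar t aE x) 0) as [E|E].
  - assert (Hx : ~ In x e) by (rewrite <- HE; lia).
    apply flush_ok in HI. destruct HI as (A & Bk & G & T & hs & (H1 & H2 & H3 & H4 & H5 & H6 & H7 & H8 & H9 & H10 & H11 & H12 & H13 & H14 & H15 & H16)).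
    set (u := eval p flush_cmd t) in *. clearbody u.
    cbn [app] in H4. rewrite Hsk in H4.
    destruct H11 as [(A1 & -> & -> & ->)|(A1 & A2 & A3)].
    + exists (A ++ [x]), [], [], [], [], hs. split; [|split; [now left|]].
      * split; [auto|split; [auto|split; [auto|split]]]; [rewrite <- app_assoc; exact H4|].
        split; [intros y [Hy|[]]; apply in_app_or in Hy as [Hy|[<-|[]]]; auto|].
        split; [intros y [[]|[]]|]. split; [rewrite length_app; simpl in *; lia|].
        split; [rewrite Hfs; simpl in *; rewrite !app_nil_r in *; now rewrite H8|].
        split; [auto|]. split; [intros []; auto|]. split; [left; auto|]. split; [auto|]. split; [auto|]. split; [auto|]. split; auto.
        intros y Hy. rewrite Hfs. apply in_or_app. auto.
      * intros _ _. replace (S j - 1) with j by lia. exact Hx.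
    + exists A, Bk, (G ++ [x]), [], T, hs. split; [|split; [right; destruct G; discriminate|]].
      * split; [auto|split; [auto|split; [auto|split]]]; [rewrite <- app_assoc; exact H4|].
        split; [intros y [Hy|Hy]; [auto|apply in_app_or in Hy as [Hy|[<-|[]]]; auto]|].
        split; [auto|]. split; [rewrite length_app; simpl in *; lia|].
        split; [rewrite Hfs, <- H8, !app_nil_r, <- !app_assoc; auto|].
        split; [auto|]. split; [intros []; auto|]. split; [right; auto|]. split; [auto|]. split; [auto|]. split; [auto|]. split; auto.
        intros y Hy. rewrite Hfs. apply in_or_app. auto.
      * intros _ _. replace (S j - 1) with j by lia. exact Hx.
  - assert (Hx : In x e) by (now apply HE).
    destruct HI as (A & Bk & G & R & T & hs & (H1 & H2 & H3 & H4 & H5 & H6 & H7 & H8 & H9 & H10 & H11 & H12 & H13 & H14 & H15 & H16) & HG & Hlast).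
    rewrite H9. set (u := if length R =? 0 then _ else _).
    assert (Hu : (forall v, v <> vRs -> vr u v = vr t v) /\ (forall f y, ar u f y = ar t f y) /\ vr u vRs = if length R =? 0 then j + 1 else vr t vRs).
    { unfold u. destruct (Nat.eqb_spec (length R) 0); cbn [eval]; ev; [|auto].
      split; [|split; [auto|lia]]. intros v Hv. destruct (var_beq v vRs) eqn:Ev; [apply internal_var_dec_bl in Ev; congruence|auto]. }
    destruct Hu as (U1 & U2 & U3). clearbody u.
    set (hs' := if length R =? 0 then x :: hs else hs).
    exists A, Bk, G, (R ++ [x]), T, hs'. split; [|split].
    + unfold scan_state. ev. split; [split; ev; [rewrite U1 by discriminate; apply H1|intros i Hi; rewrite U2; now apply H1]|].
      rewrite (U1 vAn), (U1 vCnt), (U1 vLen), (U1 vCC), U3 by discriminate.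
      split; [auto|]. split; [auto|]. split; [rewrite H4, Hsk, <- !app_assoc; reflexivity|]. split; [auto|].
      split; [intros y [Hy|Hy]; [auto|apply in_app_or in Hy as [Hy|[<-|[]]]; auto]|].
      split; [rewrite length_app; simpl; lia|].
      split; [rewrite Hfs, <- H8, <- !app_assoc; auto|].
      split; [rewrite length_app; simpl; lia|].
      split. { intros _. rewrite length_app. simpl. destruct (Nat.eqb_spec (length R) 0) as [E2|E2]; [lia|].
        assert (R <> []) by (intros ->; now apply E2). specialize (H10 H). lia. }
      split; [auto|].
      rewrite length_app. cbn [length]. destruct (Nat.eqb_spec (length R + 1) 0) as [E3|E3]; [lia|].
      unfold hs'. destruct (Nat.eqb_spec (length R) 0) as [E2|E2].
      * assert (HR : R = []) by (destruct R; [auto|discriminate E2]). subst R.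
        assert (Hxn : ~ In x (firstn j pi)).
        { intros Hi. apply in_firstn_nth in Hi as (i & I1 & I2 & I3). apply NoDup_nth_inj in I3; auto; lia. }
        split; [simpl in *; lia|]. split; [constructor; auto|]. split; [intros y [<-|Hy]; auto|].
        split; [intros y [<-|Hy]; rewrite Hfs; apply in_or_app; [right; now left|left; auto]|].
        constructor; auto. apply Forall_forall. intros z Hz.
        destruct (Nat.eq_dec j 0) as [->|Hj0]; [destruct (H15 z Hz)|].
        (* A new run begins at [x], so its predecessor is a non-member and separates [x] from every
           earlier representative. *)
        exists (nth (j - 1) pi 0). assert (Hy : ~ In (nth (j - 1) pi 0) e) by (apply Hlast; auto; lia). split; auto.
        assert (Hz2 := H15 z Hz). apply in_firstn_nth in Hz2 as (i & I1 & I2 & I3). split; [|apply bf_nth; lia].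
        rewrite <- I3. apply bf_nth; [|lia]. destruct (Nat.eq_dec i (j - 1)) as [->|]; [|lia].
        exfalso. apply Hy. rewrite I3. auto.
      * split; [simpl in *; lia|]. split; [auto|]. split; [auto|]. split; [|auto].
        intros y Hy. rewrite Hfs. apply in_or_app. auto.
    + ev. rewrite U1 by discriminate. exact HG.
    + intros HR. destruct R; discriminate HR.
Qed.

Lemma scan_ok e os0 t : order_in t -> (forall x, ar t aE x <> 0 <-> In x e) -> outs t os0 ->
  vr t vCC = 0 -> vr t vAn = 0 -> vr t vLen = 0 -> NoDup e -> e <> [] -> (forall x, In x e -> 1 <= x <= k) ->
  exists T, gathers k pi e T /\ outs (eval p scan_cmd t) (os0 ++ flat T) /\ vr (eval p scan_cmd t) vCC = length T.
Proof.
  intros Hord HE HO HC HA HLn NDe Hne Hek.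
  change (eval p scan_cmd t) with (eval p flush_cmd (eval p (CFor vJ (LP pK) scan_body) t)).
  assert (HI : (fun j u => scan_inv e os0 j u /\ order_in u /\ forall x, ar u aE x <> 0 <-> In x e) (lm p (LP pK))
     (eval p (CFor vJ (LP pK) scan_body) t)).
  { apply (for_inv p vJ (LP pK) scan_body t (fun j u => scan_inv e os0 j u /\ order_in u /\ forall x, ar u aE x <> 0 <-> In x e)).
    - split; [|auto]. exists [], [], [], [], [], []. split; [|split; [now left|intros; lia]].
      unfold scan_state. rewrite HA, HLn, HC. cbn [flat map concat app length]. rewrite app_nil_r.
      split; [auto|]. split; [auto|]. split; [constructor|]. split; [reflexivity|]. split; [intros x [[]|[]]|]. split; [intros x [[]|[]]|].
      split; [reflexivity|]. split; [reflexivity|]. split; [auto|]. split; [intros []; auto|]. split; [left; auto|].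
      split; [reflexivity|]. split; [constructor|]. split; [intros x []|]. split; [intros x []|constructor].
    - intros j u Hj (I1 & I2 & I3). cbn [lm] in Hj. rewrite HpK in Hj.
      split; [|split].
      + apply scan_body_ok; auto.
      + intros i Hi. rewrite frame_fld by reflexivity. ev. auto.
      + intros x. rewrite frame_fld by reflexivity. ev. auto. }
  destruct HI as (HI & _). cbn [lm] in HI. rewrite HpK in HI. apply flush_ok in HI.
  set (u := eval p flush_cmd _) in *. clearbody u.
  destruct HI as (A & Bk & G & T & hs & (H1 & H2 & H3 & H4 & H5 & H6 & H7 & H8 & H9 & H10 & H11 & H12 & H13 & H14 & H15 & H16)).
  exists T. split; [|auto]. pose proof (perm_length k pi Hpi) as HL.
  rewrite (skipn_all2 pi) in H4 by lia. rewrite (firstn_all2 pi) in H8 by lia. cbn [app] in H4, H8. rewrite !app_nil_r in *.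
  assert (Hin : forall x, In x e -> In x Bk).
  { intros x Hx. assert (In x pi) by (apply (perm_in k pi Hpi); auto). rewrite <- H8, !in_app_iff in H.
    destruct H as [H|[H|H]]; auto; exfalso; apply (H5 x); auto. }
  split; auto. split.
  - exists A, Bk, G. split; auto. apply NoDup_Permutation; auto.
    + pose proof (perm_NoDup k pi Hpi) as ND. rewrite <- H8 in ND. apply NoDup_app_remove_l in ND. now apply NoDup_app_remove_r in ND.
    + intros x. split; auto.
  - exists hs. destruct H11 as [(A1 & -> & _)|(A1 & _)].
    + exfalso. destruct e as [|x e']; [congruence|]. destruct (Hin x). now left.
    + rewrite A1 in H12. split; [|auto]. destruct (Nat.eqb_spec (length A + 1) 0); simpl in *; lia.
Qed.

Lemma edge_pi j : j < n -> NoDup (edge j) /\ edge j <> [] /\ length (edge j) <= d /\ forall x, In x (edge j) -> 1 <= x <= k.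
Proof.
  intros Hj. destruct (edge_facts d k M HM HMd j Hj) as (H1 & H2 & H3).
  repeat split; auto; try apply H3; auto; try lia. intros E. rewrite E in H2. simpl in H2. lia.
Qed.

Lemma member_ok b t j : j < n -> static d M t -> vr t vI = j ->
  let u := eval p (member_cmd d b) t in
  forall x, (In x (edge j) -> ar u aE x = b) /\ (~ In x (edge j) -> ar u aE x = ar t aE x).
Proof.
  intros Hj Hst HI u. destruct (edge_pi j Hj) as (NDe & _ & Hle & Hek).
  set (I := fun c v => vr v vI = j /\ (forall x, ar v aM x = ar t aM x) /\
    forall x, (In x (firstn c (edge j)) -> ar v aE x = b) /\ (~ In x (edge j) -> ar v aE x = ar t aE x)).
  assert (HII : I (lm p (LN d)) u).
  { apply (for_inv p vC (LN d) _ t I); unfold I.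
    - split; auto. split; auto. intros x. split; auto. intros [].
    - intros c v Hc (A1 & A2 & A3). cbn [lm] in Hc.
      assert (HX : ar v aM (d * vr v vI + c) = mm M j c) by (rewrite A1, A2; now apply Hst).
      ev. rewrite HX. destruct (le_lt_dec (length (edge j)) c) as [Hl|Hl].
      + assert (E0 : mm M j c = 0) by (apply nth_overflow; auto). rewrite E0. cbn [Nat.eqb]. ev.
        split; auto. split; auto. rewrite firstn_all2 by lia. intros x. destruct (A3 x) as (B1 & B2).
        rewrite firstn_all2 in B1 by lia. auto.
      + assert (Hin : In (mm M j c) (edge j)) by (now apply nth_In).
        destruct (Nat.eqb_spec (mm M j c) 0) as [E|E]; [apply Hek in Hin; lia|]. ev.
        split; auto. split; auto. intros x. rewrite (firstn_succ _ 0) by auto. destruct (A3 x) as (B1 & B2).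
        destruct (Nat.eqb_spec x (mm M j c)) as [->|Hn].
        * split; auto. tauto.
        * split; auto. intros H. apply B1. apply in_app_or in H as [H|[H|[]]]; auto. exfalso. now apply Hn. }
  destruct HII as (_ & _ & H). cbn [lm] in H. intros x. destruct (H x) as (H1 & H2). split; auto.
  intros Hx. apply H1. now rewrite firstn_all2.
Qed.

(** [os2] stands for the cell already reserved for the number of crossings, which follows the
    crossings that are read back. *)
Lemma revert_cmd_ok t os os1 os2 Tp : outs t os -> os = os1 ++ flat Tp ++ os2 -> vr t vPS = length os1 ->
  vr t vPC = length Tp -> length Tp <= d ->
  outs (eval p (revert_cmd d) t) (os ++ flat (map inv_bc (rev Tp))).
Proof.
  intros HO Hos HPS HPC HT.
  set (I := fun c u => vr u vPS = length os1 /\ vr u vPC = length Tp /\ outs u (os ++ flat (map inv_bc (firstn c (rev Tp))))).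
  assert (HI : I (lm p (LN d)) (eval p (revert_cmd d) t)).
  { apply (for_inv p vJ (LN d) _ t I); unfold I.
    - cbn [firstn map flat concat]. rewrite app_nil_r. auto.
    - intros c u Hc (A1 & A2 & A3). cbn [eval ex].
      replace (vr (set_var u vJ c) vPC - vr (set_var u vJ c) vJ) with (length Tp - c) by (ev; lia).
      destruct (Nat.eqb_spec (length Tp - c) 0) as [E|E].
      + ev. rewrite firstn_all2 in * by (rewrite length_rev; lia). auto.
      + set (u1 := set_var (set_var u vJ c) vT _).
        assert (V1 : vr u1 vT = length os1 + 3 * (length Tp - S c)).
        { unfold u1. ev. rewrite A1, A2. lia. }
        assert (HO1 : outs u1 (os ++ flat (map inv_bc (firstn c (rev Tp))))) by exact A3.
        assert (P1 : vr u1 vPS = length os1 /\ vr u1 vPC = length Tp) by (unfold u1; ev; auto).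
        clearbody u1. set (o := os ++ flat (map inv_bc (firstn c (rev Tp)))) in *.
        destruct (nth (length Tp - S c) Tp (0, 0, 0)) as ((a & b) & z) eqn:Et.
        assert (Hlt : length Tp - S c < length Tp) by lia.
        destruct (flat_nth Tp (length Tp - S c) os2 a b z Hlt Et) as (N1 & N2 & N3).
        assert (Hrd : forall v o', outs v (o ++ o') -> vr v vT = vr u1 vT ->
          ar v aO (vr v vT) = a /\ ar v aO (vr v vT + 1) = b /\ ar v aO (vr v vT + 2) = z).
        { intros v o' (_ & Hv) Hvt. rewrite Hvt, V1.
          assert (Hl : length os = length os1 + (3 * length Tp + length os2)) by (rewrite Hos, !length_app, flat_length; lia).
          assert (Hx : forall m, m < 3 -> ar v aO (length os1 + 3 * (length Tp - S c) + m) = nth (3 * (length Tp - S c) + m) (flat Tp ++ os2) 0).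
          { intros m Hm. rewrite Hv by (unfold o; rewrite !length_app; lia).
            unfold o. rewrite <- app_assoc, app_nth1 by lia. rewrite Hos, app_nth2 by lia. f_equal. lia. }
          rewrite <- (Nat.add_0_r (length os1 + 3 * (length Tp - S c))) at 1.
          rewrite !Hx by lia. rewrite Nat.add_0_r. auto. }
        pose proof (put_out_ok u1 _ (EA aO vT) HO1) as O1.
        set (u2 := eval p (put_out (EA aO vT)) u1) in *.
        assert (T2 : vr u2 vT = vr u1 vT /\ vr u2 vPS = vr u1 vPS /\ vr u2 vPC = vr u1 vPC) by (unfold u2; rewrite !put_out_var by discriminate; auto).
        set (e2 := EA aO vT :+ EA aO (vT :+ 2) :- EA aO (vT :+ 1) :- 1).
        pose proof (put_out_ok u2 _ e2 O1) as O2.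
        change (eval p (put_out (EA aO vT :+ EA aO (vT :+ 2) :- EA aO (vT :+ 1) :- 1)) u2) with (eval p (put_out e2) u2).
        set (u3 := eval p (put_out e2) u2) in *.
        assert (T3 : vr u3 vT = vr u1 vT /\ vr u3 vPS = vr u1 vPS /\ vr u3 vPC = vr u1 vPC) by (unfold u3; rewrite !put_out_var by discriminate; auto).
        pose proof (put_out_ok u3 _ (EA aO (vT :+ 2)) O2) as O3.
        set (u4 := eval p (put_out (EA aO (vT :+ 2))) u3) in *.
        assert (T4 : vr u4 vPS = vr u1 vPS /\ vr u4 vPC = vr u1 vPC) by (unfold u4; rewrite !put_out_var by discriminate; tauto).
        split; [destruct T4, P1; congruence|]. split; [destruct T4, P1; congruence|].
        assert (R1 : ex p u1 (EA aO vT) = a).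
        { cbn [ex]. destruct (Hrd u1 []) as (X1 & _); auto. now rewrite app_nil_r. }
        assert (R2 : ex p u2 e2 = a + z - b - 1).
        { unfold e2. cbn [ex]. destruct (Hrd u2 [ex p u1 (EA aO vT)]) as (X1 & X2 & X3); [exact O1|apply T2|]. lia. }
        assert (R3 : ex p u3 (EA aO (vT :+ 2)) = z).
        { cbn [ex]. rewrite <- app_assoc in O2. destruct (Hrd u3 _ O2) as (X1 & X2 & X3); [apply T3|]. auto. }
        rewrite R1, R2, R3 in O3.
        assert (Hfs : firstn (S c) (rev Tp) = firstn c (rev Tp) ++ [(a, b, z)]).
        { rewrite <- Et. rewrite <- (rev_nth Tp (0, 0, 0)) by lia.
          apply firstn_succ. rewrite length_rev. lia. }
        rewrite Hfs, map_app, flat_app. unfold o in O3. rewrite <- !app_assoc in O3. cbn [app] in O3. exact O3. }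
  destruct HI as (_ & _ & H). cbn [lm] in H. rewrite firstn_all2 in H by (rewrite length_rev; lia). exact H.
Qed.

Definition meeting_inv os Tp t := outs t os /\ (exists os1, os = os1 ++ flat Tp /\ vr t vPS = length os1) /\
  vr t vPC = length Tp /\ length Tp <= d /\ (forall x, ar t aE x = 0) /\ order_in t /\ static d M t.

Lemma meeting_ok os Tp t j : j < n -> vr t vI = j -> meeting_inv os Tp t ->
  exists T, gathers k pi (edge j) T /\
    let B := map inv_bc (rev Tp) ++ T in
    meeting_inv (os ++ length B :: flat B) T (eval p (meeting_cmd d) t).
Proof.
  intros Hj HIj (HO & (os1 & Hos & HPS) & HPC & HTd & HE & Hord & Hst).
  destruct (edge_pi j Hj) as (NDe & Hne & Hle & Hek).
  unfold meeting_cmd. cbn [eval].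
  match goal with |- context [eval p (revert_cmd d) ?z] => set (t1 := z) end.
  set (h := ar t aO (length os)).
  assert (HO1 : outs t1 (os ++ [h])).
  { destruct HO as (O1 & O2). unfold t1. split; ev; [rewrite length_app; simpl; lia|].
    apply (arr_snoc (ar t aO)); auto. }
  pose proof (revert_cmd_ok t1 (os ++ [h]) os1 [h] Tp HO1) as HO2.
  rewrite Hos, <- app_assoc in HO2 at 1. specialize (HO2 eq_refl HPS HPC HTd).
  set (rv := flat (map inv_bc (rev Tp))) in *.
  set (t2 := eval p (revert_cmd d) t1) in *.
  assert (V2 : vr t2 vH = length os /\ vr t2 vPC = length Tp /\ vr t2 vI = j).
  { unfold t2. rewrite !frame_var by reflexivity. unfold t1. ev. repeat split; auto. apply HO. }
  assert (F2 : forall f x, f <> aO -> ar t2 f x = ar t f x).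
  { intros f x Hf. unfold t2. rewrite frame_fld by (destruct f; auto; congruence). reflexivity. }
  clearbody t2. clear t1 HO1.
  match goal with |- context [eval p (member_cmd d 1) ?z] => set (t3 := z) end.
  assert (HO3 : outs t3 ((os ++ [h]) ++ rv)) by exact HO2.
  assert (Hst3 : static d M t3) by (eapply static_eq; [exact Hst|]; intros x; unfold t3; ev; apply F2; discriminate).
  assert (V3 : vr t3 vI = j) by (unfold t3; ev; apply V2).
  pose proof (member_ok 1 t3 j Hj Hst3 V3) as HM1. cbn zeta in HM1.
  set (t4 := eval p (member_cmd d 1) t3) in *.
  assert (V4 : forall v, v <> vC -> vr t4 v = vr t3 v) by (intros v Hv; apply frame_var; destruct v; auto; congruence).
  assert (F4 : forall f x, f <> aE -> ar t4 f x = ar t3 f x) by (intros f x Hf; apply frame_fld; destruct f; auto; congruence).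
  destruct (scan_ok (edge j) ((os ++ [h]) ++ rv) t4) as (T & HT & HO5 & HC5); auto.
  { intros i Hi. rewrite F4 by discriminate. unfold t3. ev. rewrite F2 by discriminate. auto. }
  { intros x. destruct (HM1 x) as (M1 & M2). destruct (classic (In x (edge j))) as [Hx|Hx].
    - rewrite M1 by auto. split; auto.
    - rewrite M2 by auto. unfold t3. ev. rewrite F2, HE by discriminate. tauto. }
  { destruct HO3 as (O1 & O2). split; [rewrite V4; auto; discriminate|]. intros i Hi. rewrite F4 by discriminate. auto. }
  { rewrite V4 by discriminate. reflexivity. } { rewrite V4 by discriminate. reflexivity. } { rewrite V4 by discriminate. reflexivity. }
  exists T. split; auto.
  set (t5 := eval p scan_cmd t4) in *.
  assert (V5 : vr t5 vI = j /\ vr t5 vH = length os /\ vr t5 vPC = length Tp /\ vr t5 vPS = length ((os ++ [h]) ++ rv)).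
  { unfold t5. rewrite !frame_var by reflexivity. unfold t4. rewrite !frame_var by reflexivity. unfold t3. ev.
    repeat split; try apply V2. apply HO2. }
  assert (F5 : forall f x, f <> aE -> f <> aO -> ar t5 f x = ar t f x).
  { intros f x H1 H2. unfold t5. rewrite frame_fld by (destruct f; auto; congruence). rewrite F4 by auto. unfold t3. ev. auto. }
  assert (F5E : forall x, ar t5 aE x = ar t4 aE x) by (intros x; unfold t5; now rewrite frame_fld).
  clearbody t5.
  assert (Hst5 : static d M t5) by (eapply static_eq; [exact Hst|]; intros x; apply F5; discriminate).
  pose proof (member_ok 0 t5 j Hj Hst5 (proj1 V5)) as HM0. cbn zeta in HM0.
  set (t6 := eval p (member_cmd d 0) t5) in *.
  assert (V6 : forall v, v <> vC -> vr t6 v = vr t5 v) by (intros v Hv; apply frame_var; destruct v; auto; congruence).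
  assert (F6 : forall f x, f <> aE -> ar t6 f x = ar t5 f x) by (intros f x Hf; apply frame_fld; destruct f; auto; congruence).
  clearbody t6. cbn zeta.
  set (B := map inv_bc (rev Tp) ++ T).
  assert (HBl : length B = length Tp + length T) by (unfold B; rewrite length_app, length_map, length_rev; auto).
  assert (HBf : flat B = rv ++ flat T) by (unfold B; apply flat_app).
  split; [|split; [|split; [|split; [|split; [|split]]]]].
  - destruct HO5 as (O1 & O2). split.
    + ev. rewrite V6, O1 by discriminate. rewrite HBf, !length_app. cbn [length]. rewrite !length_app. lia.
    + intros i Hi. ev. rewrite !V6 by discriminate. destruct V5 as (_ & -> & -> & _). rewrite HC5.
      destruct (Nat.eqb_spec i (length os)) as [->|Hn].
      * rewrite nth_middle. lia.
      * rewrite F6 by discriminate. rewrite length_app in Hi. cbn [length] in Hi. rewrite HBf, length_app in Hi.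
        rewrite O2 by (rewrite !length_app; simpl; lia). rewrite HBf, <- !app_assoc. cbn [app].
        destruct (le_lt_dec (length os) i).
        -- rewrite !(app_nth2 os) by lia. destruct (i - length os) as [|i'] eqn:Ei; [lia|]. reflexivity.
        -- now rewrite !app_nth1 by lia.
  - exists (os ++ length B :: rv). split; [rewrite HBf, <- app_assoc; reflexivity|].
    ev. rewrite V6 by discriminate. destruct V5 as (_ & _ & _ & ->). rewrite !length_app. simpl. lia.
  - ev. rewrite V6 by discriminate. auto.
  - apply gathers_length in HT. lia.
  - intros x. ev. destruct (HM0 x) as (M1 & M2). destruct (classic (In x (edge j))) as [Hx|Hx]; auto.
    rewrite M2, F5E by auto. destruct (HM1 x) as (_ & M3). rewrite M3 by auto. unfold t3. ev. rewrite F2 by discriminate. auto.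
  - intros i Hi. ev. rewrite F6, F5 by discriminate. auto.
  - eapply static_eq; [exact Hst5|]. intros x. ev. apply F6. discriminate.
Qed.

Lemma output_ok t : order_in t -> static d M t -> (forall x, ar t aE x = 0) -> vr t vO = 0 -> vr t vPC = 0 ->
  exists Ts, Forall2 (gathers k pi) M Ts /\ outs (eval p (output_cmd d) t) (pi ++ out_blocks (assemble [] Ts)).
Proof.
  intros Hord Hst HE HO HPC. pose proof (perm_length k pi Hpi) as HL.
  set (t1 := eval p put_order_cmd t).
  change (eval p (output_cmd d) t) with (eval p (CFor vI (LP pN) (meeting_cmd d)) (set_var t1 vPS (vr t1 vO))).
  assert (H1 : (fun c u => outs u (firstn c pi) /\ order_in u) (lm p (LP pK)) t1).
  { apply (for_inv p vJ (LP pK) _ t (fun c u => outs u (firstn c pi) /\ order_in u)).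
    - split; auto. split; [rewrite HO; reflexivity|]. intros i Hi. simpl in Hi. lia.
    - intros c u Hc (A1 & A2). cbn [lm] in Hc. rewrite HpK in Hc. split.
      + rewrite (firstn_succ _ 0) by lia. rewrite <- (A2 c Hc).
        assert (A3 : outs (set_var u vJ c) (firstn c pi)) by exact A1.
        apply (put_out_ok _ _ (EA aP (vJ :+ 1))) in A3. cbn [ex] in A3. exact A3.
      + intros i Hi. rewrite put_out_fld by discriminate. ev. auto. }
  destruct H1 as (H1 & H2). cbn [lm] in H1. rewrite HpK, firstn_all2 in H1 by lia.
  set (t2 := set_var t1 vPS (vr t1 vO)).
  assert (Hm0 : meeting_inv pi [] t2).
  { split; [exact H1|]. split; [exists pi; split; [now rewrite app_nil_r|]; apply H1|].
    split; [unfold t2, t1; ev; now rewrite frame_var|]. split; [simpl; lia|].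
    split; [intros x; unfold t2, t1; ev; now rewrite frame_fld|]. split; [exact H2|].
    eapply static_eq; [exact Hst|]. intros x. unfold t2, t1. ev. now rewrite frame_fld. }
  assert (HI : (fun c u => exists Ts, Forall2 (gathers k pi) (firstn c M) Ts /\ meeting_inv (pi ++ out_blocks (assemble [] Ts)) (last Ts []) u)
     (lm p (LP pN)) (eval p (CFor vI (LP pN) (meeting_cmd d)) t2)).
  { apply (for_inv p vI (LP pN) _ t2 (fun c u => exists Ts, Forall2 (gathers k pi) (firstn c M) Ts /\
       meeting_inv (pi ++ out_blocks (assemble [] Ts)) (last Ts []) u)).
    - exists []. split; [constructor|]. cbn [assemble out_blocks map concat last]. now rewrite app_nil_r.
    - intros c u Hc (Ts & A1 & A2). cbn [lm] in Hc. rewrite HpN in Hc.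
      assert (A3 : meeting_inv (pi ++ out_blocks (assemble [] Ts)) (last Ts []) (set_var u vI c)) by exact A2.
      destruct (meeting_ok _ _ (set_var u vI c) c Hc eq_refl A3) as (T & B1 & B2).
      exists (Ts ++ [T]). split.
      + replace (firstn (S c) M) with (firstn c M ++ [nth c M []]); [now apply Forall2_app; auto|].
        symmetry. now apply firstn_succ.
      + rewrite assemble_snoc, out_blocks_snoc, last_last, app_assoc. exact B2. }
  cbn [lm] in HI. rewrite HpN, firstn_all in HI. destruct HI as (Ts & A1 & A2). exists Ts. split; auto. apply A2.
Qed.

End Output.

(** * Parsing and running time *)

Section Parse.
Context (d k : nat) (M : list (list nat)) (p : par -> nat).
Context (Hd : 2 <= d) (HM : storyline_instance k M) (HMd : meetings_at_most d M).
Notation n := (length M).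
Notation edge j := (nth j M []).
Notation enc := (encode_instance k M).

Definition body_of (l : list (list nat)) := concat (map (fun m => length m :: m) l).
Definition offset j := 2 + length (body_of (firstn j M)).

Lemma body_app l l' : body_of (l ++ l') = body_of l ++ body_of l'.
Proof. unfold body_of. now rewrite map_app, concat_app. Qed.

Lemma firstn_S_edge j : j < n -> firstn (S j) M = firstn j M ++ [edge j].
Proof. apply firstn_succ. Qed.

Lemma offset_S j : j < n -> offset (S j) = offset j + (1 + length (edge j)).
Proof.
  intros Hj. unfold offset. rewrite firstn_S_edge, body_app, length_app by auto. unfold body_of. simpl.
  rewrite app_nil_r. simpl. lia.
Qed.

Lemma enc_at j : j < n -> enc_inp enc (offset j) = length (edge j) /\
  forall c, c < length (edge j) -> enc_inp enc (offset j + (1 + c)) = nth c (edge j) 0.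
Proof.
  intros Hj.
  assert (E : enc = ([k; n] ++ body_of (firstn j M)) ++ (length (edge j) :: edge j) ++ body_of (skipn (S j) M)).
  { unfold encode_instance. rewrite <- (firstn_skipn (S j) M) at 2. fold (body_of (firstn (S j) M ++ skipn (S j) M)).
    rewrite firstn_S_edge, !body_app by auto. unfold body_of at 2. simpl. now rewrite app_nil_r, <- !app_assoc. }
  assert (HO : length ([k; n] ++ body_of (firstn j M)) = offset j) by reflexivity.
  assert (Hnth : forall x, 2 <= x -> enc_inp enc x = nth x enc 0).
  { intros x Hx. unfold enc_inp. destruct (Nat.eqb_spec x 1); auto; lia. }
  split.
  - rewrite Hnth by (unfold offset; lia). rewrite E, app_nth2 by lia. now rewrite HO, Nat.sub_diag.
  - intros c Hc. rewrite Hnth by (unfold offset; lia). rewrite E, app_nth2 by lia. rewrite HO.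
    replace (offset j + (1 + c) - offset j) with (S c) by lia. cbn [app nth]. now rewrite app_nth1.
Qed.

Lemma enc_end : enc_inp enc (offset n) = 0.
Proof.
  unfold enc_inp. destruct (Nat.eqb_spec (offset n) 1); auto. apply nth_overflow.
  unfold offset. rewrite firstn_all. reflexivity.
Qed.

Definition parsed i s := vr s vPtr = offset i /\ vr s vN = i /\ (forall x, ar s aI x = enc_inp enc x) /\
  (forall j c, j < i -> c < d -> ar s aM (d * j + c) = mm M j c) /\ (forall x, d * i <= x -> ar s aM x = 0).

(** There are no more meetings than input cells, so [pL] rounds suffice; once all meetings are read,
    the remaining rounds find a zero length behind the input and do nothing. *)
Lemma parse_ok s : p pL = length enc -> vr s vN = 0 -> (forall x, ar s aI x = enc_inp enc x) -> (forall x, ar s aM x = 0) ->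
  parsed n (eval p (parse_cmd d) s).
Proof.
  intros HL HN HI HA. set (s1 := set_var s vPtr (ex p s 2)).
  change (eval p (parse_cmd d) s) with (eval p (CFor vI (LP pL) (parse_body d)) s1).
  assert (Hn : n <= length enc).
  { unfold encode_instance. cbn [length]. clear. induction M as [|x l IH]; simpl; [lia|]. rewrite length_app. lia. }
  assert (HP : (fun i u => parsed (Nat.min i n) u) (lm p (LP pL)) (eval p (CFor vI (LP pL) (parse_body d)) s1)).
  { apply (for_inv p vI (LP pL) _ s1 (fun i u => parsed (Nat.min i n) u)).
    - split; [reflexivity|]. split; [exact HN|]. split; [exact HI|]. split; [intros; lia|]. intros x _. exact (HA x).
    - intros i u _ (A1 & A2 & A3 & A4 & A5). set (u1 := set_var u vI i).
      assert (Hz : ex p u1 (EA aI vPtr) = enc_inp enc (offset (Nat.min i n))) by (unfold u1; ev; now rewrite A1, A3).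
      unfold parse_body. cbn [eval]. rewrite Hz.
      destruct (le_lt_dec n i) as [Hi|Hi].
      + replace (Nat.min (S i) n) with n by lia. replace (Nat.min i n) with n in * by lia.
        rewrite enc_end. cbn [Nat.eqb]. split; [auto|]. split; [auto|]. auto.
      + replace (Nat.min (S i) n) with (S i) by lia. replace (Nat.min i n) with i in * by lia.
        destruct (enc_at i Hi) as (E1 & E2). destruct (edge_facts d k M HM HMd i Hi) as (_ & El & _).
        rewrite E1. destruct (Nat.eqb_spec (length (edge i)) 0); [lia|].
        set (J := fun c v => vr v vPtr = offset i /\ vr v vN = i /\ (forall x, ar v aI x = enc_inp enc x) /\
            (forall j c', j < i -> c' < d -> ar v aM (d * j + c') = mm M j c') /\
            (forall c', c' < c -> ar v aM (d * i + c') = mm M i c') /\ (forall x, d * i + c <= x -> ar v aM x = 0)).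
        assert (HJ : J (lm p (LN d)) (eval p (parse_inner d) u1)).
        { apply (for_inv p vC (LN d) _ u1 J); unfold J.
          - unfold u1. ev. repeat split; auto; try (intros; lia). intros x Hx. apply A5. lia.
          - intros c v Hc (B1 & B2 & B3 & B4 & B5 & B6). cbn [lm] in Hc. ev. rewrite B1, B3, E1.
            destruct (Nat.eqb_spec (length (edge i) - c) 0) as [E|E].
            + ev. split; [auto|split; [auto|split; [auto|split; [auto|split]]]].
              * intros c' Hc'. destruct (Nat.eq_dec c' c) as [->|]; [|apply B5; lia].
                rewrite B6 by lia. unfold mm. rewrite nth_overflow by lia. auto.
              * intros x Hx. apply B6. lia.
            + ev. rewrite ?B1, ?B2, ?B3, ?E2 by lia. split; [auto|split; [auto|split; [auto|split; [|split]]]].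
              * intros j c' Hj Hc'. destruct (Nat.eqb_spec (d * j + c') (d * i + c)); [nia|]. auto.
              * intros c' Hc'. destruct (Nat.eqb_spec (d * i + c') (d * i + c)).
                -- replace c' with c by lia. reflexivity.
                -- apply B5. lia.
              * intros x Hx. destruct (Nat.eqb_spec x (d * i + c)); [lia|]. apply B6. lia. }
        cbn [lm] in HJ. destruct HJ as (B1 & B2 & B3 & B4 & B5 & B6).
        set (w := eval p (parse_inner d) u1) in *. clearbody w.
        split; [ev; rewrite B1, B3, E1, offset_S by auto; reflexivity|].
        split; [ev; rewrite B2; lia|]. split; [auto|]. split.
        * intros j c Hj Hc. ev. destruct (Nat.eq_dec j i) as [->|]; [apply B5; auto|apply B4; auto; lia].
        * intros x Hx. ev. apply B6. nia. }
  cbn [lm] in HP. rewrite HL in HP. replace (Nat.min (length enc) n) with n in HP by lia. exact HP.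
Qed.

End Parse.

Lemma seq_nth_id k : forall i, i < k -> nth i (seq 1 k) 0 = i + 1.
Proof. intros i Hi. rewrite seq_nth by auto. lia. Qed.

Lemma order_mod d : (forall v, v = vO \/ v = vPC -> mod_var (order_cmd d) v = false) /\
  (forall f, f = aE \/ f = aM -> mod_fld (order_cmd d) f = false).
Proof.
  split.
  - intros v Hv. unfold order_cmd, step_cmd, extend_cmd. cbn [mod_var].
    rewrite all_cands_mod_var by (destruct Hv as [-> | ->]; reflexivity). destruct Hv as [-> | ->]; reflexivity.
  - intros f Hf. unfold order_cmd, step_cmd, extend_cmd. cbn [mod_fld].
    rewrite all_cands_mod_fld by (destruct Hf as [-> | ->]; try reflexivity; discriminate). destruct Hf as [-> | ->]; reflexivity.
Qed.

Definition good_order (M : list (list nat)) (pi : list nat) := exists ps, pi = concat ps /\ pieces_ok M [0] ps.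

Lemma order_phase_ok d k M p s : 2 <= d -> storyline_instance k M -> meetings_at_most d M ->
  p pN = length M -> p pK = k -> p pK1 = k + 1 -> p pD = d * length M + 1 -> 2 * k + 1 + S d * length M <= p pS ->
  vr s vB = 1 -> vr s vQ = 1 -> vr s vP = 1 -> ar s aP 0 = 0 -> ar s aS 0 = 1 -> (forall x, x <> 0 -> ar s aS x = 0) ->
  (forall j, ar s aK j = 0) -> static d M s ->
  exists pi, is_perm k pi /\ good_order M pi /\ order_in k pi (eval p (order_cmd d) s).
Proof.
  intros Hd HM HMd H1 H2 H3 H4 H5 HB HQ HP HP0 HS0 HS HK Hst.
  destruct (order_ok d k M p Hd HM HMd H1 H2 H3 H4 s [] [] 1) as (ps & cur & Hi).
  { split; [|split; [lia|split; [intros; lia|split; [exact I|split; [|split]]]]].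
    - split; [split; [repeat constructor; intros []|now left]|]. split; [intros x [<-|[]]; lia|].
      split; [|split; [|auto]].
      + split; [auto|]. split; [auto|]. split; [|auto]. intros i Hi. simpl in Hi. assert (i = 0) by lia. now subst.
      + intros x. simpl. destruct (Nat.eqb_spec x 0) as [->|]; auto.
    - split; [intros h _ x y z []|intros A x y []].
    - intros j _ H. rewrite HK in H. tauto.
    - simpl. lia. }
  { unfold potential. cbn [concat app length].
    assert (sumf (fun j => unfinished [0] (nth j M []) + b2n (ar s aK j =? 0)) (seq 0 (length M)) <= sumf (fun _ => S d) (seq 0 (length M))).
    { apply sumf_le. intros j Hj. apply in_seq in Hj. rewrite HK. cbn [Nat.eqb b2n]. unfold unfinished.
      destruct (edge_facts d k M HM HMd j ltac:(lia)) as (_ & Hl & _).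
      match goal with |- ?a + 1 <= _ => assert (a <= length (nth j M [])) by (apply filter_length_le) end. lia. }
    rewrite sumf_const, length_seq in H. lia. }
  destruct Hi as ((Hwf & Hk & (HB' & HQ' & HP' & _) & _ & _) & _ & Hpl & Hps & Hpc & _ & _).
  set (t := eval p (order_cmd d) s) in *. clearbody t.
  assert (E : ([0] ++ concat ps) ++ cur = 0 :: concat (ps ++ [cur])).
  { rewrite concat_app. simpl. now rewrite app_nil_r. }
  assert (HwfD : NoDup (([0] ++ concat ps) ++ cur)) by apply Hwf.
  rewrite E in *. set (pi := concat (ps ++ [cur])) in *.
  inversion_clear HwfD.
  assert (Hpi : is_perm k pi).
  { apply NoDup_Permutation; auto; [apply seq_NoDup|]. intros x. rewrite in_seq. split.
    - intros Hx. assert (x <> 0) by (intros ->; tauto). specialize (Hk x (or_intror Hx)). lia.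
    - intros Hx. destruct (Hpl x ltac:(lia)); [lia|auto]. }
  exists pi. split; auto. split.
  (* The last piece is closed because all characters are placed, so that no meeting has a member
     left to absorb. *)
  - exists (ps ++ [cur]). split; auto. apply pieces_ok_snoc; auto.
    intros e He (_ & y & Hy & Hny). exfalso. apply Hny.
    apply (In_nth _ _ []) in He as (j & Hj & <-). destruct (edge_facts d k M HM HMd j Hj) as (_ & _ & Her).
    apply Her in Hy. rewrite E. apply Hpl. lia.
  - intros i Hi. assert (Hl : length pi = k) by (rewrite (Permutation_length Hpi); apply length_seq).
    rewrite HP' by (simpl; lia). now rewrite Nat.add_1_r.
Qed.

Lemma fill_ok p s k : p pK1 = k + 1 -> order_in k (seq 1 k) (eval p fill_cmd s).
Proof.
  intros H.
  assert (HI : forall i, i < lm p (LP pK1) -> ar (eval p fill_cmd s) aP i = i).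
  { apply (for_inv p vJ (LP pK1) _ s (fun c u => forall i, i < c -> ar u aP i = i)); [intros; lia|].
    intros c u Hc A i Hi. ev. destruct (Nat.eqb_spec i c); auto. apply A. lia. }
  intros i Hi. cbn [lm] in HI. rewrite HI by lia. now rewrite seq_nth_id.
Qed.

(** * Running time *)

Section Bounds.
Context (d N1 : nat) (p : par -> nat) (Hd : 2 <= d) (HN : p pN <= N1) (HD : p pD <= d * N1) (H1 : 1 <= N1).

Lemma write_bound l : forall t, tick_bound p (write_cmd t l) = 0.
Proof. induction l as [|i l IH]; intros t; simpl; auto. Qed.

Lemma all_cands_bound L : tick_bound p (all_cands d L) <= length L * (5 * d * N1).
Proof.
  induction L as [|l L IH]; [simpl; lia|]. unfold all_cands, guard_cmd, cand_cmd in *.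
  cbn [fold_right tick_bound length]. rewrite write_bound.
  assert (E : tick_bound p shift_cmd = p pD * 1 /\ tick_bound p (setpos_cmd aC (vQ :+ vM)) = p pD * 1 /\
    tick_bound p (test_cmd d) = p pN * (1 + d * 1) /\ tick_bound p commit_cmd = p pD * 1).
  { repeat split; cbn -[Nat.mul]; lia. }
  destruct E as (-> & -> & -> & ->).
  assert (p pN * (1 + d * 1) <= N1 * (1 + d * 1)) by (now apply Nat.mul_le_mono_r).
  assert (N1 <= d * N1) by nia. lia.
Qed.

Lemma step_bound : tick_bound p (step_cmd d) <= (length (tables d) * (5 * d) + 20 * d) * N1.
Proof.
  unfold step_cmd, extend_cmd. cbn [tick_bound]. pose proof (all_cands_bound (tables d)).
  assert (E : tick_bound p (find_cmd d) = p pN * (1 + d * 1) /\ tick_bound p (window_cmd d) = d * 1 + ((8 * d + 1) * 1 + d * 1) /\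
    tick_bound p (undo_cmd d) = d * 1 + p pD * 1 /\ tick_bound p next_piece_cmd = p pN * 1).
  { repeat split; cbn -[Nat.mul]; lia. }
  destruct E as (-> & -> & -> & ->).
  assert (p pN * (1 + d * 1) <= N1 * (1 + d * 1)) by (now apply Nat.mul_le_mono_r).
  assert (N1 <= d * N1) by nia. assert (d <= d * N1) by nia. lia.
Qed.

End Bounds.

Lemma output_bound d p : tick_bound p (ident_cmd d;; output_cmd d) = p pK1 + (p pK + p pN * (1 + (3 * d + p pK))).
Proof. cbn -[Nat.mul]. lia. Qed.

(** The critical product is [pS * n]. Either no step is made, or [n] is at most [2 * d * k], so that
    [pS] is O(k) up to an additive constant. The first hypothesis lets terms linear in [n] be
    absorbed. *)
Lemma time_arith k n d A L : (n = 0 \/ 1 <= k) -> L <= 2 + S d * n ->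
  forall pS, pS = 0 \/ (n <= 2 * d * k /\ pS <= 2 * k + 1 + S d * n) ->
  1 + L + (7 + L * (1 + d) + pS * (1 + A * (n + 1)) + (k + 1) + (k + n * (1 + (3 * d + k)))) + (k + n * (1 + 6 * d)) <=
  (100 * d * d * (A + 1) + 100 * (A + 1) + 100 * d * (A + 1)) * (k * (n + 1) + 1).
Proof.
  intros Hk HL pS HS. set (X := k * (n + 1) + 1).
  assert (Hn : n <= X). { unfold X. destruct Hk as [->|Hk]; [lia|nia]. }
  assert (Hkx : k <= X) by (unfold X; nia).
  assert (Hnk : n * k <= X) by (unfold X; nia).
  assert (H1 : 1 <= X) by (unfold X; lia).
  assert (Hdn : S d * n <= S d * X) by (now apply Nat.mul_le_mono_l).
  assert (HLX : L <= (3 + d) * X) by (replace ((3 + d) * X) with (2 * X + S d * X) by ring; lia).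
  assert (HPS : pS * (n + 1) <= (4 + 2 * d * S d) * X).
  { destruct HS as [->|(HS1 & HS2)]; [lia|].
    assert (pS <= 2 * k + 1 + S d * (2 * d * k)) by (eapply Nat.le_trans; [exact HS2|]; apply Nat.add_le_mono_l, Nat.mul_le_mono_l; auto).
    assert (pS * (n + 1) <= (2 * k + 1 + S d * (2 * d * k)) * (n + 1)) by (now apply Nat.mul_le_mono_r).
    assert (k * (n + 1) <= X) by (unfold X; lia).
    replace ((2 * k + 1 + S d * (2 * d * k)) * (n + 1)) with (2 * (k * (n + 1)) + (n + 1) + 2 * d * S d * (k * (n + 1))) in H0 by ring.
    assert (2 * d * S d * (k * (n + 1)) <= 2 * d * S d * X) by (now apply Nat.mul_le_mono_l).
    rewrite Nat.mul_add_distr_r. lia. }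
  assert (HPS2 : pS * 1 <= pS * (n + 1)) by (apply Nat.mul_le_mono_l; lia).
  set (w := A + 1). set (v := w * d). set (u := v * d).
  assert (HA : pS * (1 + A * (n + 1)) <= 4 * w * X + 2 * v * X + 2 * u * X).
  { replace (pS * (1 + A * (n + 1))) with (pS * 1 + A * (pS * (n + 1))) by ring.
    assert (A * (pS * (n + 1)) <= A * ((4 + 2 * d * S d) * X)) by (now apply Nat.mul_le_mono_l).
    replace (4 * w * X + 2 * v * X + 2 * u * X) with ((4 + 2 * d * S d) * X + A * ((4 + 2 * d * S d) * X)) by (unfold u, v, w; ring).
    lia. }
  assert (HL2 : L * (1 + d) <= (3 + 4 * d + d * d) * X).
  { eapply Nat.le_trans; [apply Nat.mul_le_mono_r, HLX|]. apply Nat.eq_le_incl. ring. }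
  assert (Hnd : n * (1 + (3 * d + k)) <= (2 + 3 * d) * X).
  { replace (n * (1 + (3 * d + k))) with (n * (1 + 3 * d) + n * k) by ring.
    assert (n * (1 + 3 * d) <= X * (1 + 3 * d)) by (now apply Nat.mul_le_mono_r).
    replace ((2 + 3 * d) * X) with (X * (1 + 3 * d) + X) by ring. lia. }
  assert (Hnd2 : n * (1 + 6 * d) <= X * (1 + 6 * d)) by (now apply Nat.mul_le_mono_r).
  assert (Hw : 1 * X <= w * X) by (apply Nat.mul_le_mono_r; unfold w; lia).
  assert (Hv : d * X <= v * X) by (apply Nat.mul_le_mono_r; unfold v, w; rewrite Nat.mul_add_distr_r; lia).
  assert (Hu : d * d * X <= u * X) by (apply Nat.mul_le_mono_r, Nat.mul_le_mono_r; unfold v, w; rewrite Nat.mul_add_distr_r; lia).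
  replace ((100 * d * d * (A + 1) + 100 * (A + 1) + 100 * d * (A + 1)) * X) with (100 * (u * X) + 100 * (w * X) + 100 * (v * X)) by (unfold u, v, w; ring).
  replace (4 * w * X + 2 * v * X + 2 * u * X) with (4 * (w * X) + 2 * (v * X) + 2 * (u * X)) in HA by ring.
  replace ((3 + 4 * d + d * d) * X) with (3 * X + 4 * (d * X) + d * d * X) in HL2 by ring.
  replace ((2 + 3 * d) * X) with (2 * X + 3 * (d * X)) in Hnd by ring.
  replace (X * (1 + 6 * d)) with (X + 6 * (d * X)) in Hnd2 by ring.
  replace ((3 + d) * X) with (3 * X + d * X) in HLX by ring.
  lia.
Qed.

Lemma body_length d k M : storyline_instance k M -> meetings_at_most d M ->
  length (encode_instance k M) <= 2 + S d * length M.
Proof.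
  intros _ H. unfold encode_instance. cbn [length]. induction H as [|m M Hm H IH]; simpl in *; [lia|].
  rewrite length_app in *. lia.
Qed.

Lemma flat_total Bs : length (out_blocks Bs) = length Bs + 3 * list_sum (map (@length triple) Bs).
Proof.
  induction Bs as [|B Bs IH]; [reflexivity|]. unfold out_blocks in *. cbn [map concat length list_sum fold_right app].
  rewrite length_app, flat_length, IH. unfold list_sum. lia.
Qed.

Theorem machine_ok d : 2 <= d -> exists C, forall k M,
  storyline_instance k M -> meetings_at_most d M ->
  exists mem pi Ts,
    run (ram_program d (phases d)) (C * (k * (length M + 1) + 1)) 0 (init_mem (encode_instance k M)) = Some mem /\
    read_output mem = pi ++ out_blocks (assemble [] Ts) /\
    is_perm k pi /\ Forall2 (gathers k pi) M Ts /\ (2 * d * k < length M \/ good_order M pi).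
Proof.
  intros Hd. destruct (ram_main d (phases d)) as (C0 & HC0).
  set (A := length (tables d) * (5 * d) + 20 * d).
  exists (C0 * (100 * d * d * (A + 1) + 100 * (A + 1) + 100 * d * (A + 1))).
  intros k M HM HMd. destruct (HC0 k M HM HMd) as (mem & Hrun & Hout). clear HC0.
  set (n := length M) in *. set (enc := encode_instance k M) in *.
  set (p0 := init_par (length enc)) in *. set (s0 := init_st enc) in *.
  set (s1 := eval p0 (parse_cmd d) s0). set (p1 := set_par p0 pN (vr s1 vN)).
  set (p2 := set_par p1 pK (ar s1 aI 0)). set (p3 := set_par p2 pK1 (p2 pK + 1)).
  set (p4 := set_par p3 pD (d * p3 pN + 1)). set (s5 := eval p4 (init_cmd d) s1).
  set (p5 := set_par p4 pS (vr s5 vS)). set (s6 := eval p5 (order_cmd d) s5). set (p6 := set_par p5 pL 0).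
  assert (HE : snd (phases_eval (phases d) p0 s0) = eval p6 (ident_cmd d;; output_cmd d) s6) by reflexivity.
  assert (HTk : phases_ticks (phases d) p0 s0 = 1 + tick_bound p0 (parse_cmd d) + (1 + 0 + (1 + 0 + (1 + 0 +
     (1 + tick_bound p4 (init_cmd d) + (1 + tick_bound p5 (order_cmd d) + (1 + tick_bound p6 (ident_cmd d;; output_cmd d) + 0))))))) by reflexivity.
  destruct (parse_ok d k M p0 Hd HM HMd s0) as (Q1 & Q2 & Q3 & Q4 & _); auto.
  fold n s1 in Q1, Q2, Q3, Q4.
  assert (Hk0 : ar s1 aI 0 = k) by (rewrite Q3; reflexivity).
  assert (Hst1 : static d M s1) by (intros j c Hj Hc; now apply Q4).
  assert (F1 : forall f x, f <> aM -> ar s1 f x = ar s0 f x).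
  { intros f x Hf. unfold s1. apply frame_fld. destruct f; auto; congruence. }
  assert (V1 : vr s1 vO = 0 /\ vr s1 vPC = 0) by (unfold s1; rewrite !frame_var by reflexivity; auto).
  assert (P4 : p4 pN = n /\ p4 pK = k /\ p4 pK1 = k + 1 /\ p4 pD = d * n + 1).
  { unfold p4, p3, p2, p1, set_par. cbn [par_beq]. rewrite Q2, Hk0. auto. }
  clearbody s1. destruct P4 as (P4N & P4K & P4K1 & P4D).
  assert (P5 : p5 pN = n /\ p5 pK = k /\ p5 pK1 = k + 1 /\ p5 pD = d * n + 1 /\ p5 pS = vr s5 vS).
  { unfold p5, set_par. cbn [par_beq]. auto. }
  destruct P5 as (P5N & P5K & P5K1 & P5D & P5S).
  assert (P6 : p6 pN = n /\ p6 pK = k /\ p6 pK1 = k + 1) by (unfold p6, set_par; cbn [par_beq]; auto).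
  destruct P6 as (P6N & P6K & P6K1).
  assert (H5 : vr s5 vB = 1 /\ vr s5 vQ = 1 /\ vr s5 vP = 1 /\ ar s5 aP 0 = 0 /\ ar s5 aS 0 = 1 /\
     (forall x, x <> 0 -> ar s5 aS x = 0) /\ (forall j, ar s5 aK j = 0) /\ static d M s5 /\
     vr s5 vO = 0 /\ vr s5 vPC = 0 /\ (forall x, ar s5 aE x = 0) /\
     vr s5 vS = if n - 2 * d * k =? 0 then 2 * k + 1 + S d * n else 0).
  { unfold s5, init_cmd. cbn [eval ex]. rewrite P4N, P4K.
    destruct (Nat.eqb_spec (n - 2 * d * k) 0); ev; rewrite ?P4N, ?P4K, ?F1 by discriminate; cbn [Nat.eqb];
      (split; [auto|split; [auto|split; [auto|split; [auto|split; [auto|split; [|split; [|split; [exact Hst1|split; [apply V1|split; [apply V1|split; [|auto]]]]]]]]]]]).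
    all: try (intros x; rewrite F1 by discriminate; reflexivity).
    all: intros x Hx; destruct (Nat.eqb_spec x 0); [tauto|]; rewrite F1 by discriminate; reflexivity. }
  destruct H5 as (B1 & B2 & B3 & B4 & B5 & B6 & B7 & B8 & B9 & B10 & B11 & B12).
  destruct (order_mod d) as (OV & OF).
  assert (V6 : vr s6 vO = 0 /\ vr s6 vPC = 0) by (unfold s6; rewrite !frame_var by auto; auto).
  assert (F6 : (forall x, ar s6 aE x = 0) /\ static d M s6).
  { split; [intros x; unfold s6; rewrite frame_fld by auto; auto|]. eapply static_eq; [exact B8|].
    intros x. unfold s6. now rewrite frame_fld by auto. }
  assert (HS5 : p5 pS = 0 \/ (n <= 2 * d * k /\ p5 pS <= 2 * k + 1 + S d * n)).
  { rewrite P5S, B12. destruct (Nat.eqb_spec (n - 2 * d * k) 0); [right; lia|now left]. }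
  assert (Hpi : exists pi, is_perm k pi /\ (2 * d * k < n \/ good_order M pi) /\ order_in k pi (eval p6 (ident_cmd d) s6)).
  { unfold ident_cmd. cbn [eval ex]. rewrite P6N, P6K. destruct (Nat.eqb_spec (n - 2 * d * k) 0) as [E|E].
    - destruct (order_phase_ok d k M p5 s5 Hd HM HMd) as (pi & I1 & I2 & I3); auto.
      + fold n. rewrite P5S, B12. destruct (Nat.eqb_spec (n - 2 * d * k) 0); [lia|tauto].
      + exists pi. auto.
    - exists (seq 1 k). split; [apply Permutation_refl|]. split; [left; lia|]. now apply fill_ok. }
  destruct Hpi as (pi & I1 & I2 & I3).
  set (s7 := eval p6 (ident_cmd d) s6) in *.
  assert (F7 : (forall x, ar s7 aE x = 0) /\ static d M s7 /\ vr s7 vO = 0 /\ vr s7 vPC = 0).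
  { split; [intros x; unfold s7; rewrite frame_fld by reflexivity; apply F6|].
    split; [eapply static_eq; [apply F6|]; intros x; unfold s7; now rewrite frame_fld|].
    unfold s7. rewrite !frame_var by reflexivity. auto. }
  destruct F7 as (F7 & F8 & F9 & F10).
  destruct (output_ok d k M p6 pi Hd HM HMd P6N P6K I1 s7 I3 F8 F7 F9 F10) as (Ts & T1 & (T2 & T3)).
  change (eval p6 (ident_cmd d;; output_cmd d) s6) with (eval p6 (output_cmd d) s7) in HE.
  rewrite HE in *.
  assert (HTl : length Ts = n) by (symmetry; exact (Forall2_length T1)).
  assert (HTs : list_sum (map (@length triple) Ts) <= n * d).
  { rewrite <- HTl. clear - T1 HMd. unfold meetings_at_most in HMd. revert HMd. induction T1 as [|e T l Ts HT H IH]; intros HMd; simpl; [lia|].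
    inversion_clear HMd. apply gathers_length in HT. specialize (IH H1). lia. }
  assert (Hpl : length pi = k) by (rewrite (Permutation_length I1); apply length_seq).
  assert (HvO : vr (eval p6 (output_cmd d) s7) vO <= k + n * (1 + 6 * d)).
  { rewrite T2, length_app, flat_total, assemble_length. pose proof (assemble_cost Ts []). simpl in H. lia. }
  exists mem, pi, Ts. split; [|split; [|auto]].
  - apply Hrun. rewrite HTk. rewrite <- Nat.mul_assoc. apply Nat.mul_le_mono_l.
    assert (HnK : n = 0 \/ 1 <= k).
    { destruct (Nat.eq_dec n 0); [now left|right]. destruct (edge_facts d k M HM HMd 0 ltac:(fold n; lia)) as (_ & Hl & Her).
      destruct (nth 0 M []) as [|x e]; [simpl in Hl; lia|]. specialize (Her x (or_introl eq_refl)). lia. }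
    pose proof (time_arith k n d A (length enc) HnK (body_length d k M HM HMd) (p5 pS) HS5) as HTA.
    eapply Nat.le_trans; [|exact HTA].
    rewrite output_bound, P6N, P6K, P6K1.
    assert (TP : tick_bound p0 (parse_cmd d) = length enc * (1 + d)).
    { cbn -[Nat.mul]. change (p0 pL) with (length enc). rewrite Nat.mul_1_r. f_equal. lia. }
    assert (TI : tick_bound p4 (init_cmd d) = 0) by reflexivity.
    assert (TO : tick_bound p5 (order_cmd d) <= p5 pS * (1 + A * (n + 1))).
    { unfold order_cmd. cbn [tick_bound lm]. apply Nat.mul_le_mono_l, le_n_S. apply step_bound; auto; try lia. }
    lia.
  - rewrite Hout. rewrite T2. symmetry. apply (nth_ext _ _ 0 0); [now rewrite length_map, length_seq|].
    intros i Hi. rewrite <- T3 by auto.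
    rewrite (nth_indep _ 0 (ar (eval p6 (output_cmd d) s7) aO 0)) by (rewrite length_map, length_seq; auto).
    rewrite (map_nth (ar (eval p6 (output_cmd d) s7) aO)). now rewrite seq_nth.
Qed.

(** * Cuts of a competing solution *)

Fixpoint adj (l : list nat) (x y : nat) : Prop :=
  match l with
  | a :: l' => (x = a /\ exists r, l' = y :: r) \/ adj l' x y
  | [] => False
  end.

Lemma adj_nth l x y : adj l x y <-> exists i, S i < length l /\ nth i l 0 = x /\ nth (S i) l 0 = y.
Proof.
  induction l as [|a l IH]; cbn [adj].
  - split; [tauto|]. intros (i & H & _). simpl in H. lia.
  - rewrite IH. split.
    + intros [(-> & r & ->)|(i & H1 & H2 & H3)].
      * exists 0. simpl. repeat split; lia.
      * exists (S i). simpl in *. repeat split; auto; lia.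
    + intros (i & H1 & H2 & H3). destruct i as [|i].
      * left. simpl in *. split; auto. destruct l as [|b l]; simpl in *; [lia|]. subst. eauto.
      * right. exists i. simpl in *. repeat split; auto; lia.
Qed.

Lemma adj_app_l L1 L2 x y : adj L1 x y -> adj (L1 ++ L2) x y.
Proof.
  induction L1 as [|a L1 IH]; simpl; [tauto|]. intros [(-> & r & ->)|H]; auto. left. split; auto. simpl. eauto.
Qed.

Lemma adj_app_r L1 L2 x y : adj L2 x y -> adj (L1 ++ L2) x y.
Proof. induction L1 as [|a L1 IH]; simpl; auto. Qed.

Lemma adj_app L1 L2 x y : adj (L1 ++ L2) x y -> adj L1 x y \/ adj L2 x y \/ (L1 <> [] /\ x = last L1 0).
Proof.
  induction L1 as [|a L1 IH]; simpl; [tauto|]. intros [(-> & r & E)|H].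
  - destruct L1 as [|b L1]; simpl in E.
    + right. right. split; [discriminate|reflexivity].
    + left. injection E as -> E. left. eauto.
  - destruct (IH H) as [|[|(H1 & H2)]]; auto. right. right. split; [discriminate|].
    destruct L1; [congruence|auto].
Qed.

(** In an exchange of [G] and [R] only the last elements of [A], [G] and [R] get another right
    neighbour. *)
Lemma adj_swap A G R Y x y : A <> [] -> adj (A ++ G ++ R ++ Y) x y -> x <> last A 0 -> (G <> [] -> x <> last G 0) -> (R <> [] -> x <> last R 0) ->
  adj (A ++ R ++ G ++ Y) x y.
Proof.
  intros HA H H1 H2 H3. apply adj_app in H as [H|[H|(_ & H)]]; [now apply adj_app_l| |tauto].
  apply adj_app_r. apply adj_app in H as [H|[H|(H0 & H)]].
  - now apply adj_app_r, adj_app_l.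
  - apply adj_app in H as [H|[H|(H0 & H)]].
    + now apply adj_app_l.
    + now apply adj_app_r, adj_app_r.
    + exfalso. now apply H3.
  - exfalso. now apply H2.
Qed.

(** The three block ends, in a list with a sentinel 0 in front; the sentinel serves as left
    neighbour when a crossing begins at the first position. *)
Definition brk (pi : list nat) (t : triple) : list nat :=
  let '(a, b, c) := t in [nth (a - 1) (0 :: pi) 0; nth b (0 :: pi) 0; nth c (0 :: pi) 0].

(* Left elements of the adjacencies of 0 :: pi that the crossings destroy. *)
Fixpoint broken (pi : list nat) (C : list triple) : list nat :=
  match C with [] => [] | t :: C' => brk pi t ++ broken (apply_bcs pi [t]) C' end.

Lemma broken_length C : forall pi, length (broken pi C) = 3 * length C.
Proof. induction C as [|((a & b) & c) C IH]; intros pi; simpl; auto. rewrite IH. lia. Qed.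

Lemma nth_last_app (l r : list nat) : l <> [] -> nth (length l - 1) (l ++ r) 0 = last l 0.
Proof.
  intros H. rewrite app_nth1 by (destruct l; simpl; [congruence|lia]).
  induction l as [|a l IH]; [congruence|]. destruct l as [|b l]; auto.
  change (last (a :: b :: l) 0) with (last (b :: l) 0). rewrite <- IH by discriminate. simpl. now rewrite Nat.sub_0_r.
Qed.

Lemma brk_shape (A G R Y : list nat) : G <> [] -> R <> [] ->
  brk (A ++ G ++ R ++ Y) (length A + 1, length A + length G, length A + length G + length R) = [last (0 :: A) 0; last G 0; last R 0].
Proof.
  intros HG HR. unfold brk. f_equal; [|f_equal; [|f_equal]].
  - rewrite <- (nth_last_app (0 :: A) (G ++ R ++ Y)) by discriminate. cbn [length app]. f_equal. lia.
  - rewrite <- (nth_last_app G (R ++ Y)) by auto.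
    assert (1 <= length G) by (destruct G; simpl; [congruence|lia]).
    change (0 :: A ++ G ++ R ++ Y) with ((0 :: A) ++ G ++ R ++ Y). rewrite app_nth2 by (simpl; lia). f_equal. simpl. lia.
  - rewrite <- (nth_last_app R Y) by auto.
    assert (1 <= length R) by (destruct R; simpl; [congruence|lia]).
    replace (0 :: A ++ G ++ R ++ Y) with (((0 :: A) ++ G) ++ R ++ Y) by (now rewrite <- app_assoc).
    rewrite app_nth2 by (rewrite length_app; simpl; lia). f_equal. rewrite length_app. simpl. lia.
Qed.

Lemma unbroken_step k pi t x y : length pi = k -> valid_bc k t -> ~ In x (brk pi t) ->
  adj (0 :: apply_bcs pi [t]) x y <-> adj (0 :: pi) x y.
Proof.
  intros Hl Hv Hx. destruct t as ((a & b) & c). destruct (bc_shape k pi a b c Hl Hv) as (A & G & R & Y & -> & HG & HR & -> & -> & ->).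
  rewrite brk_shape in Hx by auto. rewrite apply_one, bc_split by auto.
  assert (H1 : x <> last (0 :: A) 0) by (intros ->; apply Hx; now left).
  assert (H2 : x <> last G 0) by (intros ->; apply Hx; right; now left).
  assert (H3 : x <> last R 0) by (intros ->; apply Hx; right; right; now left).
  split; intros H; apply (adj_swap (0 :: A)) in H; auto; discriminate.
Qed.

Lemma unbroken k C x y : forall pi, length pi = k -> Forall (valid_bc k) C -> ~ In x (broken pi C) ->
  forall j, adj (0 :: apply_bcs pi (firstn j C)) x y <-> adj (0 :: pi) x y.
Proof.
  induction C as [|t C IH]; intros pi Hl HC Hx j; [now rewrite firstn_nil|].
  inversion_clear HC. cbn [broken] in Hx. rewrite in_app_iff in Hx. destruct j as [|j]; [reflexivity|].
  cbn [firstn]. change (t :: firstn j C) with ([t] ++ firstn j C). rewrite apply_app, IH; auto; [|now apply bc_length].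
  apply (unbroken_step k); auto.
Qed.

Section Touch.
Context (k d : nat) (pi0 : list nat) (C : list triple).
Context (Hpi : is_perm k pi0) (HC : Forall (valid_bc k) C).

Definition pos_in (x : nat) := idx pi0 x - 1.
(** As [idx] counts from 1 and positions count from 0, the index of a character is the cut just
    after its position; the sentinel yields cut 0. *)
Definition cuts := nodup Nat.eq_dec (map (idx pi0) (broken pi0 C)).

Lemma ext_ND l : Permutation l pi0 -> NoDup (0 :: l).
Proof. intros H. constructor; [rewrite H, (perm_in k pi0 Hpi); lia|rewrite H; apply (perm_NoDup k pi0 Hpi)]. Qed.

Lemma idx_ext q : q <= k -> idx pi0 (nth q (0 :: pi0) 0) = q.
Proof.
  intros Hq. pose proof (perm_length k pi0 Hpi). destruct q as [|q]; cbn [nth].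
  - apply idx_notin. rewrite (perm_in k pi0 Hpi). lia.
  - apply idx_nth; [apply (perm_NoDup k pi0 Hpi)|lia].
Qed.

Lemma ext_idx x : In x pi0 -> nth (idx pi0 x) (0 :: pi0) 0 = x /\ 1 <= idx pi0 x <= k.
Proof. intros H. apply idx_in in H as (i & H1 & H2 & ->). pose proof (perm_length k pi0 Hpi). split; [exact H2|lia]. Qed.

Lemma cut_in q : q <= k -> In (nth q (0 :: pi0) 0) (broken pi0 C) -> In q cuts.
Proof. intros Hq H. apply nodup_In. rewrite <- (idx_ext q Hq). now apply in_map. Qed.

Lemma pos_inj x y : In x pi0 -> In y pi0 -> pos_in x = pos_in y -> x = y.
Proof.
  intros Hx Hy H. unfold pos_in in H. apply (idx_inj pi0); auto.
  destruct (ext_idx x Hx) as (_ & A1). destruct (ext_idx y Hy) as (_ & A2). lia.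
Qed.

(* Starting from [e0], the meeting occupies around [pos_in e0] exactly the positions of its interval in the
   intermediate permutation, unless a cut is met first. *)
Lemma supports_interval f m1 e0 m2 l r j : NoDup f -> (forall x, In x f -> In x pi0) -> length f <= d ->
  apply_bcs pi0 (firstn j C) = l ++ (m1 ++ e0 :: m2) ++ r -> Permutation (m1 ++ e0 :: m2) f ->
  (forall q, In q cuts -> pos_in e0 < q -> q < pos_in e0 + d -> exists y, pos_in e0 <= y < q /\ ~ In y (map pos_in f)) ->
  (forall q, In q cuts -> q <= pos_in e0 -> S (pos_in e0) < q + d -> exists y, q <= y <= pos_in e0 /\ ~ In y (map pos_in f)) ->
  (forall i, i <= length m2 -> nth (S (pos_in e0) + i) (0 :: pi0) 0 = nth i (e0 :: m2) 0 /\ S (pos_in e0) + i <= k) /\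
  (forall i, i <= length m1 -> nth (S (pos_in e0) - i) (0 :: pi0) 0 = nth i (e0 :: rev m1) 0 /\ i <= pos_in e0).
Proof.
  intros NDf Hf Hd Heq Hp HR HL.
  assert (Hlen : length m1 + S (length m2) <= d) by (rewrite <- (Permutation_length Hp), length_app in Hd; exact Hd).
  assert (Hin : forall x, In x (m1 ++ e0 :: m2) -> In x f) by (intros x; now rewrite Hp).
  assert (He0 : In e0 pi0) by (apply Hf, Hin, in_or_app; right; now left).
  destruct (ext_idx e0 He0) as (E1 & E2).
  assert (Hpos : S (pos_in e0) = idx pi0 e0) by (unfold pos_in; lia).
  assert (HPt : Permutation (apply_bcs pi0 (firstn j C)) pi0).
  { apply (apply_bcs_perm k); [apply (perm_length k pi0 Hpi)|]. apply Forall_forall. intros t Ht. rewrite Forall_forall in HC. apply HC.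
    rewrite <- (firstn_skipn j C). apply in_or_app. auto. }
  pose proof (ext_ND _ HPt) as NDt. pose proof (ext_ND _ (Permutation_refl pi0)) as ND0.
  assert (Hunb : forall x y, ~ In x (broken pi0 C) -> (adj (0 :: apply_bcs pi0 (firstn j C)) x y <-> adj (0 :: pi0) x y)).
  { intros x y Hx. apply (unbroken k); auto. apply (perm_length k pi0 Hpi). }
  assert (Hpi' : forall q, 1 <= q <= k -> In (nth q (0 :: pi0) 0) f -> In (q - 1) (map pos_in f)).
  { intros q Hq Hqf. apply in_map_iff. exists (nth q (0 :: pi0) 0). split; auto. unfold pos_in. rewrite idx_ext by lia. reflexivity. }
  pose proof (perm_length k pi0 Hpi) as Hk0.
  set (ext := 0 :: apply_bcs pi0 (firstn j C)) in *.
  assert (Hext : ext = (0 :: l ++ m1) ++ (e0 :: m2) ++ r) by (unfold ext; rewrite Heq; simpl; now rewrite <- !app_assoc).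
  assert (Hlext : length ext = S (length l + length m1) + S (length m2) + length r).
  { rewrite Hext, !length_app. simpl. rewrite length_app. lia. }
  assert (Hright : forall i, i <= length m2 -> nth (S (length l + length m1) + i) ext 0 = nth i (e0 :: m2) 0).
  { intros i Hi. rewrite Hext, app_nth2 by (simpl; rewrite length_app; lia).
    rewrite app_nth1 by (simpl; rewrite length_app; lia). f_equal. simpl. rewrite length_app. lia. }
  assert (Hleft : forall i, i <= length m1 -> nth (S (length l + length m1) - i) ext 0 = nth i (e0 :: rev m1) 0).
  { intros [|i] Hi.
    - replace (S (length l + length m1) - 0) with (S (length l + length m1) + 0) by lia. rewrite Hright by lia. reflexivity.
    - cbn [nth]. rewrite rev_nth by lia. rewrite Hext. rewrite app_nth1 by (simpl; rewrite length_app; lia).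
      replace (S (length l + length m1) - S i) with (S (length l + (length m1 - S i))) by lia. cbn [nth].
      rewrite app_nth2 by lia. f_equal. lia. }
  assert (Hmem2 : forall i, i <= length m2 -> In (nth i (e0 :: m2) 0) f).
  { intros i Hi. apply Hin, in_or_app. right. apply nth_In. simpl. lia. }
  assert (Hmem1 : forall i, i <= length m1 -> In (nth i (e0 :: rev m1) 0) f).
  { intros [|i] Hi; [apply (Hmem2 0); lia|]. apply Hin, in_or_app. left. cbn [nth]. apply in_rev. apply nth_In. rewrite length_rev. lia. }
  split.
  - assert (HI : forall i, i <= length m2 -> forall u, u <= i -> nth (S (pos_in e0) + u) (0 :: pi0) 0 = nth u (e0 :: m2) 0 /\ S (pos_in e0) + u <= k).
    { induction i as [|i IH]; intros Hi u Hu.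
      - replace u with 0 by lia. rewrite Nat.add_0_r, Hpos. split; [exact E1|lia].
      - specialize (IH ltac:(lia)). destruct (Nat.eq_dec u (S i)) as [->|]; [|apply IH; lia].
        destruct (IH i ltac:(lia)) as (I1 & I2).
        set (q := S (pos_in e0) + i) in *. set (c := nth i (e0 :: m2) 0) in *.
        assert (Hadj : adj ext c (nth (S i) (e0 :: m2) 0)).
        { apply adj_nth. exists (S (length l + length m1) + i). split; [lia|]. split; [apply Hright; lia|].
          rewrite <- Nat.add_succ_r. apply Hright. lia. }
        (* Otherwise there is a cut at [q], and all positions from [pos_in e0] up to it belong to
           [f] by induction, which [HR] excludes. *)
        assert (Hnb : ~ In c (broken pi0 C)).
        { intros Hb. destruct (HR q) as (y & Hy1 & Hy2); try (unfold q; lia).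
          - apply cut_in; auto. now rewrite I1.
          - apply Hy2. destruct (IH (y - pos_in e0)) as (J1 & J2); [unfold q in Hy1; lia|].
            replace y with (S (pos_in e0) + (y - pos_in e0) - 1) by lia. apply Hpi'; [lia|]. rewrite J1. apply Hmem2. unfold q in Hy1. lia. }
        apply (Hunb _ _ Hnb) in Hadj. apply adj_nth in Hadj as (i2 & A1 & A2 & A3).
        assert (i2 = q).
        { apply (NoDup_nth_inj (0 :: pi0)); auto; [lia|simpl; lia|]. congruence. }
        subst i2. replace (S (pos_in e0) + S i) with (S q) by (unfold q; lia). split; auto. simpl in A1. lia. }
    intros i Hi. apply (HI i Hi). lia.
  - assert (HI : forall i, i <= length m1 -> forall u, u <= i -> nth (S (pos_in e0) - u) (0 :: pi0) 0 = nth u (e0 :: rev m1) 0 /\ u <= pos_in e0).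
    { induction i as [|i IH]; intros Hi u Hu.
      - replace u with 0 by lia. rewrite Nat.sub_0_r, Hpos. split; [exact E1|lia].
      - specialize (IH ltac:(lia)). destruct (Nat.eq_dec u (S i)) as [->|]; [|apply IH; lia].
        destruct (IH i ltac:(lia)) as (I1 & I2).
        set (q := S (pos_in e0) - S i). set (c := nth i (e0 :: rev m1) 0) in *.
        assert (Hadj : adj ext (nth (S i) (e0 :: rev m1) 0) c).
        { apply adj_nth. exists (S (length l + length m1) - S i). split; [lia|]. split; [apply Hleft; lia|].
          replace (S (S (length l + length m1) - S i)) with (S (length l + length m1) - i) by lia. apply Hleft. lia. }
        assert (Hadj0 : adj (0 :: pi0) (nth q (0 :: pi0) 0) c).
        { apply adj_nth. exists q. split; [simpl; unfold q; lia|]. split; auto. rewrite <- I1. f_equal. unfold q. lia. }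
        assert (Hnb : ~ In (nth q (0 :: pi0) 0) (broken pi0 C)).
        { intros Hb. destruct (HL q) as (y & Hy1 & Hy2); try (unfold q; lia).
          - apply cut_in; auto. unfold q. lia.
          - apply Hy2. destruct (IH (pos_in e0 - y)) as (J1 & J2); [unfold q in Hy1; lia|].
            replace y with (S (pos_in e0) - (pos_in e0 - y) - 1) by lia. apply Hpi'; [lia|]. rewrite J1. apply Hmem1. unfold q in Hy1. lia. }
        apply (Hunb _ _ Hnb) in Hadj0. apply adj_nth in Hadj0 as (i1 & A1 & A2 & A3). apply adj_nth in Hadj as (i2 & B1 & B2 & B3).
        assert (S i1 = S i2) by (apply (NoDup_nth_inj ext); auto; congruence).
        assert (i1 = i2) by lia. subst i2.
        assert (Hp' : nth q (0 :: pi0) 0 = nth (S i) (e0 :: rev m1) 0) by congruence. split; auto.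
        assert (Hc' : In (nth (S i) (e0 :: rev m1) 0) pi0) by (apply Hf, Hmem1; lia).
        destruct (le_lt_dec (S i) (pos_in e0)); auto. exfalso.
        assert (Hq0 : q = 0) by (unfold q; lia). rewrite Hq0 in Hp'. rewrite <- Hp' in Hc'. apply (perm_in k pi0 Hpi) in Hc'. cbn [nth] in Hc'. lia. }
    intros i Hi. apply (HI i Hi). lia.
Qed.

(** If no cut is reached from [x] within [f], [supports_interval] transfers the whole interval of
    [f] from the intermediate to the start permutation, and [f] is contiguous there. *)
Lemma touch_ok f j x : NoDup f -> (forall y, In y f -> In y pi0) -> length f <= d ->
  supports (apply_bcs pi0 (firstn j C)) f -> ~ itv (map pos_in f) -> In x (map pos_in f) ->
  (exists r, In r cuts /\ x < r /\ r < x + d /\ forall y, x <= y < r -> In y (map pos_in f)) \/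
  (exists r, In r cuts /\ r <= x /\ S x < r + d /\ forall y, r <= y <= x -> In y (map pos_in f)).
Proof.
  intros NDf Hf Hd (l & mid & r & Heq & Hp) Hni Hx. apply NNPP. intros Hno. apply Hni. clear Hni.
  apply in_map_iff in Hx as (e0 & <- & He0).
  assert (He0' : In e0 mid) by (now rewrite Hp). apply in_split in He0' as (m1 & m2 & ->).
  destruct (supports_interval f m1 e0 m2 l r j NDf Hf Hd Heq Hp) as (HR & HL).
  - intros q Hq H1 H2. apply NNPP. intros Hn. apply Hno. left. exists q. repeat split; auto.
    intros y Hy. apply NNPP. intros Hny. apply Hn. eauto.
  - intros q Hq H1 H2. apply NNPP. intros Hn. apply Hno. right. exists q. repeat split; auto.
    intros y Hy. apply NNPP. intros Hny. apply Hn. eauto.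
  - assert (Hchar : forall y, In y (map pos_in f) <-> pos_in e0 - length m1 <= y <= pos_in e0 + length m2).
    { assert (A1 : forall i, i <= length m2 -> In (pos_in e0 + i) (map pos_in f) /\ pos_in (nth i (e0 :: m2) 0) = pos_in e0 + i).
      { intros i Hi. destruct (HR i Hi) as (R1 & R2).
        assert (E : pos_in (nth i (e0 :: m2) 0) = pos_in e0 + i) by (unfold pos_in at 1; rewrite <- R1, idx_ext by lia; lia).
        split; auto. rewrite <- E. apply in_map. rewrite <- Hp. apply in_or_app. right. apply nth_In. simpl. lia. }
      assert (A2 : forall i, i <= length m1 -> In (pos_in e0 - i) (map pos_in f) /\ pos_in (nth i (e0 :: rev m1) 0) = pos_in e0 - i).
      { intros i Hi. destruct (HL i Hi) as (R1 & R2).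
        assert (Hk : S (pos_in e0) <= k) by (destruct (HR 0); lia).
        assert (E : pos_in (nth i (e0 :: rev m1) 0) = pos_in e0 - i) by (unfold pos_in at 1; rewrite <- R1, idx_ext by lia; lia).
        split; auto. rewrite <- E. apply in_map. rewrite <- Hp. apply in_or_app.
        destruct i as [|i]; [right; now left|]. left. cbn [nth]. apply in_rev, nth_In. rewrite length_rev. lia. }
      assert (Hl1 : length m1 <= pos_in e0) by (destruct (HL (length m1)); lia).
      intros y. split.
      - intros Hy. apply in_map_iff in Hy as (z & <- & Hz). rewrite <- Hp in Hz. apply in_app_or in Hz as [Hz|Hz].
        + apply in_rev in Hz. apply (In_nth _ _ 0) in Hz as (i & Hi & <-). rewrite length_rev in Hi.
          destruct (A2 (S i)) as (_ & E); [lia|]. cbn [nth] in E. lia.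
        + apply (In_nth _ _ 0) in Hz as (i & Hi & <-). simpl in Hi. destruct (A1 i) as (_ & E); [lia|]. lia.
      - intros Hy. destruct (le_lt_dec (pos_in e0) y).
        + replace y with (pos_in e0 + (y - pos_in e0)) by lia. apply A1. lia.
        + replace y with (pos_in e0 - (pos_in e0 - y)) by lia. apply A2. lia. }
    intros a b c Ha Hc Hb. rewrite Hchar in *. lia.
Qed.

End Touch.

(** * Meetings that a competing solution must pay for *)

(** Weighted form of [rel_inj_length]. *)
Lemma rel_inj_sum {A B} (R : A -> B -> Prop) (g : A -> nat) (h : B -> nat) (l : list A) : forall (L : list B),
  NoDup l -> (forall a, In a l -> exists b, In b L /\ R a b /\ g a <= h b) ->
  (forall a a' b, In a l -> In a' l -> R a b -> R a' b -> a = a') -> sumf g l <= sumf h L.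
Proof.
  induction l as [|a l IH]; intros L ND Hex Hinj; [unfold sumf; simpl; lia|].
  inversion_clear ND.
  destruct (Hex a (or_introl eq_refl)) as (b & Hb & Rab & Hab).
  apply in_split in Hb as (L1 & L2 & ->).
  assert (sumf g l <= sumf h (L1 ++ L2)).
  { apply IH; auto.
    - intros a' Ha'. destruct (Hex a' (or_intror Ha')) as (b' & Hb' & Rb' & Hab').
      exists b'. split; auto. apply in_app_or in Hb'. apply in_or_app.
      destruct Hb' as [|[->|]]; auto. exfalso. apply H. rewrite (Hinj a a' b'); simpl; auto.
    - intros; eapply Hinj; simpl; eauto. }
  rewrite sumf_app in *. rewrite !sumf_cons. lia.
Qed.

Lemma sumf_flat_map {A B} (h : B -> nat) (F : A -> list B) l : sumf h (flat_map F l) = sumf (fun x => sumf h (F x)) l.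
Proof. induction l as [|a l IH]; [reflexivity|]. cbn [flat_map]. rewrite sumf_app, sumf_cons, IH. reflexivity. Qed.

Lemma sumf_map {A B} (h : B -> nat) (F : A -> B) l : sumf h (map F l) = sumf (fun x => h (F x)) l.
Proof. unfold sumf. now rewrite map_map. Qed.

(* The intervals of at most [d] positions with position [r] strictly inside. *)
Definition windows d (pi : list nat) r :=
  flat_map (fun w => map (fun i => firstn w (skipn (r - i) pi)) (seq 1 (w - 1))) (seq 2 (d - 1)).

(** There are [w - 1] windows of width [w], each of weight at most [w - 1]; the right-hand side is
    six times the sum of the squares up to [d - 1]. *)
Lemma windows_sum d pi r : 6 * sumf (fun c : list nat => length c - 1) (windows d pi r) <= d * (d - 1) * (2 * d - 1).
Proof.
  unfold windows. rewrite sumf_flat_map.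
  assert (H : sumf (fun w => sumf (fun c : list nat => length c - 1) (map (fun i => firstn w (skipn (r - i) pi)) (seq 1 (w - 1)))) (seq 2 (d - 1))
     <= sumf (fun w => (w - 1) * (w - 1)) (seq 2 (d - 1))).
  { apply sumf_le. intros w _. rewrite sumf_map.
    eapply Nat.le_trans; [apply (sumf_le _ (fun _ => w - 1)); intros i _; rewrite length_firstn; lia|].
    rewrite sumf_const, length_seq. lia. }
  enough (E : 6 * sumf (fun w => (w - 1) * (w - 1)) (seq 2 (d - 1)) = d * (d - 1) * (2 * d - 1)) by lia.
  clear. destruct d as [|d]; [reflexivity|]. replace (S d - 1) with d by lia.
  induction d as [|d IH]; [reflexivity|]. rewrite seq_S, sumf_app, Nat.mul_add_distr_l, IH.
  unfold sumf. simpl list_sum. replace (S (S d) - 1) with (S d) by lia. nia.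
Qed.

Lemma windows_count d pi r : 2 * length (windows d pi r) <= d * (d - 1).
Proof.
  unfold windows.
  assert (E : length (flat_map (fun w => map (fun i => firstn w (skipn (r - i) pi)) (seq 1 (w - 1))) (seq 2 (d - 1))) =
    sumf (fun w => w - 1) (seq 2 (d - 1))).
  { rewrite length_flat_map. unfold sumf. f_equal. apply map_ext. intros w. now rewrite length_map, length_seq. }
  rewrite E. clear. destruct d as [|d]; [unfold sumf; simpl; lia|]. replace (S d - 1) with d by lia.
  induction d as [|d IH]; [unfold sumf; simpl; lia|]. rewrite seq_S, sumf_app, Nat.mul_add_distr_l.
  unfold sumf at 2. simpl list_sum. nia.
Qed.

(** The boundaries between the blocks after the exchange. Only a meeting that straddles one of them
    can be supported for the first time. *)
Definition borders (t : triple) : list nat := let '(a, b, c) := t in [a - 1; a - 1 + (c - b); c].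

Fixpoint cands d (pi : list nat) (C : list triple) : list (list nat) :=
  match C with
  | [] => []
  | t :: C' => flat_map (windows d (apply_bcs pi [t])) (borders t) ++ cands d (apply_bcs pi [t]) C'
  end.

Lemma cands_sum d C : forall pi, 6 * sumf (fun c : list nat => length c - 1) (cands d pi C) <= 3 * length C * (d * (d - 1) * (2 * d - 1)).
Proof.
  induction C as [|((a & b) & c) C IH]; intros pi; [unfold sumf; simpl; lia|].
  cbn [cands borders flat_map length]. rewrite !sumf_app. specialize (IH (apply_bcs pi [(a, b, c)])).
  pose proof (windows_sum d (apply_bcs pi [(a, b, c)]) (a - 1)).
  pose proof (windows_sum d (apply_bcs pi [(a, b, c)]) (a - 1 + (c - b))).
  pose proof (windows_sum d (apply_bcs pi [(a, b, c)]) c).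
  set (X := d * (d - 1) * (2 * d - 1)) in *.
  replace (3 * S (length C) * X) with (3 * X + 3 * length C * X) by lia. change (sumf (fun c => length c - 1) []) with 0. unfold triple in *. lia.
Qed.

Lemma cands_count d C : forall pi, 2 * length (cands d pi C) <= 3 * length C * (d * (d - 1)).
Proof.
  induction C as [|((a & b) & c) C IH]; intros pi; [simpl; lia|].
  cbn [cands borders flat_map length]. rewrite !length_app. specialize (IH (apply_bcs pi [(a, b, c)])).
  pose proof (windows_count d (apply_bcs pi [(a, b, c)]) (a - 1)).
  pose proof (windows_count d (apply_bcs pi [(a, b, c)]) (a - 1 + (c - b))).
  pose proof (windows_count d (apply_bcs pi [(a, b, c)]) c).
  set (X := d * (d - 1)) in *.
  replace (3 * S (length C) * X) with (3 * X + 3 * length C * X) by lia. change (length (@nil (list nat))) with 0. unfold triple in *. lia.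
Qed.

Definition at_pos (l : list nat) s (mid : list nat) := exists x y, l = x ++ mid ++ y /\ length x = s.

Lemma app_cut (x y U V : list nat) : x ++ y = U ++ V -> length U <= length x -> exists z, x = U ++ z /\ V = z ++ y.
Proof.
  revert x. induction U as [|u U IH]; intros x E H; simpl in *; [eauto|].
  destruct x as [|a x]; simpl in *; [lia|]. injection E as -> E. destruct (IH x E) as (z & -> & ->); [lia|]. eauto.
Qed.

Lemma at_pos_l U V s mid : at_pos (U ++ V) s mid -> s + length mid <= length U -> at_pos U s mid.
Proof.
  intros (x & y & E & Hs) H. symmetry in E. symmetry in E. rewrite app_assoc in E.
  apply app_cut in E as (z & -> & _); [|rewrite length_app; lia]. exists x, z. split; auto. now rewrite app_assoc.
Qed.

Lemma at_pos_r U V s mid : at_pos (U ++ V) s mid -> length U <= s -> at_pos V (s - length U) mid.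
Proof.
  intros (x & y & E & Hs) H. symmetry in E. apply app_cut in E as (z & -> & ->); [|lia].
  exists z, y. split; auto. rewrite length_app in Hs. lia.
Qed.

Lemma at_pos_supports U l V s mid f : at_pos l s mid -> Permutation mid f -> supports (U ++ l ++ V) f.
Proof.
  intros (x & y & -> & _) Hp. exists (U ++ x), mid, (y ++ V). split; auto. now rewrite <- !app_assoc.
Qed.

Lemma at_pos_firstn l s mid : at_pos l s mid -> firstn (length mid) (skipn s l) = mid.
Proof.
  intros (x & y & -> & <-). rewrite skipn_app, skipn_all, Nat.sub_diag. simpl.
  rewrite firstn_app, firstn_all, Nat.sub_diag, firstn_O. apply app_nil_r.
Qed.

(** A supported meeting without a border strictly inside lies in one of the four blocks, and these
    are intact in the permutation before the crossing. *)
Lemma cands_step d k pi t f : length pi = k -> valid_bc k t -> 2 <= length f <= d ->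
  supports (apply_bcs pi [t]) f -> ~ supports pi f ->
  exists c, In c (flat_map (windows d (apply_bcs pi [t])) (borders t)) /\ Permutation c f.
Proof.
  intros Hl Hv Hf (l & mid & r & E & Hp) Hn.
  destruct t as ((a & b) & c). destruct (bc_shape k pi a b c Hl Hv) as (A & G & R & Y & -> & HG & HR & -> & -> & ->).
  set (pi' := apply_bcs (A ++ G ++ R ++ Y) [(length A + 1, length A + length G, length A + length G + length R)]) in *.
  assert (Epi : pi' = A ++ R ++ G ++ Y) by (unfold pi'; rewrite apply_one; now apply bc_split).
  assert (Hmid : length mid = length f) by (now apply Permutation_length).
  assert (Hat : at_pos pi' (length l) mid) by (exists l, r; auto).
  exists mid. split; auto.
  assert (Hborder : exists q, In q (borders (length A + 1, length A + length G, length A + length G + length R)) /\ length l < q < length l + length mid).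
  { apply NNPP. intros Hno. apply Hn.
    assert (B1 : ~ length l < length A < length l + length mid).
    { intros H. apply Hno. exists (length A). split; auto. left. lia. }
    assert (B2 : ~ length l < length A + length R < length l + length mid).
    { intros H. apply Hno. exists (length A + length R). split; auto. right. left. lia. }
    assert (B3 : ~ length l < length A + length G + length R < length l + length mid).
    { intros H. apply Hno. exists (length A + length G + length R). split; auto. right. right. left. lia. }
    rewrite Epi in Hat.
    destruct (le_lt_dec (length l + length mid) (length A)) as [C1|C1].
    { apply at_pos_l in Hat; auto. apply (at_pos_supports [] A (G ++ R ++ Y)) with (f := f) in Hat; auto. }
    apply at_pos_r in Hat; [|lia].
    destruct (le_lt_dec (length l - length A + length mid) (length R)) as [C2|C2].
    { apply at_pos_l in Hat; auto. apply (at_pos_supports (A ++ G) R Y) with (f := f) in Hat; auto. now rewrite <- app_assoc in Hat. }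
    apply at_pos_r in Hat; [|lia].
    destruct (le_lt_dec (length l - length A - length R + length mid) (length G)) as [C3|C3].
    { apply at_pos_l in Hat; auto. apply (at_pos_supports A G (R ++ Y)) with (f := f) in Hat; auto. }
    apply at_pos_r in Hat; [|lia].
    apply (at_pos_supports (A ++ G ++ R) Y []) with (f := f) in Hat; auto. rewrite app_nil_r, <- !app_assoc in Hat. exact Hat. }
  destruct Hborder as (q & Hq & H1 & H2).
  apply in_flat_map. exists q. split; auto. unfold windows. apply in_flat_map. exists (length mid).
  split; [apply in_seq; lia|]. apply in_map_iff. exists (q - length l). split; [|apply in_seq; lia].
  replace (q - (q - length l)) with (length l) by lia. now apply at_pos_firstn.
Qed.

(** Consider the first crossing after which [f] is supported. *)
Lemma cands_ok d k C f : 2 <= length f <= d -> forall pi j, length pi = k -> Forall (valid_bc k) C ->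
  supports (apply_bcs pi (firstn j C)) f -> ~ supports pi f -> exists c, In c (cands d pi C) /\ Permutation c f.
Proof.
  intros Hf. induction C as [|t C IH]; intros pi j Hl HC Hs Hn; [rewrite firstn_nil in Hs; tauto|].
  destruct j as [|j]; [tauto|]. inversion_clear HC. cbn [cands].
  destruct (classic (supports (apply_bcs pi [t]) f)) as [H1|H1].
  - destruct (cands_step d k pi t f) as (c & Hc & Hp); auto. exists c. split; auto. apply in_or_app. auto.
  - cbn [firstn] in Hs. change (t :: firstn j C) with ([t] ++ firstn j C) in Hs. rewrite apply_app in Hs.
    destruct (IH (apply_bcs pi [t]) j) as (c & Hc & Hp); auto; [now apply bc_length|].
    exists c. split; auto. apply in_or_app. auto.
Qed.

Lemma run_supports k M : forall pi Bs, valid_run k pi M Bs ->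
  Forall (valid_bc k) (concat Bs) /\ forall m, In m M -> exists j, supports (apply_bcs pi (firstn j (concat Bs))) m.
Proof.
  induction M as [|m M IH]; intros pi [|B Bs]; simpl; try tauto.
  - intros _. split; [constructor|tauto].
  - intros (H1 & H2 & H3). destruct (IH _ _ H3) as (H4 & H5). split; [apply Forall_app; auto|].
    intros m' [<-|Hm].
    + exists (length B). rewrite firstn_app, firstn_all, Nat.sub_diag, firstn_O, app_nil_r. exact H2.
    + destruct (H5 m' Hm) as (j & Hj). exists (length B + j).
      rewrite firstn_app, firstn_all2 by lia. replace (length B + j - length B) with j by lia. now rewrite apply_app.
Qed.

Lemma cost_concat s : cost s = length (concat (crossings s)).
Proof. unfold cost. now rewrite length_concat. Qed.

Lemma distinct_pairs M : distinct_meetings M -> ForallOrdPairs (fun a b => ~ seteq a b) M.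
Proof.
  induction M as [|m M IH]; intros H; constructor.
  - apply Forall_forall. intros m' Hm'. apply (In_nth _ _ []) in Hm' as (j & Hj & <-).
    apply (H 0 (S j)). simpl. lia.
  - apply IH. intros i j Hij. apply (H (S i) (S j)). simpl. lia.
Qed.

Section Compare.
Context (k d : nat) (M : list (list nat)) (pi0 : list nat) (C : list triple).
Context (Hd : 2 <= d) (HM : storyline_instance k M) (HMd : meetings_at_most d M) (HMx : distinct_meetings M).
Context (Hpi : is_perm k pi0) (HC : Forall (valid_bc k) C).
Context (HS : forall m, In m M -> exists j, supports (apply_bcs pi0 (firstn j C)) m).
Notation pos := (pos_in pi0).

Lemma meeting_facts e : In e M -> NoDup e /\ 2 <= length e <= d /\ forall x, In x e -> 1 <= x <= k.
Proof. intros H. apply (In_nth _ _ []) in H as (j & Hj & <-). now apply (edge_facts d k M HM HMd). Qed.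

Lemma meeting_pi0 e x : In e M -> In x e -> In x pi0.
Proof. intros He Hx. apply (perm_in k pi0 Hpi). now apply (meeting_facts e He). Qed.

Lemma M_NoDup : NoDup M.
Proof. apply distinct_NoDup, distinct_pairs, HMx. Qed.

Lemma perm_determines c f f' : In f M -> In f' M -> Permutation c f -> Permutation c f' -> f = f'.
Proof.
  intros Hf Hf' H H'. apply (distinct_eq M); auto; [now apply distinct_pairs|].
  intros x. now rewrite <- H, <- H'.
Qed.

(** A window is the set of at most one meeting because the meetings are pairwise distinct, so these
    meetings can be charged to the windows of the crossings. *)
Lemma unsupported_sum : 6 * sumf (fun f : list nat => length f - 1) (sel (fun f => ~ supports pi0 f) M) <= 3 * length C * (d * (d - 1) * (2 * d - 1)).
Proof.
  eapply Nat.le_trans; [|apply (cands_sum d C pi0)]. apply Nat.mul_le_mono_l.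
  apply (rel_inj_sum (fun f c => Permutation c f)).
  - apply sel_NoDup, M_NoDup.
  - intros f Hf. apply in_sel in Hf as (Hf & Hn). destruct (HS f Hf) as (j & Hj).
    destruct (cands_ok d k C f (proj1 (proj2 (meeting_facts f Hf))) pi0 j (perm_length k pi0 Hpi) HC Hj Hn) as (c & Hc & Hp).
    exists c. split; auto. split; auto. now rewrite (Permutation_length Hp).
  - intros f f' c Hf Hf' H H'. apply in_sel in Hf as (Hf & _). apply in_sel in Hf' as (Hf' & _). now apply (perm_determines c).
Qed.

(** The meetings supported at the start are intervals given by a left end and a width from 2 to [d];
    all others take up windows of the crossings. With many meetings this alone forces many
    crossings. *)
Lemma meetings_count : 2 * length M <= 2 * (k * (d - 1)) + 3 * length C * (d * (d - 1)).
Proof.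
  rewrite <- (sel_length (fun f => supports pi0 f) M).
  assert (H1 : length (sel (fun f => supports pi0 f) M) <= k * (d - 1)).
  { replace (k * (d - 1)) with (length (list_prod (seq 0 k) (seq 2 (d - 1)))) by (now rewrite length_prod, !length_seq).
    apply (rel_inj_length (fun f (c : nat * nat) => Permutation (firstn (snd c) (skipn (fst c) pi0)) f)).
    - apply sel_NoDup, M_NoDup.
    - intros f Hf. apply in_sel in Hf as (Hf & (l & mid & r & E & Hp)).
      destruct (meeting_facts f Hf) as (_ & Hl & _). pose proof (Permutation_length Hp) as Hm.
      assert (Hk : length l + length mid <= k) by (rewrite <- (perm_length k pi0 Hpi), E, !length_app; lia).
      exists (length l, length mid). split; [apply in_prod; apply in_seq; lia|]. simpl.
      rewrite (at_pos_firstn pi0 (length l) mid); auto. exists l, r. auto.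
    - intros f f' c Hf Hf' H H'. apply in_sel in Hf as (Hf & _). apply in_sel in Hf' as (Hf' & _). eapply perm_determines; eauto. }
  assert (H2 : length (sel (fun f => ~ supports pi0 f) M) <= length (cands d pi0 C)).
  { apply (rel_inj_length (fun f c => Permutation c f)).
    - apply sel_NoDup, M_NoDup.
    - intros f Hf. apply in_sel in Hf as (Hf & Hn). destruct (HS f Hf) as (j & Hj).
      exact (cands_ok d k C f (proj1 (proj2 (meeting_facts f Hf))) pi0 j (perm_length k pi0 Hpi) HC Hj Hn).
    - intros f f' c Hf Hf' H H'. apply in_sel in Hf as (Hf & _). apply in_sel in Hf' as (Hf' & _). eapply perm_determines; eauto. }
  pose proof (cands_count d C pi0). lia.
Qed.

Lemma supports_itv f : supports pi0 f -> itv (map pos f).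
Proof.
  intros (l & mid & r & E & Hp) a b c Ha Hc Hb.
  pose proof (perm_NoDup k pi0 Hpi) as ND.
  assert (Hch : forall y, In y (map pos f) <-> length l <= y < length l + length mid).
  { intros y. rewrite in_map_iff. split.
    - intros (z & <- & Hz). rewrite <- Hp in Hz. apply (In_nth _ _ 0) in Hz as (i & Hi & <-).
      replace (nth i mid 0) with (nth (length l + i) pi0 0).
      + unfold pos_in. rewrite idx_nth; auto; [lia|]. rewrite E, !length_app. lia.
      + rewrite E, app_nth2 by lia. rewrite app_nth1 by lia. f_equal. lia.
    - intros Hy. exists (nth y pi0 0). split.
      + unfold pos_in. rewrite idx_nth; auto; [lia|]. rewrite E, !length_app. lia.
      + rewrite <- Hp. rewrite E, app_nth2 by lia. rewrite app_nth1 by lia. apply nth_In. lia. }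
  rewrite Hch in *. lia.
Qed.

End Compare.

(** * Ranks of characters in the sequence of pieces *)

Fixpoint rank (ps : list (list nat)) (x : nat) : nat :=
  match ps with [] => 0 | P :: r => if dec (In x P) then 0 else S (rank r x) end.

Lemma rank_in ps x : In x (concat ps) -> rank ps x < length ps /\ In x (nth (rank ps x) ps []).
Proof.
  induction ps as [|P ps IH]; simpl; [tauto|]. intros H. destruct (dec (In x P)) eqn:D.
  - apply dec_elim in D. split; [lia|auto].
  - apply dec_nelim in D. apply in_app_or in H as [H|H]; [tauto|]. destruct (IH H). split; [lia|auto].
Qed.

Lemma rank_unique ps x : NoDup (concat ps) -> forall i, i < length ps -> In x (nth i ps []) -> rank ps x = i.
Proof.
  induction ps as [|P ps IH]; simpl; intros ND i Hi Hx; [lia|]. destruct i as [|i].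
  - now rewrite (proj2 (dec_true _) Hx).
  - assert (Hn : ~ In x P).
    { intros Hp. apply (NoDup_app_disj _ _ ND x Hp). apply in_concat. exists (nth i ps []). split; auto. apply nth_In. lia. }
    rewrite (proj2 (dec_false _) Hn). f_equal. apply IH; auto; [|lia]. now apply NoDup_app_remove_l in ND.
Qed.

Lemma rank_before ps x i : NoDup (concat ps) -> i <= length ps -> In x (concat (firstn i ps)) <-> In x (concat ps) /\ rank ps x < i.
Proof.
  revert i. induction ps as [|P ps IH]; intros i ND Hi; [rewrite firstn_nil; simpl; tauto|].
  destruct i as [|i]; [simpl; split; [tauto|lia]|]. simpl in *. rewrite !in_app_iff.
  pose proof (NoDup_app_disj _ _ ND x) as HD. apply NoDup_app_remove_l in ND. rewrite (IH i ND) by lia.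
  destruct (dec (In x P)) eqn:D; [apply dec_elim in D|apply dec_nelim in D].
  - split; [intros _|auto]. split; [auto|lia].
  - split; [intros [|(H1 & H2)]; [tauto|split; [auto|lia]]|intros ([|H1] & H2); [tauto|right; split; [auto|lia]]].
Qed.

Lemma bf_rank ps x y : NoDup (concat ps) -> bf (concat ps) x y ->
  rank ps x <= rank ps y /\ (rank ps x = rank ps y -> bf (nth (rank ps x) ps []) x y).
Proof.
  induction ps as [|P ps IH]; simpl; [tauto|]. intros ND H. apply bf_app in H.
  pose proof (NoDup_app_disj _ _ ND) as HD.
  destruct H as [H|[(H1 & H2)|H]].
  - destruct (bf_in _ _ _ H) as (H1 & H2). rewrite (proj2 (dec_true (In x P)) H1), (proj2 (dec_true (In y P)) H2). auto.
  - assert (Hy : ~ In y P) by (intros Hy; exact (HD y Hy H2)).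
    rewrite (proj2 (dec_true (In x P)) H1), (proj2 (dec_false (In y P)) Hy). split; [lia|discriminate].
  - destruct (bf_in _ _ _ H) as (H1 & H2).
    assert (Hx : ~ In x P) by (intros Hx; exact (HD x Hx H1)). assert (Hy : ~ In y P) by (intros Hy; exact (HD y Hy H2)).
    rewrite (proj2 (dec_false (In x P)) Hx), (proj2 (dec_false (In y P)) Hy).
    apply NoDup_app_remove_l in ND. destruct (IH ND H) as (I1 & I2). split; [lia|]. intros E. apply I2. lia.
Qed.

Lemma pieces_nth M ps : forall D, pieces_ok M D ps -> forall i, i < length ps ->
  piece_ok M (D ++ concat (firstn i ps)) (nth i ps []) /\ closed M (D ++ concat (firstn i ps)) (nth i ps []).
Proof.
  induction ps as [|P ps IH]; simpl; intros D HD i Hi; [lia|]. destruct HD as (H1 & H2 & H3). destruct i as [|i].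
  - simpl. rewrite app_nil_r. auto.
  - cbn [firstn concat nth]. rewrite app_assoc. apply IH; auto. lia.
Qed.

(** * Comparison *)

Lemma FOP_map (F : list nat -> list nat) l (R S : list nat -> list nat -> Prop) :
  ForallOrdPairs R l -> (forall a b, In a l -> In b l -> R a b -> S (F a) (F b)) -> ForallOrdPairs S (map F l).
Proof.
  induction 1 as [|a l Ha Hl IH]; intros H; simpl; constructor.
  - apply Forall_map. rewrite Forall_forall in *. intros b Hb. apply H; simpl; auto.
  - apply IH. intros; apply H; simpl; auto.
Qed.

Lemma sel_map {A B} (P : B -> Prop) (F : A -> B) l : sel P (map F l) = map F (sel (fun x => P (F x)) l).
Proof.
  unfold sel. induction l as [|a l IH]; simpl; auto. destruct (dec (P (F a))); simpl; now rewrite IH.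
Qed.

Lemma sumf_sel_incl {A} (g : A -> nat) (P Q : A -> Prop) l : (forall x, P x -> Q x) -> sumf g (sel P l) <= sumf g (sel Q l).
Proof.
  intros H. unfold sel. induction l as [|a l IH]; simpl; auto.
  destruct (dec (P a)) eqn:D1; destruct (dec (Q a)) eqn:D2; rewrite ?sumf_cons; try lia.
  apply dec_elim in D1. apply dec_nelim in D2. exfalso. auto.
Qed.

Section Placement.
Context (k d : nat) (M : list (list nat)) (pi0 : list nat) (C : list triple).
Context (Hd : 2 <= d) (HM : storyline_instance k M) (HMd : meetings_at_most d M) (HMx : distinct_meetings M).
Context (Hpi : is_perm k pi0) (HC : Forall (valid_bc k) C).
Context (HS : forall m, In m M -> exists j, supports (apply_bcs pi0 (firstn j C)) m).
Context (ps : list (list nat)) (Hps : is_perm k (concat ps)) (Hok : pieces_ok M [0] ps).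
Notation pos := (pos_in pi0).

Definition place_rank i := rank ps (nth i pi0 0).

Lemma nth_pos x : In x pi0 -> nth (pos x) pi0 0 = x /\ pos x < k.
Proof.
  intros H. destruct (ext_idx k pi0 Hpi x H) as (H1 & H2). unfold pos_in.
  destruct (idx pi0 x) as [|i]; [lia|]. simpl in *. rewrite Nat.sub_0_r. split; [exact H1|lia].
Qed.

Lemma place_rank_pos x : In x pi0 -> place_rank (pos x) = rank ps x.
Proof. intros H. unfold place_rank. now rewrite (proj1 (nth_pos x H)). Qed.

Lemma pos_nth i : i < k -> In (nth i pi0 0) pi0 /\ pos (nth i pi0 0) = i.
Proof.
  intros Hi. pose proof (perm_length k pi0 Hpi). split; [apply nth_In; lia|].
  unfold pos_in. rewrite idx_nth; [lia|now apply (perm_NoDup k)|lia].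
Qed.

Lemma pi0_ps x : In x pi0 <-> In x (concat ps).
Proof. rewrite Hpi, <- Hps. reflexivity. Qed.

Lemma ps_ND : NoDup (concat ps).
Proof. apply (perm_NoDup k _ Hps). Qed.

Lemma before_iff x i : In x pi0 -> i <= length ps -> In x ([0] ++ concat (firstn i ps)) <-> rank ps x < i.
Proof.
  intros Hx Hi. rewrite in_app_iff, rank_before by (auto using ps_ND). rewrite <- pi0_ps. simpl.
  assert (x <> 0) by (apply (perm_in k pi0 Hpi) in Hx; lia). split; [intros [[|[]]|]; [congruence|tauto]|auto].
Qed.

Lemma in_piece x i : i < length ps -> In x (nth i ps []) <-> In x pi0 /\ rank ps x = i.
Proof.
  intros Hi. split.
  - intros H. split; [|now apply rank_unique; auto using ps_ND].
    apply pi0_ps, in_concat. exists (nth i ps []). split; auto. now apply nth_In.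
  - intros (H1 & <-). apply rank_in. now apply pi0_ps.
Qed.

Lemma mem_pos e x : In e M -> In x pi0 -> In (pos x) (map pos e) <-> In x e.
Proof.
  intros He Hx. rewrite in_map_iff. split; [|eauto]. intros (y & Hy & Hye).
  apply (pos_inj k pi0 Hpi) in Hy; subst; auto. now apply (meeting_pi0 k d M pi0 HM HMd Hpi e).
Qed.

Notation mpi := (meeting_pi0 k d M pi0 HM HMd Hpi).

Lemma placement_layout : layout d k (map (map pos) M) (cuts pi0 C) place_rank.
Proof.
  split.
  - exact Hd.
  - intros e He. apply in_map_iff in He as (m & <- & Hm). apply NoDup_map_NoDup_ForallPairs.
    + intros x y Hx Hy. apply (pos_inj k pi0 Hpi); eapply mpi; eauto.
    + now apply (meeting_facts k d M HM HMd).
  - intros e He. apply in_map_iff in He as (m & <- & Hm). pose proof (meeting_facts k d M HM HMd m Hm) as (_ & H & _).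
    destruct m; simpl in *; [lia|discriminate].
  - intros e He. apply in_map_iff in He as (m & <- & Hm). rewrite length_map. now apply (meeting_facts k d M HM HMd).
  - intros e x He Hx. apply in_map_iff in He as (m & <- & Hm). apply in_map_iff in Hx as (y & <- & Hy).
    apply nth_pos. eapply mpi; eauto.
  - apply (FOP_map _ _ _ _ (distinct_pairs M HMx)). intros a b Ha Hb Hab H. apply Hab. intros x.
    split; intros Hx.
    + rewrite <- (mem_pos b x Hb (mpi a x Ha Hx)). apply H. now apply in_map.
    + rewrite <- (mem_pos a x Ha (mpi b x Hb Hx)). apply H. now apply in_map.
  - apply NoDup_nodup.
  - intros r Hr. apply nodup_In, in_map_iff in Hr as (x & <- & _).
    destruct (classic (In x pi0)) as [H|H]; [now apply (ext_idx k pi0 Hpi)|].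
    apply idx_notin in H. lia.
  - intros f x Hf Hn Hx. apply in_map_iff in Hf as (m & <- & Hm). destruct (HS m Hm) as (j & Hj).
    pose proof (meeting_facts k d M HM HMd m Hm) as (F1 & F2 & F3).
    apply (touch_ok k d pi0 C Hpi HC m j); auto; [|lia]. intros y. now apply mpi.
  - intros i A x y Hx Hy Hrx Hry HAx HAy.
    destruct (pos_nth x Hx) as (X1 & X2). destruct (pos_nth y Hy) as (Y1 & Y2).
    assert (Hi : i < length ps) by (rewrite <- Hrx; apply rank_in; now apply pi0_ps).
    destruct (pieces_nth M ps [0] Hok i Hi) as ((_ & Hc) & _).
    destruct (Hc (fun z => A (pos z)) (nth x pi0 0) (nth y pi0 0)) as (h & Hh & Hsub & (u & U1 & U2 & U3) & v & V1 & V2 & V3).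
    + now apply in_piece.
    + now apply in_piece.
    + now rewrite X2.
    + now rewrite Y2.
    + apply in_piece in U2 as (U2 & Ur); auto. apply in_piece in V2 as (V2 & Vr); auto.
      exists (map pos h). split; [now apply in_map|]. split; [|split].
      * intros z Hz. apply in_map_iff in Hz as (w & <- & Hw). pose proof (mpi h w Hh Hw) as Hwp.
        rewrite place_rank_pos by auto. specialize (Hsub w Hw). apply in_app_or in Hsub as [Hs|Hs].
        -- apply before_iff in Hs; auto; lia.
        -- apply in_piece in Hs as (_ & ->); auto.
      * exists (pos u). rewrite place_rank_pos by auto. auto using in_map.
      * exists (pos v). rewrite place_rank_pos by auto. auto using in_map.
  - intros e' x' y' He Hx Hy Hr. apply in_map_iff in He as (e & <- & He).
    apply in_map_iff in Hx as (x & <- & Hx). apply in_map_iff in Hy as (y & <- & Hy).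
    pose proof (mpi e x He Hx) as Hxp. pose proof (mpi e y He Hy) as Hyp.
    rewrite !place_rank_pos in Hr by auto.
    assert (Hi : rank ps x < length ps) by (apply rank_in; now apply pi0_ps).
    destruct (pieces_nth M ps [0] Hok _ Hi) as (_ & Hcl).
    assert (Ht : touching ([0] ++ concat (firstn (rank ps x) ps)) (nth (rank ps x) ps []) e).
    { split.
      - exists x. split; auto. now apply in_piece.
      - exists y. split; auto. rewrite in_app_iff, before_iff, in_piece by (auto; lia). lia. }
    specialize (Hcl e He Ht).
    set (D := [0] ++ concat (firstn (rank ps x) ps)) in *. set (P := nth (rank ps x) ps []) in *.
    (* The start permutation restricted to the enlarged piece. Since absorption is blocked, it is
       not admissible, and a violated meeting provides [u], [v] and [w]. *)
    set (sigma := sel (fun z => In z P \/ (In z e /\ ~ In z D)) pi0).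
    assert (Hsig : forall z, In z sigma -> In z pi0 /\ (rank ps z = rank ps x \/ In z e /\ rank ps x <= rank ps z)).
    { intros z Hz. apply in_sel in Hz as (Hz & [H|(H1 & H2)]); split; auto.
      - left. apply in_piece in H; tauto.
      - right. split; auto. unfold D in H2. rewrite before_iff in H2 by (auto; lia). lia. }
    assert (Hno : ~ okl M sigma).
    { intros Hokl. apply Hcl. exists sigma. split; [apply sel_NoDup, (perm_NoDup k pi0 Hpi)|]. split; auto.
      intros z. unfold sigma. rewrite in_sel. split; [tauto|]. intros H. split; auto.
      destruct H as [H|(H & _)]; [apply in_piece in H; tauto|now apply (mpi e)]. }
    apply not_all_ex_not in Hno as (f & Hno). apply imply_to_and in Hno as (Hf & Hno).
    apply not_all_ex_not in Hno as (u & Hno). apply not_all_ex_not in Hno as (v & Hno). apply not_all_ex_not in Hno as (w & Hno).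
    apply imply_to_and in Hno as (Huv & Hno). apply imply_to_and in Hno as (Hvw & Hno).
    apply imply_to_and in Hno as (Hu & Hno). apply imply_to_and in Hno as (Hw & Hv).
    destruct (bf_in _ _ _ Huv) as (Su & Sv). destruct (bf_in _ _ _ Hvw) as (_ & Sw).
    unfold sigma, sel in Huv, Hvw. apply bf_filter in Huv, Hvw.
    apply bf_idx in Huv, Hvw; try apply (perm_NoDup k pi0 Hpi).
    exists (map pos f), (pos u), (pos v), (pos w).
    split; [now apply in_map|]. split; [unfold pos_in; lia|]. split; [now apply in_map|]. split; [now apply in_map|].
    split; [rewrite mem_pos; auto; now apply Hsig|].
    intros z Hz.
    assert (Hz' : exists c, z = pos c /\ In c sigma) by (destruct Hz as [->|[->| ->]]; eauto).
    destruct Hz' as (c & -> & Hc). destruct (Hsig c Hc) as (Hcp & Hcr). rewrite !place_rank_pos by auto.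
    split; [now apply nth_pos|]. rewrite mem_pos by auto. exact Hcr.
Qed.

Lemma placement_bound : 4 * sumf (fun e => np (rank ps) e - 1) M <= 3 * (d * d - 1) * (d * d) * length C.
Proof.
  replace (sumf (fun e => np (rank ps) e - 1) M) with (sumf (fun e => np place_rank e - 1) (map (map pos) M)).
  - apply (cost_bound d k _ _ _ placement_layout).
    + unfold cuts. rewrite <- (broken_length C pi0), <- (length_map (idx pi0) (broken pi0 C)).
      apply NoDup_incl_length; [apply NoDup_nodup|]. intros x Hx. now apply nodup_In in Hx.
    + rewrite sel_map, sumf_map.
      eapply Nat.le_trans; [|apply (unsupported_sum k d M pi0 C HM HMd HMx Hpi HC HS)]. apply Nat.mul_le_mono_l.
      eapply Nat.le_trans; [apply (sumf_sel_incl _ _ (fun f => ~ supports pi0 f))|].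
      * intros f Hf H. apply Hf. now apply (supports_itv k d).
      * apply sumf_le. intros f _. now rewrite length_map.
  - rewrite sumf_map. unfold sumf. f_equal. apply map_ext_in. intros e He. unfold np. rewrite map_map.
    do 3 f_equal. apply map_ext_in. intros x Hx. apply place_rank_pos. now apply (mpi e).
Qed.

End Placement.

(** Two members of equal rank lie in one piece together with everything between them, and there the
    trace of [e] is contiguous; so separated members have different ranks. *)
Lemma gathers_rank k M ps e B : is_perm k (concat ps) -> pieces_ok M [0] ps -> In e M -> gathers k (concat ps) e B -> S (length B) <= np (rank ps) e.
Proof.
  intros Hps Hok He HB. pose proof (perm_NoDup k _ Hps) as ND. apply (gathers_np k (concat ps)); auto. intros x z Hx Hz (y & Hy & Hxy & Hyz) Hr.
  destruct (bf_rank _ _ _ ND Hxy) as (R1 & R2). destruct (bf_rank _ _ _ ND Hyz) as (R3 & R4).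
  specialize (R2 ltac:(lia)). specialize (R4 ltac:(lia)). replace (rank ps y) with (rank ps x) in R4 by lia.
  assert (Hi : rank ps x < length ps) by (apply rank_in; now apply bf_in in Hxy).
  destruct (pieces_nth M ps [0] Hok _ Hi) as ((Hokl & _) & _). apply Hy. eapply Hokl; eauto.
Qed.

Lemma gathers_total k pi M Ts (g : list nat -> nat) : Forall2 (gathers k pi) M Ts ->
  (forall e B, In e M -> gathers k pi e B -> S (length B) <= g e) ->
  list_sum (map (@length triple) Ts) <= sumf (fun e => g e - 1) M.
Proof.
  induction 1 as [|e B M Ts HB HF IH]; intros H; [unfold sumf; simpl; lia|].
  rewrite sumf_cons. cbn [map list_sum fold_right]. specialize (H e B (or_introl eq_refl) HB) as He.
  enough (list_sum (map (@length triple) Ts) <= sumf (fun e => g e - 1) M) by (unfold list_sum in *; lia).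
  apply IH. intros; apply H; simpl; auto.
Qed.

Theorem theorem8 :
  forall d : nat, 2 <= d ->
  exists (P : program) (C : nat),
    forall (k : nat) (M : list (list nat)),
      storyline_instance k M ->
      meetings_at_most d M ->
      distinct_meetings M ->
      exists (mem : nat -> nat) (s : solution),
        run P (C * (k * (length M + 1) + 1)) 0 (init_mem (encode_instance k M)) = Some mem /\
        decode_solution k (length M) (read_output mem) = Some s /\
        is_solution k M s /\
        (forall s' : solution, is_solution k M s' ->
           2 * cost s <= 3 * (d * d - 1) * (d * d) * cost s').
Proof.
  intros d Hd. destruct (machine_ok d Hd) as (C & HC). exists (ram_program d (phases d)), C.
  intros k M HM HMd HMx. destruct (HC k M HM HMd) as (mem & pi & Ts & Hrun & Hout & Hpi & HT & Hcase).
  pose proof (Forall2_length HT) as HTl.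
  exists mem, (mkSolution pi (assemble [] Ts)). split; [exact Hrun|]. split; [|split].
  - rewrite Hout. replace (length M) with (length (assemble [] Ts)) by (rewrite assemble_length; auto).
    apply decode_out. apply (perm_length k pi Hpi).
  - split; [exact Hpi|]. apply (assemble_run k pi M Ts (perm_length k pi Hpi) [] (Forall_nil _) HT).
  - intros [pi0 Bs] (Hpi0 & Hval). cbn [start crossings] in *.
    destruct (run_supports k M pi0 Bs Hval) as (HV & HS).
    assert (Hcost : cost (mkSolution pi0 Bs) = length (concat Bs)) by (apply cost_concat).
    rewrite Hcost. unfold cost. cbn [crossings].
    pose proof (assemble_cost Ts []) as Has. simpl in Has.
    destruct Hcase as [Hbig|(ps & -> & Hps)].
    (* With T crossings in the competing solution, [meetings_count] and n > 2dk give n at most 3Td(d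
       - 1), and a meeting costs at most 2(d - 1). The comparison reduces to 4(d - 1) being at most
       d(d + 1); below, [d] is replaced by its successor. *)
    + assert (H1 : list_sum (map (@length triple) Ts) <= sumf (fun _ => d - 1) M).
      { apply (gathers_total k pi M Ts (fun _ => d)); auto. intros e B He HB.
        apply gathers_length in HB. pose proof (meeting_facts k d M HM HMd e He). lia. }
      rewrite sumf_const in H1.
      pose proof (meetings_count k d M pi0 (concat Bs) Hd HM HMd HMx Hpi0 HV HS) as H2.
      set (T := @length triple (concat Bs)) in *. set (n := length M) in *.
      destruct d as [|d]; [lia|]. replace (S d - 1) with d in * by lia. replace (S d * S d - 1) with (d * (d + 2)) by lia.
      assert (H3 : 2 * (k * d) <= 2 * S d * k) by (rewrite (Nat.mul_comm k d), Nat.mul_assoc; apply Nat.mul_le_mono_r; lia).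
      assert (H4 : n * d <= 3 * T * (S d * d) * d) by (apply Nat.mul_le_mono_r; lia).
      assert (H5 : (4 * d) * (3 * T * d * S d) <= ((d + 2) * S d) * (3 * T * d * S d)) by (apply Nat.mul_le_mono_r; clear; nia).
      lia.
    (* The 4 in [placement_bound] combines the factor 2 for undoing with the 2 on the left of the
       goal. *)
    + assert (H1 : list_sum (map (@length triple) Ts) <= sumf (fun e => np (rank ps) e - 1) M).
      { apply (gathers_total k (concat ps) M Ts (np (rank ps))); auto. intros e B He HB.
        now apply (gathers_rank k M ps). }
      pose proof (placement_bound k d M pi0 (concat Bs) Hd HM HMd HMx Hpi0 HV HS ps Hpi Hps). lia.
Qed.
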